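(* (a) Let positive numbers $C,\alpha,\delta$ satisfy $\delta\le1$ and $\alpha>2\left(1+\frac2\delta\right)$. Let $\varphi\in L_2(\mathbb R^2)$ (real-valued) satisfy $\int_{\mathbb R^2}\varphi^2(t)\,dt=1$ and $\operatorname{ess\,sup}_{t\in\mathbb R^2}(1+|t|)^{\alpha}\varphi^2(t)<\infty$. Let a Lebesgue measurable function $\psi:\mathbb R\to\mathbb R$ satisfy $\int_{\mathbb R}\exp\left(\frac1C|\psi(u)|\right)e^{-u^2/2}\,du<\infty$, $\int_{\mathbb R}\psi(u)e^{-u^2/2}\,du=0$, and $$\log\int_{\mathbb R}\exp\left|\psi\left(\frac{x+h+y}2\right)-\psi\left(\frac{x+h-y}2\right)\right|\cdot\frac1{\sqrt{2\pi}}e^{-x^2/2}\,dx\le C|y|^\delta$$ for all $y,h\in\mathbb R$. Then the random field $X=\psi(\varphi*w)$ on $\mathbb R^2$, that is, $X_t=\psi\left(\int_{\mathbb R^2}\varphi(t-s)w_s\,ds\right)$, is splittable; here $w$ is the real white noise on $\mathbb R^2$. (b) Let positive numbers $C,\alpha,\delta$ satisfy $\delta\le1$ and $\alpha>2\left(1+\frac2\delta\right)$. Let $\varphi\in L_2(\mathbb R^2\to\mathbb C)$ satisfy $\int_{\mathbb R^2}|\varphi(t)|^2\,dt=1$ and $\operatorname{ess\,sup}_{t\in\mathbb R^2}(1+|t|)^{\alpha}|\varphi(t)|^2<\infty$. Let a Lebesgue measurable function $\psi:\mathbb C\to\mathbb R$ satisfy $\int_{\mathbb C}\exp\left(\frac1C|\psi(z)|\right)e^{-|z|^2}\,dz<\infty$,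 $\int_{\mathbb C}\psi(z)e^{-|z|^2}\,dz=0$, and $$\log\int_{\mathbb C}\exp\left|\psi\left(\frac{x+h+y}2\right)-\psi\left(\frac{x+h-y}2\right)\right|\cdot\frac1\pi e^{-|x|^2}\,dx\le C|y|^\delta$$ for all $y,h\in\mathbb C$. Then the random field $X=\psi(\varphi*w_{\mathbb C})$ on $\mathbb R^2$, that is, $X_t=\psi\left(\int_{\mathbb R^2}\varphi(t-s)w_{\mathbb C}(s)\,ds\right)$, is splittable; here $w_{\mathbb C}$ is the complex white noise on $\mathbb R^2$.
   Context: Integrals over $\mathbb C$ are with respect to Lebesgue (area) measure. White noise. $w$ on $\mathbb R^2$ is the isonormal Gaussian process over $L_2(\mathbb R^2)$: $f\mapsto\int f(s)w_s\,ds$ is linear, with jointly Gaussian centered values of variance $\|f\|_2^2$. The complex white noise is $w_{\mathbb C}=\frac1{\sqrt2}(w_1+\mathrm i w_2)$ with $w_1,w_2$ independent copies of $w$; it is integrated against complex-valued $L_2$ functions. $G=\varphi*w$ (or $\varphi*w_{\mathbb C}$) is the Gaussian field $G_t=\int\varphi(t-s)w_s\,ds$, taken in a jointly measurable version (it is continuous in mean square); $\psi(G)$ denotes the random measure $B\mapsto\int_B\psi(G_t)\,dt$. Random fields on $\mathbb R^2$. A random field $X$ on $\mathbb R^2$ is a random locally finite signed Borel measure on $\mathbb R^2$ (a measurable map from a probability space to the space of such measures, with the $\sigma$-field generated by the evaluations $\nu\mapsto\nu(B)$, $B$ bounded Borel). Its value on $B$ is written $\int_B X_t\,dt$, and $\int_B|X_t|\,dt$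 denotes its variation on $B$ (possibly infinite for unbounded $B$). An a.s. locally integrable random function $(X_t)_{t\in\mathbb R^2}$ is identified with the random measure $B\mapsto\int_B X_t\,dt$. Shifts and coordinate swaps such as $(X_{t_1+r,t_2})_{t_1,t_2}$, $(X_{t_2,t_1})_{t_1,t_2}$ are understood accordingly. Split: a split of $X$ is a triple $(X^0,X^-,X^+)$ of random fields on a common probability space (possibly different from that of $X$) such that $X^-,X^+$ are independent and $X,X^0,X^-,X^+$ are identically distributed. Its leak is the random field $Y$ with $Y_{t_1,t_2}=X^-_{t_1,t_2}-X^0_{t_1,t_2}$ for $t_1<0$ and $Y_{t_1,t_2}=X^+_{t_1,t_2}-X^0_{t_1,t_2}$ for $t_1\ge0$ (equality of the restricted signed measures). $Y$ is called a leak for $X$ if it is distributed like the leak of some split of $X$. Splittability on $\mathbb R^2$. ''Centered'' means $\mathbb E\int_A X_t\,dt=0$ for every bounded Borel $A\subset\mathbb R^2$. $X$ is $(1,1)$-splittable if: (a) $\mathbb E\exp\int_{[s,s+1)\times\mathbb R}|X_t|\,dt\le2$ for all $s\in\mathbb R$; (b) $X$ is centered; (c) for every $r\in\mathbb R$ there is a leak $Y$ for $(X_{t_1+r,t_2})_{t_1,t_2}$ with $\mathbb E\exp\int_{\mathbb R^2}|Y_t|\,dt\le2$. $X$ is $1$-splittable (that is, $(1,2)$-splittable) if: (a) $\mathbb E\exp\int_{[s_1,s_1+1)\times[s_2,s_2+1)}|X_t|\,dt\le2$ for all $s_1,s_2\in\mathbb R$; (b) $X$ is centered; (c) for every $r\in\mathbb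 R$ there is a leak $Y$ for $(X_{t_1+r,t_2})_{t_1,t_2}$ such that $(Y_{t_2,t_1})_{t_1,t_2}$ is $(1,1)$-splittable, and there is a leak $Y'$ for $(X_{t_2,t_1+r})_{t_1,t_2}$ such that $(Y'_{t_2,t_1})_{t_1,t_2}$ is $(1,1)$-splittable. $X$ is $C$-splittable if $\frac1C X$ is $1$-splittable; $X$ is splittable if it is $C$-splittable for some $C\in(0,\infty)$. *)

(* Defs.v *)
From HB Require Import structures.
From mathcomp Require Import all_boot all_order all_algebra.
From mathcomp Require Import all_classical all_reals all_analysis.
From mathcomp Require Import measurable_realfun ess_sup_inf complex.

Set Implicit Arguments.
Unset Strict Implicit.
Unset Printing Implicit Defensive.

Import Order.TTheory GRing.Theory Num.Theory.
Import numFieldNormedType.Exports.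

Local Open Scope classical_set_scope.
Local Open Scope ring_scope.

Definition leb2 (R : realType) :
    {measure set (measurableTypeR R * measurableTypeR R) -> \bar R} :=
  (@lebesgue_measure R \x @lebesgue_measure R)%E.

(* The measurable sets of [R] and [R * R] are the Borel sets, and those of
   [completed_algebra_gen] the Borel sets up to negligible sets.  The library
   integral of a nonnegative function is the supremum of the integrals of the
   Borel simple functions below it, which is the Lebesgue integral also for
   functions that are only Lebesgue measurable. *)
Definition lebesgue_measurable d (T : measurableType d) (R : realType)
    (mu : {measure set T -> \bar R}) (f : T -> R) : Prop :=
  forall A : set R, measurable A -> completed_algebra_gen mu (f @^-1` A).

(* The norm of the product [R * R] is the maximum norm. *)
Definition euclid (R : realType) (t : R * R) : R :=
  Num.sqrt (t.1 ^+ 2 + t.2 ^+ 2).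

Definition bounded_borel (R : realType) (A : set (R * R)) : Prop :=
  measurable A /\ bounded_set A.

(* A locally finite signed measure lives on the bounded Borel sets; extending it
   by 0 to the other sets makes equality of measures Leibniz equality. *)
Record lfsm (R : realType) := Lfsm {
  lfval :> set (R * R) -> R ;
  lf_out : forall A, ~ bounded_borel A -> lfval A = 0 ;
  lf_sigma_additive : forall F : nat -> set (R * R),
    (forall k, bounded_borel (F k)) -> trivIset setT F ->
    bounded_borel (\bigcup_k F k) ->
    (fun n => \sum_(k < n) lfval (F k)) @ \oo --> lfval (\bigcup_k F k) }.

Section lfsm_space.
Variable R : realType.
Implicit Types (nu : lfsm R) (A B : set (R * R)).

Lemma lfsmP nu1 nu2 : (forall A, nu1 A = nu2 A) -> nu1 = nu2.
Proof.
case: nu1 nu2 => f Pf Qf [g Pg Qg] /= fg.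
have E : f = g by apply/funext.
subst g; congr Lfsm; exact: Prop_irrelevance.
Qed.

Lemma bounded_setP A : bounded_set A <-> exists M, forall p, A p -> `|p| <= M.
Proof.
split=> [[M [_ bM]]|[M bM]].
  by exists (M + 1) => p Ap; apply: bM => //; rewrite ltrDl.
exists M; split; first exact: num_real.
by move=> N MN p Ap; apply: (le_trans (bM _ Ap)); exact: ltW.
Qed.

Lemma bounded_borelI A B :
  bounded_borel A -> measurable B -> bounded_borel (A `&` B).
Proof.
move=> [mA /bounded_setP[M bM]] mB; split; first exact: measurableI.
by apply/bounded_setP; exists M => p [Ap _]; exact: bM.
Qed.

Definition lf0_fun (_ : set (R * R)) : R := 0.

Lemma lf0_sigma_additive (F : nat -> set (R * R)) :
  (forall k, bounded_borel (F k)) -> trivIset setT F ->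
  bounded_borel (\bigcup_k F k) ->
  (fun n => \sum_(k < n) lf0_fun (F k)) @ \oo --> lf0_fun (\bigcup_k F k).
Proof.
move=> _ _ _; rewrite /lf0_fun; under eq_fun do rewrite big1//.
exact: cvg_cst.
Qed.

Definition lf0 : lfsm R :=
  @Lfsm R lf0_fun (fun _ _ => erefl) lf0_sigma_additive.

HB.instance Definition _ := gen_eqMixin (lfsm R).
HB.instance Definition _ := gen_choiceMixin (lfsm R).
HB.instance Definition _ := isPointed.Build (lfsm R) lf0.

Definition lf_evaluations : set (set (lfsm R)) :=
  \bigcup_(B in [set B | bounded_borel B])
     preimage_set_system setT (fun nu : lfsm R => nu B) measurable.

HB.instance Definition _ := @isMeasurable.Build (sigma_display lf_evaluations)
  (lfsm R) <<s lf_evaluations >> (@sigma_algebra0 _ setT lf_evaluations)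
  (@sigma_algebraC _ lf_evaluations)
  (@sigma_algebra_bigcup _ setT lf_evaluations).

Lemma measurable_lfval B : measurable_fun setT (fun nu : lfsm R => nu B).
Proof.
have [bB|nbB] := pselect (bounded_borel B); last first.
  rewrite (_ : (fun _ => _) = cst 0); first exact: measurable_cst.
  by apply/funext => nu; rewrite lf_out.
by move=> _ A mA; apply: sub_sigma_algebra; exists B => //; exists A.
Qed.

Lemma measurable_lfsmP d (T : measurableType d) (g : T -> lfsm R) :
  (forall B, bounded_borel B -> measurable_fun setT (fun x => g x B)) ->
  measurable_fun setT g.
Proof.
move=> mg; apply: (@measurability _ _ _ _ _ _ lf_evaluations) => //.
move=> _ [_ [B bB [A mA <-]] <-]; rewrite !setTI.
by rewrite -[X in measurable X]setTI; exact: mg.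
Qed.

End lfsm_space.

Section lfsm_operations.
Variable R : realType.
Implicit Types (nu : lfsm R) (A B : set (R * R)).

Lemma lf_scale_out (c : R) nu A : ~ bounded_borel A -> c * nu A = 0.
Proof. by move=> nA; rewrite lf_out// mulr0. Qed.

Lemma lf_scale_sigma_additive (c : R) nu (F : nat -> set (R * R)) :
  (forall k, bounded_borel (F k)) -> trivIset setT F ->
  bounded_borel (\bigcup_k F k) ->
  (fun n => \sum_(k < n) c * nu (F k)) @ \oo --> c * nu (\bigcup_k F k).
Proof.
move=> bF tF bUF; under eq_fun do rewrite -mulr_sumr.
by apply: cvgMl_tmp; exact: lf_sigma_additive.
Qed.

Definition lf_scale (c : R) nu : lfsm R :=
  @Lfsm R _ (@lf_scale_out c nu) (@lf_scale_sigma_additive c nu).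

Lemma measurable_lf_scale c : measurable_fun setT (lf_scale c).
Proof.
apply: measurable_lfsmP => B bB /=.
by apply: measurable_funM => //; exact: measurable_lfval.
Qed.

Lemma lf_add_out nu1 nu2 A : ~ bounded_borel A -> nu1 A + nu2 A = 0.
Proof. by move=> nA; rewrite !lf_out// addr0. Qed.

Lemma lf_add_sigma_additive nu1 nu2 (F : nat -> set (R * R)) :
  (forall k, bounded_borel (F k)) -> trivIset setT F ->
  bounded_borel (\bigcup_k F k) ->
  (fun n => \sum_(k < n) (nu1 (F k) + nu2 (F k))) @ \oo -->
    nu1 (\bigcup_k F k) + nu2 (\bigcup_k F k).
Proof.
move=> bF tF bUF; under eq_fun do rewrite big_split/=.
by apply: cvgD; exact: lf_sigma_additive.
Qed.

Definition lf_add nu1 nu2 : lfsm R :=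
  @Lfsm R _ (@lf_add_out nu1 nu2) (@lf_add_sigma_additive nu1 nu2).

Lemma measurable_lf_add d (T : measurableType d) (g h : T -> lfsm R) :
  measurable_fun setT g -> measurable_fun setT h ->
  measurable_fun setT (fun x => lf_add (g x) (h x)).
Proof.
move=> mg mh; apply: measurable_lfsmP => B bB /=.
apply: measurable_funD.
- exact: (measurableT_comp (@measurable_lfval R B) mg).
- exact: (measurableT_comp (@measurable_lfval R B) mh).
Qed.

(* Restriction to [D], which is meant to be a Borel set: the restriction to any
   other set is the zero measure. *)
Definition lf_restr_fun (D : set (R * R)) nu A : R :=
  if `[< bounded_borel A /\ measurable D >] then nu (A `&` D) else 0.

Lemma lf_restr_out D nu A : ~ bounded_borel A -> lf_restr_fun D nu A = 0.
Proof. by move=> nA; rewrite /lf_restr_fun; case: asboolP => // -[]. Qed.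

Lemma lf_restr_sigma_additive D nu (F : nat -> set (R * R)) :
  (forall k, bounded_borel (F k)) -> trivIset setT F ->
  bounded_borel (\bigcup_k F k) ->
  (fun n => \sum_(k < n) lf_restr_fun D nu (F k)) @ \oo -->
    lf_restr_fun D nu (\bigcup_k F k).
Proof.
move=> bF tF bUF; have [mD|nD] := pselect (measurable D); last first.
  have E A : lf_restr_fun D nu A = 0.
    by rewrite /lf_restr_fun; case: asboolP => // -[].
  rewrite E; under eq_fun do under eq_bigr do rewrite E.
  under eq_fun do rewrite big1//; exact: cvg_cst.
have E A : bounded_borel A -> lf_restr_fun D nu A = nu (A `&` D).
  by move=> bA; rewrite /lf_restr_fun; case: asboolP => // -[].
rewrite E//; under eq_fun do under eq_bigr do rewrite E//.
rewrite setI_bigcupl; apply: (@lf_sigma_additive R nu (fun k => F k `&` D)).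
- by move=> k; exact: bounded_borelI.
- exact: trivIset_setIr.
- by rewrite -setI_bigcupl; exact: bounded_borelI.
Qed.

Definition lf_restr D nu : lfsm R :=
  @Lfsm R _ (@lf_restr_out D nu) (@lf_restr_sigma_additive D nu).

Lemma lf_restrE D nu A : measurable D -> bounded_borel A ->
  lf_restr D nu A = nu (A `&` D).
Proof. by move=> mD bA; rewrite /= /lf_restr_fun; case: asboolP => // -[]. Qed.

Lemma measurable_lf_restr D : measurable_fun setT (lf_restr D).
Proof.
apply: measurable_lfsmP => B bB /=; rewrite /lf_restr_fun.
by case: asboolP => _; [exact: measurable_lfval | exact: measurable_cst].
Qed.

(* [lf_image f g nu] is the image of [nu] under the bijection [f] with inverse
   [g], that is, [B] has value [nu] of the preimage of [B] under [f]. *)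
Definition bounded_bimeasurable (f g : R * R -> R * R) : Prop :=
  [/\ cancel f g, cancel g f,
      forall A, bounded_borel A -> bounded_borel (f @^-1` A) &
      forall A, bounded_borel A -> bounded_borel (g @^-1` A)].

Lemma lf_image_out f g (fg : bounded_bimeasurable f g) nu A :
  ~ bounded_borel A -> nu (f @^-1` A) = 0.
Proof.
move: fg => [fK gK _ bg] nA; rewrite lf_out// => /bg; apply: contra_not nA.
rewrite (_ : g @^-1` _ = A)//.
by apply/seteqP; split=> x /=; rewrite gK.
Qed.

Lemma lf_image_sigma_additive f g (fg : bounded_bimeasurable f g) nu
    (F : nat -> set (R * R)) :
  (forall k, bounded_borel (F k)) -> trivIset setT F ->
  bounded_borel (\bigcup_k F k) ->
  (fun n => \sum_(k < n) nu (f @^-1` F k)) @ \oo -->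
    nu (f @^-1` \bigcup_k F k).
Proof.
move: fg => [fK gK bf _] bF tF bUF; rewrite preimage_bigcup.
apply: (@lf_sigma_additive R nu (fun k => f @^-1` F k)).
- by move=> k; exact: bf.
- by move=> i j _ _ [x Fx]; apply: (tF i j) => //; exists (f x).
- by rewrite -preimage_bigcup; exact: bf.
Qed.

Definition lf_image f g (fg : bounded_bimeasurable f g) nu : lfsm R :=
  @Lfsm R _ (@lf_image_out f g fg nu) (@lf_image_sigma_additive f g fg nu).

Lemma measurable_lf_image f g (fg : bounded_bimeasurable f g) :
  measurable_fun setT (lf_image fg).
Proof. by apply: measurable_lfsmP => B bB /=; exact: measurable_lfval. Qed.

Lemma bounded_bimeasurable_shift (r : R) :
  bounded_bimeasurable (fun p : R * R => (p.1 - r, p.2))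
                       (fun p : R * R => (p.1 + r, p.2)).
Proof.
have H (c : R) A : bounded_borel A ->
    bounded_borel ((fun p : R * R => (p.1 + c, p.2)) @^-1` A).
  move=> [mA /bounded_setP[M bM]]; split.
    rewrite -[X in measurable X]setTI.
    have m : measurable_fun setT (fun p : R * R => (p.1 + c, p.2)).
      apply/measurable_fun_pairP; split => /=; last exact: measurable_snd.
      by apply: measurable_funD => //; exact: measurable_fst.
    exact: m.
  apply/bounded_setP; exists (M + `|c|) => -[x y] /= /bM.
  rewrite !prod_normE /= !ge_max => /andP[xM yM]; apply/andP; split.
    by rewrite -[x](addrK c); apply: (le_trans (ler_normB _ _)); rewrite lerD2r.
  by rewrite (le_trans yM)// lerDl.
split; [by move=> [x y] /=; rewrite subrK | by move=> [x y] /=; rewrite addrK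
  | by move=> A; exact: H | by move=> A; exact: H].
Qed.

Lemma bounded_bimeasurable_swap :
  bounded_bimeasurable (fun p : R * R => (p.2, p.1)) (fun p : R * R => (p.2, p.1)).
Proof.
have H A : bounded_borel A ->
    bounded_borel ((fun p : R * R => (p.2, p.1)) @^-1` A).
  move=> [mA /bounded_setP[M bM]]; split.
    rewrite -[X in measurable X]setTI.
    have m : measurable_fun setT (fun p : R * R => (p.2, p.1)).
      apply/measurable_fun_pairP; split => /=.
        exact: measurable_snd.
      exact: measurable_fst.
    exact: m.
  apply/bounded_setP; exists M => -[x y] /= /bM.
  by rewrite !prod_normE /= maxC.
by split; [case | case | exact: H | exact: H].
Qed.

(* [(nu_{t1 + r, t2})_{t1, t2}] gives to [B] the value of [nu] on
   [{(t1 + r, t2) | (t1, t2) in B}]. *)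
Definition lf_shift (r : R) : lfsm R -> lfsm R :=
  lf_image (bounded_bimeasurable_shift r).

Definition lf_swap : lfsm R -> lfsm R := lf_image bounded_bimeasurable_swap.

Definition lf_leak (nu0 num nup : lfsm R) : lfsm R :=
  lf_add (lf_restr [set p | p.1 < 0] (lf_add num (lf_scale (-1) nu0)))
         (lf_restr [set p | 0 <= p.1] (lf_add nup (lf_scale (-1) nu0))).

Lemma lf_leakE nu0 num nup B : bounded_borel B ->
  lf_leak nu0 num nup B =
    (num (B `&` [set p | p.1 < 0]) - nu0 (B `&` [set p | p.1 < 0])) +
    (nup (B `&` [set p | 0 <= p.1]) - nu0 (B `&` [set p | 0 <= p.1])).
Proof.
have m1 : measurable_fun setT (fun p : R * R => p.1) by exact: measurable_fst.
move=> bB; rewrite /lf_leak.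
rewrite -[lf_add _ _ B]/(lf_restr _ _ B + lf_restr _ _ B).
rewrite !lf_restrE//=; first by rewrite !mulN1r.
- rewrite -[X in measurable X]setTI.
  by rewrite -[[set p | _]](_ : (fun p : R * R => p.1) @^-1` `[0, +oo[ = _);
    [exact: m1 | apply/seteqP; split=> p /=; rewrite in_itv/= andbT].
- rewrite -[X in measurable X]setTI.
  by rewrite -[[set p | _]](_ : (fun p : R * R => p.1) @^-1` `]-oo, 0[ = _);
    [exact: m1 | apply/seteqP; split=> p /=; rewrite in_itv].
Qed.

HB.instance Definition _ c :=
  isMeasurableFun.Build _ _ _ _ (lf_scale c) (measurable_lf_scale c).
HB.instance Definition _ r :=
  isMeasurableFun.Build _ _ _ _ (lf_shift r)
    (measurable_lf_image (bounded_bimeasurable_shift r)).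
HB.instance Definition _ :=
  isMeasurableFun.Build _ _ _ _ lf_swap
    (measurable_lf_image bounded_bimeasurable_swap).

(* The total variation of [nu] on [S], where [S] may be unbounded. *)
Definition variation nu (S : set (R * R)) : \bar R :=
  ereal_sup [set v | exists (n : nat) (F : 'I_n -> set (R * R)),
    [/\ forall i, bounded_borel (F i) /\ F i `<=` S, trivIset setT F &
        v = (\sum_(i < n) `|nu (F i)|)%:E]].

End lfsm_operations.

Arguments lf_swap {R}.

Section random_fields.
Variables (R : realType) (d : measure_display) (T : measurableType d).
Variable P : probability T R.

Definition rf_scale (c : R) (X : {RV P >-> lfsm R}) : {RV P >-> lfsm R} :=
  lf_scale c \o X.

Definition rf_shift (r : R) (X : {RV P >-> lfsm R}) : {RV P >-> lfsm R} :=
  lf_shift r \o X.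

Definition rf_swap (X : {RV P >-> lfsm R}) : {RV P >-> lfsm R} :=
  lf_swap \o X.

Section leak.
Variables X0 Xm Xp : {RV P >-> lfsm R}.

Definition rf_leak_fun (x : T) : lfsm R := lf_leak (X0 x) (Xm x) (Xp x).

Lemma measurable_rf_leak_fun : measurable_fun setT rf_leak_fun.
Proof.
apply: measurable_lf_add; apply: measurableT_comp => //;
  try exact: measurable_lf_restr; apply: measurable_lf_add => //;
  by apply: measurableT_comp.
Qed.

HB.instance Definition _ := isMeasurableFun.Build _ _ _ _
  rf_leak_fun measurable_rf_leak_fun.

Definition rf_leak : {RV P >-> lfsm R} := rf_leak_fun.

End leak.

Definition independent_rf (X Y : {RV P >-> lfsm R}) : Prop :=
  forall E F : set (lfsm R), measurable E -> measurable F ->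
    P (X @^-1` E `&` Y @^-1` F) = (P (X @^-1` E) * P (Y @^-1` F))%E.

Definition centered (X : {RV P >-> lfsm R}) : Prop :=
  forall A : set (R * R), bounded_borel A ->
    (\int[P]_x (X x A)%:E = 0)%E.

Definition exp_moment_le2 (X : {RV P >-> lfsm R}) (S : set (R * R)) : Prop :=
  (\int[P]_x expeR (variation (X x) S) <= 2%:E)%E.

End random_fields.

Definition same_law (R : realType) d1 (T1 : measurableType d1)
    (P1 : probability T1 R) (X1 : {RV P1 >-> lfsm R})
    d2 (T2 : measurableType d2) (P2 : probability T2 R)
    (X2 : {RV P2 >-> lfsm R}) : Prop :=
  forall E : set (lfsm R), measurable E ->
    distribution P1 X1 E = distribution P2 X2 E.

Definition is_split (R : realType) d (T : measurableType d)
    (P : probability T R) (X : {RV P >-> lfsm R})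
    d' (T' : measurableType d') (P' : probability T' R)
    (X0 Xm Xp : {RV P' >-> lfsm R}) : Prop :=
  [/\ independent_rf Xm Xp, same_law X X0, same_law X Xm & same_law X Xp].

Definition is_leak (R : realType) d (T : measurableType d)
    (P : probability T R) (X : {RV P >-> lfsm R})
    d' (T' : measurableType d') (P' : probability T' R)
    (Y : {RV P' >-> lfsm R}) : Prop :=
  exists (ds : measure_display) (Ts : measurableType ds) (Ps : probability Ts R)
    (X0 Xm Xp : {RV Ps >-> lfsm R}),
    is_split X X0 Xm Xp /\ same_law Y (rf_leak X0 Xm Xp).

Definition splittable11 (R : realType) d (T : measurableType d)
    (P : probability T R) (X : {RV P >-> lfsm R}) : Prop :=
  [/\ forall s : R, exp_moment_le2 X [set p | s <= p.1 < s + 1],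
      centered X &
      forall r : R,
        exists (d' : measure_display) (T' : measurableType d')
          (P' : probability T' R) (Y : {RV P' >-> lfsm R}),
          is_leak (rf_shift r X) Y /\ exp_moment_le2 Y setT].

Definition splittable12 (R : realType) d (T : measurableType d)
    (P : probability T R) (X : {RV P >-> lfsm R}) : Prop :=
  [/\ forall s1 s2 : R,
        exp_moment_le2 X [set p | s1 <= p.1 < s1 + 1 /\ s2 <= p.2 < s2 + 1],
      centered X &
      forall r : R,
        (exists (d' : measure_display) (T' : measurableType d')
           (P' : probability T' R) (Y : {RV P' >-> lfsm R}),
           is_leak (rf_shift r X) Y /\ splittable11 (rf_swap Y)) /\
        (* [rf_shift r (rf_swap X)] is [(X_{t2, t1 + r})_{t1, t2}]. *)
        (exists (d' : measure_display) (T' : measurableType d')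
           (P' : probability T' R) (Y : {RV P' >-> lfsm R}),
           is_leak (rf_shift r (rf_swap X)) Y /\ splittable11 (rf_swap Y))].

Definition splittable (R : realType) d (T : measurableType d)
    (P : probability T R) (X : {RV P >-> lfsm R}) : Prop :=
  exists C : R, 0 < C /\ splittable12 (rf_scale C^-1 X).

Section random_functions.
Variable R : realType.

Definition locally_integrable (f : R * R -> R) : Prop :=
  lebesgue_measurable (@leb2 R) f /\
  forall B, bounded_borel B -> (\int[@leb2 R]_(t in B) `|f t|%:E < +oo)%E.

(* [X] is the random field identified with the a.s. locally integrable random
   function [f]. *)
Definition identified_with d (T : measurableType d) (P : probability T R)
    (X : {RV P >-> lfsm R}) (f : T -> R * R -> R) : Prop :=
  {ae P, forall x, locally_integrable (f x) /\
    forall B, bounded_borel B ->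
      ((X x B)%:E = \int[@leb2 R]_(t in B) (f x t)%:E)%E}.

(* All random fields identified with [f] are a.s. equal. *)
Definition is_splittable_field d (T : measurableType d) (P : probability T R)
    (f : T -> R * R -> R) : Prop :=
  (exists X : {RV P >-> lfsm R}, identified_with X f) /\
  (forall X : {RV P >-> lfsm R}, identified_with X f -> splittable X).

End random_functions.

Section white_noise.
Variables (R : realType) (d : measure_display) (T : measurableType d).
Variable P : probability T R.

(* The library's [normal_prob 0 0] is not the Dirac measure. *)
Definition centered_gaussian_law (s : R) (A : set R) : \bar R :=
  if s == 0 then \d_(0 : R) A else normal_prob 0 s A.

Definition centered_gaussian (Z : T -> R) : Prop :=
  exists s : R, forall A : set R, measurable A ->
    P (Z @^-1` A) = centered_gaussian_law s A.

Definition L2fun (f : R * R -> R) : Prop := f \in Lfun (@leb2 R) 2%:E.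

(* [w f] is the integral of [f] against the noise; its values outside [L2fun]
   are irrelevant. *)
Record white_noise (w : (R * R -> R) -> {RV P >-> R}) : Prop := WhiteNoise {
  wn_linear : forall (a b : R) (f g : R * R -> R), L2fun f -> L2fun g ->
    {ae P, forall x, w (fun t => a * f t + b * g t) x = a * w f x + b * w g x} ;
  wn_jointly_gaussian : forall (n : nat) (f : 'I_n -> R * R -> R) (c : 'I_n -> R),
    (forall i, L2fun (f i)) ->
    centered_gaussian (fun x => \sum_(i < n) c i * w (f i) x) ;
  wn_variance : forall f : R * R -> R, L2fun f ->
    ('V_P[w f] = \int[@leb2 R]_t (f t ^+ 2)%:E)%E }.

Definition noise_sigma_algebra (w : (R * R -> R) -> {RV P >-> R}) : set (set T) :=
  <<s \bigcup_(f in L2fun) preimage_set_system setT (w f) measurable >>.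

Definition independent_noises (w1 w2 : (R * R -> R) -> {RV P >-> R}) : Prop :=
  forall E F, noise_sigma_algebra w1 E -> noise_sigma_algebra w2 F ->
    P (E `&` F) = (P E * P F)%E.

Definition L2fun_complex (f : R * R -> R[i]) : Prop :=
  L2fun (fun t => complex.Re (f t)) /\ L2fun (fun t => complex.Im (f t)).

(* The integral of [f] against the complex noise [(w1 + 'i * w2) / sqrt 2]. *)
Definition complex_noise (w1 w2 : (R * R -> R) -> {RV P >-> R})
    (f : R * R -> R[i]) (x : T) : R[i] :=
  let f1 t := complex.Re (f t) in let f2 t := complex.Im (f t) in
  Complex ((w1 f1 x - w2 f2 x) / Num.sqrt 2) ((w1 f2 x + w2 f1 x) / Num.sqrt 2).

Definition jointly_measurable (G : T -> R * R -> R) : Prop :=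
  measurable_fun setT (fun p : T * (R * R) => G p.1 p.2).

(* [G] is a jointly measurable version of the convolution of [phi] and [w]. *)
Definition convolution_version (w : (R * R -> R) -> {RV P >-> R})
    (phi : R * R -> R) (G : T -> R * R -> R) : Prop :=
  jointly_measurable G /\
  forall t, {ae P, forall x, G x t = w (fun s => phi (t - s)) x}.

Definition complex_convolution_version (w1 w2 : (R * R -> R) -> {RV P >-> R})
    (phi : R * R -> R[i]) (G : T -> R * R -> R[i]) : Prop :=
  [/\ jointly_measurable (fun x t => complex.Re (G x t)),
      jointly_measurable (fun x t => complex.Im (G x t)) &
      forall t, {ae P, forall x,
        G x t = complex_noise w1 w2 (fun s => phi (t - s)) x}].

End white_noise.

Definition cplx (R : realType) (p : R * R) : R[i] := Complex p.1 p.2.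

(* The library norm [`|z|] of [z : R[i]] is itself complex valued. *)
Definition cmod (R : realType) (z : R[i]) : R := ComplexField.Normc.normc z.

(* Main.v *)
(* Off a set [A] of the plane a white noise may be replaced by an independent copy. By the decay of
   the kernel, the field at a point of [A] at distance [r] from the complement of [A] changes by a
   Gaussian amount of standard deviation [O(r ^ (1 - alpha / 2))]. For a half plane this gives a
   split; gluing once more along a line in the other direction gives the splits of its leak. To
   bound the exponential moments of a leak, write the integral over the plane as an average over
   the translates of a sparse lattice (Jensen). On a sparse lattice the sum [a + b] of the Gaussian
   values before and after gluing is independent of the difference [y = a - b] and, by diagonal
   dominance, it is an i.i.d. Gaussian vector plus an independent shift [h]. Conditionally on [h]
   and [y] the hypothesis on [psi] applies at each lattice point, and the exponents
   [C |y| ^ delta] have a convergent lattice sum because [alpha > 2 (1 + 2 / delta)]. *)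

Require Import Defs.
From HB Require Import structures.
From mathcomp Require Import all_boot all_order all_algebra.
From mathcomp Require Import all_classical all_reals all_analysis.
From mathcomp Require Import measurable_realfun ess_sup_inf complex.
From mathcomp Require Import ring lra.

Set Implicit Arguments.
Unset Strict Implicit.
Unset Printing Implicit Defensive.

Import Order.TTheory GRing.Theory Num.Theory.
Import numFieldNormedType.Exports.

Local Open Scope classical_set_scope.
Local Open Scope ring_scope.

(** * Measures and integrals *)

(** A split needs independent copies of the noise, which the given probability space need not carry.
    Since leaks depend on laws only, the noise is moved to its law [G] on the space of paths indexed
    by square integrable functions, and splits live on products of that space; jointly measurable
    versions of the field have to be built there again from the kernel. The noise lives on an
    abstract space [S] with a position map into the plane: two copies of the plane then serve the
    complex case, and moving the positions turns every line into t1 = 0 without changing the noise.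
    The distance to one line does not suffice for a bound over the whole plane, as it gives no decay
    along the line. The density of the leak of a leak is a mixed second difference; it may be read
    as two differences across either line, and at each point the farther line is used, whose
    distance is that to the crossing point. Eight sectors and two differences give the constant 16.
    The bound 2 for the moments follows from any finite bound: by convexity of the exponential a
    smaller factor in the exponent suffices. *)

Section measure_tools.
Context d (T : measurableType d) (R : realType).
Implicit Type mu : {measure set T -> \bar R}.

(* No measurability is assumed: both sides are lower integrals. *)
Lemma le_lower_integral mu (f g : T -> \bar R) :
  (forall x, 0 <= f x)%E -> (forall x, f x <= g x)%E ->
  (\int[mu]_x f x <= \int[mu]_x g x)%E.
Proof.
move=> f0 fg; rewrite !ge0_integralTE//; last by move=> x; exact: le_trans (fg x).
apply: le_ereal_sup => _ [h hf <-]; exists h => // x.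
exact: le_trans (hf x) (fg x).
Qed.

Import HBNNSimple.

(** The standard machine: a nonnegative measurable function is an increasing limit of simple
    functions, and a simple function is a sum over its finite range of multiples of indicators. *)
Lemma ge0_measurable_ind (Pr : (T -> \bar R) -> Prop) :
  (forall A, measurable A -> Pr (fun x => (\1_A x)%:E)) ->
  (forall k f, 0 <= k -> measurable_fun setT f -> (forall x, 0 <= f x)%E ->
     Pr f -> Pr (fun x => k%:E * f x)%E) ->
  (forall f g, measurable_fun setT f -> measurable_fun setT g ->
     (forall x, 0 <= f x)%E -> (forall x, 0 <= g x)%E ->
     Pr f -> Pr g -> Pr (fun x => f x + g x)%E) ->
  (forall f_ : nat -> T -> \bar R, (forall n, measurable_fun setT (f_ n)) ->
     (forall n x, 0 <= f_ n x)%E ->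
     (forall x m n, (m <= n)%N -> f_ m x <= f_ n x)%E ->
     (forall n, Pr (f_ n)) -> Pr (fun x => limn (f_ ^~ x))) ->
  forall f, measurable_fun setT f -> (forall x, 0 <= f x)%E -> Pr f.
Proof.
move=> P1 PZ PD Plim f mf f0.
pose f_ := nnsfun_approx measurableT mf.
have -> : f = (fun x => limn (fun n => (f_ n x)%:E)).
  by apply/funext => x; apply/esym/cvg_lim => //; apply: cvg_nnsfun_approx.
apply: (Plim (fun n x => (f_ n x)%:E)).
- by move=> n; exact/measurable_EFinP.
- by move=> n x; rewrite lee_fin.
- by move=> x m n mn; rewrite lee_fin; exact/lefP/nd_nnsfun_approx.
move=> n; move: (f_ n) => h {f_ Plim}.
have Psum (s : seq R) : (forall r, r \in s -> 0 <= r) ->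
    Pr (fun x => \sum_(r <- s) (r * \1_(h @^-1` [set r]) x)%:E)%E.
  elim: s => [|r s IH] s0.
    have -> : (fun x : T => \sum_(r <- [::]) (r * \1_(h @^-1` [set r]) x)%:E)%E =
        (fun x => (\1_(@set0 T) x)%:E).
      by apply/funext => x; rewrite big_nil indicE in_set0.
    exact: P1.
  have -> : (fun x : T => \sum_(i <- r :: s) (i * \1_(h @^-1` [set i]) x)%:E)%E =
     (fun x => r%:E * (\1_(h @^-1` [set r]) x)%:E +
        \sum_(i <- s) (i * \1_(h @^-1` [set i]) x)%:E)%E.
    by apply/funext => x; rewrite big_cons EFinM.
  have r0 : 0 <= r by apply: s0; rewrite mem_head.
  have mi i : measurable_fun setT (fun x => (\1_(h @^-1` [set i]) x)%:E : \bar R).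
    exact/measurable_EFinP/measurable_indic.
  have i0 i x : (0 <= (\1_(h @^-1` [set i]) x)%:E :> \bar R)%E.
    by rewrite lee_fin.
  apply: PD.
  - exact: measurable_funeM.
  - by apply: emeasurable_sum => i; apply/measurable_EFinP/measurable_funM => //;
      exact/measurable_EFinP/mi.
  - by move=> x; rewrite mule_ge0// lee_fin.
  - move=> x; rewrite big_seq; apply: sume_ge0 => i si.
    by rewrite lee_fin mulr_ge0// s0// inE si orbT.
  - by apply: PZ => //; exact: P1.
  - by apply: IH => i si; apply: s0; rewrite inE si orbT.
have -> : (fun x => (h x)%:E) =
    (fun x => \sum_(r <- finmap.enum_fset (fset_set (range h)))
       (r * \1_(h @^-1` [set r]) x)%:E)%E.
  apply/funext => x; rewrite {1}fimfunE fsbig_finite//=.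
  by rewrite sumEFin.
by apply: Psum => r; rewrite in_fset_set ?inE; [case=> x _ <-|exact: fimfunP].
Qed.

Lemma ge0_integral_density mu (nu : {measure set T -> \bar R}) (g : T -> R)
    (f : T -> \bar R) :
  measurable_fun setT g -> (forall x, 0 <= g x) ->
  (forall A, measurable A -> nu A = \int[mu]_(x in A) (g x)%:E)%E ->
  measurable_fun setT f -> (forall x, 0 <= f x)%E ->
  (\int[nu]_x f x = \int[mu]_x (f x * (g x)%:E))%E.
Proof.
move=> mg g0 nuE.
have mg' : measurable_fun setT (fun x => (g x)%:E) by exact/measurable_EFinP.
have g0' x : (0 <= (g x)%:E)%E by rewrite lee_fin.
move: f; apply: ge0_measurable_ind.
- move=> A mA; rewrite integral_indic// setIT nuE// [LHS]integral_mkcond.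
  apply: eq_integral => x _; rewrite patchE indicE.
  by case: ifP => xA; rewrite ?mul1e ?mul0e.
- move=> k f k0 mf f0 IH; rewrite ge0_integralZl// IH.
  under [RHS]eq_integral do rewrite -muleA.
  rewrite [RHS]ge0_integralZl//; first exact: emeasurable_funM.
  by move=> x _; rewrite mule_ge0.
- move=> f h mf mh f0 h0 IHf IHh; rewrite ge0_integralD// IHf IHh.
  under [RHS]eq_integral do rewrite ge0_muleDl//.
  rewrite [RHS]ge0_integralD//.
  + by move=> x _; rewrite mule_ge0.
  + exact: emeasurable_funM.
  + by move=> x _; rewrite mule_ge0.
  + exact: emeasurable_funM.
- move=> f_ mf f0 ndf IH.
  rewrite monotone_convergence//; last by move=> x _ m n mn; exact: ndf.
  under eq_fun do rewrite IH.
  rewrite -monotone_convergence//.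
  + apply: eq_integral => x _; under eq_fun do rewrite muleC.
    rewrite limeMl//; first by rewrite muleC.
    by apply: ereal_nondecreasing_is_cvgn => m n mn; exact: ndf.
  + by move=> n; exact: emeasurable_funM.
  + by move=> n x _; rewrite mule_ge0.
  + by move=> x _ m n mn; rewrite lee_wpmul2r// ndf.
Qed.

End measure_tools.

Section measure_preserving.
Variable R : realType.

Definition pprod d1 (T1 : measurableType d1) d2 (T2 : measurableType d2)
    (P1 : probability T1 R) (P2 : probability T2 R) : probability (T1 * T2)%type R :=
  (P1 \x P2)%E.

Lemma pprodE d1 (T1 : measurableType d1) d2 (T2 : measurableType d2)
    (P1 : probability T1 R) (P2 : probability T2 R) A B :
  measurable A -> measurable B -> pprod P1 P2 (A `*` B) = (P1 A * P2 B)%E.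
Proof. exact: product_measure1E. Qed.

Lemma pprod_unique d1 (T1 : measurableType d1) d2 (T2 : measurableType d2)
    (P1 : probability T1 R) (P2 : probability T2 R)
    (Q : {measure set (T1 * T2) -> \bar R}) :
  (forall A B, measurable A -> measurable B -> Q (A `*` B) = (P1 A * P2 B)%E) ->
  forall A, measurable A -> pprod P1 P2 A = Q A.
Proof. exact: product_measure_unique. Qed.

Lemma pprod_fubini d1 (T1 : measurableType d1) d2 (T2 : measurableType d2)
    (P1 : probability T1 R) (P2 : probability T2 R) (f : T1 * T2 -> \bar R) :
  measurable_fun setT f -> (forall x, 0 <= f x)%E ->
  (\int[pprod P1 P2]_x f x = \int[P1]_x \int[P2]_y f (x, y))%E.
Proof. by move=> mf f0; rewrite [LHS]fubini_tonelli1. Qed.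

(** Measure-preserving maps. Every coupling below is such a map on a product of copies of the noise,
    assembled with [mp_comp], [mp_pair] and [mp_interchange]. *)
Definition mp d (T : measurableType d) d' (T' : measurableType d')
    (P : probability T R) (Q : probability T' R) (h : T -> T') :=
  measurable_fun setT h /\ forall A, measurable A -> P (h @^-1` A) = Q A.

Lemma mp_integral d (T : measurableType d) d' (T' : measurableType d')
    (P : probability T R) (Q : probability T' R) (h : T -> T') (f : T' -> \bar R) :
  mp P Q h -> measurable_fun setT f -> (forall x, 0 <= f x)%E ->
  (\int[P]_x f (h x) = \int[Q]_x f x)%E.
Proof.
move=> [mh PQ] mf f0.
transitivity (\int[pushforward P h]_x f x)%E.
  by rewrite ge0_integral_pushforward// => x _; exact: f0.
by apply: eq_measure_integral => A mA _; have := PQ _ mA.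
Qed.

Lemma mp_comp d1 (T1 : measurableType d1) d2 (T2 : measurableType d2)
  d3 (T3 : measurableType d3) (P1 : probability T1 R) (P2 : probability T2 R)
  (P3 : probability T3 R) (h : T1 -> T2) (k : T2 -> T3) :
  mp P1 P2 h -> mp P2 P3 k -> mp P1 P3 (k \o h).
Proof.
move=> [mh hE] [mk kE]; split; first exact: measurableT_comp.
move=> A mA; rewrite -kE// -hE//.
by rewrite -[X in measurable X]setTI; exact: mk.
Qed.

Section mp_maps.
Context d1 (T1 : measurableType d1) d2 (T2 : measurableType d2).
Context (P1 : probability T1 R) (P2 : probability T2 R).

Lemma mp_fst : mp (pprod P1 P2) P1 fst.
Proof.
split; first exact: measurable_fst.
move=> A mA; rewrite (_ : _ @^-1` A = A `*` setT); last by apply/seteqP; split=> -[x y] //= [].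
by rewrite pprodE// probability_setT mule1.
Qed.

Lemma mp_snd : mp (pprod P1 P2) P2 snd.
Proof.
split; first exact: measurable_snd.
move=> A mA; rewrite (_ : _ @^-1` A = setT `*` A); last by apply/seteqP; split=> -[x y] //= [].
by rewrite pprodE// probability_setT mul1e.
Qed.

Lemma mp_prod d (T : measurableType d) (P : probability T R) (h : T -> T1 * T2) :
  measurable_fun setT h ->
  (forall A B, measurable A -> measurable B ->
     P (h @^-1` (A `*` B)) = (P1 A * P2 B)%E) ->
  mp P (pprod P1 P2) h.
Proof.
move=> mh hE; split => // A mA; symmetry.
exact: (@pprod_unique _ _ _ _ P1 P2 (pushforward P h)).
Qed.

End mp_maps.

Lemma mp_swap d1 (T1 : measurableType d1) d2 (T2 : measurableType d2)
    (P1 : probability T1 R) (P2 : probability T2 R) :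
  mp (pprod P1 P2) (pprod P2 P1) (fun x => (x.2, x.1)).
Proof.
apply: mp_prod.
  by apply: measurable_fun_pair; [exact: measurable_snd|exact: measurable_fst].
move=> A B mA mB; rewrite muleC -pprodE//; congr (pprod _ _ _).
by apply/seteqP; split=> -[x y] [].
Qed.

Lemma mp_pair d1 (T1 : measurableType d1) d2 (T2 : measurableType d2)
    d3 (T3 : measurableType d3) d4 (T4 : measurableType d4)
    (P1 : probability T1 R) (P2 : probability T2 R)
    (P3 : probability T3 R) (P4 : probability T4 R) h k :
  mp P1 P3 h -> mp P2 P4 k ->
  mp (pprod P1 P2) (pprod P3 P4) (fun x => (h x.1, k x.2)).
Proof.
move=> [mh hE] [mk kE]; apply: mp_prod.
  by apply: measurable_fun_pair;
    [exact: (measurableT_comp mh measurable_fst)|exact: (measurableT_comp mk measurable_snd)].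
move=> A B mA mB; rewrite -hE// -kE// -pprodE//.
- by rewrite -[X in measurable X]setTI; exact: mh.
- by rewrite -[X in measurable X]setTI; exact: mk.
Qed.

(** After Tonelli the indicator of [A] involves only the first components of the two pairs and that
    of [B] only the second ones, so the integral factors. This is what allows two noises to be glued
    at once, each with its own independent counterpart. *)
Lemma mp_interchange d1 (T1 : measurableType d1) d2 (T2 : measurableType d2)
    d3 (T3 : measurableType d3) d4 (T4 : measurableType d4)
    (P1 : probability T1 R) (P2 : probability T2 R)
    (P3 : probability T3 R) (P4 : probability T4 R) :
  mp (pprod (pprod P1 P2) (pprod P3 P4)) (pprod (pprod P1 P3) (pprod P2 P4))
    (fun x => ((x.1.1, x.2.1), (x.1.2, x.2.2))).
Proof.
have m : measurable_fun setT (fun x : (T1 * T2) * (T3 * T4) =>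
    ((x.1.1, x.2.1), (x.1.2, x.2.2))).
  by apply: measurable_fun_pair; apply: measurable_fun_pair;
    [apply: (measurableT_comp (measurable_fst)); exact: measurable_fst
    |apply: (measurableT_comp (measurable_fst)); exact: measurable_snd
    |apply: (measurableT_comp (measurable_snd)); exact: measurable_fst
    |apply: (measurableT_comp (measurable_snd)); exact: measurable_snd].
have iE d' (T' : measurableType d') (Q : probability T' R) (C : set T') :
   measurable C -> (\int[Q]_x (\1_C x)%:E)%E = Q C.
  by move=> mC; rewrite integral_indic// setIT.
have mI d' (T' : measurableType d') (C : set T') : measurable C ->
    measurable_fun setT (fun x => (\1_C x)%:E : \bar R).
  by move=> mC; exact/measurable_EFinP/measurable_indic.
have I0 d' (T' : measurableType d') (C : set T') x : (0 <= (\1_C x)%:E :> \bar R)%E.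
  by rewrite lee_fin.
apply: mp_prod => // A B mA mB.
have mAB : measurable ((fun x : (T1 * T2) * (T3 * T4) =>
    ((x.1.1, x.2.1), (x.1.2, x.2.2))) @^-1` (A `*` B)).
  by rewrite -[X in measurable X]setTI; apply: m => //; exact: measurableX.
pose f1 (x : T1) := (\int[P3]_y (\1_A (x, y))%:E)%E.
pose f2 (x : T2) := (\int[P4]_y (\1_B (x, y))%:E)%E.
have mf1 : measurable_fun setT f1.
  by apply: (@measurable_fun_fubini_tonelli_F _ _ _ _ _ P3 (fun x => (\1_A x)%:E));
    do ?[exact: mI|by move=> ?; exact: I0].
have mf2 : measurable_fun setT f2.
  by apply: (@measurable_fun_fubini_tonelli_F _ _ _ _ _ P4 (fun x => (\1_B x)%:E));
    do ?[exact: mI|by move=> ?; exact: I0].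
have f10 x : (0 <= f1 x)%E by apply: integral_ge0 => y _; exact: I0.
have f20 x : (0 <= f2 x)%E by apply: integral_ge0 => y _; exact: I0.
transitivity (\int[pprod P1 P2]_x (f1 x.1 * f2 x.2))%E; last first.
  rewrite pprod_fubini//; first last.
  - by move=> x; rewrite mule_ge0.
  - by apply: emeasurable_funM; apply: measurableT_comp.
  transitivity (\int[P1]_x (f1 x * \int[P2]_y f2 y))%E.
    by apply: eq_integral => x _ /=; rewrite ge0_integralZl.
  rewrite ge0_integralZr//; last by apply: integral_ge0 => x _.
  rewrite -(iE _ _ (pprod P1 P3) A)// -(iE _ _ (pprod P2 P4) B)//.
  by rewrite !pprod_fubini//; do ?[exact: mI|move=> ?; exact: I0].
rewrite -iE// pprod_fubini//; first last.
- exact: mI.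
apply: eq_integral => -[x1 x2] _ /=.
transitivity (\int[pprod P3 P4]_y ((\1_A (x1, y.1))%:E * (\1_B (x2, y.2))%:E))%E.
  apply: eq_integral => -[y1 y2] _ /=; rewrite -EFinM !indicE -natrM mulnb.
  by congr ((nat_of_bool _)%:R%:E); apply/idP/andP; rewrite !inE.
have m1 : measurable_fun setT (fun y => (\1_A (x1, y))%:E : \bar R).
  by apply: (measurableT_comp (mI _ _ _ mA)); exact: pair1_measurable.
have m2 : measurable_fun setT (fun y => (\1_B (x2, y))%:E : \bar R).
  by apply: (measurableT_comp (mI _ _ _ mB)); exact: pair1_measurable.
rewrite pprod_fubini//; first last.
- by apply: emeasurable_funM; [exact: (measurableT_comp m1 measurable_fst)
    |exact: (measurableT_comp m2 measurable_snd)].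
transitivity (\int[P3]_x ((\1_A (x1, x))%:E * f2 x2))%E.
  apply: eq_integral => y _ /=; rewrite ge0_integralZl//.
by rewrite ge0_integralZr.
Qed.

End measure_preserving.

Section bounded_expectation.
Context d (T : measurableType d) (R : realType) (P : probability T R).

(** Trigonometric identities are handled in the field [R] rather than in the extended reals: bounded
    functions are closed under products, and their real expectations are linear. *)
Definition mb (f : T -> R) := measurable_fun setT f /\ exists M, forall x, `|f x| <= M.

Definition Ex (f : T -> R) : R := (\int[P]_x f x)%R.

Lemma mb_int f : mb f -> P.-integrable setT (EFin \o f).
Proof.
move=> [mf [M fM]]; apply: measurable_bounded_integrable => //.
  by rewrite (_ : _ [set: T] = 1%E) ?ltry//; exact: (@probability_setT _ _ _ P).
exists M; split; first exact: num_real.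
by move=> N MN x _; apply: (le_trans (fM x)); exact: ltW.
Qed.

Lemma mb_cst c : mb (fun=> c).
Proof. by split; [exact: measurable_cst|exists `|c|]. Qed.

Lemma mbD f g : mb f -> mb g -> mb (fun x => f x + g x).
Proof.
move=> [mf [M fM]] [mg [N gN]]; split; first exact: measurable_funD.
by exists (M + N) => x; apply: (le_trans (ler_normD _ _)); rewrite lerD.
Qed.

Lemma mbM f g : mb f -> mb g -> mb (fun x => f x * g x).
Proof.
move=> [mf [M fM]] [mg [N gN]]; split; first exact: measurable_funM.
by exists (M * N) => x; rewrite normrM ler_pM.
Qed.

Lemma mbZ c f : mb f -> mb (fun x => c * f x).
Proof. by apply: mbM; exact: mb_cst. Qed.

Lemma mb_comp (k : R -> R) f : measurable_fun setT k -> (exists M, forall x, `|k x| <= M) ->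
  measurable_fun setT f -> mb (fun x => k (f x)).
Proof.
move=> mk [M kM] mf; split; first exact: measurableT_comp.
by exists M => x; exact: kM.
Qed.

Lemma mb_cos f : measurable_fun setT f -> mb (fun x => cos (f x)).
Proof.
apply: mb_comp; first by apply: continuous_measurable_fun; exact: continuous_cos.
by exists 1 => x; rewrite ler_norml cos_geN1 cos_le1.
Qed.

Lemma mb_sin f : measurable_fun setT f -> mb (fun x => sin (f x)).
Proof.
apply: mb_comp; first by apply: continuous_measurable_fun; exact: continuous_sin.
by exists 1 => x; rewrite ler_norml sin_geN1 sin_le1.
Qed.

Lemma ExD f g : mb f -> mb g -> Ex (fun x => f x + g x) = Ex f + Ex g.
Proof. by move=> /mb_int bf /mb_int bg; rewrite /Ex RintegralD. Qed.

Lemma ExZ c f : mb f -> Ex (fun x => c * f x) = c * Ex f.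
Proof. by move=> /mb_int bf; rewrite /Ex RintegralZl. Qed.

Lemma le_Ex f g : mb f -> mb g -> (forall x, f x <= g x) -> Ex f <= Ex g.
Proof. by move=> /mb_int bf /mb_int bg fg; apply: le_Rintegral. Qed.

Lemma Ex_cst c : Ex (fun=> c) = c.
Proof.
by rewrite /Ex Rintegral_cst// (_ : _ [set: T] = 1%E) ?mulr1//; exact: (@probability_setT _ _ _ P).
Qed.

Lemma Ex_indic A : measurable A -> (Ex (\1_A))%:E = P A.
Proof.
move=> mA; rewrite /Ex /Rintegral integral_indic// setIT fineK//.
exact: fin_num_measure.
Qed.

Lemma eq_Ex f g : (forall x, f x = g x) -> Ex f = Ex g.
Proof. by move=> fg; congr Ex; apply/funext. Qed.

Lemma Ex_ae f g : measurable_fun setT f -> measurable_fun setT g ->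
  {ae P, forall x, f x = g x} -> Ex f = Ex g.
Proof.
move=> mf mg fg; rewrite /Ex /Rintegral; congr fine.
apply: ae_eq_integral => //; try exact/measurable_EFinP.
by apply: filterS fg => x /= ->.
Qed.

Lemma Ex_EFin f : mb f -> (\int[P]_x (f x)%:E = (Ex f)%:E)%E.
Proof.
move=> bf; rewrite /Ex /Rintegral fineK//.
exact: integrable_fin_num (mb_int bf).
Qed.

Lemma Ex_lim (f_ : nat -> T -> R) f M : (forall n, measurable_fun setT (f_ n)) ->
  (forall n x, `|f_ n x| <= M) -> (forall x, f_ n x @[n --> \oo] --> f x) ->
  Ex (f_ n) @[n --> \oo] --> Ex f.
Proof.
move=> mf fM cf.
have mlim : measurable_fun setT f.
  by apply: (measurable_fun_cvg mf) => x _; exact: cf.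
have mE (g : T -> R) : measurable_fun setT g -> measurable_fun setT (fun x => (g x)%:E).
  by move=> ?; exact/measurable_EFinP.
have cE x : (f_ n x)%:E @[n --> \oo] --> (f x)%:E.
  by apply/cvg_EFin; [exact: nearW|exact: cf].
have [If _ ] := @dominated_convergence _ _ _ P setT measurableT
  (fun n x => (f_ n x)%:E) (fun x => (f x)%:E) (fun=> M%:E)
  (fun n => mE _ (mf n)) (mE _ mlim)
  (aeW _ (fun x _ => cE x)) (mb_int (mb_cst M)) (aeW _ (fun x n _ => fM n x)).
rewrite -[X in _ --> X -> _]fineK; last exact: integrable_fin_num If.
by move/fine_cvg.
Qed.

End bounded_expectation.

Section Ex_product.
Variable R : realType.

Lemma Ex_fubini d1 (T1 : measurableType d1) d2 (T2 : measurableType d2)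
    (P1 : probability T1 R) (P2 : probability T2 R) (f : T1 * T2 -> R) :
  mb f -> Ex (pprod P1 P2) f = Ex P1 (fun x => Ex P2 (fun y => f (x, y))).
Proof.
move=> bf; have If := mb_int (pprod P1 P2) bf.
rewrite /Ex /Rintegral; congr fine.
rewrite -integral12_prod_meas1//; apply: eq_integral => x _.
rewrite fineK//; apply: integrable_fin_num => //; apply: mb_int.
case: bf => mf [M fM]; split; last by exists M => y; exact: fM.
by apply: (measurableT_comp mf); exact: pair1_measurable.
Qed.

Lemma Ex_swap d1 (T1 : measurableType d1) d2 (T2 : measurableType d2)
    (P1 : probability T1 R) (P2 : probability T2 R) (f : T1 -> T2 -> R) :
  mb (fun z : T1 * T2 => f z.1 z.2) ->
  Ex P1 (fun x => Ex P2 (f x)) = Ex P2 (fun y => Ex P1 (f ^~ y)).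
Proof.
move=> bf; have If := mb_int (pprod P1 P2) bf.
case: bf => mf [M fM].
have sec x : mb (f x).
  split; last by exists M => y; exact: (fM (x, y)).
  exact: (measurableT_comp mf (pair1_measurable x)).
have sec' y : mb (f ^~ y).
  split; last by exists M => x; exact: (fM (x, y)).
  exact: (measurableT_comp mf (pair2_measurable y)).
rewrite /Ex /Rintegral; congr fine.
transitivity (\int[P1]_x \int[P2]_y (f x y)%:E)%E.
  by apply: eq_integral => x _; rewrite -Ex_EFin.
transitivity (\int[P2]_y \int[P1]_x (f x y)%:E)%E; last first.
  by apply: eq_integral => x _; rewrite -Ex_EFin.
exact: (@Fubini _ _ _ _ _ P1 P2 (fun z => (f z.1 z.2)%:E)).
Qed.

Lemma mb_Ex d1 (T1 : measurableType d1) d2 (T2 : measurableType d2)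
    (P2 : probability T2 R) (f : T1 -> T2 -> R) :
  mb (fun z : T1 * T2 => f z.1 z.2) -> mb (fun x => Ex P2 (f x)).
Proof.
move=> [mf [M fM]].
have sec x : mb (f x).
  split; last by exists M => y; exact: (fM (x, y)).
  exact: (measurableT_comp mf (pair1_measurable x)).
split.
  (* Adding the bound [M] makes the integrand nonnegative, so that Tonelli gives measurability in
     [x]. *)
  rewrite (_ : (fun _ => _) = fun x => (fine (\int[P2]_y (f x y + M)%:E)) - M).
    apply: measurable_funB => //; apply: measurableT_comp => //.
    apply: (@measurable_fun_fubini_tonelli_F _ _ _ _ _ P2 (fun z => (f z.1 z.2 + M)%:E)).
      by apply/measurable_EFinP; exact: measurable_funD.
    by move=> z; rewrite lee_fin -lerBlDr sub0r; have := fM z; rewrite ler_norml => /andP[].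
  apply/funext => x; rewrite -[fine _]/(Ex P2 (fun y => f x y + M)) ExD//; last exact: mb_cst.
  by rewrite Ex_cst addrK.
exists M => x; rewrite -[leRHS](Ex_cst P2 M) ler_norml -[- _]mulN1r -ExZ; last exact: mb_cst.
apply/andP; split; apply: le_Ex => //; do ?exact: mb_cst; move=> y.
  by rewrite mulN1r; have := fM (x, y); rewrite ler_norml => /andP[].
by have := fM (x, y); rewrite ler_norml => /andP[].
Qed.

End Ex_product.

Section lebesgue_affine.
Variable R : realType.
Notation mu := (@lebesgue_measure R).

(** Lebesgue measure is determined by its values on half-open intervals, hence equals [a] times its
    image under the affine map; the substitution rule is the integral form of this. *)
Lemma lebesgue_affine (f : R -> \bar R) (a b : R) : 0 < a ->
  measurable_fun setT f -> (forall x, 0 <= f x)%E ->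
  (\int[mu]_x f x = a%:E * \int[mu]_x f (a * x + b)%R)%E.
Proof.
move=> a0 mf f0.
pose phi (x : R) : measurableTypeR R := a * x + b.
have mphi : measurable_fun setT phi.
  by apply: measurable_funD => //; apply: measurable_funM.
have a0' := ltW a0.
pose nu0 : {measure set (measurableTypeR R) -> \bar R} := mscale (NngNum a0') (pushforward mu phi).
pose nu := nu0 mphi.
have muE A : measurable A -> mu A = nu A.
  apply: lebesgue_measure_unique => _ [[x y] _ <-].
  rewrite /nu /nu0 /= /mscale /= /pushforward.
  have -> : phi @^-1` `]x, y] = `](x - b) / a, (y - b) / a]%classic.
    apply/seteqP; split => z /=; rewrite !in_itv/= ltr_pdivrMr// ler_pdivlMr//
      ltrBlDr lerBrDr (mulrC z) //.
  rewrite !lebesgue_measure_itv/= !lte_fin ltr_pM2r ?invr_gt0// ltrD2r.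
  case: ifPn => xy; last by rewrite mule0.
  by rewrite -!EFinD -EFinM; congr EFin; field; rewrite gt_eqF.
transitivity (\int[nu]_x f x)%E.
  by apply: eq_measure_integral => A mA _; exact: muE.
rewrite ge0_integral_mscale//=; congr (_ * _)%E.
by rewrite ge0_integral_pushforward// => x _; exact: f0.
Qed.

End lebesgue_affine.

(** * Gaussian variables *)

Section gaussian.
Variable R : realType.
Notation mu := (@lebesgue_measure R).

Definition gam : probability (measurableTypeR R) R := normal_prob 0 1.

Lemma normal_pdf0E (s u : R) : s != 0 ->
  normal_pdf 0 s u = (Num.sqrt (s ^+ 2 * pi *+ 2))^-1 * expR (- (u ^+ 2 / (s ^+ 2 *+ 2))).
Proof.
by move=> s0; rewrite /normal_pdf (negbTE s0) /normal_fun subr0 mulNr.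
Qed.

Lemma normal_integral (s : R) (f : R -> \bar R) : measurable_fun setT f ->
  (forall x, 0 <= f x)%E ->
  (\int[normal_prob 0 s]_x f x = \int[mu]_x (f x * (normal_pdf 0 s x)%:E))%E.
Proof.
move=> mf f0; apply: ge0_integral_density => //.
- exact: measurable_normal_pdf.
- by move=> x; exact: normal_pdf_ge0.
Qed.

(** Completing the square in the normal density: tilting by an exponential is a translation up to a
    constant. The characteristic function and the variance of [gam] are derived from this
    identity. *)
Lemma gam_translate (l : R) (f : R -> \bar R) : measurable_fun setT f ->
  (forall x, 0 <= f x)%E ->
  (\int[gam]_x (f x * (expR (l * x))%:E) =
   (expR (l ^+ 2 / 2))%:E * \int[gam]_x f (x + l)%R)%E.
Proof.
move=> mf f0.
have me : measurable_fun setT (fun x : R => (expR (l * x))%:E).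
  by apply/measurable_EFinP; apply: measurableT_comp => //; exact: measurable_funM.
have ms : measurable_fun setT (fun x : R => f (x + l)).
  by apply: measurableT_comp => //; exact: measurable_funD.
have mp : measurable_fun setT (fun x : R => (normal_pdf 0 1 x)%:E).
  by apply/measurable_EFinP; exact: measurable_normal_pdf.
have p0 x : (0 <= (normal_pdf 0 1 x)%:E :> \bar R)%E by rewrite lee_fin normal_pdf_ge0.
rewrite [LHS]normal_integral; first last.
- by move=> x; rewrite mule_ge0// lee_fin expR_ge0.
- exact: emeasurable_funM.
rewrite [X in (_ * X)%E]normal_integral//.
rewrite -ge0_integralZl//; first last.
- by move=> x _; rewrite mule_ge0.
- exact: emeasurable_funM.
rewrite [LHS](@lebesgue_affine _ _ 1 l)//; first last.
- by move=> x; rewrite mule_ge0// mule_ge0// lee_fin expR_ge0.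
- by apply: emeasurable_funM => //; exact: emeasurable_funM.
rewrite mul1e; apply: eq_integral => x _; rewrite mul1r.
rewrite -muleA [RHS]muleCA; congr (_ * _)%E; rewrite -!EFinM; congr EFin.
rewrite !normal_pdf0E ?oner_neq0// mulrCA -expRD [RHS]mulrCA -expRD.
congr (_ * expR _); by field.
Qed.

Lemma gam_sym (f : R -> \bar R) : measurable_fun setT f ->
  (forall x, 0 <= f x)%E -> (\int[gam]_x f (- x)%R = \int[gam]_x f x)%E.
Proof.
move=> mf f0.
have mp : measurable_fun setT (fun x : R => (normal_pdf 0 1 x)%:E).
  by apply/measurable_EFinP; exact: measurable_normal_pdf.
have p0 x : (0 <= (normal_pdf 0 1 x)%:E :> \bar R)%E by rewrite lee_fin normal_pdf_ge0.
rewrite normal_integral//; last exact: measurableT_comp.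
rewrite [RHS]normal_integral//.
transitivity (\int[pushforward mu (-%R : R -> measurableTypeR R)]_x (f x * (normal_pdf 0 1 x)%:E))%E.
  have H := @ge0_integral_pushforward _ _ (measurableTypeR R) (measurableTypeR R) R (-%R : R -> measurableTypeR R)
    (measurable_funN (@measurable_id _ _ setT)) mu setT (fun x => f x * (normal_pdf 0 1 x)%:E)%E measurableT.
  rewrite {}H; first last.
  - by move=> x _; rewrite mule_ge0.
  - exact: emeasurable_funM.
  rewrite preimage_setT; apply: eq_integral => x _; congr (_ * _%:E)%E.
  by rewrite !normal_pdf0E ?oner_neq0// sqrrN.
by apply: eq_measure_integral => A mA _; exact: lebesgue_measureN.
Qed.

Lemma normal_scale (s : R) (f : R -> \bar R) : s != 0 -> measurable_fun setT f ->
  (forall x, 0 <= f x)%E ->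
  (\int[normal_prob 0 s]_x f x = \int[gam]_x f (s * x)%R)%E.
Proof.
move=> s0 mf f0.
have mp t : measurable_fun setT (fun x : R => (normal_pdf 0 t x)%:E).
  by apply/measurable_EFinP; exact: measurable_normal_pdf.
have p0 t x : (0 <= (normal_pdf 0 t x)%:E :> \bar R)%E by rewrite lee_fin normal_pdf_ge0.
have ns : 0 < `|s| by rewrite normr_gt0.
transitivity (\int[gam]_x f (`|s| * x)%R)%E.
  rewrite normal_integral// (@lebesgue_affine _ _ `|s| 0)//; first last.
  - by move=> x; rewrite mule_ge0.
  - exact: emeasurable_funM.
  rewrite [RHS]normal_integral//; last first.
    by apply: measurableT_comp => //; exact: measurable_funM.
  rewrite -ge0_integralZl//; first last.
  - by move=> x _; rewrite mule_ge0.
  - have ma : measurable_fun setT (fun x : R => `|s| * x + 0).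
      by apply: measurable_funD => //; exact: measurable_funM.
    by apply: emeasurable_funM; [exact: (measurableT_comp mf)|exact: (measurableT_comp (mp s))].
  apply: eq_integral => x _; rewrite addr0 muleCA; congr (_ * _)%E.
  rewrite -EFinM; congr EFin; rewrite !normal_pdf0E ?oner_neq0// expr1n mul1r mulrA.
  congr (_ * expR _).
    rewrite -mulrnAr sqrtrM ?sqr_ge0// sqrtr_sqr invfM mulrA divff ?mul1r//.
    by rewrite gt_eqF.
  by rewrite exprMn real_normK ?num_real//; field.
have [s_ge0|s_lt0] := leP 0 s; first by rewrite ger0_norm.
rewrite ltr0_norm// -[RHS]gam_sym//; last first.
  by apply: measurableT_comp => //; exact: measurable_funM.
by apply: eq_integral => x _; rewrite mulrN mulNr.
Qed.

Lemma gam_expR (l : R) : (\int[gam]_x (expR (l * x))%:E = (expR (l ^+ 2 / 2))%:E)%E.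
Proof.
have := @gam_translate l (cst 1%E) (measurable_cst _) (fun=> lee01).
under eq_integral do rewrite mul1e.
move=> ->; rewrite integral_cst// (_ : _ setT = 1%E) ?mule1//.
exact: (@probability_setT _ _ _ gam).
Qed.

Lemma gam_integrable (f : R -> R) (M l : R) : measurable_fun setT f ->
  (forall u, `|f u| <= M * expR (l * u) + M * expR (- l * u)) ->
  gam.-integrable setT (EFin \o f).
Proof.
move=> mf fM.
have ie m : gam.-integrable setT (EFin \o (fun u : R => M * expR (m * u))).
  have -> : EFin \o (fun u : R => M * expR (m * u)) = (fun u => M%:E * (expR (m * u))%:E)%E by [].
  apply: integrableZl => //.
  apply/integrableP; split.
    by apply/measurable_EFinP; apply: measurableT_comp => //; exact: measurable_funM.
  under eq_integral do rewrite /= ger0_norm ?expR_ge0//.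
  by rewrite gam_expR ltry.
apply: le_integrable (integrableD _ (ie l) (ie (- l))) => //.
  exact/measurable_EFinP.
by move=> u _ /=; rewrite lee_fin (le_trans (fM u))// ler_norm.
Qed.

Lemma norm_expR_le (u : R) : expR `|u| <= expR u + expR (- u).
Proof.
have [u0|u0] := leP 0 u; first by rewrite ger0_norm// lerDl expR_ge0.
by rewrite ltr0_norm// lerDr expR_ge0.
Qed.

(** Only parameters within distance 1 of [a] have to be dominated; the dominating sum of two
    exponentials is integrable by [gam_integrable]. *)
Lemma derive_Ex_gam (f f' : R -> R -> R) (a M l : R) :
  (forall x, measurable_fun setT (f x)) ->
  (forall x u : R, is_derive x (1 : R) (f ^~ u) (f' x u)) ->
  (forall x u, a - 1 < x < a + 1 ->
     `|f x u| <= M * expR (l * u) + M * expR (- l * u)) ->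
  (forall x u, a - 1 < x < a + 1 ->
     `|f' x u| <= M * expR (l * u) + M * expR (- l * u)) ->
  is_derive a (1 : R) (fun x => Ex gam (f x)) (Ex gam (f' a)).
Proof.
move=> mf df fM f'M.
pose G (u : R) := `|M| * expR (l * u) + `|M| * expR (- l * u).
have Ia : `]a - 1, a + 1[%classic a.
  by rewrite /= in_itv/=; apply/andP; split; lra.
have I1 x : `]a - 1, a + 1[%classic x -> gam.-integrable setT (EFin \o f x).
  by rewrite /= in_itv/= => xa; apply: (gam_integrable (mf x)) => u; exact: fM.
have I2 x y : `]a - 1, a + 1[%classic x -> setT y -> derivable (f ^~ y) x 1.
  by move=> _ _; have [] := df x y.
have G0 u : 0 <= G u by rewrite addr_ge0// mulr_ge0// expR_ge0.
have IG : gam.-integrable setT (EFin \o G).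
  apply: (@gam_integrable _ `|M| l).
    by apply: measurable_funD; apply: measurable_funM => //;
      apply: measurableT_comp => //; exact: measurable_funM.
  by move=> u; rewrite ger0_norm.
have dE x y : partial1of2 f x y = f' x y.
  by rewrite /partial1of2 derive1E; have [_ ] := df x y.
have I3 x y : `]a - 1, a + 1[%classic x -> setT y -> `|partial1of2 f x y| <= G y.
  rewrite /= in_itv/= => xa _; rewrite dE (le_trans (f'M x y xa))//.
  by rewrite lerD// ler_wpM2r ?expR_ge0// ler_norm.
apply: DeriveDef.
  exact: (@derivable_under_integral _ _ _ gam f setT measurableT a _ _ Ia I1 I2 G G0 IG I3).
rewrite -derive1E.
rewrite (@differentiation_under_integral _ _ _ gam f setT measurableT a _ _ Ia I1 I2 G G0 IG I3).
by apply: eq_Rintegral => y _; rewrite dE.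
Qed.

Definition gcos (x : R) := Ex gam (fun u => cos (x * u)).

Let mM (x : R) : measurable_fun setT (fun u : R => x * u).
Proof. exact: measurable_funM. Qed.

Lemma gam_sin (x : R) : Ex gam (fun u => sin (x * u)) = 0.
Proof.
have b := mb_sin (mM x).
(* The constant 1 makes the integrand nonnegative and cancels at the end; [gam_sin_translate] uses
   the same device. *)
have := @gam_sym (fun u => (1 + sin (x * u))%:E).
have m : measurable_fun setT (fun u : R => (1 + sin (x * u))%:E).
  by apply/measurable_EFinP; apply: measurable_funD => //; case: b.
have b' : mb (fun u : R => 1 + sin (x * - u)).
  by apply: mbD; [exact: mb_cst|apply: mb_sin; apply: measurable_funM => //; exact: measurable_funN].
move=> /(_ m).
have H : forall u : R, (0 <= (1 + sin (x * u))%:E)%E.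
  by move=> u; rewrite lee_fin -lerBlDl sub0r sin_geN1.
move=> /(_ H); rewrite !Ex_EFin//; last by apply: mbD => //; exact: mb_cst.
case; under eq_Ex do rewrite mulrN sinN -mulN1r.
rewrite !ExD ?ExZ ?Ex_cst//; do ?[exact: mb_cst|exact: mbZ].
by move=> /addrI; lra.
Qed.

Lemma gam_sin_translate (x l : R) :
  Ex gam (fun u => sin (x * u) * expR (l * u)) = expR (l ^+ 2 / 2) * (sin (x * l) * gcos x).
Proof.
have b := mb_sin (mM x).
have me : measurable_fun setT (fun u : R => expR (l * u)).
  by apply: measurableT_comp.
have ie : gam.-integrable setT (EFin \o (fun u : R => expR (l * u))).
  apply: (@gam_integrable _ 1 l) => // u.
  by rewrite !mul1r ger0_norm ?expR_ge0// lerDl expR_ge0.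
have ise : gam.-integrable setT (EFin \o (fun u : R => sin (x * u) * expR (l * u))).
  apply: (@gam_integrable _ 1 l).
    by apply: measurable_funM => //; case: b.
  move=> u; rewrite !mul1r normrM (ger0_norm (expR_ge0 _)).
  rewrite (@le_trans _ _ (1 * expR (l * u)))//; last by rewrite mul1r lerDl expR_ge0.
  by rewrite ler_wpM2r ?expR_ge0// ler_norml sin_geN1 sin_le1.
have bD : mb (fun u : R => 1 + sin (x * (u + l))).
  by apply: mbD; [exact: mb_cst|apply: mb_sin; apply: measurable_funM => //; exact: measurable_funD].
have := @gam_translate l (fun u => (1 + sin (x * u))%:E).
have m : measurable_fun setT (fun u : R => (1 + sin (x * u))%:E).
  by apply/measurable_EFinP; apply: measurable_funD => //; case: b.
have H : forall u : R, (0 <= (1 + sin (x * u))%:E)%E.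
  by move=> u; rewrite lee_fin -lerBlDl sub0r sin_geN1.
move=> /(_ m H); rewrite (Ex_EFin gam bD) -EFinM.
have -> : Ex gam (fun u : R => 1 + sin (x * (u + l))) = 1 + sin (x * l) * gcos x.
  transitivity (Ex gam (fun u : R => 1 + (sin (x * l) * cos (x * u) + cos (x * l) * sin (x * u)))).
    by apply: eq_Ex => u; rewrite mulrDr sinD; ring.
  rewrite !ExD ?ExZ ?Ex_cst//; do ?[exact: mb_cst|apply: mbZ|apply: mbD|exact: mb_cos|exact: mb_sin].
  by rewrite gam_sin mulr0 addr0.
under eq_integral do rewrite -EFinM mulrDl mul1r EFinD.
rewrite integralD_EFin// gam_expR.
rewrite /Ex /Rintegral.
move: (integrable_fin_num measurableT ise) => /=.
move=> /fineK; set I := fine _ => <-; rewrite -EFinD => -[].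
by rewrite mulrDr mulr1 => /addrI.
Qed.

Let norm_le_expR (u : R) : `|u| <= expR (1 * u) + expR (- 1 * u).
Proof.
rewrite mulN1r mul1r (le_trans _ (norm_expR_le u))// (le_trans _ (expR_ge1Dx _))//.
by rewrite lerDr.
Qed.

Let sqr_le_expR (u : R) : u ^+ 2 <= 2 * expR (1 * u) + 2 * expR (- 1 * u).
Proof.
rewrite -mulrDr mulN1r mul1r -(real_normK (num_real u)).
rewrite (@le_trans _ _ (2 * expR `|u|))//; last by rewrite ler_wpM2l// norm_expR_le.
have := expR_ge1Dxn 1 (normr_ge0 u).
by rewrite (_ : 2`!%:R = 2)//; lra.
Qed.

Let mexp (l : R) : measurable_fun setT (fun u : R => expR (l * u)).
Proof. exact: measurableT_comp. Qed.

Let sin_le1' (u : R) : `|sin u| <= 1. Proof. by rewrite ler_norml sin_geN1 sin_le1. Qed.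

Let cos_le1' (u : R) : `|cos u| <= 1. Proof. by rewrite ler_norml cos_geN1 cos_le1. Qed.

Let norm_le2 (u : R) : `|u| <= 2 * expR (1 * u) + 2 * expR (- 1 * u).
Proof.
have := norm_le_expR u; have := expR_ge0 (1 * u); have := expR_ge0 (- 1 * u); lra.
Qed.

Let expR_2norm (u : R) : expR `|u| * expR `|u| <= 2 * expR (2 * u) + 2 * expR (- 2 * u).
Proof.
rewrite -expRD (_ : `|u| + `|u| = `|2 * u|); last by rewrite normrM ger0_norm//; ring.
rewrite (le_trans (norm_expR_le _))// mulNr.
by have := expR_ge0 (2 * u); have := expR_ge0 (- (2 * u)); lra.
Qed.

Let expR_lt1 (l u : R) : `|l| < 1 -> expR (l * u) <= expR `|u|.
Proof.
by move=> l1; rewrite ler_expR (le_trans (ler_norm _))// normrM ler_piMl// ltW.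
Qed.

Let expR_le2 (l u : R) : `|l| < 1 -> `|u| * expR (l * u) <= 2 * expR (2 * u) + 2 * expR (- 2 * u).
Proof.
move=> l1; apply: le_trans (expR_2norm u).
apply: ler_pM; [exact: normr_ge0|exact: expR_ge0| |exact: expR_lt1].
by rewrite (le_trans _ (expR_ge1Dx _))// lerDr.
Qed.

Let expR_le2' (l u : R) : `|l| < 1 -> expR (l * u) <= 2 * expR (2 * u) + 2 * expR (- 2 * u).
Proof.
move=> l1; apply: le_trans (expR_2norm u); apply: (le_trans (expR_lt1 u l1)).
by rewrite ler_peMl ?expR_ge0// (le_trans _ (expR_ge1Dx _))// lerDl.
Qed.

(** Gaussian integration by parts, obtained by differentiating [gam_sin_translate] in [l] at 0,
    where the right-hand side has derivative [x * gcos x]. *)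
Lemma gam_Xsin (x : R) : Ex gam (fun u => u * sin (x * u)) = x * gcos x.
Proof.
have D := @derive_Ex_gam (fun l u => sin (x * u) * expR (l * u))
  (fun l u => sin (x * u) * (u * expR (l * u))) 0 2 2.
have {}D : is_derive (0 : R) (1 : R) (fun l => Ex gam (fun u => sin (x * u) * expR (l * u)))
    (Ex gam (fun u => sin (x * u) * (u * expR (0 * u)))).
  apply: D.
  - move=> l; apply: measurable_funM; first by case: (mb_sin (mM x)).
    exact: mexp.
  - move=> l u; apply: is_derive_eq.
    by rewrite /GRing.scale/=; ring.
  - move=> l u l1; rewrite normrM (ger0_norm (expR_ge0 _)).
    apply: (@le_trans _ _ (1 * expR (l * u))); first by rewrite ler_wpM2r ?expR_ge0.
    rewrite mul1r; apply: expR_le2'.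
    by rewrite ltr_norml; move: l1; rewrite sub0r add0r.
  - move=> l u l1; rewrite normrM.
    apply: (@le_trans _ _ (1 * `|u * expR (l * u)|)); first by rewrite ler_wpM2r.
    rewrite mul1r normrM (ger0_norm (expR_ge0 _)); apply: expR_le2.
    by rewrite ltr_norml; move: l1; rewrite sub0r add0r.
have D2 : is_derive (0 : R) (1 : R) (fun l : R => expR (l ^+ 2 / 2) * (sin (x * l) * gcos x)) (x * gcos x).
  apply: is_derive_eq.
  by rewrite /GRing.scale/= !mulr0 sin0 cos0 expr0n/= mul0r expR0; ring.
have E : (fun l => Ex gam (fun u => sin (x * u) * expR (l * u))) =
    (fun l : R => expR (l ^+ 2 / 2) * (sin (x * l) * gcos x)).
  by apply/funext => l; exact: gam_sin_translate.
rewrite E in D.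
have [_ <-] := D2; have [_ ->] := D.
by apply: eq_Ex => u; rewrite mul0r expR0 mulr1 mulrC.
Qed.

(** By [gam_Xsin] the function [gcos] solves g' = - x g. Hence [gcos y * expR (y ^+ 2 / 2)] has
    derivative zero and keeps its value 1 at 0. *)
Lemma gcosE (x : R) : gcos x = expR (- (x ^+ 2 / 2)).
Proof.
have D (y : R) : is_derive y (1 : R) gcos (- (y * gcos y)).
  rewrite -gam_Xsin.
  have := @derive_Ex_gam (fun y u => cos (y * u)) (fun y u => - (u * sin (y * u))) y 2 1.
  have -> : Ex gam (fun u => - (u * sin (y * u))) = - Ex gam (fun u => u * sin (y * u)).
    rewrite -[RHS]mulN1r /Ex -RintegralZl//.
      by apply: eq_Rintegral => u _; rewrite mulN1r.
    apply: (@gam_integrable _ 2 1); first by apply: measurable_funM => //; case: (mb_sin (mM y)).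
    by move=> u; rewrite normrM (le_trans _ (norm_le2 u))// ler_piMr.
  apply.
  - by move=> z; case: (mb_cos (mM z)).
  - move=> z u; apply: is_derive_eq.
    by rewrite /GRing.scale/=; ring.
  - move=> z u _; apply: (le_trans (cos_le1' _)).
    by have := expR_ge1Dx (1 * u); have := expR_ge1Dx (- 1 * u); lra.
  - by move=> z u _; rewrite normrN normrM (le_trans _ (norm_le2 u))// ler_piMr.
have D1 (y : R) : is_derive y (1 : R) (fun y => gcos y * expR (y ^+ 2 / 2)) 0.
  apply: is_derive_eq.
  by rewrite /GRing.scale/=; field.
have := @is_derive_0_is_cst _ _ x 0 D1.
rewrite expr0n/= mul0r expR0 mulr1 {2}/gcos.
under eq_Ex do rewrite mul0r cos0.
rewrite (Ex_cst gam 1) => H.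
apply: (mulIf (lt0r_neq0 (expR_gt0 (x ^+ 2 / 2)))).
by rewrite H mulrC expRxMexpNx_1.
Qed.

(** Differentiate [gam_Xsin] at 0: the left-hand side yields the second moment, and the right-hand
    side, by now the explicit function [y * expR (- (y ^+ 2 / 2))], has derivative 1. *)
Lemma gam_var : (\int[gam]_u (u ^+ 2)%:E = 1)%E.
Proof.
have D := @derive_Ex_gam (fun y u => u * sin (y * u)) (fun y u => u * (u * cos (y * u))) 0 2 1.
have {}D : is_derive (0 : R) (1 : R) (fun y => Ex gam (fun u => u * sin (y * u)))
    (Ex gam (fun u => u * (u * cos (0 * u)))).
  apply: D.
  - by move=> z; apply: measurable_funM => //; case: (mb_sin (mM z)).
  - move=> z u; apply: is_derive_eq.
    by rewrite /GRing.scale/=; ring.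
  - by move=> z u _; rewrite normrM (le_trans _ (norm_le2 u))// ler_piMr.
  - move=> z u _; rewrite mulrA normrM (le_trans _ (sqr_le_expR u))//.
    by rewrite -expr2 normrX real_normK ?num_real// ler_piMr// sqr_ge0.
have E : (fun y => Ex gam (fun u => u * sin (y * u))) = (fun y : R => y * expR (- (y ^+ 2 / 2))).
  by apply/funext => y; rewrite gam_Xsin gcosE.
rewrite E in D.
have D2 : is_derive (0 : R) (1 : R) (fun y : R => y * expR (- (y ^+ 2 / 2))) 1.
  clear D; apply: is_derive_eq.
  rewrite /GRing.scale/=.
  by rewrite mul0r add0r mulr1 expr0n/= mul0r oppr0 expR0.
have {D2} : Ex gam (fun u => u * (u * cos (0 * u))) = 1.
  by have [_ <-] := D2; have [_ ->] := D.
under eq_Ex do rewrite mul0r cos0 mulr1 -expr2.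
rewrite /Ex /Rintegral => H.
have I : gam.-integrable setT (EFin \o (fun u : R => u ^+ 2)).
  apply: (@gam_integrable _ 2 1); first exact: measurable_funX.
  by move=> u; rewrite ger0_norm ?sqr_ge0.
by rewrite -(fineK (integrable_fin_num measurableT I)) H.
Qed.

End gaussian.

(** * Fourier uniqueness on the line *)

Section uniqueness1.
Variable R : realType.
Notation mu := (@lebesgue_measure R).

(** The weight [g] may change sign. Uniqueness in several dimensions is reduced to this
    one-dimensional notion by taking for [g] the contribution of all the other coordinates. *)
Definition trig_agree d (T : measurableType d) (P : probability T R) (g Z : T -> R)
    d' (T' : measurableType d') (P' : probability T' R) (g' Z' : T' -> R) :=
  forall x : R, Ex P (fun t => g t * cos (x * Z t)) = Ex P' (fun t => g' t * cos (x * Z' t)) /\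
    Ex P (fun t => g t * sin (x * Z t)) = Ex P' (fun t => g' t * sin (x * Z' t)).

(* The Gaussian of width [e] at distance [v - Z], written as a mixture of cosines. *)
Lemma Ex_gauss_kernel d (T : measurableType d) (P : probability T R) (g Z : T -> R)
    (v e : R) : mb g -> measurable_fun setT Z ->
  Ex P (fun t => g t * expR (- ((e * (v - Z t)) ^+ 2 / 2))) =
  Ex (gam R) (fun x => cos (x * (e * v)) * Ex P (fun t => g t * cos ((x * e) * Z t)) +
    sin (x * (e * v)) * Ex P (fun t => g t * sin ((x * e) * Z t))).
Proof.
move=> bg mZ.
have mW : measurable_fun setT (fun z : T * measurableTypeR R => e * (v - Z z.1) * z.2).
  apply: measurable_funM => //; apply: measurable_funM => //.
  by apply: measurable_funB => //; exact: measurableT_comp.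
have bW : mb (fun z : T * measurableTypeR R => g z.1 * cos (e * (v - Z z.1) * z.2)).
  apply: mbM; last exact: mb_cos.
  case: bg => mg [M gM]; split; last by exists M => z; exact: gM.
  exact: (measurableT_comp mg measurable_fst).
have mxZ x : measurable_fun setT (fun t => x * Z t) by exact: measurable_funM.
transitivity (Ex P (fun t => Ex (gam R) (fun x => g t * cos (e * (v - Z t) * x)))).
  by apply: eq_Ex => t; rewrite -gcosE /gcos ExZ//; apply: mb_cos; exact: measurable_funM.
rewrite (Ex_swap _ _ bW); apply: eq_Ex => x.
have bs : mb (fun t => g t * sin (x * e * Z t)) by apply: mbM => //; exact: mb_sin.
have bc : mb (fun t => g t * cos (x * e * Z t)) by apply: mbM => //; exact: mb_cos.
rewrite -!ExZ//.
rewrite -ExD; first last.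
- by apply: mbZ; apply: mbM => //; exact: mb_sin.
- by apply: mbZ; apply: mbM => //; exact: mb_cos.
apply: eq_Ex => t.
rewrite (_ : e * (v - Z t) * x = x * (e * v) - x * e * Z t); last by ring.
by rewrite cosB; ring.
Qed.

Lemma trig_agree_kernel d (T : measurableType d) (P : probability T R) (g Z : T -> R)
    d' (T' : measurableType d') (P' : probability T' R) (g' Z' : T' -> R) :
  mb g -> mb g' -> measurable_fun setT Z -> measurable_fun setT Z' ->
  trig_agree P g Z P' g' Z' -> forall v e : R,
  Ex P (fun t => g t * expR (- ((e * (v - Z t)) ^+ 2 / 2))) =
  Ex P' (fun t => g' t * expR (- ((e * (v - Z' t)) ^+ 2 / 2))).
Proof.
move=> bg bg' mZ mZ' H v e; rewrite !Ex_gauss_kernel//; apply: eq_Ex => x.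
by have [-> ->] := H (x * e).
Qed.

Lemma mb_indic_comp d (T : measurableType d) (Z : T -> R) (A : set R) :
  measurable_fun setT Z -> measurable A -> mb (fun t => \1_A (Z t) : R).
Proof.
move=> mZ mA; split; first exact: (measurableT_comp (measurable_indic mA) mZ).
by exists 1 => x; rewrite indicE; case: (_ \in _); rewrite ?normr1 ?normr0.
Qed.

Let peak0 : 0 <= normal_peak 1 :> R. Proof. exact: normal_peak_ge0. Qed.

Lemma gam_smoothed (b e z : R) : 0 < e ->
  (\int[gam R]_u (\1_(`]b, +oo[) (z + u / e))%:E =
   \int[mu]_v (\1_(`]b, +oo[) v * (e * normal_peak 1 * expR (- ((e * (v - z)) ^+ 2 / 2))))%:E)%E.
Proof.
move=> e0; have mI : measurable_fun setT (\1_(`]b, +oo[) : R -> R) by exact: measurable_indic.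
have mzu : measurable_fun setT (fun u : R => z + u / e).
  by apply: measurable_funD => //; exact: measurable_funM.
rewrite normal_integral; first last.
- by move=> u; rewrite lee_fin.
- by apply/measurable_EFinP; exact: measurableT_comp.
have mk : measurable_fun setT (fun v : R => expR (- ((e * (v - z)) ^+ 2 / 2))).
  apply: measurableT_comp => //; apply: measurable_funN => //.
  apply: measurable_funM => //; apply: measurable_funX; apply: measurable_funM => //.
  exact: measurable_funB.
rewrite [RHS](@lebesgue_affine _ _ e^-1 z) ?invr_gt0//; first last.
- by move=> v; rewrite lee_fin !mulr_ge0// ?expR_ge0// ltW.
- by apply/measurable_EFinP; apply: measurable_funM => //; exact: measurable_funM.
rewrite -ge0_integralZl//; first last.
- by rewrite lee_fin invr_ge0 ltW.
- by move=> u _; rewrite lee_fin !mulr_ge0// ?expR_ge0// ltW.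
- apply/measurable_EFinP; apply: measurable_funM.
    by apply: measurableT_comp => //; apply: measurable_funD => //; exact: measurable_funM.
  apply: measurable_funM => //; apply: (measurableT_comp mk).
  by apply: measurable_funD => //; exact: measurable_funM.
apply: eq_integral => u _; rewrite -!EFinM; congr EFin.
rewrite normal_pdf0E ?oner_neq0// (_ : e^-1 * u + z = z + u / e); last by rewrite addrC mulrC.
have -> : e * (z + u / e - z) = u by field; rewrite gt_eqF.
rewrite -[(Num.sqrt _)^-1]/(normal_peak 1) expr1n; move: (normal_peak 1) => s.
by field; rewrite gt_eqF.
Qed.

(** By Fubini, smoothing the indicator of a ray with a normal variable of width [1 / e] turns its
    expectation into an integral of the kernels of [Ex_gauss_kernel], which [trig_agree]
    determines. *)
Lemma Ex_smoothed d (T : measurableType d) (P : probability T R) (g Z : T -> R)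
    (b e : R) : 0 < e -> mb g -> measurable_fun setT Z ->
  (Ex P (fun t => Ex (gam R) (fun u => g t * \1_(`]b, +oo[) (Z t + u / e))))%:E =
  (\int[mu]_v (\1_(`]b, +oo[) v * (e * normal_peak 1) *
     Ex P (fun t => g t * expR (- ((e * (v - Z t)) ^+ 2 / 2))))%:E)%E.
Proof.
move=> e0 bg mZ; have [mg [M gM]] := bg.
pose k (v z : R) := \1_(`]b, +oo[) v * (e * normal_peak 1 * expR (- ((e * (v - z)) ^+ 2 / 2))).
have k0 v z : 0 <= k v z by rewrite /k !mulr_ge0// ?expR_ge0// ltW.
have mI : measurable_fun setT (\1_(`]b, +oo[) : R -> R) by exact: measurable_indic.
have mk : measurable_fun setT (fun w : T * measurableTypeR R => k w.2 (Z w.1)).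
  apply: measurable_funM; first exact: (measurableT_comp mI measurable_snd).
  apply: measurable_funM => //.
  apply: measurableT_comp => //; apply: measurable_funN => //.
  apply: measurable_funM => //; apply: measurable_funX; apply: measurable_funM => //.
  by apply: measurable_funB => //; exact: (measurableT_comp mZ measurable_fst).
have mgk : measurable_fun setT (fun w : T * measurableTypeR R => (g w.1 * k w.2 (Z w.1))%:E).
  apply/measurable_EFinP; apply: measurable_funM => //.
  exact: (measurableT_comp mg measurable_fst).
have mks t : measurable_fun setT (fun v : measurableTypeR R => (k v (Z t))%:E).
  by apply/measurable_EFinP; exact: (measurableT_comp mk (pair1_measurable t)).
have mzu z : measurable_fun setT (fun u : R => z + u / e).
  by apply: measurable_funD => //; exact: measurable_funM.
have bu z : mb (fun u : measurableTypeR R => \1_(`]b, +oo[) (z + u / e) : R).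
  exact: (mb_indic_comp (mzu z) (measurable_itv _)).
have kE t : (\int[mu]_v (k v (Z t))%:E =
    (Ex (gam R) (fun u => \1_(`]b, +oo[) (Z t + u / e)))%:E)%E.
  rewrite -gam_smoothed// Ex_EFin//.
have kle1 t : (\int[mu]_v (k v (Z t))%:E <= 1)%E.
  rewrite kE lee_fin -[leRHS](Ex_cst (gam R) 1); apply: le_Ex; [exact: bu|exact: mb_cst|].
  by move=> u; rewrite indicE; case: (_ \in _).
have Igk : ((P \x mu)%E).-integrable setT (fun w => (g w.1 * k w.2 (Z w.1))%:E).
  apply/integrable12ltyP => //=.
  apply: (@le_lt_trans _ _ (\int[P]_t M%:E)%E); last first.
    by rewrite Ex_EFin ?ltry//; exact: mb_cst.
  apply: le_lower_integral => t.
    by apply: integral_ge0 => v _; rewrite lee_fin.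
  under eq_integral do rewrite normrM (ger0_norm (k0 _ _)) EFinM.
  rewrite ge0_integralZl//; last by move=> v _; rewrite lee_fin.
  rewrite -[leRHS]mule1 lee_pmul// ?lee_fin//.
  by apply: integral_ge0 => v _; rewrite lee_fin.
have IkZ t : mu.-integrable setT (fun v => (k v (Z t))%:E).
  apply/integrableP; split => //.
  under eq_integral do rewrite /= ger0_norm//.
  by rewrite kE ltry.
transitivity (\int[P]_t \int[mu]_v (g t * k v (Z t))%:E)%E.
  have bE : mb (fun t => Ex (gam R) (fun u => g t * \1_(`]b, +oo[) (Z t + u / e))).
    apply: (@mb_Ex _ _ _ _ _ (gam R) (fun t u => g t * \1_(`]b, +oo[) (Z t + u / e))).
    apply: mbM.
      by split; [exact: (measurableT_comp mg measurable_fst)|exists M => w; exact: gM].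
    apply: mb_indic_comp => //; apply: measurable_funD.
      exact: (measurableT_comp mZ measurable_fst).
    by apply: measurable_funM => //; exact: measurable_snd.
  rewrite -Ex_EFin//; apply: eq_integral => t _.
  under [RHS]eq_integral do rewrite EFinM.
  by rewrite (@integralZl _ _ _ mu)// kE -EFinM ExZ.
rewrite (@Fubini _ _ _ _ _ P mu (fun w => (g w.1 * k w.2 (Z w.1))%:E))//.
apply: eq_integral => v _ /=.
have bk : mb (fun t => expR (- ((e * (v - Z t)) ^+ 2 / 2))).
  split.
    apply: measurableT_comp => //; apply: measurable_funN => //.
    apply: measurable_funM => //; apply: measurable_funX; apply: measurable_funM => //.
    exact: measurable_funB.
  exists 1 => t; rewrite ger0_norm ?expR_ge0// -[leRHS]expR0 ler_expR oppr_le0.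
  by rewrite divr_ge0// sqr_ge0.
rewrite -ExZ; last exact: mbM.
have -> : (fun t => (g t * k v (Z t))%:E) =
   (fun t => (\1_`]b, +oo[ v * (e * normal_peak 1) * (g t * expR (- ((e * (v - Z t)) ^+ 2 / 2))))%:E).
  by apply/funext => t; rewrite /k; congr EFin; ring.
by rewrite Ex_EFin//; apply: mbZ; exact: mbM.
Qed.

(** The threshold tends to [a] like 1/n while the perturbation vanishes like 1/n^2. The limit is
    therefore the indicator at every point, also at [z = a], where an unshifted threshold would
    leave the answer to the sign of [u]. *)
Lemma smoothed_indic_cvg (a z u : R) :
  \1_(`]a + n.+1%:R^-1, +oo[) (z + u / n.+1%:R ^+ 2) @[n --> \oo] --> (\1_(`]a, +oo[) z : R).
Proof.
have [za|az] := ltP a z.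
  (* Beyond [|u|] the numerator [1 - u / m] is at most 2, and beyond [2 / (z - a)] the quotient
     [2 / m] is smaller than [z - a]. *)
  pose N := Num.truncn (Num.max `|u| (2 / (z - a))).
  apply: cvg_near_cst; near=> n.
  have nN : Num.max `|u| (2 / (z - a)) < n.+1%:R.
    rewrite (lt_le_trans (Num.Theory.truncnS_gt _))// ler_nat ltnS; near: n; exact: nbhs_infty_ge.
  rewrite !indicE !mem_set//= in_itv/= andbT//.
  move: nN; rewrite gt_max => /andP[un zn].
  have : 0 < n.+1%:R :> R by [].
  move: un zn; move: (n.+1%:R) => m un zn n0; rewrite -subr_gt0.
  have -> : z + u / m ^+ 2 - (a + m^-1) = (z - a) - (1 - u / m) / m.
    by field; rewrite gt_eqF.
  rewrite subr_gt0 ltr_pdivrMr//.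
  move: zn; rewrite ltr_pdivrMr ?subr_gt0// mulrC; apply: le_lt_trans.
  have : `|u / m| <= 1 by rewrite normrM normfV (gtr0_norm n0) ler_pdivrMr// mul1r ltW.
  by rewrite ler_norml => /andP[]; lra.
pose N := Num.truncn `|u|.
apply: cvg_near_cst; near=> n.
have nN : `|u| < n.+1%:R.
  rewrite (lt_le_trans (Num.Theory.truncnS_gt _))// ler_nat ltnS; near: n; exact: nbhs_infty_ge.
rewrite !indicE !memNset//= in_itv/= andbT; apply/negP; rewrite -leNgt//.
have n0 : 0 < n.+1%:R :> R by [].
rewrite lerD// ler_pdivrMr ?exprn_gt0// expr2 mulrA mulVf ?gt_eqF// mul1r.
by rewrite (le_trans (ler_norm _))// ltW.
Unshelve. all: by end_near. Qed.

Lemma trig_agree_ray d (T : measurableType d) (P : probability T R) (g Z : T -> R)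
    d' (T' : measurableType d') (P' : probability T' R) (g' Z' : T' -> R) :
  mb g -> mb g' -> measurable_fun setT Z -> measurable_fun setT Z' ->
  trig_agree P g Z P' g' Z' -> forall a : R,
  Ex P (fun t => g t * \1_(`]a, +oo[) (Z t)) = Ex P' (fun t => g' t * \1_(`]a, +oo[) (Z' t)).
Proof.
move=> bg bg' mZ mZ' H a.
pose b n : R := a + n.+1%:R^-1.
pose e n : R := n.+1%:R ^+ 2.
have S n : Ex P (fun t => Ex (gam R) (fun u => g t * \1_(`]b n, +oo[) (Z t + u / e n))) =
    Ex P' (fun t => Ex (gam R) (fun u => g' t * \1_(`]b n, +oo[) (Z' t + u / e n))).
  apply: EFin_inj; rewrite !Ex_smoothed// ?exprn_gt0//.
  by apply: eq_integral => v _; rewrite (trig_agree_kernel bg bg' mZ mZ' H).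
have L d0 (T0 : measurableType d0) (P0 : probability T0 R) (g0 Z0 : T0 -> R) :
    mb g0 -> measurable_fun setT Z0 ->
    Ex P0 (fun t => Ex (gam R) (fun u => g0 t * \1_(`]b n, +oo[) (Z0 t + u / e n))) @[n --> \oo]
    --> Ex P0 (fun t => g0 t * \1_(`]a, +oo[) (Z0 t)).
  move=> b0 m0; have [mg0 [M gM]] := b0.
  have bg0 : mb (fun w : T0 * measurableTypeR R => g0 w.1).
    by split; [exact: (measurableT_comp mg0 measurable_fst)|exists M => w; exact: gM].
  have mZu n : measurable_fun setT (fun w : T0 * measurableTypeR R => Z0 w.1 + w.2 / e n).
    apply: measurable_funD; first exact: (measurableT_comp m0 measurable_fst).
    by apply: measurable_funM => //; exact: measurable_snd.
  have bn n : mb (fun w : T0 * measurableTypeR R => g0 w.1 * \1_(`]b n, +oo[) (Z0 w.1 + w.2 / e n)).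
    by apply: mbM => //; exact: mb_indic_comp.
  have -> : Ex P0 (fun t => g0 t * \1_(`]a, +oo[) (Z0 t)) =
      Ex (pprod P0 (gam R)) (fun w => g0 w.1 * \1_(`]a, +oo[) (Z0 w.1)).
    rewrite Ex_fubini/=; last first.
      apply: mbM => //; apply: mb_indic_comp => //.
      exact: (measurableT_comp m0 measurable_fst).
    by apply: eq_Ex => t; rewrite Ex_cst.
  under eq_fun => n do rewrite -(Ex_fubini P0 (gam R) (bn n)).
  apply: (@Ex_lim _ _ _ _ _ _ M).
  - by move=> n; case: (bn n).
  - move=> n w; rewrite normrM indicE (le_trans _ (gM w.1))// ler_piMr//.
    by case: (_ \in _); rewrite ?normr1 ?normr0.
  - move=> [t u] /=; apply: cvgM; first exact: cvg_cst.
    exact: smoothed_indic_cvg.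
have := L _ _ P g Z bg mZ; under eq_fun do rewrite S.
by move/(cvg_unique (@Rhausdorff R)); apply; exact: L.
Qed.

(* One-dimensional Fourier uniqueness, for the signed measures [E[g 1_A(Z)]]. *)
Lemma trig_agree_indic d (T : measurableType d) (P : probability T R) (g Z : T -> R)
    d' (T' : measurableType d') (P' : probability T' R) (g' Z' : T' -> R) :
  mb g -> mb g' -> measurable_fun setT Z -> measurable_fun setT Z' ->
  trig_agree P g Z P' g' Z' -> forall A : set R, measurable A ->
  Ex P (fun t => g t * \1_A (Z t)) = Ex P' (fun t => g' t * \1_A (Z' t)).
Proof.
move=> bg bg' mZ mZ' H.
have HT : Ex P g = Ex P' g'.
  have [+ _] := H 0; under eq_Ex do rewrite mul0r cos0 mulr1.
  by under [in RHS]eq_Ex do rewrite mul0r cos0 mulr1.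
suff Hs : forall A, <<s @RGenOInfty.G R >> A ->
    Ex P (fun t => g t * \1_A (Z t)) = Ex P' (fun t => g' t * \1_A (Z' t)).
  have GE : @measurable _ (measurableTypeR R) = <<s @RGenOInfty.G R >>.
    exact: RGenOInfty.measurableE.
  by move=> A mA; apply: Hs; rewrite -GE.
apply: (@dynkin_induction _ (measurableTypeR R) (@RGenOInfty.G R)
  (fun A => Ex P (fun t => g t * \1_A (Z t)) = Ex P' (fun t => g' t * \1_A (Z' t)))).
- exact: RGenOInfty.measurableE.
- move=> _ _ [x ->] [y ->]; exists (Num.max x y).
  by apply/seteqP; split => z /=; rewrite !in_itv/= !andbT gt_max; [case=> -> ->|case/andP].
- by under eq_Ex do rewrite indicT mulr1; under [RHS]eq_Ex do rewrite indicT mulr1.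
- by move=> _ [x ->]; exact: trig_agree_ray.
- move=> A mA IH.
  have C d0 (T0 : measurableType d0) (P0 : probability T0 R) (g0 Z0 : T0 -> R) :
     mb g0 -> measurable_fun setT Z0 ->
     Ex P0 (fun t => g0 t * \1_(~` A) (Z0 t)) = Ex P0 g0 + -1 * Ex P0 (fun t => g0 t * \1_A (Z0 t)).
    move=> b0 m0; rewrite -ExZ; last by apply: mbM => //; exact: mb_indic_comp.
    rewrite -ExD//; last by apply: mbZ; apply: mbM => //; exact: mb_indic_comp.
    apply: eq_Ex => t; rewrite !indicE in_setC.
    by case: (Z0 t \in A) => /=; rewrite ?mulr0 ?mulr1; ring.
  by rewrite !C// HT IH.
- move=> F mF tF IH.
  pose S n (z : R) : R := \sum_(k < n) \1_(F k) z.
  have SE n z : S n z = \1_(\bigcup_(k < n) F k) z.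
    have [/existsP[k Fk]|nF] := boolP [exists k : 'I_n, z \in F k].
      rewrite /S (bigD1 k)//= indicE Fk big1 ?addr0; last first.
        move=> i ik; rewrite indicE memNset// => Fi; move/eqP: ik; apply.
        by apply/val_inj/(tF i k I I); exists z; split=> //; exact: set_mem.
      by rewrite indicE mem_set//; exists k => //=; exact: set_mem.
    rewrite /S big1 => [|k _]; last first.
      by rewrite indicE; case: (boolP (_ \in _)) => // Fk; case/negP: nF; apply/existsP; exists k.
    rewrite indicE memNset// => -[k /= kn Fk]; case/negP: nF; apply/existsP.
    by exists (Ordinal kn); exact: mem_set.
  have bS d0 (T0 : measurableType d0) (Z0 : T0 -> R) n : measurable_fun setT Z0 ->
      mb (fun t => S n (Z0 t)).
    move=> m0; under eq_fun do rewrite SE; apply: mb_indic_comp => //.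
    by apply: (@bigcup_measurable _ (measurableTypeR R)) => k _; exact: mF.
  have cS z : S n z @[n --> \oo] --> (\1_(\bigcup_k F k) z : R).
    have [[k _ Fk]|nF] := pselect ((\bigcup_k F k) z).
      have -> : \1_(\bigcup_k F k) z = 1 :> R by rewrite indicE mem_set//; exists k.
      apply: cvg_near_cst; near=> n; rewrite SE indicE mem_set//; exists k => //=.
      by near: n; exact: nbhs_infty_gt.
    have -> : \1_(\bigcup_k F k) z = 0 :> R by rewrite indicE memNset.
    apply: cvg_near_cst; apply: nearW => n.
    by rewrite SE indicE memNset// => -[k _ Fk]; apply: nF; exists k.
  have L d0 (T0 : measurableType d0) (P0 : probability T0 R) (g0 Z0 : T0 -> R) :
     mb g0 -> measurable_fun setT Z0 ->
     Ex P0 (fun t => g0 t * S n (Z0 t)) @[n --> \oo] -->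
     Ex P0 (fun t => g0 t * \1_(\bigcup_k F k) (Z0 t)).
    move=> b0 m0; have [mg0 [M gM]] := b0.
    apply: (@Ex_lim _ _ _ P0 _ _ M).
    - by move=> n; apply: measurable_funM => //; case: (bS _ _ _ n m0).
    - move=> n t; rewrite normrM SE indicE (le_trans _ (gM t))// ler_piMr//.
      by case: (_ \in _); rewrite ?normr1 ?normr0.
    - move=> t; apply: cvgM; first exact: cvg_cst.
      exact: cS.
  have E n : Ex P (fun t => g t * S n (Z t)) = Ex P' (fun t => g' t * S n (Z' t)).
    elim: n => [|n IHn].
      transitivity (0 : R).
        by rewrite -(Ex_cst P 0); apply: eq_Ex => t; rewrite /S big_ord0 mulr0.
      by rewrite -(Ex_cst P' 0); apply: eq_Ex => t; rewrite /S big_ord0 mulr0.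
    have Sr d0 (T0 : measurableType d0) (P0 : probability T0 R) (g0 Z0 : T0 -> R) :
        mb g0 -> measurable_fun setT Z0 -> Ex P0 (fun t => g0 t * S n.+1 (Z0 t)) =
        Ex P0 (fun t => g0 t * S n (Z0 t)) + Ex P0 (fun t => g0 t * \1_(F n) (Z0 t)).
      move=> b0 m0; rewrite -ExD; [|by apply: mbM => //; exact: bS|by apply: mbM => //; exact: (mb_indic_comp m0 (mF n))].
      by apply: eq_Ex => t; rewrite /S big_ord_recr/= mulrDr.
    by rewrite !Sr// IHn IH.
  have := L _ _ P g Z bg mZ; under eq_fun do rewrite E.
  by move/(cvg_unique (@Rhausdorff R)); apply; exact: L.
Unshelve. all: by end_near. Qed.

End uniqueness1.

(** * White noise on an abstract space *)

Section paths.
Variables (R : realType) (I : Type).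

Definition paths := I -> R.

HB.instance Definition _ := gen_eqMixin paths.
HB.instance Definition _ := gen_choiceMixin paths.
HB.instance Definition _ := isPointed.Build paths (fun=> 0).

Definition path_cylinders : set (set paths) :=
  \bigcup_(i in setT) preimage_set_system setT (fun z : paths => z i) measurable.

HB.instance Definition _ := @isMeasurable.Build (sigma_display path_cylinders)
  paths <<s path_cylinders >> (@sigma_algebra0 _ setT path_cylinders)
  (@sigma_algebraC _ path_cylinders)
  (@sigma_algebra_bigcup _ setT path_cylinders).

Lemma measurable_ev i : measurable_fun setT (fun z : paths => z i).
Proof. by move=> _ A mA; apply: sub_sigma_algebra; exists i => //; exists A. Qed.

Lemma measurable_pathsP d (T : measurableType d) (g : T -> paths) :
  (forall i, measurable_fun setT (fun x => g x i)) -> measurable_fun setT g.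
Proof.
move=> mg; apply: (@measurability _ _ _ _ _ _ path_cylinders) => //.
move=> _ [_ [i _ [A mA <-]] <-]; rewrite !setTI.
by rewrite -[X in measurable X]setTI; exact: mg.
Qed.

Definition linform (s : seq (R * I)) (z : paths) : R := \sum_(p <- s) p.1 * z p.2.

Definition cylset (s : seq (I * set R)) : set paths :=
  foldr (fun p A => [set z | p.2 (z p.1)] `&` A) setT s.

Definition cylseq (s : seq (I * set R)) : Prop :=
  foldr (fun p Q => measurable p.2 /\ Q) True s.

Lemma cylset_cat s s' : cylset (s ++ s') = cylset s `&` cylset s'.
Proof. by elim: s => [|p s IH] /=; rewrite ?setTI// IH setIA. Qed.

Lemma cylseq_cat s s' : cylseq s -> cylseq s' -> cylseq (s ++ s').
Proof. by elim: s => [|p s IH] //= [mp ms] ms'; split=> //; exact: IH. Qed.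

Lemma measurable_cylset s : cylseq s -> measurable (cylset s).
Proof.
elim: s => [_|p s IH /= [mp ms]]; first exact: measurableT.
by apply: measurableI; [rewrite -[X in measurable X]setTI; exact: measurable_ev|exact: IH].
Qed.

Lemma measurable_linform s : measurable_fun setT (linform s).
Proof.
apply: measurable_sum => p; apply: measurable_funM => //; exact: measurable_ev.
Qed.

Lemma linform_cons p s z : linform (p :: s) z = p.1 * z p.2 + linform s z.
Proof. by rewrite /linform big_cons. Qed.

(** Coordinates are converted one at a time from trigonometric factors into indicators. The claim
    [key] keeps a free linear form [l] under the cosine and the sine, because [trig_agree_indic],
    applied to the next coordinate, consumes one new frequency of that form. *)
Lemma paths_law_unique d (T : measurableType d) (P : probability T R)
    d' (T' : measurableType d') (P' : probability T' R) (Z : T -> paths) (Z' : T' -> paths) :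
  measurable_fun setT Z -> measurable_fun setT Z' ->
  (forall s, Ex P (fun t => cos (linform s (Z t))) = Ex P' (fun t => cos (linform s (Z' t))) /\
    Ex P (fun t => sin (linform s (Z t))) = Ex P' (fun t => sin (linform s (Z' t)))) ->
  forall A, measurable A -> P (Z @^-1` A) = P' (Z' @^-1` A).
Proof.
move=> mZ mZ' H.
have b d0 (T0 : measurableType d0) (Z0 : T0 -> paths) s :
    measurable_fun setT Z0 -> cylseq s -> mb (fun t => \1_(cylset s) (Z0 t) : R).
  move=> m0 cs; split; last by exists 1 => x; rewrite indicE; case: (_ \in _); rewrite ?normr1 ?normr0.
  exact: (measurableT_comp (measurable_indic (measurable_cylset cs)) m0).
have bc d0 (T0 : measurableType d0) (Z0 : T0 -> paths) s :
    measurable_fun setT Z0 -> mb (fun t => cos (linform s (Z0 t))).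
  by move=> m0; apply: mb_cos; exact: (measurableT_comp (measurable_linform s) m0).
have bs d0 (T0 : measurableType d0) (Z0 : T0 -> paths) s :
    measurable_fun setT Z0 -> mb (fun t => sin (linform s (Z0 t))).
  by move=> m0; apply: mb_sin; exact: (measurableT_comp (measurable_linform s) m0).
have key s : cylseq s -> forall l,
    Ex P (fun t => \1_(cylset s) (Z t) * cos (linform l (Z t))) =
    Ex P' (fun t => \1_(cylset s) (Z' t) * cos (linform l (Z' t))) /\
    Ex P (fun t => \1_(cylset s) (Z t) * sin (linform l (Z t))) =
    Ex P' (fun t => \1_(cylset s) (Z' t) * sin (linform l (Z' t))).
  elim: s => [_ l|[i A] s IH /= [mA cs] l].
    have [E1 E2] := H l; split.
      by under eq_Ex do rewrite indicT mul1r; under [RHS]eq_Ex do rewrite indicT mul1r.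
    by under eq_Ex do rewrite indicT mul1r; under [RHS]eq_Ex do rewrite indicT mul1r.
  have {}IH := IH cs.
  have mi d0 (T0 : measurableType d0) (Z0 : T0 -> paths) : measurable_fun setT Z0 ->
      measurable_fun setT (fun t => Z0 t i).
    by move=> m0; exact: (measurableT_comp (measurable_ev i) m0).
  (* Product-to-sum formulas: a factor in [x * Z0 t i] is absorbed into the linear form by adding
     the term [(x, i)] or [(- x, i)]. *)
  have comb d0 (T0 : measurableType d0) (P0 : probability T0 R) (Z0 : T0 -> paths) x :
      measurable_fun setT Z0 -> let w t := \1_(cylset s) (Z0 t) : R in
    [/\ Ex P0 (fun t => w t * cos (linform l (Z0 t)) * cos (x * Z0 t i)) =
      2^-1 * (Ex P0 (fun t => w t * cos (linform ((x, i) :: l) (Z0 t))) +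
              Ex P0 (fun t => w t * cos (linform ((- x, i) :: l) (Z0 t)))),
      Ex P0 (fun t => w t * cos (linform l (Z0 t)) * sin (x * Z0 t i)) =
      2^-1 * (Ex P0 (fun t => w t * sin (linform ((x, i) :: l) (Z0 t))) +
              -1 * Ex P0 (fun t => w t * sin (linform ((- x, i) :: l) (Z0 t)))),
      Ex P0 (fun t => w t * sin (linform l (Z0 t)) * cos (x * Z0 t i)) =
      2^-1 * (Ex P0 (fun t => w t * sin (linform ((x, i) :: l) (Z0 t))) +
              Ex P0 (fun t => w t * sin (linform ((- x, i) :: l) (Z0 t)))) &
      Ex P0 (fun t => w t * sin (linform l (Z0 t)) * sin (x * Z0 t i)) =
      2^-1 * (Ex P0 (fun t => w t * cos (linform ((- x, i) :: l) (Z0 t))) +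
              -1 * Ex P0 (fun t => w t * cos (linform ((x, i) :: l) (Z0 t))))].
    move=> m0 w.
    have bwc s' : mb (fun t => w t * cos (linform s' (Z0 t))) by apply: mbM; [exact: b|exact: bc].
    have bws s' : mb (fun t => w t * sin (linform s' (Z0 t))) by apply: mbM; [exact: b|exact: bs].
    split; rewrite -?ExZ// -ExD//; do ?[exact: mbZ]; rewrite -ExZ; do ?[by apply: mbD => //; exact: mbZ];
      apply: eq_Ex => t; rewrite !linform_cons/= !mulNr !(cosD, sinD, cosN, sinN); by field.
  have I1 d0 (T0 : measurableType d0) (Z0 : T0 -> paths) t :
      \1_([set z | A (z i)] `&` cylset s) (Z0 t) = \1_(cylset s) (Z0 t) * \1_A (Z0 t i) :> R.
    rewrite !indicE in_setI mulrC -natrM mulnb.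
    have -> : (Z0 t \in [set z | A (z i)]) = (Z0 t i \in A) by apply/idP/idP; rewrite !inE.
    by [].
  have bwc d0 (T0 : measurableType d0) (Z0 : T0 -> paths) s' : measurable_fun setT Z0 ->
    mb (fun t => \1_(cylset s) (Z0 t) * cos (linform s' (Z0 t)) : R).
    by move=> m0; apply: mbM; [exact: b|exact: bc].
  have bws d0 (T0 : measurableType d0) (Z0 : T0 -> paths) s' : measurable_fun setT Z0 ->
    mb (fun t => \1_(cylset s) (Z0 t) * sin (linform s' (Z0 t)) : R).
    by move=> m0; apply: mbM; [exact: b|exact: bs].
  split.
    under eq_Ex do rewrite I1 mulrAC; under [RHS]eq_Ex do rewrite I1 mulrAC.
    apply: trig_agree_indic => //; do ?[exact: bwc|exact: mi].
    move=> x; have [-> -> _ _] := comb _ _ P Z x mZ; have [-> -> _ _] := comb _ _ P' Z' x mZ'.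
    by have [-> ->] := IH ((x, i) :: l); have [-> ->] := IH ((- x, i) :: l).
  under eq_Ex do rewrite I1 mulrAC; under [RHS]eq_Ex do rewrite I1 mulrAC.
  apply: trig_agree_indic => //; do ?[exact: bws|exact: mi].
  move=> x; have [_ _ -> ->] := comb _ _ P Z x mZ; have [_ _ -> ->] := comb _ _ P' Z' x mZ'.
  by have [-> ->] := IH ((x, i) :: l); have [-> ->] := IH ((- x, i) :: l).
pose G : set (set paths) := [set A | exists2 s, cylseq s & A = cylset s].
have mpre d0 (T0 : measurableType d0) (Z0 : T0 -> paths) A : measurable_fun setT Z0 ->
    measurable A -> measurable (Z0 @^-1` A).
  by move=> m0 mA; rewrite -[X in measurable X]setTI; exact: m0.
have GE : (@measurable _ paths) = <<s G >>.
  apply/seteqP; split.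
    apply: smallest_sub; first exact: smallest_sigma_algebra.
    move=> _ [i _ [A mA <-]]; apply: sub_sigma_algebra.
    by exists [:: (i, A)]; rewrite //= setTI setIT.
  apply: smallest_sub; first exact: sigma_algebra_measurable.
  by move=> _ [s cs ->]; exact: measurable_cylset.
move=> A mA; rewrite -[RHS]/((fun A => P' (Z' @^-1` A)) A).
apply: (@dynkin_induction _ paths G (fun A => P (Z @^-1` A) = P' (Z' @^-1` A)) GE).
- move=> _ _ [s cs ->] [s' cs' ->]; exists (s ++ s'); last by rewrite cylset_cat.
  exact: cylseq_cat.
- by rewrite !preimage_setT !probability_setT.
- move=> _ [s cs ->]; have [+ _] := key s cs [::].
  have E d0 (T0 : measurableType d0) (P0 : probability T0 R) (Z0 : T0 -> paths) :
      measurable_fun setT Z0 ->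
      (Ex P0 (fun t => \1_(cylset s) (Z0 t) * cos (linform [::] (Z0 t))))%:E = P0 (Z0 @^-1` cylset s).
    move=> m0; rewrite -Ex_indic; last by apply: mpre => //; exact: measurable_cylset.
    congr EFin; apply: eq_Ex => t.
    by rewrite /linform big_nil cos0 mulr1.
  by move=> K; rewrite -E// K E.
- move=> B mB IH; rewrite -[Z @^-1` _]/(~` (Z @^-1` B)) -[Z' @^-1` _]/(~` (Z' @^-1` B)).
  by rewrite !probability_setC ?IH//; exact: mpre.
- move=> F mF tF IH; rewrite !preimage_bigcup.
  have tp d0 (T0 : measurableType d0) (Z0 : T0 -> paths) : trivIset setT (fun k => Z0 @^-1` F k).
    by move=> j k _ _ [x [Fj Fk]]; apply: (tF j k Logic.I Logic.I); exists (Z0 x).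
  rewrite !measure_bigcup//; do ?[exact: tp|by move=> k _; exact: mpre].
  by apply: eq_eseriesr => k _; exact: IH.
- by rewrite -GE.
Qed.

End paths.

Section gaussian_variable.
Variable R : realType.

(** A centered Gaussian variable of variance [v], described by its characteristic function so that
    the degenerate case [v = 0] needs no separate treatment. *)
Definition isG d (T : measurableType d) (P : probability T R) (Z : T -> R) (v : R) :=
  [/\ 0 <= v, measurable_fun setT Z & forall x : R,
    Ex P (fun t => cos (x * Z t)) = expR (- (x ^+ 2 * v / 2)) /\
    Ex P (fun t => sin (x * Z t)) = 0].

Lemma law_integral d (T : measurableType d) (P : probability T R)
    d' (T' : measurableType d') (P' : probability T' R)
    d0 (U : measurableType d0) (Z : T -> U) (Z' : T' -> U) (F : U -> \bar R) :
  measurable_fun setT Z -> measurable_fun setT Z' ->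
  (forall A, measurable A -> P (Z @^-1` A) = P' (Z' @^-1` A)) ->
  measurable_fun setT F -> (forall x, 0 <= F x)%E ->
  (\int[P]_t F (Z t) = \int[P']_t F (Z' t))%E.
Proof.
move=> mZ mZ' H mF F0.
transitivity (\int[pushforward P Z]_x F x)%E.
  by rewrite ge0_integral_pushforward// => x _; exact: F0.
transitivity (\int[pushforward P' Z']_x F x)%E.
  by apply: eq_measure_integral => A mA _; exact: H.
by rewrite ge0_integral_pushforward// => x _; exact: F0.
Qed.

Lemma isG_law d (T : measurableType d) (P : probability T R) Z v
    d' (T' : measurableType d') (P' : probability T' R) Z' :
  isG P Z v -> isG P' Z' v ->
  forall A, measurable A -> P (Z @^-1` A) = P' (Z' @^-1` A).
Proof.
move=> [v0 mZ GZ] [_ mZ' GZ'] A mA.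
have mpre d0 (T0 : measurableType d0) (Z0 : T0 -> R) : measurable_fun setT Z0 ->
  measurable (Z0 @^-1` A) by move=> m0; rewrite -[X in measurable X]setTI; exact: m0.
rewrite -!Ex_indic; do ?exact: mpre.
congr EFin; have := @trig_agree_indic R _ _ P (fun=> 1) Z _ _ P' (fun=> 1) Z'
  (@mb_cst _ _ R 1) (@mb_cst _ _ R 1) mZ mZ' _ A mA.
have E1 d0 (T0 : measurableType d0) (P0 : probability T0 R) (Z0 : T0 -> R) :
    Ex P0 (fun t => 1 * \1_A (Z0 t)) = Ex P0 \1_(Z0 @^-1` A).
  by apply: eq_Ex => t; rewrite mul1r.
rewrite !E1; apply => x; have [{}E1 E2] := GZ x; have [E1' E2'] := GZ' x; split.
  by under eq_Ex do rewrite mul1r; rewrite E1 -E1'; apply: eq_Ex => t; rewrite mul1r.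
by under eq_Ex do rewrite mul1r; rewrite E2 -E2'; apply: eq_Ex => t; rewrite mul1r.
Qed.

Lemma isG_gam (v : R) : 0 <= v -> isG (gam R) (fun u => Num.sqrt v * u) v.
Proof.
move=> v0; split => //; first exact: measurable_funM.
move=> x; split; under eq_Ex do rewrite mulrA; last exact: gam_sin.
by rewrite -[LHS]/(gcos _) gcosE exprMn sqr_sqrtr.
Qed.

Lemma isG_integral d (T : measurableType d) (P : probability T R) Z v (F : R -> \bar R) :
  isG P Z v -> measurable_fun setT F -> (forall x, 0 <= F x)%E ->
  (\int[P]_t F (Z t) = \int[gam R]_u F (Num.sqrt v * u)%R)%E.
Proof.
move=> GZ mF F0; have [v0 mZ _] := GZ; have [_ mg _] := isG_gam v0.
by apply: (law_integral mZ mg) => //; exact: (isG_law GZ (isG_gam v0)).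
Qed.

Lemma isG_var d (T : measurableType d) (P : probability T R) Z v : isG P Z v ->
  (\int[P]_t (Z t ^+ 2)%:E = v%:E)%E.
Proof.
move=> GZ; have [v0 _ _] := GZ.
rewrite (isG_integral GZ (F := fun x => (x ^+ 2)%:E)); first last.
- by move=> x; rewrite lee_fin sqr_ge0.
- by apply/measurable_EFinP; exact: measurable_funX.
under eq_integral do rewrite exprMn sqr_sqrtr// EFinM.
rewrite ge0_integralZl//; first by rewrite gam_var mule1.
- by apply/measurable_EFinP; exact: measurable_funX.
- by move=> x _; rewrite lee_fin sqr_ge0.
Qed.

Lemma isG0 d (T : measurableType d) (P : probability T R) Z : isG P Z 0 ->
  {ae P, forall t, Z t = 0}.
Proof.
move=> GZ; have [_ mZ _] := GZ.
have mE : measurable [set x : R | x != 0].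
  rewrite (_ : [set x | _] = ~` [set 0]); first exact: measurableC.
  by apply/seteqP; split => x /=; move/eqP.
exists (Z @^-1` [set x | x != 0]); split.
- by rewrite -[X in measurable X]setTI; exact: mZ.
- have := isG_law GZ (isG_gam (lexx 0)) mE => ->.
  rewrite (_ : _ @^-1` _ = set0) ?measure0//.
  by apply/seteqP; split => x //=; rewrite sqrtr0 mul0r eqxx.
- by move=> t /= /eqP.
Qed.

Lemma isG_exp d (T : measurableType d) (P : probability T R) Z v (l : R) : isG P Z v ->
  (\int[P]_t (expR (l * `|Z t|))%:E <= (2 * expR (l ^+ 2 * v / 2))%:E)%E.
Proof.
move=> GZ; have [v0 _ _] := GZ.
have me (k : R) : measurable_fun setT (fun u : R => (expR (k * u))%:E).
  by apply/measurable_EFinP; apply: measurableT_comp => //; exact: measurable_funM.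
have mn : measurable_fun setT (fun x : R => (expR (l * `|x|))%:E).
  apply/measurable_EFinP; apply: measurableT_comp => //; apply: measurable_funM => //.
rewrite (isG_integral GZ mn); last by move=> x; rewrite lee_fin expR_ge0.
pose k := l * Num.sqrt v.
apply: (@le_trans _ _ (\int[gam R]_u ((expR (k * u))%:E + (expR (- k * u))%:E))%E).
  apply: le_lower_integral => u; rewrite lee_fin ?expR_ge0//.
  rewrite normrM ger0_norm ?sqrtr_ge0// mulrA -/k mulNr.
  have [u0|u0] := leP 0 u; first by rewrite ger0_norm// lerDl expR_ge0.
  by rewrite ltr0_norm// mulrN lerDr expR_ge0.
rewrite ge0_integralD//; do ?[exact: me|by move=> u _; rewrite lee_fin expR_ge0].
rewrite !gam_expR -EFinD lee_fin sqrrN /k exprMn sqr_sqrtr//.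
by rewrite mulr2n mulrDl mul1r.
Qed.

Lemma Ex_prod d1 (T1 : measurableType d1) d2 (T2 : measurableType d2)
    (P1 : probability T1 R) (P2 : probability T2 R) f g : mb f -> mb g ->
  Ex (pprod P1 P2) (fun w => f w.1 * g w.2) = Ex P1 f * Ex P2 g.
Proof.
move=> bf bg; have [mf [M fM]] := bf; have [mg [N gN]] := bg.
rewrite Ex_fubini/=; last first.
  apply: mbM.
    by split; [exact: (measurableT_comp mf measurable_fst)|exists M => w; exact: fM].
  by split; [exact: (measurableT_comp mg measurable_snd)|exists N => w; exact: gN].
by under eq_Ex do rewrite ExZ// mulrC; rewrite ExZ// mulrC.
Qed.

Lemma isG_prod d1 (T1 : measurableType d1) d2 (T2 : measurableType d2)
    (P1 : probability T1 R) (P2 : probability T2 R) X Y v w :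
  isG P1 X v -> isG P2 Y w -> isG (pprod P1 P2) (fun t => X t.1 + Y t.2) (v + w).
Proof.
move=> [v0 mX GX] [w0 mY GY].
have mX1 := measurableT_comp mX (@measurable_fst _ _ T1 T2).
have mY2 := measurableT_comp mY (@measurable_snd _ _ T1 T2).
split; [exact: addr_ge0|exact: measurable_funD|].
move=> x; have [cX sX] := GX x; have [cY sY] := GY x.
have mxX : measurable_fun setT (fun t => x * X t) by exact: measurable_funM.
have mxY : measurable_fun setT (fun t => x * Y t) by exact: measurable_funM.
have mxX1 := measurableT_comp mxX (@measurable_fst _ _ T1 T2).
have mxY2 := measurableT_comp mxY (@measurable_snd _ _ T1 T2).
have bcX := mb_cos mxX; have bsX := mb_sin mxX; have bcY := mb_cos mxY; have bsY := mb_sin mxY.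
have bcX1 := mb_cos mxX1; have bsX1 := mb_sin mxX1; have bcY2 := mb_cos mxY2; have bsY2 := mb_sin mxY2.
split.
  transitivity (Ex (pprod P1 P2) (fun t => cos (x * X t.1) * cos (x * Y t.2) +
     -1 * (sin (x * X t.1) * sin (x * Y t.2)))).
    by apply: eq_Ex => t; rewrite mulrDr cosD mulN1r.
  rewrite ExD; [|exact: mbM|by apply: mbZ; exact: mbM].
  rewrite ExZ; last exact: mbM.
  rewrite (Ex_prod _ _ bcX bcY) (Ex_prod _ _ bsX bsY) cX cY sX sY mul0r mulr0 addr0 -expRD.
  by congr expR; field.
transitivity (Ex (pprod P1 P2) (fun t => sin (x * X t.1) * cos (x * Y t.2) +
   (cos (x * X t.1) * sin (x * Y t.2)))).
  by apply: eq_Ex => t; rewrite mulrDr sinD.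
rewrite ExD; [|exact: mbM|exact: mbM].
by rewrite (Ex_prod _ _ bsX bcY) (Ex_prod _ _ bcX bsY) sX sY mul0r mulr0 addr0.
Qed.

Lemma isG_ext d (T : measurableType d) (P : probability T R) Z Z' v :
  isG P Z v -> measurable_fun setT Z' -> {ae P, forall t, Z t = Z' t} -> isG P Z' v.
Proof.
move=> [v0 mZ GZ] mZ' E; split => // x; have [cZ sZ] := GZ x.
have mk (Y : T -> R) (mY : measurable_fun setT Y) : measurable_fun setT (fun t => x * Y t).
  exact: measurable_funM.
have [mc _] := mb_cos (mk _ mZ); have [mc' _] := mb_cos (mk _ mZ').
have [ms _] := mb_sin (mk _ mZ); have [ms' _] := mb_sin (mk _ mZ').
rewrite -cZ -sZ; split; apply: Ex_ae => //; by apply: filterS E => t ->.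
Qed.

Lemma mp_Ex d1 (T1 : measurableType d1) d2 (T2 : measurableType d2)
    (P1 : probability T1 R) (P2 : probability T2 R) h f :
  mp P1 P2 h -> mb f -> Ex P1 (fun t => f (h t)) = Ex P2 f.
Proof.
move=> mph bf; have [mh _] := mph; have [mf [M fM]] := bf.
have bf' : mb (fun t => f (h t)).
  by split; [exact: measurableT_comp|exists M => t; exact: fM].
have H0 x : (0 <= (f x + M)%:E)%E.
  by rewrite lee_fin -lerBlDr sub0r; have := fM x; rewrite ler_norml => /andP[].
have := mp_integral mph (f := fun x => (f x + M)%:E) _ H0.
have mfM : measurable_fun setT (fun x => (f x + M)%:E).
  by apply/measurable_EFinP; exact: measurable_funD.
move=> /(_ mfM); rewrite !Ex_EFin ?ExD//; do ?[exact: mb_cst|apply: mbD => //; exact: mb_cst].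
by rewrite !Ex_cst => -[/addIr].
Qed.

Lemma isG_mp d1 (T1 : measurableType d1) d2 (T2 : measurableType d2)
    (P1 : probability T1 R) (P2 : probability T2 R) h Z v :
  mp P1 P2 h -> isG P2 Z v -> isG P1 (fun t => Z (h t)) v.
Proof.
move=> mph [v0 mZ GZ]; have [mh _] := mph; split => //; first exact: measurableT_comp.
move=> x; have [cZ sZ] := GZ x.
have mk : measurable_fun setT (fun t => x * Z t) by exact: measurable_funM.
by rewrite -cZ -sZ -(mp_Ex mph (mb_cos mk)) -(mp_Ex mph (mb_sin mk)).
Qed.

End gaussian_variable.

(** * Square integrable functions *)

Section square_integrable.
Context dS (S : measurableType dS) (R : realType).
Variable mu : {measure set S -> \bar R}.

(** Functions, not classes modulo null sets: a path assigns a value to each function, and that it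
    respects almost everywhere equality is an almost sure statement ([white_ae_eq]). *)
Record l2 := L2 { l2f :> S -> R ; l2_meas : measurable_fun setT l2f ;
  l2_int : (\int[mu]_s (l2f s ^+ 2)%:E < +oo)%E }.

Implicit Types f g : l2.

Lemma l2_prod f g : mu.-integrable setT (fun s => (f s * g s)%:E).
Proof.
have mf := l2_meas f; have mg := l2_meas g.
have msq h : measurable_fun setT (fun s => (l2f h s ^+ 2)%:E).
  by apply/measurable_EFinP; apply: measurable_funX; exact: l2_meas.
apply/integrableP; split; first by apply/measurable_EFinP; exact: measurable_funM.
apply: (@le_lt_trans _ _ (\int[mu]_s ((f s ^+ 2)%:E + (g s ^+ 2)%:E))%E).
  apply: le_lower_integral => s; rewrite ?abse_ge0// -EFinD lee_fin normrM.
  have := sqr_ge0 (`|f s| - `|g s|); have := normr_ge0 (f s); have := normr_ge0 (g s).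
  by rewrite -(real_normK (num_real (f s))) -(real_normK (num_real (g s))); nra.
rewrite ge0_integralD//; do ?[by move=> s _; rewrite lee_fin sqr_ge0].
by rewrite lte_add_pinfty// l2_int.
Qed.

Definition ip f g : R := \int[mu]_s (f s * g s).

Lemma ipE f g : ((ip f g)%:E = \int[mu]_s (f s * g s)%:E)%E.
Proof. by rewrite /ip /Rintegral fineK//; exact: integrable_fin_num (l2_prod f g). Qed.

Lemma ip_ge0 f : 0 <= ip f f.
Proof. by apply: Rintegral_ge0 => s _; rewrite -expr2 sqr_ge0. Qed.

Lemma l2lin_proof (s : seq (R * l2)) :
  let h x := \sum_(p <- s) p.1 * l2f p.2 x in
  measurable_fun setT h /\ (\int[mu]_x (h x ^+ 2)%:E < +oo)%E.
Proof.
elim: s => [|[c f] s IH] h.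
  split; first by apply: measurable_sum => p; apply: measurable_funM => //; exact: l2_meas.
  rewrite (eq_integral (fun=> 0%E)) ?integral0// => x _; by rewrite /h big_nil expr0n.
have [mh ih] := IH; set k := (fun x => _ : R) in mh ih.
have mf := l2_meas f.
have hE x : h x = c * f x + k x by rewrite /h big_cons.
have mh' : measurable_fun setT h.
  by rewrite (_ : h = fun x => c * f x + k x); [apply: measurable_funD => //; exact: measurable_funM|exact/funext].
split => //.
have msq (u : S -> R) : measurable_fun setT u -> measurable_fun setT (fun s => (u s ^+ 2)%:E).
  by move=> mu0; apply/measurable_EFinP; exact: measurable_funX.
apply: (@le_lt_trans _ _ (\int[mu]_x ((2 * c ^+ 2)%:E * (f x ^+ 2)%:E + 2%:E * (k x ^+ 2)%:E))%E).
  apply: le_lower_integral => x; first by rewrite lee_fin sqr_ge0.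
  by rewrite -!EFinM -EFinD lee_fin hE; have := sqr_ge0 (c * f x - k x); nra.
have c0 : 0 <= 2 * c ^+ 2 by rewrite mulr_ge0// sqr_ge0.
rewrite ge0_integralD//; first last.
- by apply: measurable_funeM; exact: msq.
- by move=> x _; rewrite mule_ge0// lee_fin sqr_ge0.
- by apply: measurable_funeM; exact: msq.
- by move=> x _; rewrite mule_ge0// lee_fin ?sqr_ge0.
rewrite !ge0_integralZl//; do ?[exact: msq|by move=> x _; rewrite lee_fin sqr_ge0].
by rewrite lte_add_pinfty// lte_mul_pinfty ?lee_fin// l2_int.
Qed.

Definition l2lin s : l2 := L2 (l2lin_proof s).1 (l2lin_proof s).2.

Lemma l2linE s x : l2lin s x = \sum_(p <- s) p.1 * p.2 x. Proof. by []. Qed.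

Lemma ip_linl s g : ip (l2lin s) g = \sum_(p <- s) p.1 * ip p.2 g.
Proof.
rewrite /ip.
transitivity (\int[mu]_x (\sum_(p <- s) p.1 * (l2f p.2 x * g x))).
  by apply: eq_Rintegral => x _; rewrite mulr_suml; apply: eq_bigr => p _; rewrite mulrA.
elim: s => [|p s IH]; first by under eq_Rintegral do rewrite big_nil; rewrite big_nil Rintegral_cst ?mul0r.
under eq_Rintegral do rewrite big_cons.
have I q : mu.-integrable setT (EFin \o (fun x => q.1 * (l2f q.2 x * g x))).
  have -> : EFin \o (fun x => q.1 * (l2f q.2 x * g x)) = (fun x => q.1%:E * (l2f q.2 x * g x)%:E)%E by [].
  by apply: integrableZl => //; exact: l2_prod.
rewrite RintegralD//; last first.
  rewrite (_ : _ \o _ = (fun x => \sum_(q <- s) (q.1 * (l2f q.2 x * g x))%:E)%E).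
    by apply: (@integrable_sum _ _ _ mu setT measurableT _ s xpredT
      (fun q x => (q.1 * (l2f q.2 x * g x))%:E)) => q _; exact: I.
  by apply/funext => x /=; rewrite sumEFin.
rewrite IH big_cons RintegralZl//; exact: l2_prod.
Qed.

Lemma ipC f g : ip f g = ip g f.
Proof. by apply: eq_Rintegral => x _; rewrite mulrC. Qed.

Lemma ip_linr s g : ip g (l2lin s) = \sum_(p <- s) p.1 * ip g p.2.
Proof. by rewrite ipC ip_linl; apply: eq_bigr => p _; rewrite ipC. Qed.

Lemma l2restr_proof (A : set S) f : measurable A ->
  measurable_fun setT (fun s => f s * \1_A s) /\ (\int[mu]_s ((f s * \1_A s) ^+ 2)%:E < +oo)%E.
Proof.
move=> mA; split; first by apply: measurable_funM; [exact: l2_meas|exact: measurable_indic].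
apply: le_lt_trans (l2_int f); apply: le_lower_integral => x.
  by rewrite lee_fin sqr_ge0.
rewrite lee_fin exprMn ler_piMr ?sqr_ge0// indicE.
Qed.

Definition l2restr A (mA : measurable A) f : l2 := L2 (l2restr_proof f mA).1 (l2restr_proof f mA).2.

End square_integrable.

Section gaussian_family.
Variable R : realType.

(** The characteristic function of a linear form depends on its variance only, so a common variance
    function [V] forces equal laws. All identities in law between couplings reduce in this way to
    computing covariances. *)
Lemma gauss_law (J : Type) d (T : measurableType d) (P : probability T R)
    d' (T' : measurableType d') (P' : probability T' R)
    (Z : T -> paths R J) (Z' : T' -> paths R J) (V : seq (R * J) -> R) :
  (forall j, measurable_fun setT (fun t => Z t j)) ->
  (forall j, measurable_fun setT (fun t => Z' t j)) ->
  (forall s, isG P (fun t => linform s (Z t)) (V s)) ->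
  (forall s, isG P' (fun t => linform s (Z' t)) (V s)) ->
  forall A, measurable A -> P (Z @^-1` A) = P' (Z' @^-1` A).
Proof.
move=> mZ mZ' GZ GZ'; apply: paths_law_unique; do ?exact: measurable_pathsP.
have E d0 (T0 : measurableType d0) (P0 : probability T0 R) (X : T0 -> R) v : isG P0 X v ->
    Ex P0 (fun t => cos (X t)) = expR (- (v / 2)) /\ Ex P0 (fun t => sin (X t)) = 0.
  move=> [_ _ /(_ 1)[cX sX]]; split.
    by have := cX; rewrite expr1n mul1r => <-; apply: eq_Ex => t; rewrite mul1r.
  by rewrite -sX; apply: eq_Ex => t; rewrite mul1r.
move=> s; have [-> ->] := E _ _ _ _ _ (GZ s).
by have [-> ->] := E _ _ _ _ _ (GZ' s).
Qed.

Lemma linform_map (J K : Type) (h : R * J -> R * K) (s : seq (R * J)) (z : paths R K) :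
  linform (map h s) z = \sum_(p <- s) (h p).1 * z (h p).2.
Proof. by rewrite /linform big_map. Qed.

End gaussian_family.

Section white_measure.
Context dS (S : measurableType dS) (R : realType).
Variable mu : {measure set S -> \bar R}.
Notation l2 := (l2 mu).

(** The law of an isonormal process on path space. Linearity is encoded in the variances of formal
    combinations: one that represents the zero function has variance zero, hence vanishes almost
    surely ([white_ae]). *)
Definition white (G : probability (paths R l2) R) :=
  forall s, isG G (linform s) (ip (l2lin s) (l2lin s)).

Variable G : probability (paths R l2) R.
Hypothesis wG : white G.

Lemma white1 (f : l2) : isG G (fun z => z f) (ip f f).
Proof.
have := wG [:: (1, f)]; rewrite ip_linl big_seq1/= ip_linr big_seq1/= !mul1r.
by under [linform _]eq_fun do rewrite /linform big_seq1 mul1r.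
Qed.

Lemma white_ae s : ip (l2lin s) (l2lin s) = 0 -> {ae G, forall z, linform s z = 0}.
Proof. by move=> s0; have := wG s; rewrite s0; exact: isG0. Qed.

Lemma white_ae_eq (f g : l2) : {ae mu, forall s, f s = g s} -> {ae G, forall z, z f = z g}.
Proof.
move=> fg; have H : ip (l2lin [:: (1, f); (- 1, g)]) (l2lin [:: (1, f); (- 1, g)]) = 0.
  rewrite /ip /Rintegral (_ : integral _ _ _ = 0%E)//.
  rewrite (ae_eq_integral (cst 0%E))//; first exact: integral0.
    by apply/measurable_EFinP; apply: measurable_funM; exact: l2_meas.
  apply: filterS fg => s fgs _ /=.
  by rewrite !big_cons big_nil/= fgs mul1r addr0 mulN1r subrr mul0r.
apply: filterS (white_ae H) => z /=.
by rewrite /linform !big_cons big_nil/= mul1r addr0 mulN1r => /eqP; rewrite subr_eq0 => /eqP.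
Qed.

Variables (A : set S) (mA : measurable A).

(* Near [A] the noise is [w.1], away from [A] it is the independent noise [w.2]. *)
Definition gl (w : paths R l2 * paths R l2) : paths R l2 :=
  fun f => w.1 (l2restr mA f) + w.2 (l2restr (measurableC mA) f).

Lemma measurable_gl_ev f : measurable_fun setT (fun w => gl w f).
Proof.
by apply: measurable_funD;
  [exact: (measurableT_comp (measurable_ev _) measurable_fst)
  |exact: (measurableT_comp (measurable_ev _) measurable_snd)].
Qed.

Lemma indicC_split (s : S) : \1_A s + \1_(~` A) s = 1 :> R.
Proof. by rewrite !indicE in_setC; case: (s \in A); rewrite ?addr0 ?add0r. Qed.

Lemma indic_idem (B : set S) (s : S) : \1_B s * \1_B s = \1_B s :> R.
Proof. by rewrite !indicE; case: (_ \in _); rewrite ?mulr1 ?mulr0. Qed.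

Lemma ip_restr B (mB : measurable B) (f g : l2) : ip (l2restr mB f) g = ip f (l2restr mB g).
Proof. by apply: eq_Rintegral => s _ /=; ring. Qed.

Lemma ip_restr2 B (mB : measurable B) (f g : l2) :
  ip (l2restr mB f) (l2restr mB g) = ip f (l2restr mB g).
Proof. by apply: eq_Rintegral => s _ /=; rewrite -mulrA -[in RHS](indic_idem B); ring. Qed.

Lemma ip_split (f g : l2) :
  ip f g = ip f (l2restr mA g) + ip f (l2restr (measurableC mA) g).
Proof.
rewrite /ip -RintegralD//; do ?[exact: l2_prod].
by apply: eq_Rintegral => s _ /=; rewrite -mulrDr -mulrDr indicC_split mulr1.
Qed.

Lemma l2lin_restr B (mB : measurable B) (s : seq (R * l2)) : ip (l2lin (map (fun p => (p.1, l2restr mB p.2)) s))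
    (l2lin (map (fun p => (p.1, l2restr mB p.2)) s)) = ip (l2lin s) (l2restr mB (l2lin s)).
Proof.
rewrite -ip_restr2; apply: eq_Rintegral => x _ /=; rewrite big_map/=.
by congr (_ * _); rewrite mulr_suml; apply: eq_bigr => p _; rewrite mulrA.
Qed.

(** The restrictions to [A] and to its complement are orthogonal and are read from independent
    paths, so by [ip_split] their variances add up to that of the whole. *)
Lemma mp_gl : mp (pprod G G) G gl.
Proof.
have mgl : measurable_fun setT gl by apply: measurable_pathsP; exact: measurable_gl_ev.
split=> // B mB.
apply: (@gauss_law R l2 _ _ (pprod G G) _ _ G gl id (fun s => ip (l2lin s) (l2lin s))) => //.
- exact: measurable_gl_ev.
- exact: measurable_ev.
move=> s.
have := isG_prod (wG (map (fun p => (p.1, l2restr mA p.2)) s))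
  (wG (map (fun p => (p.1, l2restr (measurableC mA) p.2)) s)).
rewrite !l2lin_restr -ip_split; congr isG; apply/funext => w.
by rewrite !linform_map /linform -big_split; apply: eq_bigr => p _ /=; rewrite /gl mulrDr.
Qed.

End white_measure.

(** Restrictions to [A] and [B] commute as functions, so the identity holds for every path and not
    merely almost surely. Each side is the sum of the four noises over the four intersections of
    [A], [B] and their complements. *)
Lemma gl_exchange dS (S : measurableType dS) (R : realType) (mu : {measure set S -> \bar R})
    (A B : set S) (mA : measurable A) (mB : measurable B)
    (w : (paths R (l2 mu) * paths R (l2 mu)) * (paths R (l2 mu) * paths R (l2 mu))) :
  gl mA (gl mB (w.1.1, w.2.1), gl mB (w.1.2, w.2.2)) = gl mB (gl mA w.1, gl mA w.2).
Proof.
have l2_eq (f g : l2 mu) : (forall s, f s = g s) -> f = g.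
  case: f g => f mf jf [g mg ig] /= fg; have E : f = g by apply/funext.
  by subst g; congr L2; exact: Prop_irrelevance.
apply/funext => f; rewrite /gl /=.
have E C D (mC : measurable C) (mD : measurable D) : l2restr mC (l2restr mD f) = l2restr mD (l2restr mC f).
  by apply: l2_eq => s /=; rewrite mulrAC.
by rewrite !(E B) !(E (~` B)); ring.
Qed.

(** * Jointly measurable versions *)

Section kernel_approximation.
Context dU (U : measurableType dU) dS (S : measurableType dS) (R : realType).
Variables (nu : {sigma_finite_measure set U -> \bar R})
  (mu : {sigma_finite_measure set S -> \bar R}).
Notation M := (nu \x mu)%E.
Notation l2 := (l2 mu).

(** For a kernel that is a finite sum of products of an indicator in time and a function in space,
    the stochastic integral is the finite sum [rect_paths], which is visibly jointly measurable in
    path and time. *)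
Definition rect_seq := seq ({A : set U | measurable A} * l2).

Definition rk (r : rect_seq) (x : U * S) : R := \sum_(p <- r) \1_(proj1_sig p.1) x.1 * p.2 x.2.

Lemma measurable_rk r : measurable_fun setT (rk r).
Proof.
apply: measurable_sum => -[[A mA] f]; apply: measurable_funM => /=.
  exact: (measurableT_comp (measurable_indic mA) measurable_fst).
exact: (measurableT_comp (l2_meas f) measurable_snd).
Qed.

Definition appr (h : U * S -> R) := forall e : R, 0 < e -> exists r : rect_seq,
  (\int[M]_x ((h x - rk r x) ^+ 2)%:E <= e%:E)%E.

Lemma sq_int_le (f g h : U * S -> R) (a b : R) : 0 <= a -> 0 <= b ->
  measurable_fun setT f -> measurable_fun setT g ->
  (forall x, h x ^+ 2 <= a * f x ^+ 2 + b * g x ^+ 2) ->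
  (\int[M]_x (h x ^+ 2)%:E <=
    a%:E * \int[M]_x (f x ^+ 2)%:E + b%:E * \int[M]_x (g x ^+ 2)%:E)%E.
Proof.
move=> a0 b0 mf mg H.
have msq (u : U * S -> R) : measurable_fun setT u -> measurable_fun setT (fun s => (u s ^+ 2)%:E).
  by move=> mu0; apply/measurable_EFinP; exact: measurable_funX.
have s0 (u : U * S -> R) x : (0 <= (u x ^+ 2)%:E)%E by rewrite lee_fin sqr_ge0.
rewrite -!ge0_integralZl//; do ?exact: msq.
rewrite -ge0_integralD//; first last.
- by apply: measurable_funeM; exact: msq.
- by move=> x _; rewrite mule_ge0.
- by apply: measurable_funeM; exact: msq.
- by move=> x _; rewrite mule_ge0.
by apply: le_lower_integral => x //; rewrite -!EFinM -EFinD lee_fin.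
Qed.

Lemma apprD f g : measurable_fun setT f -> measurable_fun setT g ->
  appr f -> appr g -> appr (fun x => f x + g x).
Proof.
move=> mf mg af ag e e0; have e4 : 0 < e / 4 by rewrite divr_gt0.
have [r hr] := af _ e4; have [r' hr'] := ag _ e4; exists (r ++ r').
apply: (@le_trans _ _ (2%:E * \int[M]_x ((f x - rk r x) ^+ 2)%:E +
   2%:E * \int[M]_x ((g x - rk r' x) ^+ 2)%:E)%E).
  apply: sq_int_le => //; do ?[by apply: measurable_funB => //; exact: measurable_rk].
  move=> x; rewrite /rk big_cat/= -/(rk r x) -/(rk r' x).
  by have := sqr_ge0 ((f x - rk r x) - (g x - rk r' x)); nra.
apply: (@le_trans _ _ (2%:E * (e / 4)%:E + 2%:E * (e / 4)%:E)%E).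
  by apply: leeD; rewrite lee_pmul2l// lte_fin.
by rewrite -!EFinM -EFinD lee_fin; lra.
Qed.

Lemma apprZ c f : measurable_fun setT f -> appr f -> appr (fun x => c * f x).
Proof.
move=> mf af e e0; pose c2 := c ^+ 2 + 1.
have c20 : 0 < c2 by rewrite ltr_wpDl// sqr_ge0.
have [r hr] := af _ (divr_gt0 e0 c20).
exists (map (fun p => (p.1, l2lin [:: (c, p.2)])) r).
apply: (@le_trans _ _ (c2%:E * \int[M]_x ((f x - rk r x) ^+ 2)%:E +
   0%:E * \int[M]_x ((f x - rk r x) ^+ 2)%:E)%E).
  apply: sq_int_le => //; do ?[by apply: measurable_funB => //; exact: measurable_rk].
    exact: ltW.
  move=> x; rewrite /rk big_map/=.
  rewrite (eq_bigr (fun p : {A : set U | measurable A} * l2 => c * (\1_(proj1_sig p.1) x.1 * p.2 x.2))); last first.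
    by move=> p _; rewrite big_seq1/= mulrCA.
  rewrite -mulr_sumr -/(rk r x) -mulrBr exprMn mul0r addr0 ler_wpM2r ?sqr_ge0//.
  by rewrite /c2 lerDl.
rewrite mul0e adde0; apply: (@le_trans _ _ (c2%:E * (e / c2)%:E)%E).
  by rewrite lee_pmul2l// lte_fin.
by rewrite -EFinM lee_fin mulrC divfK// gt_eqF.
Qed.

Lemma appr_lim (h_ : nat -> U * S -> R) (h g : U * S -> R) :
  (forall n, measurable_fun setT (h_ n)) -> measurable_fun setT h ->
  (forall x, h_ n x @[n --> \oo] --> h x) ->
  (forall n x, (h x - h_ n x) ^+ 2 <= g x) -> M.-integrable setT (EFin \o g) ->
  (forall n, appr (h_ n)) -> appr h.
Proof.
move=> mh_ mh ch hg ig ah e e0; have e4 : 0 < e / 4 by rewrite divr_gt0.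
have mD n : measurable_fun setT (fun x => ((h x - h_ n x) ^+ 2)%:E).
  by apply/measurable_EFinP; apply: measurable_funX; exact: measurable_funB.
have cD x : ((h x - h_ n x) ^+ 2)%:E @[n --> \oo] --> (0 : \bar R)%E.
  apply/cvg_EFin; first exact: nearW.
  rewrite (_ : 0 = (h x - h x) ^+ 2); last by rewrite subrr expr0n.
  rewrite /comp /=; under eq_fun do rewrite expr2; rewrite expr2.
  by apply: cvgM; apply: cvgB; do ?[exact: cvg_cst|exact: ch].
have bD n x : (`|((h x - h_ n x) ^+ 2)%:E| <= (EFin \o g) x)%E.
  by rewrite /= lee_fin ger0_norm ?sqr_ge0.
have [_ _] := @dominated_convergence _ _ _ M setT measurableT _ (cst 0%E) _ mD
  (measurable_cst _) (aeW _ (fun x _ => cD x)) ig (aeW _ (fun x n _ => bD n x)).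
rewrite integral0 => cI.
have [n hn] : exists n, (\int[M]_x ((h x - h_ n x) ^+ 2)%:E <= (e / 4)%:E)%E.
  have : (0 < (e / 4)%:E)%E by rewrite lte_fin.
  move=> e40; have H : nbhs (0 : \bar R)%E [set y | (y < (e / 4)%:E)%E].
    by apply: open_nbhs_nbhs; split => //; exact: open_ereal_lt_ereal.
  by have [n _ hn] := cI _ H; exists n; apply/ltW; apply: (hn n) => /=.
have [r hr] := ah n _ e4; exists r.
apply: (@le_trans _ _ (2%:E * \int[M]_x ((h x - h_ n x) ^+ 2)%:E +
   2%:E * \int[M]_x ((h_ n x - rk r x) ^+ 2)%:E)%E).
  apply: sq_int_le => //; do ?[by apply: measurable_funB => //; exact: measurable_rk].
  by move=> x; have := sqr_ge0 ((h x - h_ n x) - (h_ n x - rk r x)); nra.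
apply: (@le_trans _ _ (2%:E * (e / 4)%:E + 2%:E * (e / 4)%:E)%E).
  by apply: leeD; rewrite lee_pmul2l// lte_fin.
by rewrite -!EFinM -EFinD lee_fin; lra.
Qed.

Lemma appr0 : appr (fun=> 0).
Proof.
move=> e e0; exists [::]; rewrite (eq_integral (fun=> 0%E)) ?integral0 ?lee_fin 1?ltW//.
by move=> x _; rewrite /rk big_nil subr0 expr0n.
Qed.

Section indicator.
Variables (V : set U) (W : set S).
Hypotheses (mV : measurable V) (mW : measurable W) (fV : (nu V < +oo)%E) (fW : (mu W < +oo)%E).

Let mI (C : set (U * S)) : measurable C -> measurable_fun setT (\1_(C `&` (V `*` W)) : U * S -> R).
Proof. by move=> mC; apply: measurable_indic; apply: measurableI => //; exact: measurableX. Qed.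

Lemma appr_rect (A : set U) (B : set S) : measurable A -> measurable B ->
  appr (\1_((A `*` B) `&` (V `*` W))).
Proof.
move=> mA mB e e0.
have mBW : measurable (B `&` W) by exact: measurableI.
have pf : measurable_fun setT (\1_(B `&` W) : S -> R) /\ (\int[mu]_s ((\1_(B `&` W) s : R) ^+ 2)%:E < +oo)%E.
  split; first exact: measurable_indic.
  rewrite (eq_integral (fun s => (\1_(B `&` W) s)%:E)); last first.
    by move=> s _; rewrite expr2 indic_idem.
  rewrite integral_indic// setIT; apply: le_lt_trans fW.
  by apply: le_measure => //; rewrite inE.
exists [:: (exist _ (A `&` V) (measurableI _ _ mA mV), L2 pf.1 pf.2)].
rewrite (eq_integral (fun=> 0%E)) ?integral0 ?lee_fin 1?ltW// => x _.
rewrite /rk big_seq1/= (_ : \1_(A `*` B `&` V `*` W) x = \1_(A `&` V) x.1 * \1_(B `&` W) x.2).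
  by rewrite subrr expr0n.
rewrite !indicE -natrM mulnb; congr ((nat_of_bool _)%:R).
apply/idP/andP; rewrite !inE; first by move=> [[? ?] [? ?]].
by move=> [[? ?] [? ?]].
Qed.

Lemma integrable_box : M.-integrable setT (EFin \o (\1_(V `*` W) : U * S -> R)).
Proof.
apply/integrableP; split; first by apply/measurable_EFinP; apply: measurable_indic; exact: measurableX.
rewrite (eq_integral (fun x => (\1_(V `*` W) x)%:E)); last first.
  by move=> x _ /=; rewrite ger0_norm.
rewrite integral_indic//; last exact: measurableX.
rewrite setIT [ltLHS]product_measure1E//.
by rewrite lte_mul_pinfty// ge0_fin_numE.
Qed.

(** Dynkin's argument starting from rectangles; the intersection with a box of finite measure keeps
    complements and increasing limits square integrable. *)
Lemma appr_indic (C : set (U * S)) : measurable C -> appr (\1_(C `&` (V `*` W))).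
Proof.
pose G : set (set (U * S)) := [set A `*` B | A in measurable & B in measurable].
have bd (A B D : set (U * S)) x : ((\1_(A `&` D) x - \1_(B `&` D) x) ^+ 2 <= \1_D x :> R).
  rewrite !indicE !in_setI; case: (x \in D); rewrite ?andbT ?andbF ?subr0 ?expr0n//.
  by case: (_ \in A); case: (_ \in B); rewrite ?subrr ?subr0 ?sub0r ?sqrrN ?expr1n ?expr0n.
move=> mC; have : <<s G >> C by rewrite -measurable_prod_measurableType.
apply: (@dynkin_induction _ _ G (fun C => appr (\1_(C `&` (V `*` W))))).
- exact: measurable_prod_measurableType.
- move=> _ _ [A mA [B mB <-]] [A' mA' [B' mB' <-]].
  exists (A `&` A'); first exact: measurableI.
  exists (B `&` B'); first exact: measurableI.
  by rewrite setXI.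
- by rewrite -setXTT; exact: appr_rect.
- by move=> _ [A mA [B mB <-]]; exact: appr_rect.
- move=> A mA IH.
  have -> : \1_(~` A `&` (V `*` W)) = (fun x => \1_((setT `*` setT) `&` (V `*` W)) x + -1 * \1_(A `&` (V `*` W)) x :> R).
    apply/funext => x; rewrite setXTT; move: (V `*` W) => D; rewrite !indicE !in_setI in_setC in_setT.
    by case: (x \in D); case: (x \in A) => /=; lra.
  apply: apprD; [by apply: mI; exact: measurableX|by apply: measurable_funM => //; exact: mI| |].
    exact: appr_rect.
  by apply: apprZ => //; exact: mI.
- move=> F mF tF IH.
  have mU n : measurable (\bigcup_(i < n) F i) by exact: bigcup_measurable.
  have IHn n : appr (\1_((\bigcup_(i < n) F i) `&` (V `*` W))).
    elim: n => [|n IHn].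
      have -> : \1_((\bigcup_(i < 0) F i) `&` (V `*` W)) = (fun=> 0) :> (U * S -> R).
        by apply/funext => x; rewrite indicE memNset// => -[[]].
      exact: appr0.
    have -> : \1_((\bigcup_(i < n.+1) F i) `&` (V `*` W)) =
       (fun x => \1_((\bigcup_(i < n) F i) `&` (V `*` W)) x + \1_(F n `&` (V `*` W)) x :> R).
      apply/funext => x; move: (V `*` W) => D; rewrite !indicE !in_setI; case: (x \in D); last by rewrite !andbF addr0.
      rewrite !andbT; case: (boolP (x \in F n)) => [xF|nF].
        rewrite mem_set; last by exists n => //=; exact: set_mem.
        rewrite memNset ?add0r// => -[i /= iltn Fi]; suff : i = n by move=> E; rewrite E ltnn in iltn.
        by apply: (tF i n) => //; exists x; split => //; exact: set_mem.
      rewrite addr0; congr ((nat_of_bool _)%:R); apply/idP/idP; rewrite !inE.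
        move=> [i /=]; rewrite ltnS leq_eqVlt => /orP[/eqP -> Fn|iltn Fi]; last by exists i.
        by case/negP: nF; exact: mem_set.
      by move=> [i /= iltn Fi]; exists i => //=; rewrite ltnS ltnW.
    by apply: apprD => //; exact: mI.
  apply: (@appr_lim (fun n => \1_((\bigcup_(i < n) F i) `&` (V `*` W))) _ (\1_(V `*` W))) => //.
  + by move=> n; exact: mI.
  + by apply: mI; exact: bigcup_measurable.
  + move=> x; have [[[k _ Fk] VW]|nF] := pselect (((\bigcup_k F k) `&` (V `*` W)) x).
      have -> : \1_((\bigcup_k F k) `&` (V `*` W)) x = 1 :> R by rewrite indicE mem_set//; split=> //; exists k.
      apply: cvg_near_cst; near=> n; rewrite indicE mem_set//; split => //; exists k => //=.
      by near: n; exact: nbhs_infty_gt.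
    have -> : \1_((\bigcup_k F k) `&` (V `*` W)) x = 0 :> R by rewrite indicE memNset.
    apply: cvg_near_cst; apply: nearW => n.
    by rewrite indicE memNset// => -[[k _ Fk] VW]; apply: nF; split => //; exists k.
  + exact: integrable_box.
Unshelve. all: by end_near. Qed.

End indicator.

Import HBNNSimple.

Lemma appr_ge0 (h : U * S -> R) : measurable_fun setT h -> (forall x, 0 <= h x) ->
  (\int[M]_x (h x ^+ 2)%:E < +oo)%E -> appr h.
Proof.
move=> mh h0 ih.
have /sigma_finiteP[V [TV ndV Voo]] := sigma_finiteT nu.
have /sigma_finiteP[W [TW ndW Woo]] := sigma_finiteT mu.
have mV n := (Voo n).1; have mW n := (Woo n).1.
have mh' : measurable_fun setT (EFin \o h) by exact/measurable_EFinP.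
pose f_ := nnsfun_approx measurableT mh'.
have cf x : f_ n x @[n --> \oo] --> h x.
  have := @cvg_nnsfun_approx _ _ _ _ measurableT _ mh' (fun x _ => h0 x) x Logic.I.
  by move/fine_cvg.
have fh n x : f_ n x <= h x.
  have nd : nondecreasing_seq (f_ ^~ x) by move=> i j ij; exact/lefP/nd_nnsfun_approx.
  by have := nondecreasing_cvgn_le nd (cvgP _ (cf x)) n; rewrite (cvg_lim _ (cf x)).
apply: (@appr_lim (fun n x => f_ n x * \1_(V n `*` W n) x) h (fun x => h x ^+ 2)) => //.
- move=> n; apply: measurable_funM => //.
  by apply: measurable_indic; apply: measurableX.
- move=> [t s]; rewrite -[X in _ --> X]mulr1; apply: cvgM; first exact: cf.
  have [i _ Vt] : (\bigcup_n V n) t by rewrite -TV.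
  have [j _ Ws] : (\bigcup_n W n) s by rewrite -TW.
  apply: cvg_near_cst; near=> n; rewrite indicE mem_set//; split => /=.
    have /subsetPset : (V i <= V n)%O by apply: ndV; near: n; exact: nbhs_infty_ge.
    by apply.
  have /subsetPset : (W j <= W n)%O by apply: ndW; near: n; exact: nbhs_infty_ge.
  by apply.
- move=> n x; have f1 : 0 <= f_ n x * \1_(V n `*` W n) x <= h x.
    rewrite mulr_ge0//= (le_trans _ (fh n x))// ler_piMr//.
  by case/andP: f1 => f1 f2; rewrite ler_sqr ?nnegrE// ?subr_ge0// gerBl.
- apply/integrableP; split; first by apply/measurable_EFinP; exact: measurable_funX.
  by under eq_integral do rewrite /= ger0_norm ?sqr_ge0//.
move=> n; move: (f_ n) => {}f; rewrite /=.
have A (s : seq R) : appr (fun x => \sum_(r <- s) r * \1_(f @^-1` [set r] `&` (V n `*` W n)) x).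
  have mC r : measurable (f @^-1` [set r]) by [].
  have mI r : measurable_fun setT (\1_(f @^-1` [set r] `&` (V n `*` W n)) : U * S -> R).
    by apply: measurable_indic; apply: measurableI => //; exact: measurableX.
  elim: s => [|r s IH]; first by under eq_fun do rewrite big_nil; exact: appr0.
  under eq_fun do rewrite big_cons; apply: apprD => //.
  - exact: measurable_funM.
  - by apply: measurable_sum => i; exact: measurable_funM.
  - by apply: apprZ => //; apply: appr_indic => //; [exact: (Voo n).2|exact: (Woo n).2].
have -> : (fun x => f x * \1_(V n `*` W n) x) =
    (fun x => \sum_(r <- finmap.enum_fset (fset_set (range f))) r * \1_(f @^-1` [set r] `&` (V n `*` W n)) x).
  apply/funext => x; rewrite {1}fimfunE fsbig_finite//= mulr_suml.
  apply: eq_bigr => r _; rewrite -mulrA; congr (_ * _).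
  by move: (V n `*` W n) => D; rewrite !indicE in_setI -natrM mulnb.
exact: A.
Unshelve. all: by end_near. Qed.

Lemma appr_L2 (h : U * S -> R) : measurable_fun setT h ->
  (\int[M]_x (h x ^+ 2)%:E < +oo)%E -> appr h.
Proof.
move=> mh ih.
have -> : h = (fun x => Num.max (h x) 0 + -1 * Num.max (- h x) 0).
  apply/funext => x; have [h0|h0] := leP (h x) 0.
    by rewrite max_l ?oppr_ge0// add0r mulN1r opprK.
  by rewrite max_r ?mulr0 ?addr0// oppr_le0 ltW.
have mp : measurable_fun setT (fun x => Num.max (h x) 0) by exact: measurable_maxr.
have mn : measurable_fun setT (fun x => Num.max (- h x) 0).
  by apply: measurable_maxr => //; exact: measurable_funN.
apply: apprD => //; first exact: measurable_funM.
  apply: appr_ge0 => //; first by move=> x; rewrite le_max lexx orbT.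
  apply: le_lt_trans ih; apply: le_lower_integral => x; rewrite lee_fin ?sqr_ge0//.
  by have [h0|h0] := leP (h x) 0; rewrite ?expr0n ?sqr_ge0.
apply: apprZ => //; apply: appr_ge0 => //; first by move=> x; rewrite le_max lexx orbT.
apply: le_lt_trans ih; apply: le_lower_integral => x; rewrite lee_fin ?sqr_ge0//.
by have [h0|h0] := leP (- h x) 0; rewrite ?expr0n ?sqrrN ?sqr_ge0.
Qed.

End kernel_approximation.

Lemma nneseries_cvg0 (R : realType) (u : nat -> \bar R) : (forall n, 0 <= u n)%E ->
  (\sum_(0 <= n <oo) u n < +oo)%E -> u n @[n --> \oo] --> (0 : \bar R)%E.
Proof.
move=> u0 su; have H := nneseries_tail_cvg su (fun k _ => u0 k).
apply: (squeeze_cvge _ (cvg_cst 0%E) H); apply: nearW => n; rewrite u0/=.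
rewrite (nneseries_split n 1)// addn1 big_nat1 leeDl//.
exact: nneseries_ge0.
Qed.

Section path_version.
Context dU (U : measurableType dU) dS (S : measurableType dS) (R : realType).
Variables (nu : {sigma_finite_measure set U -> \bar R})
  (mu : {sigma_finite_measure set S -> \bar R}).
Notation M := (nu \x mu)%E.
Notation l2 := (l2 mu).
Variables (k : U -> l2) (c : R).
Hypothesis mk : measurable_fun setT (fun x : U * S => k x.1 x.2).
Hypothesis kc : forall t, ip (k t) (k t) <= c.

Definition rect_paths (r : rect_seq U mu) (z : paths R l2) (t : U) : R :=
  \sum_(p <- r) \1_(proj1_sig p.1) t * z p.2.

(** Rectangle kernels approximate [k] with summable squared errors in the product space. Hence for
    almost every [t] the errors at [t] have summable variances, and the approximations converge
    almost surely. The variances depend on [mu] only, so one [Gt] serves every white [G]. *)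
Lemma path_version : exists Gt : paths R l2 * U -> R, measurable_fun setT Gt /\
  forall G : probability (paths R l2) R, white G ->
    {ae nu, forall t, {ae G, forall z, Gt (z, t) = z (k t)}}.
Proof.
have /sigma_finiteP[V [TV ndV Voo]] := sigma_finiteT nu.
have mV n := (Voo n).1.
(* The measure [nu] may be infinite, and then [k] is only bounded in norm at each time; the cut to
   [V N] puts the kernel into the product space. *)
pose kN N (x : U * S) : R := k x.1 x.2 * \1_(V N) x.1.
have mkN N : measurable_fun setT (kN N).
  by apply: measurable_funM => //; exact: (measurableT_comp (measurable_indic (mV N)) measurable_fst).
have ikN N : (\int[M]_x (kN N x ^+ 2)%:E < +oo)%E.
  rewrite fubini_tonelli1//=; first last.
  - by move=> x; rewrite lee_fin sqr_ge0.
  - by apply/measurable_EFinP; exact: measurable_funX.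
  apply: (@le_lt_trans _ _ (\int[nu]_t (`|c|%:E * (\1_(V N) t)%:E))%E).
    apply: le_lower_integral => t; first by apply: integral_ge0 => s _; rewrite lee_fin sqr_ge0.
    rewrite /fubini_F /kN /=.
    under eq_integral do rewrite exprMn [X in _ * X]expr2 indic_idem mulrC EFinM.
    rewrite ge0_integralZl//; first last.
    - by move=> s _; rewrite lee_fin sqr_ge0.
    - by apply/measurable_EFinP; apply: measurable_funX; exact: l2_meas.
    under eq_integral do rewrite expr2.
    by rewrite -ipE -!EFinM lee_fin mulrC ler_wpM2r// (le_trans (kc t))// ler_norm.
  rewrite ge0_integralZl//; last by apply/measurable_EFinP; exact: measurable_indic.
  rewrite integral_indic// setIT lte_mul_pinfty ?lee_fin//.
  exact: (Voo N).2.
have /choice[r rP] : forall N, exists r : rect_seq U mu,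
    (\int[M]_x ((kN N x - rk r x) ^+ 2)%:E <= (1 / (2 ^ N.+1)%:R)%:E)%E.
  by move=> N; apply: appr_L2 => //; rewrite divr_gt0// ltr0n expn_gt0.
pose D N t := (\int[mu]_s ((kN N (t, s) - rk (r N) (t, s)) ^+ 2)%:E)%E.
have mDs N : measurable_fun setT (fun x : U * S => ((kN N x - rk (r N) x) ^+ 2)%:E).
  by apply/measurable_EFinP; apply: measurable_funX; apply: measurable_funB => //; exact: measurable_rk.
have mD N : measurable_fun setT (D N).
  apply: (@measurable_fun_fubini_tonelli_F _ _ _ _ _ mu (fun x => ((kN N x - rk (r N) x) ^+ 2)%:E)) => //.
  by move=> x; rewrite lee_fin sqr_ge0.
have D0 N t : (0 <= D N t)%E by apply: integral_ge0 => s _; rewrite lee_fin sqr_ge0.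
have Dae : {ae nu, forall t, (\sum_(0 <= N <oo) D N t < +oo)%E}.
  have mS : measurable_fun setT (fun t => \sum_(0 <= N <oo) D N t)%E.
    by apply: ge0_emeasurable_sum.
  have : nu.-integrable setT (fun t => \sum_(0 <= N <oo) D N t)%E.
    apply/integrableP; split => //.
    under eq_integral do rewrite gee0_abs ?nneseries_ge0//.
    rewrite integral_nneseries//.
    apply: (@le_lt_trans _ _ (\sum_(0 <= N <oo) ((1 / (2 ^ N.+1)%:R)%:E : \bar R))%E).
      apply: lee_nneseries => [N _ _|N _]; first by apply: integral_ge0 => t _; exact: D0.
      by apply: le_trans (rP N); rewrite fubini_tonelli1// => x; rewrite lee_fin sqr_ge0.
    by apply: (@le_lt_trans _ _ 1%:E); [exact: epsilon_trick0|exact: ltry].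
  move/integrable_ae => /(_ measurableT); apply: filterS => t /(_ Logic.I).
  by rewrite ge0_fin_numE// nneseries_ge0.
pose H N (x : paths R l2 * U) := rect_paths (r N) x.1 x.2.
have mH N : measurable_fun setT (H N).
  apply: measurable_sum => -[[A mA] f]; apply: measurable_funM => /=.
    exact: (measurableT_comp (measurable_indic mA) measurable_snd).
  exact: (measurableT_comp (measurable_ev f) measurable_fst).
(* The upper limit is measurable everywhere; where the approximations converge, [fine] returns their
   limit. *)
exists (fun x => fine (limn_esup (fun N => (H N x)%:E))); split.
  apply: measurableT_comp => //; apply: measurable_fun_limn_esup => N.
  exact/measurable_EFinP.
move=> G wG; apply: filterS Dae => t Dt.
(* The linear form of the error at time [t]: its variance is [D N t]. Where [V N] has reached [t],
   its convergence to 0 means that [H N] converges to the value at [k t]. *)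
pose s N : seq (R * l2) := (- \1_(V N) t, k t) :: map (fun p => (\1_(proj1_sig p.1) t, p.2)) (r N).
have sE N z : linform (s N) z = H N (z, t) - \1_(V N) t * z (k t).
  by rewrite linform_cons /linform big_map /H /rect_paths/= addrC mulNr.
have vE N : ((ip (l2lin (s N)) (l2lin (s N)))%:E = D N t)%E.
  rewrite ipE; apply: eq_integral => x _; congr EFin.
  rewrite !l2linE !big_cons !big_map/= -expr2 -sqrrN; congr (_ ^+ 2).
  by rewrite /kN /rk /= mulNr opprD opprK mulrC.
have mL N : measurable_fun setT (fun z => ((linform (s N) z) ^+ 2)%:E).
  by apply/measurable_EFinP; apply: measurable_funX; exact: measurable_linform.
have L0 N z : (0 <= ((linform (s N) z) ^+ 2)%:E)%E by rewrite lee_fin sqr_ge0.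
have : G.-integrable setT (fun z => \sum_(0 <= N <oo) ((linform (s N) z) ^+ 2)%:E)%E.
  apply/integrableP; split; first by apply: ge0_emeasurable_sum.
  under eq_integral do rewrite gee0_abs ?nneseries_ge0//.
  rewrite integral_nneseries//; apply: le_lt_trans Dt.
  by apply: lee_nneseries => [N _ _|N _]; [exact: integral_ge0|rewrite (isG_var (wG (s N))) vE].
move/integrable_ae => /(_ measurableT); apply: filterS => z /(_ Logic.I).
rewrite ge0_fin_numE ?nneseries_ge0// => /(nneseries_cvg0 (L0^~ z)) cz.
have cH : (H N (z, t))%:E @[N --> \oo] --> (z (k t))%:E.
  apply/cvg_EFin; first exact: nearW.
  have [i _ Vt] : (\bigcup_n V n) t by rewrite -TV.
  have cl : linform (s N) z @[N --> \oo] --> 0.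
    apply: norm_cvg0; move/fine_cvg : cz => /= cz.
    rewrite -sqrtr0; under eq_fun do rewrite -sqrtr_sqr.
    by apply: continuous_cvg => //; exact: sqrt_continuous.
  have ci : \1_(V N) t @[N --> \oo] --> (1 : R).
    apply: cvg_near_cst; near=> n; rewrite indicE mem_set//.
    have /subsetPset : (V i <= V n)%O by apply: ndV; near: n; exact: nbhs_infty_ge.
    by apply.
  have cH : linform (s N) z + \1_(V N) t * z (k t) @[N --> \oo] --> 0 + 1 * z (k t).
    by apply: cvgD => //; apply: cvgM => //; exact: cvg_cst.
  rewrite mul1r add0r in cH; apply: cvg_trans cH; apply: near_eq_cvg; apply: nearW => N.
  by rewrite sE subrK.
by rewrite (cvg_limn_einf_sup cH).2.
Unshelve. all: by end_near. Qed.

End path_version.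

(** * Decoupling *)

Section gaussian_forms.
Context dS (S : measurableType dS) (R : realType).
Variable mu : {measure set S -> \bar R}.
Notation l2 := (l2 mu).
Variables (G : probability (paths R l2) R).
Hypothesis wG : white G.

Definition covform (J : Type) (K : J -> J -> R) (s : seq (R * J)) : R :=
  \sum_(p <- s) \sum_(q <- s) p.1 * q.1 * K p.2 q.2.

Lemma covformD (J : Type) (K K' : J -> J -> R) s :
  covform K s + covform K' s = covform (fun i j => K i j + K' i j) s.
Proof.
rewrite /covform -big_split; apply: eq_bigr => p _ /=.
by rewrite -big_split; apply: eq_bigr => q _; rewrite mulrDr.
Qed.

Lemma eq_covform (J : Type) (K K' : J -> J -> R) s : (forall i j, K i j = K' i j) ->
  covform K s = covform K' s.
Proof. by move=> KK; apply: eq_bigr => p _; apply: eq_bigr => q _; rewrite KK. Qed.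

(* Linear forms of linear forms: with values in lists, no null sets are involved. *)
Lemma gauss_forms (J : Type) (F : J -> seq (R * l2)) (s : seq (R * J)) :
  isG G (fun z => linform s (fun j => linform (F j) z))
    (covform (fun i j => ip (l2lin (F i)) (l2lin (F j))) s).
Proof.
pose fl := flatten [seq [seq (p.1 * q.1, q.2) | q <- F p.2] | p <- s].
have E (V : R -> l2 -> R) : (forall c d f, V (c * d) f = c * V d f) ->
    \sum_(p <- fl) V p.1 p.2 = \sum_(p <- s) p.1 * \sum_(q <- F p.2) V q.1 q.2.
  move=> VM; rewrite /fl big_flatten/= big_map; apply: eq_bigr => p _.
  by rewrite big_map mulr_sumr; apply: eq_bigr => q _; rewrite VM.
have -> : (fun z => linform s (fun j => linform (F j) z)) = linform fl.
  apply/funext => z; rewrite /linform (E (fun c f => c * z f))// => c d f.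
  by rewrite mulrA.
have -> : covform (fun i j => ip (l2lin (F i)) (l2lin (F j))) s = ip (l2lin fl) (l2lin fl).
  pose g := l2lin [seq (p.1, l2lin (F p.2)) | p <- s].
  have -> : ip (l2lin fl) (l2lin fl) = ip g g.
    apply: eq_Rintegral => x _; rewrite !l2linE (E (fun c f => c * f x)).
      by rewrite big_map.
    by move=> c d f; rewrite mulrA.
  rewrite ip_linl big_map; apply: eq_bigr => p _ /=.
  rewrite ip_linr big_map mulr_sumr; apply: eq_bigr => q _ /=.
  by rewrite mulrA.
exact: wG.
Qed.

Lemma linformD (J : Type) (s : seq (R * J)) (z z' : paths R J) :
  linform s z + linform s z' = linform s (fun j => z j + z' j).
Proof. by rewrite /linform -big_split; apply: eq_bigr => p _; rewrite mulrDr. Qed.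

Lemma l2lin1 (c : R) (f g : l2) : ip (l2lin [:: (c, f)]) g = c * ip f g.
Proof. by rewrite ip_linl big_seq1. Qed.

Lemma l2lin11 (c d : R) (f g : l2) :
  ip (l2lin [:: (c, f)]) (l2lin [:: (d, g)]) = c * (d * ip f g).
Proof. by rewrite l2lin1 ipC l2lin1 ipC. Qed.

Lemma l2lin0 (g : l2) : ip (l2lin [::]) g = 0.
Proof. by rewrite ip_linl big_nil. Qed.

End gaussian_forms.

Section diagonally_dominant.
Context dS (S : measurableType dS) (R : realType).
Variable mu : {measure set S -> \bar R}.
Notation l2 := (l2 mu).
Variables (e : nat -> l2) (J : finType) (Q : J -> J -> R).
Hypothesis e_on : forall i j, ip (e i) (e j) = (i == j)%:R.
Hypothesis Qsym : forall i j, Q i j = Q j i.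
Hypothesis Qdom : forall i, \sum_(j | j != i) `|Q i j| <= Q i i.

(* Each ordered pair [(a, b)] contributes a rank one form on the coordinates [a] and [b]. *)
Lemma diag_dominant_gram : exists phi : J -> l2, forall i j, ip (phi i) (phi j) = Q i j.
Proof.
pose D i := Q i i - \sum_(j | j != i) `|Q i j|.
have D0 i : 0 <= D i by rewrite subr_ge0.
(* The pair [(a, a)] carries the surplus [D a]. For [a != b] the form is [sqrt (|Q a b| / 2)] times
   [e_a + sg (Q a b) e_b]: the pairs [(a, b)] and [(b, a)] together contribute [Q a b] off the
   diagonal and [|Q a b|] to each of the two diagonal entries. *)
pose al (a b : J) := if a == b then Num.sqrt (D a) else Num.sqrt (`|Q a b| / 2).
pose be (a b : J) := if a == b then 0 else Num.sg (Q a b) * Num.sqrt (`|Q a b| / 2).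
pose co i (p : J * J) := (i == p.1)%:R * al p.1 p.2 + (i == p.2)%:R * be p.1 p.2.
pose rk (p : J * J) : nat := enum_rank p.
pose phi i := l2lin [seq (co i p, e (rk p)) | p <- enum {: J * J}].
exists phi => i j.
have -> : ip (phi i) (phi j) = \sum_p co i p * co j p.
  rewrite /phi ip_linl big_map big_enum/=; apply: eq_bigr => p _.
  rewrite ip_linr big_map big_enum/= (bigD1 p)//= e_on eqxx mulr1 big1 ?addr0// => q qp.
  rewrite e_on (_ : (rk p == rk q) = false) ?mulr0//.
  apply/negbTE; apply: contra qp => /eqP/val_inj/enum_rank_inj ->; exact: eqxx.
have sq (a b : J) : Num.sqrt (`|Q a b| / 2) ^+ 2 = `|Q a b| / 2 by rewrite sqr_sqrtr// divr_ge0.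
have dl (F : J -> R) k : \sum_a (k == a)%:R * F a = F k.
  rewrite (bigD1 k)//= eqxx mul1r big1 ?addr0// => a ak.
  by rewrite eq_sym (negbTE ak) mul0r.
have -> : \sum_p co i p * co j p =
   (i == j)%:R * (\sum_b al i b ^+ 2) + al i j * be i j + al j i * be j i +
   (i == j)%:R * (\sum_a be a i ^+ 2).
  rewrite -(pair_bigA _ (fun a b => co i (a, b) * co j (a, b)))/=.
  transitivity (\sum_a \sum_b ((i == a)%:R * ((j == a)%:R * al a b ^+ 2) +
     (i == a)%:R * ((j == b)%:R * (al a b * be a b)) +
     (j == a)%:R * ((i == b)%:R * (al a b * be a b)) +
     (i == b)%:R * ((j == b)%:R * be a b ^+ 2))).
    by apply: eq_bigr => a _; apply: eq_bigr => b _; rewrite /co /=; ring.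
  transitivity (\sum_a ((i == a)%:R * ((j == a)%:R * \sum_b al a b ^+ 2) +
     (i == a)%:R * (al a j * be a j) + (j == a)%:R * (al a i * be a i) +
     (j == i)%:R * be a i ^+ 2)).
    apply: eq_bigr => a _; rewrite !big_split/=; congr (_ + _ + _ + _).
    - by rewrite -!mulr_sumr.
    - by rewrite -mulr_sumr dl.
    - by rewrite -mulr_sumr dl.
    - by rewrite dl.
  by rewrite !big_split/= !dl -mulr_sumr (eq_sym j i).
have E a b : a != b -> al a b * be a b = Q a b / 2.
  by move=> ab; rewrite /al /be (negbTE ab) mulrCA -expr2 sq mulrA -numEsg.
have [<-|ij] := eqVneq i j; last first.
  by rewrite !mul0r add0r addr0 !E// 1?eq_sym// (Qsym j i) -splitr.
have be2 a : a != i -> be a i ^+ 2 = `|Q i a| / 2.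
  move=> ai; rewrite /be (negbTE ai) exprMn sq sqr_sg Qsym.
  by case: eqP => [->|_]; rewrite ?normr0 ?mul0r ?mulr0 ?mul1r.
have -> : be i i = 0 by rewrite /be eqxx.
rewrite mulr0 !mul1r !addr0 (bigD1 i)//= [X in _ + X](bigD1 i)//=.
have -> : be i i = 0 by rewrite /be eqxx.
rewrite expr0n add0r (eq_bigr _ be2) {1}/al eqxx sqr_sqrtr//.
rewrite (eq_bigr (fun a => `|Q i a| / 2)); last first.
  by move=> a ai; rewrite /al eq_sym (negbTE ai) sq.
by rewrite -!mulr_suml -addrA -splitr subrK.
Qed.

End diagonally_dominant.

Section decoupling.
Context dS (S : measurableType dS) (R : realType).
Variable mu : {measure set S -> \bar R}.
Notation l2 := (l2 mu).
Variables (G : probability (paths R l2) R) (e : nat -> l2) (Ic : finType).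
Hypothesis wG : white G.
Hypothesis e_on : forall i j, ip (e i) (e j) = (i == j)%:R.

(** Numbers the pairs of a block and a component injectively, so that different blocks read disjoint
    parts of the orthonormal sequence [e]. *)
Definition eidx (k : nat) (c : Ic) : nat := k * #|Ic| + enum_rank c.

Definition std_block (k : nat) (z : paths R l2) : paths R Ic := fun c => z (e (eidx k c)).

Lemma eidx_eq k k' c c' : (eidx k c == eidx k' c') = (k == k') && (c == c').
Proof.
apply/eqP/andP => [E|[/eqP -> /eqP ->]//].
have lt (i : Ic) : (enum_rank i < #|Ic|)%N by exact: ltn_ord.
have n0 : (0 < #|Ic|)%N := leq_ltn_trans (leq0n _) (lt c).
have k_eq : k = k'.
  have := congr1 (divn^~ #|Ic|) E; rewrite /= /eidx !divnMDl// !divn_small ?lt//.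
  by rewrite !addn0.
subst k'; split=> //; move: E => /addnI/val_inj/enum_rank_inj ->; exact: eqxx.
Qed.

Lemma measurable_std_block k : measurable_fun setT (std_block k).
Proof. by apply: measurable_pathsP => c; exact: measurable_ev. Qed.

Lemma std_block_law k (g : paths R Ic -> \bar R) : measurable_fun setT g -> (forall x, 0 <= g x)%E ->
  (\int[G]_z g (std_block k z) = \int[G]_z g (std_block 0 z))%E.
Proof.
move=> mg g0; apply: (law_integral (measurable_std_block k) (measurable_std_block 0)) => //.
apply: (@gauss_law R Ic _ _ G _ _ G _ _ (covform (fun i j => (i == j)%:R))).
- by move=> c; exact: measurable_ev.
- by move=> c; exact: measurable_ev.
- move=> s; have := gauss_forms wG (fun c => [:: (1, e (eidx k c))]) s.
  rewrite (eq_covform (K' := fun i j => (i == j)%:R)); last first.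
    by move=> i j; rewrite l2lin1 ipC l2lin1 !mul1r e_on eidx_eq eqxx eq_sym.
  by congr isG; apply/funext => z; apply: eq_bigr => p _; rewrite /linform big_seq1 mul1r.
- move=> s; have := gauss_forms wG (fun c => [:: (1, e (eidx 0 c))]) s.
  rewrite (eq_covform (K' := fun i j => (i == j)%:R)); last first.
    by move=> i j; rewrite l2lin1 ipC l2lin1 !mul1r e_on eidx_eq eqxx eq_sym.
  by congr isG; apply/funext => z; apply: eq_bigr => p _; rewrite /linform big_seq1 mul1r.
Qed.

(** Induction on the number of blocks: reading block [N] from a second, independent path changes no
    covariance, hence not the joint law, and Tonelli then splits off its factor. *)
Lemma std_blocks_indep N (g : nat -> paths R Ic -> R) (C : nat -> R) :
  (forall k, measurable_fun setT (g k)) -> (forall k x, 0 <= g k x) -> (forall k, 0 <= C k) ->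
  (forall k, \int[G]_z (g k (std_block 0 z))%:E <= (C k)%:E)%E ->
  (\int[G]_z (\prod_(k < N) g k (std_block k z))%:E <= (\prod_(k < N) C k)%:E)%E.
Proof.
move=> mg g0 C0 gC; elim: N => [|N IH].
  under eq_integral do rewrite big_ord0; rewrite big_ord0.
  by rewrite (Ex_EFin G (@mb_cst _ _ R 1)) Ex_cst.
pose Z (z : paths R l2) : paths R (nat * Ic) := fun j => z (e (eidx j.1 j.2)).
pose Z' (w : paths R l2 * paths R l2) : paths R (nat * Ic) :=
  fun j => if (j.1 < N)%N then w.1 (e (eidx j.1 j.2)) else w.2 (e (eidx j.1 j.2)).
pose Phi (x : paths R (nat * Ic)) : \bar R := (\prod_(k < N.+1) g k (fun c => x (k : nat, c)))%:E.
have mb0 k : measurable_fun setT (fun x : paths R (nat * Ic) => (fun c => x (k, c)) : paths R Ic).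
  by apply: measurable_pathsP => c; exact: measurable_ev.
have mPhi : measurable_fun setT Phi.
  apply/measurable_EFinP; apply: measurable_prod => k _.
  exact: (measurableT_comp (mg k) (mb0 k)).
have Phi0 x : (0 <= Phi x)%E by rewrite lee_fin prodr_ge0.
have mZ j : measurable_fun setT (fun z => Z z j) by exact: measurable_ev.
have mZ' j : measurable_fun setT (fun w => Z' w j).
  rewrite /Z'; case: (j.1 < N)%N.
    exact: (measurableT_comp (measurable_ev _) measurable_fst).
  exact: (measurableT_comp (measurable_ev _) measurable_snd).
have law : forall B, measurable B -> G (Z @^-1` B) = pprod G G (Z' @^-1` B).
  apply: (@gauss_law R _ _ _ G _ _ (pprod G G) Z Z' (covform (fun i j => (i == j)%:R))) => //.
    move=> s; have := gauss_forms wG (fun j : nat * Ic => [:: (1, e (eidx j.1 j.2))]) s.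
    rewrite (eq_covform (K' := fun i j => (i == j)%:R)); last first.
      move=> [i1 i2] [j1 j2]; rewrite l2lin1 ipC l2lin1 !mul1r e_on eidx_eq/=.
      by rewrite eq_sym (eq_sym j2).
    by congr isG; apply/funext => z; apply: eq_bigr => p _; rewrite /linform big_seq1 mul1r.
  move=> s.
  have := isG_prod (gauss_forms wG (fun j : nat * Ic => if (j.1 < N)%N then [:: (1, e (eidx j.1 j.2))] else [::]) s)
    (gauss_forms wG (fun j : nat * Ic => if (j.1 < N)%N then [::] else [:: (1, e (eidx j.1 j.2))]) s).
  rewrite covformD (eq_covform (K' := fun i j => (i == j)%:R)); last first.
    move=> [i1 i2] [j1 j2]/=.
    have E : ip (l2lin [:: (1, e (eidx i1 i2))]) (l2lin [:: (1, e (eidx j1 j2))]) = ((i1, i2) == (j1, j2))%:R.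
      by rewrite l2lin1 ipC l2lin1 !mul1r e_on eidx_eq eq_sym (eq_sym j2).
    case: ltnP => iN; case: ltnP => jN; rewrite ?l2lin0 ?E ?addr0 ?add0r//.
    - rewrite ipC l2lin0; case: eqP => // -[E1 _]; rewrite E1 ltnNge jN in iN.
      by [].
    - rewrite ipC l2lin0; case: eqP => // -[E1 _]; rewrite E1 leqNgt jN in iN.
      by [].
  congr isG; apply/funext => w; rewrite linformD; apply: eq_bigr => p _; rewrite /Z'.
  by case: ifP => _; rewrite /linform ?big_seq1 ?big_nil ?mul1r ?addr0 ?add0r.
have -> : (\int[G]_z (\prod_(k < N.+1) g k (std_block k z))%:E = \int[pprod G G]_w Phi (Z' w))%E.
  rewrite -(law_integral (measurable_pathsP mZ) (measurable_pathsP mZ') law mPhi Phi0).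
  by [].
have mPZ' : measurable_fun setT (fun w => Phi (Z' w)).
  exact: (measurableT_comp mPhi (measurable_pathsP mZ')).
rewrite pprod_fubini//.
have -> : (\int[G]_z \int[G]_z' Phi (Z' (z, z')) =
   \int[G]_z ((\prod_(k < N) g k (std_block k z))%:E * \int[G]_z' (g N (std_block 0 z'))%:E))%E.
  apply: eq_integral => z _.
  rewrite -(std_block_law N (g := fun x => (g N x)%:E)); last 2 first.
  - by apply/measurable_EFinP.
  - by move=> x; rewrite lee_fin.
  rewrite -ge0_integralZl//; last 3 first.
  - by apply/measurable_EFinP; exact: (measurableT_comp (mg N) (measurable_std_block N)).
  - by move=> x _; rewrite lee_fin.
  - by rewrite lee_fin prodr_ge0.
  apply: eq_integral => z' _; rewrite -EFinM /Phi big_ord_recr/=; congr (_ * _)%:E.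
    apply: eq_bigr => k _; congr (g k _); apply/funext => c; rewrite /Z'/=.
    by rewrite ltn_ord.
  by congr (g N _); apply/funext => c; rewrite /Z'/= ltnn.
have mpr : measurable_fun setT (fun z => (\prod_(k < N) g k (std_block k z))%:E).
  apply/measurable_EFinP; apply: measurable_prod => k _.
  exact: (measurableT_comp (mg k) (measurable_std_block k)).
apply: (@le_trans _ _ (\int[G]_z ((\prod_(k < N) g k (std_block k z))%:E * (C N)%:E))%E).
  apply: ge0_le_integral => //.
  - by move=> z _; rewrite mule_ge0 ?lee_fin ?prodr_ge0// integral_ge0// => z' _; rewrite lee_fin.
  - by apply: emeasurable_funM => //; exact: measurable_cst.
  - by apply: emeasurable_funM => //; exact: measurable_cst.
  - by move=> z _; apply: lee_pmul => //; rewrite ?lee_fin ?prodr_ge0// integral_ge0// => z' _; rewrite lee_fin.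
rewrite ge0_integralZr//; last 2 first.
- by move=> z _; rewrite lee_fin prodr_ge0.
- by rewrite lee_fin.
rewrite big_ord_recr/= EFinM; apply: lee_pmul => //; last by rewrite lee_fin.
by rewrite integral_ge0// => z _; rewrite lee_fin prodr_ge0.
Qed.

Lemma eq_isG d (T : measurableType d) (P : probability T R) (Z Z' : T -> R) v v' :
  isG P Z v -> Z =1 Z' -> v = v' -> isG P Z' v'.
Proof. by move=> GZ /funext <- <-. Qed.

Variables (A : set S) (mA : measurable A) (v : R) (N : nat) (kap : 'I_N.+1 * Ic -> l2).
Hypothesis v0 : 0 <= v.
Notation rA := (l2restr mA).
Notation rC := (l2restr (measurableC mA)).

(** The covariance of [a + b] minus [v] times the identity, for the values [a] before and [b] after
    gluing: on [A] the two share their noise, which gives the factor 4, and off [A] they have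
    independent noises, which gives 2. *)
Definition decQ (i j : 'I_N.+1 * Ic) : R :=
  4 * ip (kap i) (rA (kap j)) + 2 * ip (kap i) (rC (kap j)) - v * (i == j)%:R.

Hypothesis Qdom : forall i, \sum_(j | j != i) `|decQ i j| <= decQ i i.

Variables (psi H : paths R Ic -> R).
Hypothesis mpsi : measurable_fun setT psi.
Hypothesis mH : measurable_fun setT H.
Hypothesis psiH : forall h y : paths R Ic,
  (\int[G]_z (expR `|psi (fun c => (Num.sqrt v * z (e (eidx 0 c)) + h c + y c) / 2) -
                     psi (fun c => (Num.sqrt v * z (e (eidx 0 c)) + h c - y c) / 2)|)%:E
   <= (expR (H y))%:E)%E.

(* The sum [a + b] and the difference [a - b] of the values before and after gluing are
   independent, and by diagonal dominance the sum is white noise of variance [v] plus an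
   independent remainder [h]. *)
Lemma decoupling :
  (\int[pprod G G]_w (expR (\sum_(k < N.+1) `|psi (fun c => w.1 (kap (k, c))) -
      psi (fun c => gl mA w (kap (k, c)))|))%:E <=
   \int[G]_z (expR (\sum_(k < N.+1) H (fun c => Num.sqrt 2 * z (rC (kap (k, c))))))%:E)%E.
Proof.
have Qsym i j : decQ i j = decQ j i.
  by rewrite /decQ (ipC (kap i) (rA _)) (ipC (kap i) (rC _)) !ip_restr (eq_sym i).
have [phi phiQ] := diag_dominant_gram e_on Qsym Qdom.
pose J := ('I_N.+1 * Ic)%type.
pose Zl (w : paths R l2 * paths R l2) : paths R (bool * J) :=
  fun i => if i.1 then gl mA w (kap i.2) else w.1 (kap i.2).
(* Three independent paths: [w.2] supplies the white part of variance [v], [w.1.1] the remainder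
   through the Gram vectors [phi], and [w.1.2] the difference, whose variance is twice that of the
   kernel off [A], whence [Num.sqrt 2]. The sign of the difference tells the values before gluing
   from those after it. *)
pose Zr (w : (paths R l2 * paths R l2) * paths R l2) : paths R (bool * J) := fun i =>
  (Num.sqrt v * w.2 (e (eidx i.2.1 i.2.2)) + w.1.1 (phi i.2) +
   (-1) ^+ i.1 * (Num.sqrt 2 * w.1.2 (rC (kap i.2)))) / 2.
pose Phi (x : paths R (bool * J)) : \bar R :=
  (expR (\sum_(k < N.+1) `|psi (fun c => x (false, (k, c))) - psi (fun c => x (true, (k, c)))|))%:E.
have mPhi : measurable_fun setT Phi.
  apply/measurable_EFinP; apply: measurableT_comp => //; apply: measurable_sum => k.
  apply: measurableT_comp => //; apply: measurable_funB.
    by apply: (measurableT_comp mpsi); apply: measurable_pathsP => c; exact: measurable_ev.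
  by apply: (measurableT_comp mpsi); apply: measurable_pathsP => c; exact: measurable_ev.
have Phi0 x : (0 <= Phi x)%E by rewrite lee_fin expR_ge0.
have mZl j : measurable_fun setT (fun w => Zl w j).
  rewrite /Zl; case: j.1; first exact: measurable_gl_ev.
  exact: (measurableT_comp (measurable_ev _) measurable_fst).
have mZr j : measurable_fun setT (fun w => Zr w j).
  apply: measurable_funM => //; apply: measurable_funD; [apply: measurable_funD|].
  - by apply: measurable_funM => //; exact: (measurableT_comp (measurable_ev _) measurable_snd).
  - exact: (measurableT_comp (measurable_ev _) (measurableT_comp measurable_fst measurable_fst)).
  - apply: measurable_funM => //; apply: measurable_funM => //.
    exact: (measurableT_comp (measurable_ev _) (measurableT_comp measurable_snd measurable_fst)).
(* The common covariance of both families: values before and after gluing share the noise on [A],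
   and only values of the same kind share the noise off [A]. *)
pose K (i j : bool * J) := ip (kap i.2) (rA (kap j.2)) +
  (i.1 == j.1)%:R * ip (kap i.2) (rC (kap j.2)).
have law : forall B, measurable B -> pprod G G (Zl @^-1` B) = pprod (pprod G G) G (Zr @^-1` B).
  apply: (@gauss_law R _ _ _ (pprod G G) _ _ (pprod (pprod G G) G) Zl Zr (covform K)) => //.
  - move=> s.
    pose F1 (i : bool * J) := [:: (1, if i.1 then rA (kap i.2) else kap i.2)] : seq (R * l2).
    pose F2 (i : bool * J) := if i.1 then [:: (1, rC (kap i.2))] else [::] : seq (R * l2).
    apply: (eq_isG (isG_prod (gauss_forms wG F1 s) (gauss_forms wG F2 s))).
      move=> w; rewrite linformD; apply: eq_bigr => -[c [[] i]] _;
        by rewrite /Zl /F1 /F2/= /linform ?big_seq1 ?big_nil ?mul1r ?addr0.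
    rewrite covformD; apply: eq_covform => -[[] i] [[] j];
      rewrite /K /F1 /F2/= ?(ipC _ (l2lin [::])) ?l2lin0 ?l2lin11 ?mul0r ?addr0 ?mul1r//.
    + by rewrite !ip_restr2.
    + by rewrite ip_restr.
    + by rewrite (ip_split mA).
  - move=> s.
    pose F1 (i : bool * J) := [:: (2^-1, phi i.2)] : seq (R * l2).
    pose F2 (i : bool * J) := [:: ((-1) ^+ i.1 * Num.sqrt 2 / 2, rC (kap i.2))] : seq (R * l2).
    pose F3 (i : bool * J) := [:: (Num.sqrt v / 2, e (eidx i.2.1 i.2.2))] : seq (R * l2).
    apply: (eq_isG (isG_prod (isG_prod (gauss_forms wG F1 s) (gauss_forms wG F2 s)) (gauss_forms wG F3 s))).
      move=> w; rewrite !linformD; apply: eq_bigr => -[c i] _.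
      rewrite /Zr /F1 /F2 /F3/= /linform !big_seq1/=; congr (_ * _).
      by move: ((-1) ^+ _) => ep; ring.
    rewrite !covformD; apply: eq_covform => -[b i] [b' j].
    rewrite /K /F1 /F2 /F3 !l2lin11 phiQ /decQ e_on eidx_eq ip_restr2/=.
    have -> : (val i.1 == val j.1) && (i.2 == j.2) = (i == j) by case: i j => [? ?] [? ?].
    have s2 : Num.sqrt 2 ^+ 2 = 2 :> R by rewrite sqr_sqrtr.
    have -> (q c d ep ep' t r : R) : 2^-1 * (2^-1 * q) + ep * t / 2 * (ep' * t / 2 * c) +
        r / 2 * (r / 2 * d) = 4^-1 * q + ep * ep' * (t ^+ 2 * c / 4) + r ^+ 2 * d / 4.
      by field.
    rewrite s2 (sqr_sqrtr v0).
    by case: b; case: b' => /=; rewrite ?expr0 ?expr1; field.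
rewrite [leLHS](_ : _ = \int[pprod (pprod G G) G]_w Phi (Zr w))%E; last first.
  exact: (law_integral (measurable_pathsP mZl) (measurable_pathsP mZr) law mPhi Phi0).
have mPZr : measurable_fun setT (fun w => Phi (Zr w)).
  exact: (measurableT_comp mPhi (measurable_pathsP mZr)).
rewrite pprod_fubini//.
pose Y (z : paths R l2) (k : 'I_N.+1) : paths R Ic := fun c => Num.sqrt 2 * z (rC (kap (k, c))).
have mY k : measurable_fun setT (Y ^~ k).
  by apply: measurable_pathsP => c; apply: measurable_funM => //; exact: measurable_ev.
have mHY : measurable_fun setT (fun z => (expR (\sum_(k < N.+1) H (Y z k)))%:E).
  apply/measurable_EFinP; apply: measurableT_comp => //; apply: measurable_sum => k.
  exact: (measurableT_comp mH (mY k)).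
rewrite -(@mp_integral _ _ _ _ _ (pprod G G) G snd (fun z => (expR (\sum_(k < N.+1) H (Y z k)))%:E) (mp_snd G G))//.
have mHY2 : measurable_fun setT (fun w : paths R l2 * paths R l2 => (expR (\sum_(k < N.+1) H (Y w.2 k)))%:E).
  exact: (measurableT_comp mHY measurable_snd).
apply: ge0_le_integral => //.
- by move=> w _; apply: integral_ge0.
- by apply: (@measurable_fun_fubini_tonelli_F _ _ _ _ _ G (fun w => Phi (Zr w))).
move=> u _.
pose h k : paths R Ic := fun c => u.1 (phi (k, c)).
pose g (k : nat) (x : paths R Ic) := expR `|psi (fun c => (Num.sqrt v * x c + h (inord k) c + Y u.2 (inord k) c) / 2) -
   psi (fun c => (Num.sqrt v * x c + h (inord k) c - Y u.2 (inord k) c) / 2)|.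
(* With the remainder [h] and the differences [Y] frozen, each factor depends on its own standard
   block only, and [psiH] bounds it uniformly in [h]. *)
have := @std_blocks_indep N.+1 g (fun k => expR (H (Y u.2 (inord k)))).
rewrite -expR_sum => B.
rewrite (_ : \sum_(k < N.+1) H (Y u.2 k) = \sum_(k < N.+1) H (Y u.2 (inord k))); last first.
  by apply: eq_bigr => k _; rewrite inord_val.
apply: le_trans (B _ _ _ _); last 4 first.
- move=> k; apply: measurableT_comp => //; apply: measurableT_comp => //; apply: measurable_funB.
    apply: (measurableT_comp mpsi); apply: measurable_pathsP => c.
    apply: measurable_funM => //; apply: measurable_funD => //; apply: measurable_funD => //.
    by apply: measurable_funM => //; exact: measurable_ev.
  apply: (measurableT_comp mpsi); apply: measurable_pathsP => c.
  apply: measurable_funM => //; apply: measurable_funD => //; apply: measurable_funD => //.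
  by apply: measurable_funM => //; exact: measurable_ev.
- by move=> k x; exact: expR_ge0.
- by move=> k; exact: expR_ge0.
- by move=> k; exact: psiH.
rewrite le_eqVlt; apply/orP; left; apply/eqP; apply: eq_integral => z _; congr EFin.
rewrite -expR_sum; congr expR; apply: eq_bigr => k _.
rewrite inord_val /Zr /h /Y /=; congr (`|_ - _|); congr psi; apply/funext => c.
  by rewrite expr0 mul1r.
by rewrite expr1 mulN1r.
Qed.

End decoupling.

(** * Lattice sums *)

Section weights.
Variable R : realType.
Implicit Types (p q r x : R).

Definition wt q r := (1 + r) `^ (- q).

Lemma wtE q r : 0 <= r -> wt q r = expR (- q * ln (1 + r)).
Proof. by move=> r0; rewrite /wt /powR gt_eqF// ltr_pwDl. Qed.

Lemma wt_gt0 q r : 0 <= r -> 0 < wt q r.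
Proof. by move=> r0; rewrite wtE// expR_gt0. Qed.

Lemma le_wt q r r' : 0 <= q -> 0 <= r -> r <= r' -> wt q r' <= wt q r.
Proof.
move=> q0 r0 rr'; rewrite !wtE ?(le_trans r0)// ler_expR ler_wnM2l ?oppr_le0//.
by rewrite ler_ln ?posrE ?ltr_pwDl ?(le_trans r0)// lerD2l.
Qed.

Lemma wtD p q r : 0 <= r -> wt (p + q) r = wt p r * wt q r.
Proof. by move=> r0; rewrite !wtE// -expRD; congr expR; ring. Qed.

Lemma wtM q (b : R) r : 0 <= r -> wt q r `^ b = wt (q * b) r.
Proof. by move=> r0; rewrite /wt -powRrM mulNr. Qed.

(* A constant factor in the distance costs a constant factor in the weight. *)
Lemma wt_dilate q a r r' : 0 <= q -> 0 < a -> 0 <= r -> 0 <= r' -> a * (1 + r) <= 1 + r' ->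
  wt q r' <= a `^ (- q) * wt q r.
Proof.
move=> q0 a0 r0 r'0 arr; have a1 : 0 <= 1 + r by rewrite addr_ge0.
have ar0 : 0 < a * (1 + r) by rewrite mulr_gt0// ltr_pwDl.
rewrite /wt -powRM ?(ltW a0)// !powRN lef_pV2 ?posrE ?powR_gt0 ?(lt_le_trans ar0)//.
by apply: ge0_ler_powR; rewrite ?nnegrE ?(ltW ar0) ?addr_ge0.
Qed.

Lemma continuous_wt p : continuous (fun u : R => wt p `|u|).
Proof.
move=> u; rewrite (_ : (fun u => _) = expR \o (fun u => - p * ln (1 + `|u|))); last first.
  by apply/funext => v; rewrite /= wtE.
apply: continuous_comp; last exact: continuous_expR.
apply: (@continuous_comp _ _ _ (fun v : R => 1 + `|v|) (fun y => - p * ln y)).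
  by apply: cvgD; [exact: cvg_cst|exact: norm_continuous].
by apply: cvgMl_tmp; apply: continuous_ln; rewrite ltr_pwDl.
Qed.

Lemma measurable_wt d (T : measurableType d) (f : T -> R) q : (forall y : T, 0 <= f y) ->
  measurable_fun setT f -> measurable_fun setT (fun y : T => wt q (f y)).
Proof.
move=> f0 mf; have m1 : measurable_fun setT (fun y => 1 + f y) by exact: measurable_funD.
exact: (measurableT_comp (@measurable_powR R (- q)) m1).
Qed.

Notation mu := (@lebesgue_measure R).

Lemma wt_int0 p : 1 < p -> exists2 I : R, 0 <= I &
  (\int[mu]_u (wt p `|u|)%:E <= I%:E)%E.
Proof.
move=> p1; have p10 : 0 < p - 1 by rewrite subr_gt0.
exists (2 * (p - 1)^-1); first by rewrite mulr_ge0// invr_ge0 ltW.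
rewrite ge0_symfun_integralT; last 3 first.
- by move=> x; exact/ltW/wt_gt0.
- exact: continuous_wt.
- by move=> x /=; rewrite normrN.
rewrite (_ : [set x | _] = `[0, +oo[%classic); last first.
  by apply/seteqP; split => x/=; rewrite in_itv/= andbT.
rewrite EFinM; apply: lee_pmul => //.
  by apply: integral_ge0 => x _; rewrite lee_fin; exact/ltW/wt_gt0.
pose F (x : R) := - (p - 1)^-1 * (1 + x) `^ (1 - p).
have dF x : 0 < x -> is_derive x (1 : R) F ((1 + x) `^ (- p)).
  move=> x0; have x1 : 0 < 1 + x by rewrite ltr_pwDl// ltW.
  have d1 : is_derive x (1 : R) (fun x : R => 1 + x) 1.
    by have := is_deriveD (is_derive_cst (1 : R) x (1 : R)) (is_derive_id x (1 : R)); rewrite add0r.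
  have d2 := is_derive1_powR (1 - p) x1.
  have d3 := is_derive1_comp d2 d1.
  have -> : F = (fun x => - (p - 1)^-1 *: ((powR (R:=R))^~ (1 - p) \o (fun x : R => 1 + x)) x).
    by apply/funext => y; rewrite /F.
  apply: is_derive_eq; rewrite /GRing.scale/= mulr1.
  have -> : 1 - p - 1 = - p by ring.
  by field; rewrite gt_eqF.
have Fc x : 0 <= x -> {for x, continuous F}.
  move=> x0; apply: (@continuous_comp _ _ _ (fun y : R => 1 + y) (fun y => - (p - 1)^-1 * y `^ (1 - p))).
    by apply: cvgD; [exact: cvg_cst|exact: cvg_id].
  apply: cvgMl_tmp; have x1 : 0 < 1 + x by rewrite ltr_pwDl.
  have [dp _] := is_derive1_powR (1 - p) x1.
  have c : {for 1 + x, continuous ((powR (R:=R))^~ (1 - p))}.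
    by apply/differentiable_continuous/derivable1_diffP.
  exact: c.
rewrite (@ge0_continuous_FTC2y R _ F 0 0).
- rewrite -EFinB lee_fin /F addr0 powR1 mulr1 sub0r opprK lexx//.
- by move=> x x0; exact/ltW/wt_gt0.
- by apply: continuous_subspaceT; exact: continuous_wt.
- rewrite /F -(mulr0 (- (p - 1)^-1)); apply: cvgMl_tmp.
  apply/cvgrPdist_lt => e e0; near=> x.
  have x0 : 0 <= x by near: x; exact: nbhs_pinfty_ge.
  rewrite sub0r normrN ger0_norm ?powR_ge0//.
  have ex : e `^ (- (p - 1)^-1) < 1 + x.
    have : e `^ (- (p - 1)^-1) < x by near: x; exact: nbhs_pinfty_gt.
    by move=> /lt_trans; apply; rewrite ltrDr.
  have := gt0_ltr_powR p10 _ _ ex; rewrite !nnegrE powR_ge0 addr_ge0// => /(_ isT isT).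
  rewrite -powRrM mulNr mulVf ?gt_eqF// powR_inv1 ?ltW// -(opprB p 1) powRN.
  move=> h; rewrite invf_plt ?posrE ?powR_gt0 ?ltr_pwDl//.
- by move=> x x0; have [] := dF _ x0.
- by apply: cvg_at_right_filter; exact: Fc.
- move=> x; rewrite in_itv/= andbT => x0; rewrite derive1E.
  by have [_ ->] := dF _ x0; rewrite ger0_norm ?ltW.
Unshelve. all: by end_near. Qed.

Lemma wt_int1 p : 1 < p -> exists2 I : R, 0 <= I &
  forall x, (\int[mu]_u (wt p `|x - u|)%:E <= I%:E)%E.
Proof.
move=> p1; have [I I0 hI] := wt_int0 p1; exists I; first by [].
move=> x; have mw : measurable_fun setT (fun u : measurableTypeR R => (wt p `|u|)%:E).
  apply/measurable_EFinP; apply: measurable_wt => //; exact: measurableT_comp.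
apply: le_trans hI; rewrite [leRHS](@lebesgue_affine R _ 1 (- x))//.
  rewrite mul1e le_eqVlt; apply/orP; left; apply/eqP; apply: eq_integral => u _.
  by rewrite mul1r distrC.
by move=> u; rewrite lee_fin; exact/ltW/wt_gt0.
Qed.

Notation R2 := (measurableTypeR R * measurableTypeR R)%type.

Lemma measurable_normB (x : R * R) : measurable_fun setT (fun s : R2 => `|x - s|).
Proof.
under eq_fun do rewrite prod_normE/=.
apply: measurable_maxr; apply: measurableT_comp => //; apply: measurable_funB => //.
Qed.

(** The maximum norm dominates both coordinates, so half of the exponent may be spent on each: the
    weight is below a product of two one-dimensional weights of exponent [q / 2 > 1]. *)
Lemma wt_int2 q : 2 < q -> exists2 J : R, 0 <= J &
  forall x : R * R, (\int[@leb2 R]_s (wt q `|x - s|)%:E <= J%:E)%E.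
Proof.
move=> q2; have q0 : 0 <= q / 2 by lra.
have [|I I0 hI] := @wt_int1 (q / 2); first by lra.
exists (I * I) => [|x]; first exact: mulr_ge0.
have mw (a : R) : measurable_fun setT (fun u : measurableTypeR R => (wt (q / 2) `|a - u|)%:E).
  apply/measurable_EFinP; apply: measurable_wt => //; apply: measurableT_comp => //.
  exact: measurable_funB.
have w0 (a : R) : (0 <= (wt (q / 2) `|a|)%:E)%E by rewrite lee_fin; exact/ltW/wt_gt0.
apply: (@le_trans _ _ (\int[@leb2 R]_s ((wt (q / 2) `|x.1 - s.1|)%:E * (wt (q / 2) `|x.2 - s.2|)%:E))%E).
  apply: ge0_le_integral => //.
  - by move=> s _; rewrite lee_fin; exact/ltW/wt_gt0.
  - apply/measurable_EFinP; apply: measurable_wt => //; exact: measurable_normB.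
  - by apply: emeasurable_funM; [exact: (measurableT_comp (mw _) measurable_fst)
      |exact: (measurableT_comp (mw _) measurable_snd)].
  move=> s _; rewrite -EFinM lee_fin [X in wt X](splitr q) wtD//.
  rewrite ler_pM ?(ltW (wt_gt0 _ _))//; apply: le_wt => //; rewrite prod_normE/= le_max lexx ?orbT//.
rewrite [leLHS](@fubini_tonelli1 _ _ _ _ R mu mu)//; last 2 first.
- by apply: emeasurable_funM; [exact: (measurableT_comp (mw _) measurable_fst)
      |exact: (measurableT_comp (mw _) measurable_snd)].
- by move=> s; rewrite mule_ge0.
rewrite /fubini_F/=; under eq_integral do rewrite ge0_integralZl//.
rewrite ge0_integralZr//; last by apply: integral_ge0.
by rewrite EFinM; apply: lee_pmul => //; exact: integral_ge0.
Qed.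

Definition zpt (m : int * int) : R * R := (m.1%:~R, m.2%:~R).

Definition zfloor (s : R * R) : int * int := (Num.floor s.1, Num.floor s.2).

Lemma zfloor_eq (s : R * R) m : (zfloor s == m) =
  (m.1%:~R <= s.1 < m.1%:~R + 1) && (m.2%:~R <= s.2 < m.2%:~R + 1).
Proof. by case: m => a b; rewrite /zfloor xpair_eqE !floor_eq !intrD. Qed.

Definition zcell m : set R2 := [set s | zfloor s == m].

Lemma zcellE m : zcell m = `[m.1%:~R, m.1%:~R + 1[ `*` `[m.2%:~R, m.2%:~R + 1[.
Proof.
apply/seteqP; split => s; rewrite /zcell /= zfloor_eq !in_itv/=.
  by move=> /andP[].
by move=> [-> ->].
Qed.

Lemma measurable_zcell m : measurable (zcell m).
Proof. by rewrite zcellE; apply: measurableX; exact: measurable_itv. Qed.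

Lemma leb2_zcell m : @leb2 R (zcell m) = 1%E.
Proof.
rewrite zcellE [LHS]product_measure1E; do ?exact: measurable_itv.
have E (a : R) : mu `[a, a + 1[%classic = 1%E.
  by rewrite lebesgue_measure_itv/= lte_fin ltrDl ltr01 -EFinB addrC addrA addNr add0r.
have -> : (1 = 1 * 1 :> \bar R)%E by rewrite mule1.
by congr (_ * _)%E; exact: E.
Qed.

Lemma zcell_norm m s : zcell m s -> `|s - zpt m| <= 1.
Proof.
rewrite /zcell /= zfloor_eq => /andP[/andP[a1 a2] /andP[b1 b2]].
rewrite prod_normE/= ge_max !ger0_norm ?subr_ge0// !lerBlDl.
by rewrite !(ltW a2, ltW b2).
Qed.

(** Each term is compared with the integral of the weight over the unit cell of its lattice point.
    Injectivity of [f] makes the cells disjoint, so the bound depends neither on [N] nor on [x]; the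
    power of 2 pays for moving a point within its cell. *)
Lemma lattice_sum q : 2 < q -> exists2 L : R, 0 <= L &
  forall (x : R * R) N (f : 'I_N -> int * int), injective f ->
    \sum_i wt q `|zpt (f i) - x| <= L.
Proof.
move=> q2; have [J J0 hJ] := wt_int2 q2; have q0 : 0 <= q by lra.
exists (2 `^ q * J) => [|x N f fI]; first by rewrite mulr_ge0 ?powR_ge0.
have mw : measurable_fun setT (fun s : R2 => wt q `|x - s|).
  by apply: measurable_wt => //; exact: measurable_normB.
have mi (m : int * int) : measurable_fun setT (\1_(zcell m) : R2 -> R).
  by apply: measurable_indic; exact: measurable_zcell.
rewrite -lee_fin EFinM; apply: (@le_trans _ _ ((2 `^ q)%:E *
    \int[@leb2 R]_s (wt q `|x - s|)%:E)%E); last first.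
  by apply: lee_pmul => //; rewrite ?lee_fin ?powR_ge0// integral_ge0// => s _;
    rewrite lee_fin ltW// wt_gt0.
rewrite -ge0_integralZl//; last 2 first.
- exact/measurable_EFinP.
- by move=> s _; rewrite lee_fin ltW// wt_gt0.
apply: (@le_trans _ _ (\int[@leb2 R]_s \sum_i (wt q `|zpt (f i) - x| * \1_(zcell (f i)) s)%:E)%E).
  rewrite ge0_integral_sum//; last 2 first.
  - by move=> i; apply/measurable_EFinP; exact: measurable_funM.
  - by move=> i s _; rewrite lee_fin mulr_ge0// ltW// wt_gt0.
  rewrite -sumEFin; apply: lee_sum => i _; under eq_integral do rewrite EFinM.
  rewrite ge0_integralZl//; last 2 first.
  - exact/measurable_EFinP.
  - by rewrite lee_fin ltW// wt_gt0.
  rewrite integral_indic//; last exact: measurable_zcell.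
  by rewrite setIT leb2_zcell mule1.
apply: ge0_le_integral => //.
- by move=> s _; apply: sume_ge0 => i _; rewrite lee_fin mulr_ge0// ltW// wt_gt0.
- by apply: emeasurable_sum => i; apply/measurable_EFinP; exact: measurable_funM.
- by apply/measurable_EFinP; exact: measurable_funM.
move=> s _; rewrite sumEFin -EFinM lee_fin.
have ind i : \1_(zcell (f i)) s = (zfloor s == f i)%:R :> R.
  by rewrite indicE; congr (nat_of_bool _)%:R; apply/idP/idP; rewrite inE.
under eq_bigr do rewrite ind.
have [[i fi]|nfi] := pselect (exists i, zfloor s = f i); last first.
  rewrite big1 ?mulr_ge0 ?powR_ge0 ?(ltW (wt_gt0 _ _))// => i _.
  by case: eqP => [E|]; rewrite ?mulr0//; case: nfi; exists i.
rewrite (bigD1 i)//= fi eqxx mulr1 big1 ?addr0; last first.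
  move=> j ji; rewrite (inj_eq fI) eq_sym (negbTE ji) mulr0//.
have -> : 2 `^ q = 2^-1 `^ (- q) :> R by rewrite powRN -[2^-1]powR_inv1// -powRrM mulN1r powRN invrK.
apply: wt_dilate => //.
have : `|s - zpt (f i)| <= 1 by apply: zcell_norm; rewrite /zcell /= fi.
have : `|x - s| <= `|zpt (f i) - x| + `|s - zpt (f i)|.
  by rewrite (distrC _ x) (distrC s); exact: (@ler_distD _ _ (zpt (f i)) x s).
have := normr_ge0 (zpt (f i) - x).
by move=> /=; lra.
Qed.

End weights.

(** * Decaying kernels *)

Section convexity.
Variable R : realType.

Lemma expR_tangent (a y : R) : expR a * (1 + y - a) <= expR y.
Proof. by have := expR_ge1Dx (y - a); rewrite -(ler_pM2l (expR_gt0 a)) -expRD (addrC a) subrK addrA. Qed.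

(* The tangent line at the barycenter; the missing mass sits at [0]. *)
Lemma expR_convex (I : finType) (p x : I -> R) : (forall i, 0 <= p i) -> \sum_i p i <= 1 ->
  expR (\sum_i p i * x i) <= \sum_i p i * expR (x i) + (1 - \sum_i p i).
Proof.
move=> p0 p1; set a := \sum_i p i * x i; set s := \sum_i p i in p1 *.
have tangent := expR_tangent a.
have H : expR a * (s + a - s * a) <= \sum_i p i * expR (x i).
  rewrite (_ : _ * _ = \sum_i p i * (expR a * (1 + x i - a))).
    by apply: ler_sum => i _; apply: ler_wpM2l.
  rewrite (eq_bigr (fun i => expR a * (p i + p i * x i - p i * a))).
    by rewrite -mulr_sumr sumrB big_split/= -mulr_suml.
  by move=> i _; ring.
have := tangent 0; rewrite expR0 addr0 => T0.
have : (1 - s) * (expR a * (1 - a)) <= 1 - s by rewrite ler_piMr// subr_ge0.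
lra.
Qed.

(** Jensen's inequality with the weights [w i / W] reduces the sum to single variables, whatever
    their correlations; the resulting bound depends on the total weight only. *)
Lemma gauss_weights d (T : measurableType d) (P : probability T R) (I : finType)
    (Z : I -> T -> R) (v w : I -> R) (W : R) :
  (forall i, isG P (Z i) (v i)) -> (forall i, v i <= 1) -> (forall i, 0 <= w i) ->
  0 < W -> \sum_i w i <= W ->
  (\int[P]_t (expR (\sum_i w i * `|Z i t|))%:E <= (2 * expR (W ^+ 2 / 2))%:E)%E.
Proof.
move=> GZ v1 w0 W0 wW.
have p1 : \sum_i w i / W <= 1 by rewrite -mulr_suml ler_pdivrMr// mul1r.
have p0 i : 0 <= w i / W by rewrite divr_ge0// ltW.
have mZ i : measurable_fun setT (Z i) by have [] := GZ i.
have me i : measurable_fun setT (fun t => (expR (W * `|Z i t|))%:E).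
  apply/measurable_EFinP; apply: measurableT_comp => //; apply: measurable_funM => //.
  exact: measurableT_comp.
have B0 : 1 <= 2 * expR (W ^+ 2 / 2).
  by have := expR_ge1Dx (W ^+ 2 / 2); have := sqr_ge0 W; lra.
apply: (@le_trans _ _ (\int[P]_t (\sum_i (w i / W)%:E * (expR (W * `|Z i t|))%:E + (1 - \sum_i w i / W)%:E))%E).
  apply: le_lower_integral => t; first by rewrite lee_fin expR_ge0.
  rewrite [X in (_ <= X + _)%E](eq_bigr (fun i => (w i / W * expR (W * `|Z i t|))%:E)) ?sumEFin//.
  rewrite -EFinD lee_fin (eq_bigr (fun i => w i / W * (W * `|Z i t|))); first exact: expR_convex.
  by move=> i _; rewrite mulrA divfK// gt_eqF.
have m1 i : measurable_fun setT (fun t => (w i / W)%:E * (expR (W * `|Z i t|))%:E)%E.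
  exact: measurable_funeM.
rewrite ge0_integralD//; last 3 first.
- by move=> t _; apply: sume_ge0 => i _; rewrite mule_ge0 ?lee_fin ?expR_ge0.
- exact: emeasurable_sum.
- by move=> t _; rewrite lee_fin subr_ge0.
rewrite ge0_integral_sum//; last by move=> i t _; rewrite mule_ge0 ?lee_fin ?expR_ge0.
rewrite (Ex_EFin P (@mb_cst _ _ R (1 - \sum_i w i / W))) Ex_cst.
apply: (@le_trans _ _ (\sum_i (w i / W * (2 * expR (W ^+ 2 / 2)))%:E + (1 - \sum_i w i / W)%:E)%E).
  apply: leeD => //; apply: lee_sum => i _.
  rewrite ge0_integralZl ?lee_fin//.
  rewrite [leRHS]EFinM; apply: lee_pmul => //; rewrite ?lee_fin//.
    by apply: integral_ge0 => t _; rewrite lee_fin expR_ge0.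
  apply: le_trans (isG_exp W (GZ i)) _; rewrite lee_fin ler_pM2l// ler_expR.
  by rewrite ler_pM2r// ler_piMr ?sqr_ge0.
rewrite sumEFin -EFinD lee_fin -(mulr_suml _ xpredT (fun i => w i / W)).
have : 0 <= 1 - \sum_i w i / W by rewrite subr_ge0.
by nra.
Qed.

(** Replaces the power [de] of a Gaussian sum by a linear expression, to which [gauss_weights]
    applies. *)
Lemma powR_le1D (d x : R) : 0 <= d -> d <= 1 -> 0 <= x -> x `^ d <= 1 + x.
Proof.
move=> d0 d1 x0; have [x1|x1] := leP x 1.
  rewrite (@le_trans _ _ 1) ?lerDl//.
  by have := ge0_ler_powR d0 _ _ x1; rewrite !nnegrE x0 ler01 => /(_ isT isT); rewrite powR1.
by rewrite (@le_trans _ _ x) ?lerDr// -[leRHS]powRr1//; apply: ler_powR => //; exact: ltW.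
Qed.

Lemma half_dist (a b : R) : 1 + a <= 2 * (1 + b) -> 2^-1 * (1 + a) <= 1 + b.
Proof. lra. Qed.

End convexity.

Section lattice_points.
Variable R : realType.

Definition tpt (x : R * R) (M : R) (m : int * int) : R * R :=
  (x.1 + M * m.1%:~R, x.2 + M * m.2%:~R).

Lemma tpt_norm (x c : R * R) M m : 0 < M ->
  `|tpt x M m - c| = M * `|zpt R m - ((c.1 - x.1) / M, (c.2 - x.2) / M)|.
Proof.
move=> M0; rewrite !prod_normE/= maxr_pMr ?(ltW M0)//.
have E (a b y : R) : `|y + M * a - b| = M * `|a - (b - y) / M|.
  transitivity `|M * (a - (b - y) / M)|; last by rewrite normrM gtr0_norm.
  by congr (`|_|); field; rewrite gt_eqF.
by congr (Num.max _ _); exact: E.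
Qed.

Lemma zpt_dist m m' : m != m' -> 1 <= `|zpt R m - zpt R m'|.
Proof.
have H (a b : int) : a != b -> 1 <= `|a%:~R - b%:~R : R|.
  by move=> ab; rewrite -intrB -intr_norm ler1z -gtz0_ge1 normr_gt0 subr_eq0.
case: m m' => [a b] [a' b']; rewrite xpair_eqE negb_and prod_normE/= le_max.
by case/orP => /H ->; rewrite ?orbT.
Qed.

Lemma tpt_dist (x : R * R) M m m' : 0 < M ->
  `|tpt x M m - tpt x M m'| = M * `|zpt R m - zpt R m'|.
Proof.
move=> M0; rewrite tpt_norm//; congr (_ * `|_ - _|); rewrite /tpt /zpt/=.
by congr pair; field; rewrite gt_eqF.
Qed.

End lattice_points.

(** * Exponential moments on a sparse lattice *)

Section kernel_model.
Context dS (S : measurableType dS) (R : realType).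
Variable mu : {measure set S -> \bar R}.
Notation l2 := (l2 mu).
Notation R2 := (measurableTypeR R * measurableTypeR R)%type.
Variables (Ic : finType) (c0 be v : R) (Jf : R -> R).

(* [S] carries the noise, [pos] the position of its points in the plane; the value at [t] of
   component [c] of the field is the integral of [kap c t] against the noise. *)
Record kmodel (kap : Ic -> R * R -> l2) (pos : S -> R * R) : Prop := KModel {
  km_pos : measurable_fun setT (pos : S -> R2) ;
  km_meas : forall c, measurable_fun setT (fun x : R2 * S => kap c x.1 x.2) ;
  km_bound : forall c t s, `|kap c t s| <= c0 * wt be `|t - pos s| ;
  km_int : forall q t, 2 < q -> (\int[mu]_s (wt q `|t - pos s|)%:E <= (Jf q)%:E)%E ;
  km_orth : forall c c' t (H : set R2) (mA : measurable (pos @^-1` H)), c != c' ->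
    ip (kap c t) (l2restr mA (kap c' t)) = 0 ;
  km_var : forall c t, ip (kap c t) (kap c t) = v }.

(** From a point of [Q] the noise outside [H] is as far away, up to constants, as one fixed center.
    Decay away from a point is summable over a planar lattice, decay away from a line is not; this
    is why [Q] will be a half strip ending on the line, or a sector. *)
Definition ctrl (pos : S -> R * R) (H Q : set (R * R)) := exists c, forall t s,
  Q t -> ~ H (pos s) -> 1 + `|t - c| <= 2 * (1 + `|t - pos s|).

Hypotheses (c0_ge0 : 0 <= c0) (Jf_ge0 : forall q, 0 <= Jf q).

Lemma measurable_wt_pos (pos : S -> R * R) q t : measurable_fun setT (pos : S -> R2) ->
  measurable_fun setT (fun s => (wt q `|t - pos s|)%:E).
Proof.
move=> mp; apply/measurable_EFinP; apply: measurable_wt => //.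
exact: (measurableT_comp (measurable_normB t) mp).
Qed.

Lemma ip_bound (f g : l2) (h : S -> R) (K : R) : measurable_fun setT h ->
  (forall s, `|f s * g s| <= h s) -> (\int[mu]_s (h s)%:E <= K%:E)%E -> `|ip f g| <= K.
Proof.
move=> mh fgh hK; have I := l2_prod f g; apply: le_trans (le_normr_Rintegral measurableT I) _.
have [mfg Ioo] := integrableP _ _ _ I.
rewrite -lee_fin /Rintegral fineK.
  apply: le_trans hK; apply: le_lower_integral => s; rewrite ?lee_fin//; exact: fgh.
rewrite ge0_fin_numE//; apply: integral_ge0 => s _; by rewrite lee_fin.
Qed.

Variables (e : nat -> l2) (G : probability (paths R l2) R) (psi : paths R Ic -> R) (C de : R).
Hypotheses (wG : white G) (e_on : forall i j, ip (e i) (e j) = (i == j)%:R).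
Hypotheses (v0 : 0 < v) (C0 : 0 <= C) (de0 : 0 < de) (de1 : de <= 1) (be_de : 1 + 2 / de < be).
Hypothesis mpsi : measurable_fun setT psi.
Hypothesis psiH : forall h y : paths R Ic,
  (\int[G]_z (expR `|psi (fun c => (Num.sqrt v * z (e (eidx 0 c)) + h c + y c) / 2) -
                     psi (fun c => (Num.sqrt v * z (e (eidx 0 c)) + h c - y c) / 2)|)%:E
   <= (expR (C * (\sum_c `|y c|) `^ de))%:E)%E.

Let be3 : 3 <= be.
Proof.
have : 1 <= de^-1 by rewrite invf_ge1.
have := be_de; lra.
Qed.

(** At every noise point one of the two distances is at least [|t - t'| / 2]; its weight is pulled
    out and the other weight is integrated. *)
Lemma km_ip_le kap pos c c' t t' A (mA : measurable A) : kmodel kap pos ->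
  `|ip (kap c t) (l2restr mA (kap c' t'))| <= 2 * c0 ^+ 2 * Jf be * wt be (`|t - t'| / 2).
Proof.
move=> km; have mw q x := measurable_wt_pos q x (km_pos km).
have w0 q x s : 0 <= wt q `|x - pos s| by exact/ltW/wt_gt0.
have wD0 : 0 <= wt be (`|t - t'| / 2) by apply/ltW/wt_gt0; rewrite divr_ge0.
apply: (ip_bound (h := fun s => c0 ^+ 2 * wt be (`|t - t'| / 2) *
    (wt be `|t - pos s| + wt be `|t' - pos s|))).
- apply: measurable_funM => //; apply: measurable_funD; apply/measurable_EFinP; exact: mw.
- move=> s /=; apply: (@le_trans _ _ ((c0 * wt be `|t - pos s|) * (c0 * wt be `|t' - pos s|))).
    rewrite normrM; apply: ler_pM => //; first exact: km_bound.
    rewrite normrM; apply: le_trans (km_bound km c' t' s).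
    by rewrite ler_piMr// indicE; case: (_ \in _); rewrite ?normr1 ?normr0.
  rewrite mulrACA -expr2 -mulrA; apply: ler_wpM2l; first exact: sqr_ge0.
  have [D1|D1] := leP (`|t - t'| / 2) `|t - pos s|.
    have := le_wt (ltW (lt_le_trans _ be3)) _ D1; rewrite divr_ge0//= ltr0n => /(_ isT isT).
    by have := w0 be t s; have := w0 be t' s; nra.
  have D2 : `|t - t'| / 2 <= `|t' - pos s|.
    have H : `|t - t'| <= `|t - pos s| + `|t' - pos s| by rewrite (distrC t'); exact: ler_distD.
    by move: H D1; move: `|t - t'| `|t - pos s| `|t' - pos s| => x y z; lra.
  have := le_wt (ltW (lt_le_trans _ be3)) _ D2; rewrite divr_ge0//= ltr0n => /(_ isT isT).
  by have := w0 be t s; have := w0 be t' s; nra.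
under eq_integral do rewrite EFinM EFinD.
rewrite ge0_integralZl//; last 3 first.
- by apply: emeasurable_funD; exact: mw.
- by move=> s _; rewrite -EFinD lee_fin addr_ge0.
- by rewrite lee_fin mulr_ge0// sqr_ge0.
rewrite ge0_integralD//; do ?[exact: mw|by move=> s _; rewrite lee_fin].
have b2 : 2 < be by rewrite (lt_le_trans _ be3)// ltr_nat.
apply: (@le_trans _ _ ((c0 ^+ 2 * wt be (`|t - t'| / 2))%:E * ((Jf be)%:E + (Jf be)%:E))%E).
  apply: lee_pmul => //; rewrite ?lee_fin ?mulr_ge0 ?sqr_ge0//.
    by apply: adde_ge0; apply: integral_ge0 => s _; rewrite lee_fin.
  by apply: leeD; exact: (km_int km).
by rewrite -EFinD -EFinM lee_fin; lra.
Qed.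

(** Different components at one lattice point are uncorrelated by [km_orth]; between different
    lattice points the covariances are of order [(M / 4)] to the power [- be], times a summable
    weight. A large mesh [M] brings their sum below the diagonal, which is at least [v]. The
    constant 12 is the sum 4 + 2 of the coefficients in [decQ] times the factor 2 in [km_ip_le]. *)
Lemma km_dom kap pos (H : set R2) (mA : measurable (pos @^-1` H)) (L M : R) (x : R * R) N
    (f : 'I_N.+1 -> int * int) : kmodel kap pos ->
  (forall i : 'I_N.+1, \sum_j wt be `|zpt R (f j) - zpt R (f i)| <= L) -> injective f ->
  4 <= M -> 12 * c0 ^+ 2 * Jf be * #|Ic|%:R * L <= v * (M / 4) ->
  forall i, \sum_(j | j != i)
    `|decQ mA v (fun p : 'I_N.+1 * Ic => kap p.2 (tpt x M (f p.1))) i j| <=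
    decQ mA v (fun p : 'I_N.+1 * Ic => kap p.2 (tpt x M (f p.1))) i i.
Proof.
move=> km hL fI M4 hM [k c]; set Q := decQ mA v _.
have M0 : 0 < M by rewrite (lt_le_trans _ M4).
pose K := 12 * c0 ^+ 2 * Jf be * (M / 4) `^ (- be).
have K0 : 0 <= K by rewrite !mulr_ge0 ?powR_ge0 ?sqr_ge0.
have off j : j != (k, c) -> `|Q (k, c) j| <= K * wt be `|zpt R (f j.1) - zpt R (f k)|.
  case: j => [k' c'] /= jkc; rewrite /Q /decQ/= eq_sym (negbTE jkc) mulr0 subr0.
  have [kk|kk] := eqVneq k' k.
    subst k'; have cc : c != c' by apply: contra jkc => /eqP ->.
    have o1 := km_orth km (tpt x M (f k)) mA cc.
    have o2 := km_orth (H := ~` H) km (tpt x M (f k)) (measurableC mA) cc.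
    by rewrite o1 o2 !mulr0 addr0 normr0; apply: mulr_ge0 => //; exact/ltW/wt_gt0.
  set t := tpt x M (f k); set t' := tpt x M (f k').
  have b1 := km_ip_le c c' t t' mA km.
  have b2 := km_ip_le c c' t t' (measurableC mA) km.
  have w1 : wt be (`|t - t'| / 2) <= (M / 4) `^ (- be) * wt be `|zpt R (f k') - zpt R (f k)|.
    have fk : f k' != f k by apply: contra kk => /eqP/fI ->.
    have := zpt_dist R fk; rewrite /t /t' distrC tpt_dist//.
    move: `|zpt R (f k') - zpt R (f k)| => n n1.
    apply: wt_dilate; rewrite ?divr_ge0 ?mulr_ge0 ?divr_gt0 ?(ltW M0)//; do ?lra.
      by rewrite (le_trans _ be3).
    by nra.
  apply: (le_trans (ler_normD _ _)); rewrite !normrM !normr_nat /K.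
  set k0 := 2 * c0 ^+ 2 * Jf be in b1 b2.
  have k00 : 0 <= k0 by rewrite !mulr_ge0 ?sqr_ge0.
  rewrite -[leRHS]mulrA (_ : 12 * _ * _ = 6 * k0); last by rewrite /k0; ring.
  by have := ler_wpM2l k00 w1; move: b1 b2; lra.
(* The parts of the variance on [A] and off [A] are nonnegative and add up to [v], so with the
   coefficients 4 and 2 they give at least [2 * v]. *)
have dia : v <= Q (k, c) (k, c).
  rewrite /Q /decQ/= eqxx mulr1; set t := tpt _ _ _.
  have := km_var km c t; rewrite (ip_split mA).
  have : 0 <= ip (kap c t) (l2restr mA (kap c t)) by rewrite -ip_restr2 ip_ge0.
  by lra.
apply: le_trans dia; apply: (le_trans (ler_sum _ off)).
apply: (@le_trans _ _ (\sum_(j : 'I_N.+1 * Ic) K * wt be `|zpt R (f j.1) - zpt R (f k)|)).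
  by rewrite [leRHS](bigID (fun j => j != (k, c)))/= lerDl sumr_ge0// => j _;
    rewrite mulr_ge0// ltW// wt_gt0.
rewrite -(pair_bigA _ (fun a b => K * wt be `|zpt R (f a) - zpt R (f k)|))/=.
rewrite (eq_bigr (fun a => K * #|Ic|%:R * wt be `|zpt R (f a) - zpt R (f k)|)); last first.
  by move=> a _; rewrite sumr_const -[LHS]mulr_natr; ring.
rewrite -mulr_sumr; apply: (@le_trans _ _ (K * #|Ic|%:R * L)).
  by apply: ler_wpM2l => //; rewrite mulr_ge0.
have M1 : (M / 4) `^ (- be) <= (M / 4)^-1.
  rewrite powRN lef_pV2 ?posrE ?powR_gt0 ?divr_gt0//.
  have m1 : 1 <= M / 4 by rewrite ler_pdivlMr// mul1r.
  rewrite -[leLHS]powRr1 ?divr_ge0 ?(ltW M0)//; apply: ler_powR => //.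
  by apply: le_trans be3; rewrite ler1n.
have M40 : 0 < M / 4 by rewrite divr_gt0.
have L0 : 0 <= L by apply: le_trans (hL k); apply: sumr_ge0 => j _; rewrite ltW// wt_gt0.
have T0 : 0 <= 12 * c0 ^+ 2 * Jf be * #|Ic|%:R * L by rewrite !mulr_ge0 ?sqr_ge0.
have := ler_wpM2l T0 M1.
have : 12 * c0 ^+ 2 * Jf be * #|Ic|%:R * L * (M / 4)^-1 <= v by rewrite ler_pdivrMr.
have -> : K * #|Ic|%:R * L = 12 * c0 ^+ 2 * Jf be * #|Ic|%:R * L * (M / 4) `^ (- be) by rewrite /K; ring.
by move=> a /le_trans; apply.
Qed.

(** The squared kernel has exponent [2 * be]. The part [ga] of it is converted into decay from the
    center [x], while [q > 2] is kept to make the integral over the noise finite. *)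
Lemma km_outer kap pos (H Q : set (R * R)) A (mA : measurable A) ga q c :
  kmodel kap pos -> A = pos @^-1` H -> 0 <= ga -> 2 < q -> 2 * be = q + ga ->
  forall x, (forall t s, Q t -> ~ H (pos s) -> 1 + `|t - x| <= 2 * (1 + `|t - pos s|)) ->
  forall t, Q t -> ip (l2restr (measurableC mA) (kap c t)) (l2restr (measurableC mA) (kap c t)) <=
    c0 ^+ 2 * Jf q * 2^-1 `^ (- ga) * wt ga `|t - x|.
Proof.
move=> km AH ga0 q2 bE x hx t Qt; set g := l2restr _ _.
have w0 q' s : 0 <= wt q' `|t - pos s| by exact/ltW/wt_gt0.
pose K := c0 ^+ 2 * 2^-1 `^ (- ga) * wt ga `|t - x|.
have K0 : 0 <= K by rewrite !mulr_ge0 ?sqr_ge0 ?powR_ge0 ?(ltW (wt_gt0 _ _)).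
apply: (le_trans (ler_norm _)); apply: (ip_bound (h := fun s => K * wt q `|t - pos s|)).
- by apply: measurable_funM => //; apply/measurable_EFinP; exact: (measurable_wt_pos q t (km_pos km)).
- move=> s; rewrite /g/= indicE; case: (boolP (s \in ~` A)) => sA; last first.
    by rewrite mulr0 mulr0 normr0 mulr_ge0.
  rewrite mulr1 -expr2 normrX.
  have Hs : ~ H (pos s) by move: sA; rewrite inE/= AH.
  have W := @wt_dilate R ga 2^-1 `|t - x| `|t - pos s| ga0.
  have {}W : wt ga `|t - pos s| <= 2^-1 `^ (- ga) * wt ga `|t - x|.
    by apply: W => //; exact: half_dist (hx t s Qt Hs).
  apply: (@le_trans _ _ ((c0 * wt be `|t - pos s|) ^+ 2)).
    by apply: lerXn2r; rewrite ?nnegrE ?mulr_ge0//; exact: (km_bound km).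
  have -> : (c0 * wt be `|t - pos s|) ^+ 2 = c0 ^+ 2 * (wt ga `|t - pos s| * wt q `|t - pos s|).
    by rewrite exprMn expr2 expr2 -!wtD// (addrC ga) -bE; congr (_ * wt _ _); ring.
  have -> : K * wt q `|t - pos s| = c0 ^+ 2 * (2^-1 `^ (- ga) * wt ga `|t - x| * wt q `|t - pos s|).
    by rewrite /K !mulrA.
  by apply: ler_wpM2l; [exact: sqr_ge0|apply: ler_wpM2r].
under eq_integral do rewrite EFinM; rewrite ge0_integralZl//; last 2 first.
- exact: (measurable_wt_pos q t (km_pos km)).
- by move=> s _; rewrite lee_fin.
rewrite (_ : c0 ^+ 2 * _ * _ * _ = K * Jf q); last by rewrite /K; ring.
rewrite [leRHS]EFinM; apply: lee_pmul => //; rewrite ?lee_fin//.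
  by apply: integral_ge0 => s _; rewrite lee_fin.
exact: (km_int km).
Qed.

(** [B] and [M] depend on the constants of the model only, not on the kernel, the glued region or
    the translate of the lattice. The averaging over translates and the passage to shifted and
    swapped kernels both rely on this uniformity. *)
Lemma km_finite : exists B M : R, [/\ 1 <= B, 1 <= M &
  forall kap pos (H Q : set R2) (mA : measurable (pos @^-1` H)), kmodel kap pos -> ctrl pos H Q ->
  forall x N (f : 'I_N.+1 -> int * int), injective f -> (forall i, Q (tpt x M (f i))) ->
  (\int[pprod G G]_w (expR (\sum_(k < N.+1)
     `|psi (fun c => w.1 (kap c (tpt x M (f k)))) -
       psi (fun c => gl mA w (kap c (tpt x M (f k))))|))%:E <= B%:E)%E].
Proof.
have b2 : 2 < be by rewrite (lt_le_trans _ be3)// ltr_nat.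
have [L L0 hL] := lattice_sum b2.
(* The slack [ep] is divided so that [2 * be] is the sum of [q], which makes the noise integral
   finite, and [ga], which gives standard deviations of order [wt (ga / 2)]. Their powers [de] are
   summable over the lattice as [ga / 2 * de > 2]. *)
pose ep := be - (1 + 2 / de); have ep0 : 0 < ep by rewrite subr_gt0.
pose q := 2 + ep; pose ga := 4 / de + ep.
have q2 : 2 < q by rewrite ltrDl.
have bE : 2 * be = q + ga by rewrite /q /ga /ep; field; rewrite gt_eqF.
have ga0 : 0 <= ga by rewrite addr_ge0 ?divr_ge0 ?ltW.
have ga2 : 2 < ga / 2 * de.
  rewrite (_ : ga / 2 * de = 2 + ep * de / 2); first by rewrite ltrDl divr_gt0// mulr_gt0.
  by rewrite /ga; field; rewrite gt_eqF.
have [L2 L20 hL2] := lattice_sum ga2.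
pose T := 12 * c0 ^+ 2 * Jf be * #|Ic|%:R * L.
have T0 : 0 <= T by rewrite !mulr_ge0 ?sqr_ge0.
(* Chosen so that [v * (M / 4) = v + T], the sparsity asked for by [km_dom]. *)
pose M := 4 * (1 + T / v).
have M4 : 4 <= M by rewrite ler_peMr// lerDl divr_ge0// ltW.
have M1 : 1 <= M by apply: le_trans M4; rewrite ler1n.
have M0 : 0 < M by apply: lt_le_trans M1.
have hM : T <= v * (M / 4).
  rewrite (_ : v * (M / 4) = v + T); first by rewrite lerDr ltW.
  by rewrite /M; field; rewrite gt_eqF.
pose K2 := 2 * (c0 ^+ 2 * Jf q * 2^-1 `^ (- ga)).
have K20 : 0 <= K2 by rewrite !mulr_ge0 ?powR_ge0 ?sqr_ge0.
(* A convenient upper bound of the square root of [K2]; with it, [tau] below dominates the standard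
   deviations of the differences. *)
pose K := 1 + K2; have K0 : 0 < K by rewrite ltr_pwDl.
have KK : K2 <= K ^+ 2 by rewrite /K; have := sqr_ge0 K2; nra.
(* After each power is linearized by [powR_le1D], the constant terms contribute at most [TT] to the
   exponent, and [W] bounds the total weight of the Gaussian terms normalized by [tau]. *)
pose TT := C * K `^ de * L2.
have TT0 : 0 <= TT by rewrite !mulr_ge0 ?powR_ge0.
pose W := 1 + #|Ic|%:R * TT; have W0 : 0 < W by rewrite ltr_pwDl// mulr_ge0.
exists (expR TT * (2 * expR (W ^+ 2 / 2))), M; split => //.
  have := expR_ge1Dx TT; have := expR_ge1Dx (W ^+ 2 / 2); have := sqr_ge0 W.
  move: (expR TT) (expR _) => a b; nra.
move=> kap pos H Q mA km [ctr hctr] x N f fI fQ.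
pose kp (p : 'I_N.+1 * Ic) := kap p.2 (tpt x M (f p.1)).
have dom := km_dom mA x km (fun i => hL _ _ _ fI) fI M4 hM.
have mH : measurable_fun setT (fun y : paths R Ic => C * (\sum_c `|y c|) `^ de).
  apply: measurable_funM => //; apply: (measurableT_comp (@measurable_powR R de)).
  by apply: measurable_sum => c; apply: measurableT_comp => //; exact: measurable_ev.
apply: (le_trans (@decoupling _ _ _ mu G e Ic wG e_on _ mA v N kp (ltW v0) dom psi _ mpsi mH psiH)).
pose rho (k : 'I_N.+1) := `|tpt x M (f k) - ctr|.
pose tau k := K * wt (ga / 2) (rho k).
have tau0 k : 0 < tau k by rewrite mulr_gt0// wt_gt0// /rho.
pose g (p : 'I_N.+1 * Ic) := l2restr (measurableC mA) (kp p).
pose Z (p : 'I_N.+1 * Ic) (z : paths R l2) := Num.sqrt 2 / tau p.1 * z (g p).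
pose w (p : 'I_N.+1 * Ic) := C * tau p.1 `^ de.
have w0 p : 0 <= w p by rewrite mulr_ge0// powR_ge0.
have GZ p : isG G (Z p) ((Num.sqrt 2 / tau p.1) ^+ 2 * ip (g p) (g p)).
  apply: (eq_isG (wG [:: (Num.sqrt 2 / tau p.1, g p)])).
    by move=> z; rewrite /linform big_seq1.
  by rewrite l2lin11; ring.
have Z1 p : (Num.sqrt 2 / tau p.1) ^+ 2 * ip (g p) (g p) <= 1.
  rewrite expr_div_n sqr_sqrtr// mulrAC ler_pdivrMr ?exprn_gt0// mul1r.
  apply: (@le_trans _ _ (K2 * wt ga (rho p.1))).
    rewrite /K2 -mulrA ler_pM2l//; apply: (@km_outer kap pos H Q _ mA ga q p.2 km erefl) => //.
  have -> : tau p.1 ^+ 2 = K ^+ 2 * wt ga (rho p.1).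
    by rewrite /tau exprMn; congr (_ * _); rewrite [in RHS](splitr ga) wtD ?expr2 /rho.
  by apply: ler_wpM2r => //; apply: ltW; apply: wt_gt0; rewrite /rho.
have wT : \sum_(k < N.+1) C * tau k `^ de <= TT.
  rewrite -mulr_sumr /TT -mulrA; apply: ler_wpM2l => //.
  rewrite (eq_bigr (fun k => K `^ de * wt (ga / 2 * de) (rho k))); last first.
    move=> k _; have r0 : 0 <= rho k by rewrite /rho.
    by rewrite /tau powRM ?(ltW K0) ?(ltW (wt_gt0 _ r0))// wtM.
  rewrite -mulr_sumr; apply: ler_wpM2l; first exact: powR_ge0.
  apply: le_trans (hL2 ((ctr.1 - x.1) / M, (ctr.2 - x.2) / M) _ f fI).
  apply: ler_sum => k _; apply: le_wt => //; first by rewrite ltW// (lt_trans _ ga2).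
  by rewrite /rho tpt_norm// ler_peMl.
have wW : \sum_p w p <= W.
  rewrite -(pair_bigA _ (fun k c => w (k, c)))/= /w/=.
  under eq_bigr do rewrite sumr_const -[_ *+ _]mulr_natl.
  by rewrite -mulr_sumr (le_trans (ler_wpM2l _ wT))// lerDr.
apply: (@le_trans _ _ (\int[G]_z ((expR TT)%:E * (expR (\sum_p w p * `|Z p z|))%:E))%E).
  apply: le_lower_integral => z; first by rewrite lee_fin expR_ge0.
  rewrite -EFinM lee_fin -expRD ler_expR.
  apply: (@le_trans _ _ (\sum_(k < N.+1) C * tau k `^ de * (1 + \sum_c `|Z (k, c) z|))).
    apply: ler_sum => k _; rewrite -mulrA; apply: ler_wpM2l => //.
    have -> : \sum_c `|Num.sqrt 2 * z (l2restr (measurableC mA) (kp (k, c)))| =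
        tau k * \sum_c `|Z (k, c) z|.
      rewrite mulr_sumr; apply: eq_bigr => c _.
      transitivity `|tau k * Z (k, c) z|; last by rewrite normrM gtr0_norm.
      by congr (`|_|); rewrite /Z /g /= mulrA mulrCA divff ?mulr1// gt_eqF.
    rewrite powRM ?(ltW (tau0 k)) ?sumr_ge0//; apply: ler_wpM2l; first exact: powR_ge0.
    by apply: powR_le1D; rewrite ?(ltW de0) ?sumr_ge0.
  under eq_bigr do rewrite mulrDr mulr1 mulr_sumr.
  by rewrite big_split/= pair_bigA/= lerD.
have mZ : measurable_fun setT (fun z => (expR (\sum_p w p * `|Z p z|))%:E).
  apply/measurable_EFinP; apply: measurableT_comp => //; apply: measurable_sum => p.
  by apply: measurable_funM => //; apply: measurableT_comp => //; have [] := GZ p.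
rewrite ge0_integralZl ?lee_fin ?expR_ge0//.
rewrite EFinM; apply: lee_pmul => //; rewrite ?lee_fin ?expR_ge0//.
  by apply: integral_ge0 => z _; rewrite lee_fin expR_ge0.
exact: (gauss_weights GZ Z1 w0 W0 wW).
Qed.

End kernel_model.

(** * Convexity of the exponential on the extended reals *)

Section extended_exponential.
Context d (T : measurableType d) (R : realType).
Implicit Types (f : T -> \bar R) (x y : \bar R).

Lemma expeR_sup (A : set (\bar R)) y : A !=set0 -> (forall a, A a -> expeR a <= y)%E ->
  (expeR (ereal_sup A) <= y)%E.
Proof.
move=> [a Aa] Ay; have y0 : (0 <= y)%E := le_trans (expeR_ge0 a) (Ay _ Aa).
have Ey : expeR (lne y) = y by apply/eqP; rewrite lneK_eq.
rewrite -Ey lee_expeR; apply: ge_ereal_sup => b Ab.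
by rewrite -lee_expeR Ey; exact: Ay.
Qed.

Lemma measurable_expeR f : measurable_fun setT f -> (forall t, 0 <= f t)%E ->
  measurable_fun setT (fun t => expeR (f t)).
Proof.
move=> mf f0.
have mU : measurable [set t | f t = +oo%E].
  rewrite -[X in measurable X]setTI; apply: measurable_eqe => //; exact: measurable_cst.
rewrite (_ : (fun t => _) = fun t => if t \in [set t | f t = +oo%E] then +oo%E else (expR (fine (f t)))%:E); last first.
  apply/funext => t; case: ifPn => [|/negP]; rewrite inE/=; first by move=> ->.
  by case: (f t) (f0 t).
apply: measurable_fun_ifT.
  apply: (measurable_fun_bool true); rewrite setTI (_ : _ @^-1` _ = [set t | f t = +oo%E])//.
  by apply/seteqP; split => t; [move=> /set_mem|move=> /mem_set E; exact: E].
  exact: measurable_cst.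
apply/measurable_EFinP; apply: measurableT_comp => //; by apply: measurableT_comp.
Qed.

(** The tangent to the exponential at the mean [a] is integrated over a set of mass 1. An infinite
    mean makes the right-hand side infinite, as [expeR] dominates the identity. *)
Lemma expeR_jensen (mu : {measure set T -> \bar R}) (D : set T) f :
  measurable D -> mu D = 1%E -> measurable_fun setT f -> (forall t, 0 <= f t)%E ->
  (expeR (\int[mu]_(t in D) f t) <= \int[mu]_(t in D) expeR (f t))%E.
Proof.
move=> mD D1 mf f0.
have If0 : (0 <= \int[mu]_(t in D) f t)%E by exact: integral_ge0.
have mfD : measurable_fun D f by exact: measurable_funTS.
have meD : measurable_fun D (fun t => expeR (f t)) by apply: measurable_funTS; exact: measurable_expeR.
have [Ioo|Ifin] := eqVneq (\int[mu]_(t in D) f t)%E +oo%E.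
  rewrite Ioo/= -Ioo; apply: ge0_le_integral => // t _; apply: le_trans (expeR_ge1Dx (f t)).
  by rewrite leeDr.
have [a aE] : exists a, (\int[mu]_(t in D) f t = a%:E)%E.
  by exists (fine (\int[mu]_(t in D) f t)%E); rewrite fineK// ge0_fin_numE// lt_neqAle Ifin leey.
have a0 : 0 <= a by rewrite -lee_fin -aE.
have ea := expR_gt0 a.
have cD (c : R) : (\int[mu]_(t in D) c%:E = c%:E)%E by rewrite integral_cst// D1 mule1.
rewrite aE /=.
(* The negative term of the tangent is moved to the other side, so that only nonnegative functions
   are integrated. *)
have H : ((expR a + expR a * a)%:E <= \int[mu]_(t in D) expeR (f t) + (a * expR a)%:E)%E.
  apply: (@le_trans _ _ (\int[mu]_(t in D) ((expR a)%:E + (expR a)%:E * f t))%E).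
    rewrite ge0_integralD//; last 2 first.
    - by move=> t _; rewrite mule_ge0// lee_fin ltW.
    - exact: measurable_funeM.
    have -> : (\int[mu]_(t in D) ((expR a)%:E * f t) = (expR a)%:E * a%:E)%E.
      by rewrite ge0_integralZl// ?aE// lee_fin ltW.
    by rewrite cD -EFinM -EFinD.
  apply: (@le_trans _ _ (\int[mu]_(t in D) (expeR (f t) + (a * expR a)%:E))%E).
    apply: ge0_le_integral => //.
    - by move=> t _; apply: adde_ge0; rewrite ?mule_ge0 ?lee_fin// ltW.
    - by apply: emeasurable_funD => //; exact: measurable_funeM.
    - exact: emeasurable_funD.
    move=> t _; case: (f t) (f0 t) => [x x0|_|//].
      rewrite -EFinM -EFinD/= lee_fin.
      by have := expR_tangent a x; move: (expR x) (expR a) => y b; lra.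
    by rewrite mulry gtr0_sg// mul1e /= addye// addey.
  rewrite ge0_integralD//; do ?[by move=> t _; exact: expeR_ge0|by move=> t _; rewrite lee_fin mulr_ge0// ltW].
  by rewrite cD.
move: H; rewrite EFinD mulrC leeD2rE//.
Qed.

(** Convexity between 0 and [x]. It trades the size of a moment for a factor in the exponent: a
    moment bounded by [B] gives, with [theta = B^-1], the bound [2 - B^-1]. *)
Lemma expeR_interp (theta : R) x : 0 < theta -> theta <= 1 -> (0 <= x)%E ->
  (expeR (theta%:E * x) <= (1 - theta)%:E + theta%:E * expeR x)%E.
Proof.
move=> t0 t1; case: x => [x x0|_|//]; last first.
  have ty : (theta%:E * +oo = +oo :> \bar R)%E by rewrite gt0_muley ?lte_fin.
  by rewrite [expeR +oo]/= ty addey.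
rewrite -!EFinM -EFinD lee_fin.
have := @expR_convex R unit (fun=> theta) (fun=> x) (fun=> ltW t0).
rewrite !big_const card_unit/= !addr0 => /(_ t1); lra.
Qed.

Lemma integral_expeR_series (mu : {measure set T -> \bar R}) (u : nat -> T -> \bar R) (B : R) :
  (forall n, measurable_fun setT (u n)) -> (forall n t, 0 <= u n t)%E ->
  (forall N, \int[mu]_t expeR (\sum_(0 <= n < N) u n t) <= B%:E)%E ->
  (\int[mu]_t expeR (\sum_(0 <= n <oo) u n t) <= B%:E)%E.
Proof.
move=> mu' u0 uB.
pose F N t := expeR (\sum_(0 <= n < N) u n t).
have s0 N t : (0 <= \sum_(0 <= n < N) u n t)%E by exact: sume_ge0.
have nds t : {homo (fun N => \sum_(0 <= n < N) u n t)%E : n m / (n <= m)%N >-> (n <= m)%E}.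
  by move=> n m nm; apply: lee_sum_nneg_natr.
have ndF t : {homo F^~ t : n m / (n <= m)%N >-> (n <= m)%E}.
  by move=> n m nm; rewrite /F lee_expeR; exact: nds.
have mF N : measurable_fun setT (F N).
  by apply: measurable_expeR => //; exact: emeasurable_sum.
apply: (@le_trans _ _ (\int[mu]_t limn (F^~ t))%E).
  apply: le_lower_integral => t; first exact: expeR_ge0.
  have -> : limn (F^~ t) = ereal_sup (range (F^~ t)).
    by apply/cvg_lim => //; exact: ereal_nondecreasing_cvgn.
  have -> : (\sum_(0 <= n <oo) u n t)%E = ereal_sup (range (fun N => \sum_(0 <= n < N) u n t)%E).
    by apply/cvg_lim => //; exact: ereal_nondecreasing_cvgn.
  apply: expeR_sup; first by exists (\sum_(0 <= n < 0) u n t)%E, 0%N.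
  by move=> _ [N _ <-]; apply: ereal_sup_ubound; exists N.
rewrite monotone_convergence//; last by move=> n t _; exact: expeR_ge0.
apply: lime_le; last by apply: nearW => N; exact: uB.
apply: ereal_nondecreasing_is_cvgn => n m nm; apply: le_lower_integral => t; first exact: expeR_ge0.
exact: ndF.
Qed.

End extended_exponential.

(** Applied to the indicator of a null set, the change of variables shows that its preimage is
    null. *)
Lemma ae_pullback d (T : measurableType d) (R : realType) (mu : {measure set T -> \bar R})
    (h : T -> T) (c : R) (A : T -> Prop) : measurable_fun setT h -> 0 < c ->
  (forall f : T -> \bar R, measurable_fun setT f -> (forall x, 0 <= f x)%E ->
     (\int[mu]_x f x = c%:E * \int[mu]_x f (h x))%E) ->
  {ae mu, forall x, A x} -> {ae mu, forall x, A (h x)}.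
Proof.
move=> mh c0 hE [N [mN N0 AN]].
have mhN : measurable (h @^-1` N) by rewrite -[X in measurable X]setTI; exact: mh.
exists (h @^-1` N); split; [exact: mhN| |by move=> x Ax; exact: AN].
have mI : measurable_fun setT (fun x => (\1_N x : R)%:E).
  by apply/measurable_EFinP; exact: measurable_indic.
have I0 x : (0 <= (\1_N x : R)%:E)%E by rewrite lee_fin.
have := hE _ mI I0; rewrite (integral_indic mu measurableT mN) setIT [X in X = _]N0.
have := integral_indic mu measurableT mhN; rewrite setIT => <- /esym/eqP.
by rewrite mule_eq0 => /orP[/eqP[/eqP]|/eqP//]; rewrite gt_eqF.
Qed.

(** * Planar Lebesgue measure as an average over lattices *)

Section planar_lebesgue.
Variable R : realType.
Notation mu := (@lebesgue_measure R).
Notation R2 := (measurableTypeR R * measurableTypeR R)%type.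

(** The measure [leb2] again, under a name to which sigma-finiteness is attached. *)
Definition lam2_fun : set R2 -> \bar R := @leb2 R.

HB.instance Definition _ := Measure.copy lam2_fun (@leb2 R).

Lemma lam2_sigma_finite : sigma_finite setT lam2_fun.
Proof.
have /sigma_finiteP[F [TF ndF Foo]] := sigma_finiteT (@lebesgue_measure R).
exists (fun n => F n `*` F n).
  rewrite -setXTT TF predeqE => -[x y]; split; last by move=> [n _ []/= ? ?]; split; exists n.
  move=> [/= [n _ Fnx] [k _ Fky]]; exists (maxn n k) => //; split.
  - by move: x Fnx; exact/subsetPset/ndF/leq_maxl.
  - by move: y Fky; exact/subsetPset/ndF/leq_maxr.
move=> k; have [mF oo] := Foo k; split; first exact: measurableX.
by rewrite [ltLHS]product_measure1E// lte_mul_pinfty// ge0_fin_numE.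
Qed.

HB.instance Definition _ := Measure_isSigmaFinite.Build _ _ _ lam2_fun lam2_sigma_finite.

Definition lam2 : {sigma_finite_measure set R2 -> \bar R} := lam2_fun.

Lemma measurable_affine (a : R) (b : R * R) :
  measurable_fun setT (fun s : R2 => (a * s.1 + b.1, a * s.2 + b.2) : R2).
Proof.
by apply: measurable_fun_pair; apply: measurable_funD => //; apply: measurable_funM.
Qed.

Lemma leb2_affine (f : R2 -> \bar R) (a : R) (b : R * R) : 0 < a ->
  measurable_fun setT f -> (forall x, 0 <= f x)%E ->
  (\int[@leb2 R]_s f s = (a * a)%:E * \int[@leb2 R]_s f (a * s.1 + b.1, a * s.2 + b.2)%R)%E.
Proof.
move=> a0 mf f0.
have mfa := measurableT_comp mf (measurable_affine a b).
have mF : measurable_fun setT (fun x : measurableTypeR R => \int[mu]_y f (x, y))%E.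
  exact: (@measurable_fun_fubini_tonelli_F _ _ _ _ R mu f).
have F0 x : (0 <= \int[mu]_y f (x, y))%E by exact: integral_ge0.
have fx x : measurable_fun setT (fun y : measurableTypeR R => f (x, y)).
  exact: (measurableT_comp mf (measurable_pair1 x)).
rewrite [LHS](@fubini_tonelli1 _ _ _ _ R mu mu f mf f0) /fubini_F.
rewrite [X in (_ * X)%E](@fubini_tonelli1 _ _ _ _ R mu mu _ mfa (fun s => f0 _)) /fubini_F.
rewrite (lebesgue_affine b.1 a0 mF F0) EFinM -muleA; congr (_ * _)%E.
under eq_integral => x _ do rewrite (@lebesgue_affine R _ a b.2 a0 (fx _))//.
rewrite ge0_integralZl ?lee_fin ?ltW//.
  exact: (@measurable_fun_fubini_tonelli_F _ _ _ _ R mu (fun s => f (a * s.1 + b.1, a * s.2 + b.2))).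
by move=> x _; exact: integral_ge0.
Qed.

Lemma leb2_swap (f : R2 -> \bar R) : measurable_fun setT f -> (forall x, 0 <= f x)%E ->
  (\int[@leb2 R]_s f s = \int[@leb2 R]_s f (s.2, s.1))%E.
Proof.
move=> mf f0; have ms : measurable_fun setT (fun s : R2 => (s.2, s.1) : R2).
  by apply: measurable_fun_pair.
rewrite [LHS](@fubini_tonelli1 _ _ _ _ R mu mu)//.
by rewrite [RHS](@fubini_tonelli2 _ _ _ _ R mu mu)//; exact: (measurableT_comp mf ms).
Qed.

Lemma ae_affine (P : set R2) (a : R) (b : R * R) : 0 < a ->
  {ae @leb2 R, forall t, P t} -> {ae @leb2 R, forall t, P (a * t.1 + b.1, a * t.2 + b.2)}.
Proof.
move=> a0; have m := measurable_affine a b.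
exact: (ae_pullback m (mulr_gt0 a0 a0) (fun f mf f0 => leb2_affine b a0 mf f0)).
Qed.

Definition zenum (n : nat) : option (int * int) := pickle_inv n.

Lemma zcell_shift m (u : R2) : \1_(zcell m) (1 * u.1 + (zpt R m).1, 1 * u.2 + (zpt R m).2) =
  \1_(zcell (0, 0)) u :> R.
Proof.
rewrite !indicE; congr (nat_of_bool _)%:R; apply/idP/idP; rewrite !inE /zcell/= !zfloor_eq/=; lra.
Qed.

Lemma leb2_periodize (f : R2 -> \bar R) (M : R) : 0 < M ->
  measurable_fun setT f -> (forall x, 0 <= f x)%E ->
  (\int[@leb2 R]_t f t = (M * M)%:E * \int[@leb2 R]_(u in zcell (0, 0)%R) \sum_(0 <= n <oo)
     if zenum n is Some m then f (tpt (M * u.1, M * u.2) M m)%R else 0)%E.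
Proof.
move=> M0 mf f0; rewrite (@leb2_affine f M (0, 0))//; congr (_ * _)%E.
pose fM (s : R2) := f (M * s.1 + 0, M * s.2 + 0).
have mfM : measurable_fun setT fM by exact: (measurableT_comp mf (measurable_affine M (0, 0))).
have fM0 s : (0 <= fM s)%E by exact: f0.
pose F n (s : R2) := if zenum n is Some m then (fM s * (\1_(zcell m) s)%:E)%E else 0%E.
have mc m : measurable_fun setT (fun s : R2 => (\1_(zcell m) s)%:E).
  by apply/measurable_EFinP; apply: measurable_indic; exact: measurable_zcell.
have mF n : measurable_fun setT (F n).
  by rewrite /F; case: zenum => [m|]; [exact: emeasurable_funM|exact: measurable_cst].
have F0 n s : (0 <= F n s)%E.
  by rewrite /F; case: zenum => [m|//]; rewrite mule_ge0// lee_fin.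
transitivity (\int[@leb2 R]_s \sum_(0 <= n <oo) F n s)%E.
  apply: eq_integral => s _; rewrite (@nneseriesD1 _ _ (pickle (zfloor s)) xpredT)//.
  rewrite eseries0 ?adde0.
    by rewrite /F /zenum pickleK_inv indicE mem_set ?mule1// /zcell/=.
  move=> n _ /= nz; rewrite /F; case E: zenum => [m|//].
  rewrite indicE memNset ?mule0// /zcell/= => /eqP zm.
  have := @pickle_invK (int * int)%type n; rewrite /zenum in E; rewrite E/= => nE.
  by move: nz; rewrite zm nE eqxx.
rewrite integral_nneseries//.
have m0 := @measurable_zcell R (0, 0).
have mt m : measurable_fun setT (fun u : R2 => f (tpt (M * u.1, M * u.2) M m)).
  rewrite (_ : (fun u => _) = fun u : R2 => f (M * u.1 + M * m.1%:~R, M * u.2 + M * m.2%:~R))//.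
  exact: (measurableT_comp mf (measurable_affine M (_, _))).
rewrite integral_nneseries; last 3 first.
- exact: m0.
- by move=> n; case: zenum => [m|]; [apply: measurable_funTS|exact: measurable_cst].
- by move=> n u _; case: zenum.
apply: eq_eseriesr => n _; rewrite /F; case: zenum => [m|]; last by rewrite !integral0.
rewrite (@leb2_affine _ 1 (zpt R m))//; last 2 first.
- exact: emeasurable_funM.
- by move=> s; rewrite mule_ge0// lee_fin.
rewrite mulr1 mul1e [RHS]integral_mkcond; apply: eq_integral => u _.
rewrite epatch_indic/= zcell_shift; congr (f _ * _)%E.
by rewrite /tpt /= !mul1r !addr0 !mulrDr.
Qed.

End planar_lebesgue.

Section lower_integral_ae.
Import HBNNSimple.

(** Each simple function below [f] is cut off on the exceptional null set; this brings it below [g]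
    and leaves its integral unchanged. It is applied to integrands that are only Lebesgue
    measurable. *)
Lemma le_lower_integral_ae d (T : measurableType d) (R : realType)
    (mu : {measure set T -> \bar R}) (f g : T -> \bar R) :
  (forall x, 0 <= f x)%E -> (forall x, 0 <= g x)%E ->
  {ae mu, forall x, (f x <= g x)%E} -> (\int[mu]_x f x <= \int[mu]_x g x)%E.
Proof.
move=> f0 g0 [N [mN N0 fgN]]; rewrite [leLHS]ge0_integralTE//.
apply: ge_ereal_sup => _ [h hf <-]; rewrite -integralT_nnsfun.
have mh : measurable_fun setT (fun x => (h x)%:E) by exact/measurable_EFinP.
have mhN : measurable_fun setT (fun x => (h x * \1_(~` N) x)%:E).
  apply/measurable_EFinP; apply: measurable_funM => //; apply: measurable_indic; exact: measurableC.
rewrite (@ae_eq_integral _ _ _ mu setT (fun x => (h x * \1_(~` N) x)%:E) (fun x => (h x)%:E))//.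
  apply: le_lower_integral => x; first by rewrite lee_fin mulr_ge0.
  rewrite indicE; case: (boolP (x \in _)) => [|_]; last by rewrite mulr0.
  rewrite inE => Nx; rewrite mulr1; apply: le_trans (hf x) _.
  by apply: contrapT => fg; apply: Nx; exact: fgN.
exists N; split => // x /= H; apply: contrapT => Nx; apply: H => _.
by rewrite indicE mem_set ?mulr1.
Qed.

End lower_integral_ae.

Lemma ae_imp d (T : measurableType d) (R : realType) (mu : {measure set T -> \bar R}) (A B : T -> Prop) :
  (forall x, A x -> B x) -> {ae mu, forall x, A x} -> {ae mu, forall x, B x}.
Proof. by move=> AB; apply: filterS. Qed.

Lemma mp_ae d (T : measurableType d) d' (T' : measurableType d') (R : realType)
    (P : probability T R) (Q : probability T' R) (h : T -> T') (A : T' -> Prop) :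
  mp P Q h -> {ae Q, forall y, A y} -> {ae P, forall x, A (h x)}.
Proof.
move=> [mh hE] [N [mN N0 AN]]; exists (h @^-1` N); split.
- by rewrite -[X in measurable X]setTI; exact: mh.
- by rewrite hE.
- by move=> x Ax; exact: AN.
Qed.

(** * From lattice sums to integrals over the plane *)

Section kernel_field.
Context dS (S : measurableType dS) (R : realType).
Variable mu : {measure set S -> \bar R}.
Notation l2 := (l2 mu).
Notation R2 := (measurableTypeR R * measurableTypeR R)%type.
Variables (Ic : finType) (c0 be v : R) (Jf : R -> R).
Variables (e : nat -> l2) (G : probability (paths R l2) R) (psi : paths R Ic -> R) (C de : R).
Hypotheses (c0_ge0 : 0 <= c0) (Jf_ge0 : forall q, 0 <= Jf q).
Hypotheses (wG : white G) (e_on : forall i j, ip (e i) (e j) = (i == j)%:R).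
Hypotheses (v0 : 0 < v) (C0 : 0 <= C) (de0 : 0 < de) (de1 : de <= 1) (be_de : 1 + 2 / de < be).
Hypothesis mpsi : measurable_fun setT psi.
Hypothesis psiH : forall h y : paths R Ic,
  (\int[G]_z (expR `|psi (fun c => (Num.sqrt v * z (e (eidx 0 c)) + h c + y c) / 2) -
                     psi (fun c => (Num.sqrt v * z (e (eidx 0 c)) + h c - y c) / 2)|)%:E
   <= (expR (C * (\sum_c `|y c|) `^ de))%:E)%E.

Definition version (kap : Ic -> R * R -> l2) (Gt : Ic -> paths R l2 * R2 -> R) :=
  forall c, measurable_fun setT (Gt c) /\
    {ae @leb2 R, forall t, {ae G, forall z, Gt c (z, t) = z (kap c t)}}.

Definition fld (Gt : Ic -> paths R l2 * R2 -> R) (z : paths R l2) (t : R2) : R :=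
  psi (fun c => Gt c (z, t)).

Lemma measurable_fld kap Gt : version kap Gt ->
  measurable_fun setT (fun x : paths R l2 * R2 => fld Gt x.1 x.2).
Proof.
move=> vG; apply: (measurableT_comp mpsi); apply: measurable_pathsP => c.
have := (vG c).1; rewrite (_ : Gt c = fun x => Gt c (x.1, x.2))//.
by apply/funext => -[].
Qed.

Definition glue_diff (Gt : Ic -> paths R l2 * R2 -> R) (A : set S) (mA : measurable A)
    (w : paths R l2 * paths R l2) (t : R2) : R :=
  `|fld Gt w.1 t - fld Gt (gl mA w) t|.

Lemma measurable_glue_diff kap Gt (A : set S) (mA : measurable A) : version kap Gt ->
  measurable_fun setT (fun x : (paths R l2 * paths R l2) * R2 => glue_diff Gt mA x.1 x.2).
Proof.
move=> vG; have mf := measurable_fld vG.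
have [mg _] := mp_gl wG mA.
apply: measurableT_comp => //; apply: measurable_funB.
  have h : measurable_fun setT (fun x : (paths R l2 * paths R l2) * R2 => (x.1.1, x.2)).
    by apply: measurable_fun_pair => //; exact: (measurableT_comp measurable_fst measurable_fst).
  exact: (measurableT_comp mf h).
have h : measurable_fun setT (fun x : (paths R l2 * paths R l2) * R2 => (gl mA x.1, x.2)).
  by apply: measurable_fun_pair => //; exact: (measurableT_comp mg measurable_fst).
exact: (measurableT_comp mf h).
Qed.

Lemma km_finite_seq B M kap pos (H Q : set R2) (mA : measurable (pos @^-1` H)) Gt ms x :
  1 <= B ->
  (forall N (f : 'I_N.+1 -> int * int), injective f -> (forall i, Q (tpt x M (f i))) ->
  (\int[pprod G G]_w (expR (\sum_(k < N.+1)
     `|psi (fun c => w.1 (kap c (tpt x M (f k)))) -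
       psi (fun c => gl mA w (kap c (tpt x M (f k))))|))%:E <= B%:E)%E) ->
  (forall m c, m \in ms -> {ae G, forall z, Gt c (z, tpt x M m) = z (kap c (tpt x M m))}) ->
  uniq ms -> (forall m, m \in ms -> Q (tpt x M m)) ->
  (\int[pprod G G]_w (expR (\sum_(m <- ms) glue_diff Gt mA w (tpt x M m)))%:E <= B%:E)%E.
Proof.
move=> B1 hB GtE ums msQ; case E : (size ms) => [|N].
  rewrite (size0nil E); under eq_integral do rewrite big_nil expR0.
  by rewrite (Ex_EFin (pprod G G) (@mb_cst _ _ R 1)) Ex_cst lee_fin.
pose f (i : 'I_N.+1) := nth (0, 0) ms i.
have fin (i : 'I_N.+1) : f i \in ms by apply: mem_nth; rewrite E.
have fI : injective f.
  by move=> i j /eqP; rewrite nth_uniq ?E// => /eqP/val_inj.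
apply: le_trans (hB N f fI (fun i => msQ _ (fin i))).
have aeE : {ae pprod G G, forall w, forall (k : 'I_N.+1) c,
    Gt c (w.1, tpt x M (f k)) = w.1 (kap c (tpt x M (f k))) /\
    Gt c (gl mA w, tpt x M (f k)) = gl mA w (kap c (tpt x M (f k)))}.
  apply: filter_forall => k; apply: filter_forall => c; apply: filterI.
    exact: (mp_ae (mp_fst G G) (GtE _ c (fin k))).
  exact: (mp_ae (mp_gl wG mA) (GtE _ c (fin k))).
apply: le_lower_integral_ae => [w|w|]; try by rewrite lee_fin expR_ge0.
apply: ae_imp aeE => w wE; rewrite lee_fin ler_expR (big_nth (0, 0)) E big_mkord.
apply: ler_sum => k _; rewrite /glue_diff /fld le_eqVlt; apply/orP; left; apply/eqP.
congr (`|psi _ - psi _|); apply/funext => c; first exact: (wE k c).1.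
exact: (wE k c).2.
Qed.

(** In the factor [B^-1 / (M * M)], the denominator cancels the area of a lattice cell, and [B^-1]
    brings the moment [B] of [km_finite] below 2 by [expeR_interp]. Jensen's inequality on the unit
    cell is applied for each fixed [w], and Tonelli then lets [w] be integrated first. *)
Lemma glue_diff_bound : exists2 ep : R, 0 < ep &
  forall kap pos (H Q : set R2) (mA : measurable (pos @^-1` H)) Gt,
    kmodel c0 be v Jf kap pos -> ctrl pos H Q -> measurable Q -> version kap Gt ->
  (\int[pprod G G]_w expeR (ep%:E * \int[@leb2 R]_(t in Q) (glue_diff Gt mA w t)%:E) <= 2%:E)%E.
Proof.
have [B [M [B1 M1 hB]]] := km_finite c0_ge0 Jf_ge0 wG e_on v0 C0 de0 de1 be_de mpsi psiH.
have M0 : 0 < M by apply: lt_le_trans M1.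
have B0 : 0 < B by apply: lt_le_trans B1.
exists (B^-1 / (M * M)); first by rewrite divr_gt0 ?invr_gt0// mulr_gt0.
move=> kap pos H Q mA Gt km cQ mQ vG.
have mD := measurable_glue_diff mA vG; set D := glue_diff Gt mA in mD *.
have mind : measurable_fun setT (\1_Q : R2 -> R) by exact: measurable_indic.
pose u n (s : R2) (w : paths R l2 * paths R l2) : \bar R :=
  if zenum n is Some m then
    (D w (tpt (M * s.1, M * s.2) M m) * \1_Q (tpt (M * s.1, M * s.2) M m))%:E else 0%E.
have u0 n s w : (0 <= u n s w)%E.
  by rewrite /u; case: zenum => // m; rewrite lee_fin mulr_ge0// /D /glue_diff.
have mt m : measurable_fun setT (fun s : R2 => tpt (M * s.1, M * s.2) M m : R2).
  exact: (measurable_affine M (_, _)).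
have mu2 n : measurable_fun setT (fun x : R2 * (paths R l2 * paths R l2) => u n x.1 x.2).
  rewrite /u; case: zenum => [m|]; last exact: measurable_cst.
  apply/measurable_EFinP; apply: measurable_funM.
    have h : measurable_fun setT (fun x : R2 * (paths R l2 * paths R l2) =>
        (x.2, tpt (M * x.1.1, M * x.1.2) M m : R2)).
      by apply: measurable_fun_pair => //; exact: (measurableT_comp (mt m) measurable_fst).
    exact: (measurableT_comp mD h).
  exact: (measurableT_comp mind (measurableT_comp (mt m) measurable_fst)).
pose h s w := (\sum_(0 <= n <oo) u n s w)%E.
have h0 s w : (0 <= h s w)%E by exact: nneseries_ge0.
have mh : measurable_fun setT (fun x : R2 * (paths R l2 * paths R l2) => h x.1 x.2).
  by apply: ge0_emeasurable_sum.
have mDw w : measurable_fun setT (fun t : R2 => (D w t * \1_Q t)%:E).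
  apply/measurable_EFinP; apply: measurable_funM => //.
  exact: (measurableT_comp mD (measurable_pair1 w)).
pose z0 := @zcell R (0, 0).
have mz0 : measurable z0 by exact: measurable_zcell.
have mhw w : measurable_fun setT (h ^~ w).
  exact: (measurableT_comp mh (measurable_pair2 w)).
have mhs s : measurable_fun setT (h s).
  exact: (measurableT_comp mh (measurable_pair1 s)).
have inner w : ((B^-1 / (M * M))%:E * \int[@leb2 R]_(t in Q) (D w t)%:E =
    B^-1%:E * \int[@leb2 R]_(s in z0) h s w)%E.
  rewrite integral_mkcond epatch_indic; under eq_integral do rewrite -EFinM.
  rewrite (@leb2_periodize R _ M)//; last first.
    by move=> t; rewrite lee_fin mulr_ge0// /D /glue_diff.
  by rewrite muleA -EFinM divfK// gt_eqF// mulr_gt0.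
under eq_integral do rewrite inner.
have Bi : 0 < B^-1 by rewrite invr_gt0.
have Bi1 : B^-1 <= 1 by rewrite invf_le1.
pose K (x : R2 * (paths R l2 * paths R l2)) := (expeR (h x.1 x.2) * (\1_z0 x.1)%:E)%E.
have mK : measurable_fun setT K.
  apply: emeasurable_funM; first exact: measurable_expeR.
  by apply/measurable_EFinP; exact: (measurableT_comp (measurable_indic mz0) measurable_fst).
have K0 x : (0 <= K x)%E by rewrite mule_ge0 ?expeR_ge0// lee_fin.
apply: (@le_trans _ _ (\int[pprod G G]_w ((1 - B^-1)%:E + B^-1%:E * \int[@leb2 R]_s K (s, w)))%E).
  apply: le_lower_integral => w; first exact: expeR_ge0.
  apply: le_trans (expeR_interp Bi Bi1 _) _; first exact: integral_ge0.
  apply: leeD => //; apply: lee_pmul => //; rewrite ?lee_fin ?(ltW Bi) ?expeR_ge0//.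
  apply: le_trans (expeR_jensen mz0 (leb2_zcell R _) (mhw w) (fun s => h0 s w)) _.
  by rewrite integral_mkcond epatch_indic.
have mKi : measurable_fun setT (fun w => \int[@leb2 R]_s K (s, w))%E.
  exact: (@measurable_fun_fubini_tonelli_G _ _ _ _ R (lam2 R) K).
have Ki0 w : (0 <= \int[@leb2 R]_s K (s, w))%E by exact: integral_ge0.
rewrite ge0_integralD//; last 3 first.
- by move=> w _; rewrite lee_fin subr_ge0.
- by move=> w _; rewrite mule_ge0// lee_fin ltW.
- exact: measurable_funeM.
rewrite (Ex_EFin (pprod G G) (@mb_cst _ _ R (1 - B^-1))) Ex_cst ge0_integralZl ?lee_fin ?(ltW Bi)//.
rewrite -(@fubini_tonelli _ _ _ _ R (lam2 R) (pprod G G) K)//.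
have KB : (\int[lam2 R]_s \int[pprod G G]_w K (s, w) <= \int[lam2 R]_s (B%:E * (\1_z0 s)%:E))%E.
  apply: le_lower_integral_ae.
  - by move=> s; exact: integral_ge0.
  - by move=> s; rewrite mule_ge0 ?lee_fin ?(ltW B0).
  (* For almost every translate [s], the version agrees with the noise at all points of the lattice
     at once, because the lattice is countable. *)
  have aeG : {ae lam2 R, forall s, forall n c, if zenum n is Some m then
      {ae G, forall z, Gt c (z, tpt (M * s.1, M * s.2) M m) =
        z (kap c (tpt (M * s.1, M * s.2) M m))} else True}.
    apply: ae_foralln => n; apply: filter_forall => c.
    case: zenum => [m|]; last exact: nearW.
    exact: (ae_affine (M * m.1%:~R, M * m.2%:~R) M0 (vG c).2).
  apply: ae_imp aeG => s Gs; rewrite /K/=.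
  under eq_integral do rewrite muleC.
  rewrite ge0_integralZl ?lee_fin//; do ?[by move=> w _; exact: expeR_ge0|by apply: measurable_expeR].
  rewrite muleC; apply: lee_pmul => //; first by apply: integral_ge0 => w _; exact: expeR_ge0.
  apply: integral_expeR_series => //.
    by move=> n; exact: (measurableT_comp (mu2 n) (measurable_pair1 s)).
  move=> N; pose t m : R2 := tpt (M * s.1, M * s.2) M m.
  (* The lattice points in [Q] with code below [N]. They are distinct, as [pickle] inverts [zenum]
     on its domain, so [km_finite_seq] applies. *)
  pose ms := [seq m <- pmap zenum (iota 0 N) | t m \in Q].
  have ums : uniq ms.
    by apply: filter_uniq; apply: (pmap_uniq (g := pickle)); [exact: pickle_invK|exact: iota_uniq].
  have msQ m : m \in ms -> Q (t m) by rewrite mem_filter => /andP[]; rewrite inE.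
  have msG m c : m \in ms -> {ae G, forall z, Gt c (z, t m) = z (kap c (t m))}.
    rewrite mem_filter mem_pmap => /andP[_] /mapP[n _ En].
    by have := Gs n c; rewrite -En.
  have uE w : (\sum_(0 <= n < N) u n s w = (\sum_(m <- ms) D w (t m))%:E)%E.
    rewrite /ms big_filter [in RHS]big_mkcond [in RHS]big_pmap /index_iota subn0 -sumEFin.
    apply: eq_bigr => n _; rewrite /u; case: zenum => [m|//] /=.
    by rewrite indicE -/(t m); case: ifP => _; rewrite ?mulr1 ?mulr0.
  under eq_integral do rewrite uE/=.
  exact: (km_finite_seq B1 (hB kap pos H Q mA km cQ _) msG ums msQ).
apply: (@le_trans _ _ ((1 - B^-1)%:E + B^-1%:E * B%:E)%E).
  apply: leeD => //; apply: lee_pmul => //; rewrite ?lee_fin ?(ltW Bi)//.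
    by apply: integral_ge0 => s _; exact: integral_ge0.
  apply: le_trans KB _; rewrite ge0_integralZl ?lee_fin ?(ltW B0)//; last first.
    by apply/measurable_EFinP; exact: measurable_indic.
  by rewrite integral_indic// setIT [X in (_ * X)%E]leb2_zcell mule1.
by rewrite -EFinM -EFinD lee_fin mulVf ?gt_eqF//; lra.
Qed.

End kernel_field.

(** * Random fields with densities *)

Section densities.
Variable R : realType.
Notation R2 := (measurableTypeR R * measurableTypeR R)%type.
Notation leb := (@leb2 R).

Lemma bb_measurable (B : set R2) : bounded_borel (B : set (R * R)) -> measurable B.
Proof. by move=> [mB _]; exact: mB. Qed.

Lemma int_mk (D : set R2) (f : R2 -> \bar R) :
  (\int[leb]_(t in D) f t = \int[leb]_t (f t * (\1_D t)%:E))%E.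
Proof. by rewrite integral_mkcond epatch_indic. Qed.

Definition lint (h : R2 -> R) : Prop := measurable_fun setT h /\
  forall B, bounded_borel B -> (\int[leb]_(t in B) `|(h t)%:E| < +oo)%E.

(** All random fields below have densities. Fixing a Borel representative [h] lets shifts, swaps,
    restrictions and leaks be computed on functions. *)
Definition dens (nu : lfsm R) (h : R2 -> R) : Prop := lint h /\
  forall B, bounded_borel B -> ((nu B)%:E = \int[leb]_(t in B) (h t)%:E)%E.

Lemma lint_integrable h (B : set R2) : lint h -> bounded_borel B -> leb.-integrable B (EFin \o h).
Proof.
move=> [mh Bh] bB; apply/integrableP; split; last exact: Bh.
by apply/measurable_EFinP; exact: measurable_funTS.
Qed.

Lemma lintD h k : lint h -> lint k -> lint (fun t => h t + k t).
Proof.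
move=> lh lk; split => [|B bB]; first by apply: measurable_funD; [exact: lh.1|exact: lk.1].
have mB := bb_measurable bB.
have := integrableD mB (lint_integrable lh bB) (lint_integrable lk bB).
by move=> /integrableP[].
Qed.

Lemma lintZ c h : lint h -> lint (fun t => c * h t).
Proof.
move=> lh; split => [|B bB]; first by apply: measurable_funM => //; exact: lh.1.
have mB := bb_measurable bB.
by have /integrableP[] := integrableZl mB c (lint_integrable lh bB).
Qed.

Lemma dens_ext nu h k : (forall t, h t = k t) -> dens nu h -> dens nu k.
Proof. by move=> /funext ->. Qed.

Lemma dens_unique nu nu' h : dens nu h -> dens nu' h -> nu = nu'.
Proof.
move=> [_ H] [_ H']; apply: lfsmP => A; have [bA|nbA] := pselect (bounded_borel A).
  by have := H A bA; rewrite -H'// => -[].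
by rewrite !lf_out.
Qed.

Lemma dens_add nu nu' h k : dens nu h -> dens nu' k -> dens (lf_add nu nu') (fun t => h t + k t).
Proof.
move=> [lh H] [lk K]; split => [|B bB]; first exact: lintD.
rewrite -[lf_add _ _ B]/(nu B + nu' B) EFinD H// K//.
under [RHS]eq_integral do rewrite EFinD.
by rewrite integralD//; [exact: bb_measurable bB|exact: lint_integrable|exact: lint_integrable].
Qed.

Lemma dens_scale c nu h : dens nu h -> dens (lf_scale c nu) (fun t => c * h t).
Proof.
move=> [lh H]; split => [|B bB]; first exact: lintZ.
rewrite -[lf_scale _ _ B]/(c * nu B) EFinM H//.
under [RHS]eq_integral do rewrite EFinM.
by rewrite integralZl//; [exact: bb_measurable bB|exact: lint_integrable].
Qed.

Lemma lint_restr (D : set R2) h : measurable D -> lint h -> lint (fun t => h t * \1_D t).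
Proof.
move=> mD [mh lh]; split => [|B bB].
  by apply: measurable_funM => //; exact: measurable_indic.
apply: le_lt_trans (lh B bB); rewrite !(int_mk B); apply: le_lower_integral => t.
  by rewrite mule_ge0// lee_fin.
rewrite -!EFinM lee_fin ler_wpM2r// normrM ler_piMr// ger0_norm// indicE.
Qed.

Lemma dens_restr (D : set R2) nu h : measurable D -> dens nu h -> dens (lf_restr D nu) (fun t => h t * \1_D t).
Proof.
move=> mD [lh H]; split => [|B bB]; first exact: lint_restr.
rewrite lf_restrE// H; last exact: bounded_borelI.
rewrite (int_mk B) (int_mk (B `&` D)); apply: eq_integral => t _; rewrite -!EFinM indicI; congr EFin.
by rewrite /= mulrA [in RHS]mulrAC.
Qed.

Lemma measurable_halfplane : measurable ([set p | p.1 < 0] : set R2) /\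
  measurable ([set p | 0 <= p.1] : set R2).
Proof.
have m1 : measurable_fun setT (fun p : R2 => p.1) by exact: measurable_fst.
split; rewrite -[X in measurable X]setTI.
- by rewrite -[[set p | _]](_ : (fun p : R2 => p.1) @^-1` `]-oo, 0[ = _);
    [exact: m1|apply/seteqP; split=> p /=; rewrite in_itv].
- by rewrite -[[set p | _]](_ : (fun p : R2 => p.1) @^-1` `[0, +oo[ = _);
    [exact: m1|apply/seteqP; split=> p /=; rewrite in_itv/= andbT].
Qed.

Lemma dens_leak n0 nm np h0 hm hp : dens n0 h0 -> dens nm hm -> dens np hp ->
  dens (lf_leak n0 nm np) (fun t => (if t.1 < 0 then hm t else hp t) - h0 t).
Proof.
move=> d0 dm dp; have [mneg mpos] := measurable_halfplane.
have dmm := dens_restr mneg (dens_add dm (dens_scale (-1) d0)).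
have dpp := dens_restr mpos (dens_add dp (dens_scale (-1) d0)).
apply: dens_ext (dens_add dmm dpp) => t; rewrite !indicE !mulN1r.
case: (boolP (t.1 < 0)) => t0.
  by rewrite mem_set// memNset ?mulr0 ?addr0 ?mulr1//=; apply/negP; rewrite -ltNge.
by rewrite memNset ?mem_set ?mulr0 ?add0r ?mulr1//=; [rewrite leNgt|exact/negP].
Qed.

Lemma measurable_shift2 (b : R * R) : measurable_fun setT (fun s : R2 => (s.1 + b.1, s.2 + b.2) : R2).
Proof.
rewrite (_ : (fun s => _) = fun s : R2 => (1 * s.1 + b.1, 1 * s.2 + b.2)); last first.
  by apply/funext => s; rewrite !mul1r.
exact: measurable_affine.
Qed.

Lemma measurable_swap2 : measurable_fun setT (fun s : R2 => (s.2, s.1) : R2).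
Proof. exact: measurable_fun_pair. Qed.

Lemma leb2_shift (f : R2 -> \bar R) (b : R * R) :
  measurable_fun setT f -> (forall x, 0 <= f x)%E ->
  (\int[leb]_s f s = \int[leb]_s f (s.1 + b.1, s.2 + b.2)%R)%E.
Proof.
move=> mf f0; rewrite (@leb2_affine R f 1 b)// mulr1 mul1e.
by apply: eq_integral => s _; rewrite !mul1r.
Qed.

Lemma dens_image f g (fg : bounded_bimeasurable f g) nu h : dens nu h ->
  measurable_fun setT (g : R2 -> R2) ->
  (forall k : R2 -> \bar R, measurable_fun setT k -> (forall x, 0 <= k x)%E ->
     (\int[leb]_s k s = \int[leb]_s k (g s))%E) ->
  dens (lf_image fg nu) (fun t => h (g t)).
Proof.
move=> [[mh lh] H] mg inv; have [fK gK bf bg] := fg.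
have mhg : measurable_fun setT (fun t => h (g t)) by exact: (measurableT_comp mh mg).
have inv' (B : set R2) (k : R2 -> \bar R) : measurable B -> measurable (f @^-1` B : set R2) ->
    measurable_fun setT k -> (forall x, 0 <= k x)%E ->
    (\int[leb]_(s in f @^-1` B) k s = \int[leb]_(s in B) k (g s))%E.
  move=> mB mfB mk k0; rewrite (int_mk B) (int_mk (f @^-1` B)) inv; last 2 first.
  - apply: emeasurable_funM => //; apply/measurable_EFinP; exact: measurable_indic.
  - by move=> x; rewrite mule_ge0// lee_fin.
  apply: eq_integral => s _; rewrite !indicE; congr (_ * _%:R%:E)%E.
  by congr nat_of_bool; apply/idP/idP; rewrite !inE/= gK.
split; [split => // B bB|move=> B bB].
  rewrite -(inv' B (fun s => `|(h s)%:E|)%E (bb_measurable bB) (bb_measurable (bf _ bB)))//; first exact: lh (bf _ bB).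
  by apply: measurableT_comp => //; exact/measurable_EFinP.
rewrite -[lf_image _ _ _]/(nu (f @^-1` B)) H; last exact: bf.
have mh' : measurable_fun setT (fun s => (h s)%:E) by exact/measurable_EFinP.
have inv2 (g0 : \bar R -> \bar R) : measurable_fun setT (fun s => g0 (h s)%:E) ->
    (forall x, 0 <= g0 x)%E ->
    (\int[leb]_(s in f @^-1` B) g0 (h s)%:E = \int[leb]_(s in B) g0 (h (g s))%:E)%E.
  move=> mg0 g00; apply: (inv' B (fun s => g0 (h s)%:E) (bb_measurable bB) (bb_measurable (bf _ bB)) mg0).
  by move=> x; exact: g00.
rewrite integralE [RHS]integralE; congr (_ - _)%E.
  under eq_integral do rewrite funeposE; under [RHS]eq_integral do rewrite funeposE.
  apply: (inv2 (fun x => maxe x 0)%E); last by move=> x; rewrite le_max lexx orbT.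
  exact: measurable_maxe.
under eq_integral do rewrite funenegE; under [RHS]eq_integral do rewrite funenegE.
apply: (inv2 (fun x => maxe (- x) 0)%E); last by move=> x; rewrite le_max lexx orbT.
by apply: measurable_maxe => //; exact: measurableT_comp.
Qed.

Lemma dens_shift r nu h : dens nu h -> dens (lf_shift r nu) (fun t => h (t.1 + r, t.2)).
Proof.
move=> dh; apply: (dens_image (bounded_bimeasurable_shift r) dh).
  have := measurable_shift2 (r, 0).
  by congr measurable_fun; apply/funext => s /=; rewrite addr0.
move=> k mk k0; rewrite (leb2_shift (r, 0) mk k0).
by apply: eq_integral => s _; rewrite /= addr0.
Qed.

Lemma dens_swap nu h : dens nu h -> dens (lf_swap nu) (fun t => h (t.2, t.1)).
Proof.
move=> dh; apply: (dens_image (bounded_bimeasurable_swap R) dh); first exact: measurable_swap2.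
exact: leb2_swap.
Qed.

Lemma dens_variation (nu : lfsm R) (h : R2 -> R) (D : set R2) : dens nu h -> measurable D ->
  (Defs.variation nu D <= \int[leb]_(t in D) `|(h t)%:E|)%E.
Proof.
move=> [[mh lh] H] mD; apply: ge_ereal_sup => _ [n [F [bF tF ->]]].
have mah : measurable_fun setT (fun t => `|(h t)%:E|%E).
  by apply: measurableT_comp => //; exact/measurable_EFinP.
have mi i : measurable_fun setT (fun t : R2 => (\1_(F i) t)%:E).
  by apply/measurable_EFinP; apply: measurable_indic; exact: (bb_measurable (bF i).1).
apply: (@le_trans _ _ (\sum_(i < n) \int[leb]_(t in F i) `|(h t)%:E|)%E).
  rewrite -sumEFin; apply: lee_sum => i _; have [bFi _] := bF i.
  rewrite -abse_EFin H//; apply: le_abse_integral; first exact: (bb_measurable bFi).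
  by apply/measurable_EFinP; exact: measurable_funTS.
under eq_bigr => i _ do rewrite (int_mk (F i)).
rewrite -(@ge0_integral_sum _ _ R leb setT measurableT 'I_n
  (fun i t => (`|(h t)%:E| * (\1_(F i) t)%:E)%E)); last 2 first.
- by move=> i; exact: emeasurable_funM.
- by move=> i t _; rewrite mule_ge0// lee_fin.
rewrite (int_mk D); apply: le_lower_integral => t.
  by apply: sume_ge0 => i _; rewrite mule_ge0// lee_fin.
have [[i Fi]|nF] := pselect (exists i, F i t); last first.
  rewrite big1 ?mule_ge0 ?lee_fin// => i _; rewrite indicE memNset ?mule0// => Fi.
  by apply: nF; exists i.
rewrite (bigD1 i)//= big1 ?adde0.
  have Dt : D t by exact: (bF i).2.
  by rewrite !indicE mem_set// mem_set.
move=> j ji; rewrite indicE memNset ?mule0// => Fj.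
by move: ji; rewrite (tF j i I I) ?eqxx//; exists t.
Qed.

Definition box n : set R2 := [set t | `|t| <= n%:R].

Lemma box_borel n : bounded_borel (box n).
Proof.
split; last by apply/bounded_setP; exists n%:R.
have m : measurable_fun setT (fun s : R2 => `|(0 : R * R) - s|) by exact: measurable_normB.
rewrite -[X in measurable X]setTI (_ : box n = (fun s : R2 => `|(0 : R * R) - s|) @^-1` `]-oo, n%:R]).
  by apply: m => //; exact: measurable_itv.
by apply/seteqP; split => s; rewrite /box /= in_itv/= sub0r normrN.
Qed.

(** Boxes of integer size exhaust the bounded sets. Local integrability thereby becomes a countable
    condition, hence a measurable event in [measurable_lint]. *)
Lemma lintP (h : R2 -> R) : measurable_fun setT h ->
  (forall n, \int[leb]_(t in box n) `|(h t)%:E| < +oo)%E -> lint h.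
Proof.
move=> mh hn; split => // B bB; have [_ /bounded_setP[M BM]] := bB.
pose n := (Num.truncn M).+1.
apply: le_lt_trans (hn n); apply: ge0_subset_integral => //.
- exact: bb_measurable bB.
- exact: bb_measurable (box_borel n).
- by apply: measurableT_comp => //; apply: measurable_funTS; exact/measurable_EFinP.
move=> t Bt; rewrite /box/=; apply: (le_trans (BM t Bt)); apply: ltW.
exact: Num.Theory.truncnS_gt.
Qed.

Section construction.
Variable h : R2 -> R.
Hypotheses (lh : lint h) (h0 : forall t, 0 <= h t).

Definition lfp_fun (B : set (R * R)) : R :=
  if `[< bounded_borel B >] then fine (\int[leb]_(t in B) (h t)%:E)%E else 0.

Lemma lfp_fin B : bounded_borel B -> (\int[leb]_(t in B) (h t)%:E)%E \is a fin_num.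
Proof.
move=> bB; rewrite -integral_fin_num_abs; [exact: lh.2|exact: bb_measurable bB|].
by apply: measurable_funTS; exact: lh.1.
Qed.

Lemma lfp_funE B : bounded_borel B -> ((lfp_fun B)%:E = \int[leb]_(t in B) (h t)%:E)%E.
Proof. by move=> bB; rewrite /lfp_fun asboolT// fineK// lfp_fin. Qed.

Lemma lfp_out B : ~ bounded_borel B -> lfp_fun B = 0.
Proof. by move=> nB; rewrite /lfp_fun asboolF. Qed.

Lemma lfp_sigma_additive (F : nat -> set (R * R)) : (forall k, bounded_borel (F k)) ->
  trivIset setT F -> bounded_borel (\bigcup_k F k) ->
  (fun n => \sum_(k < n) lfp_fun (F k)) @ \oo --> lfp_fun (\bigcup_k F k).
Proof.
move=> bF tF bU; have mh : measurable_fun setT (fun t => (h t)%:E) by apply/measurable_EFinP; exact: lh.1.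
have UE : (\int[leb]_(t in \bigcup_k F k) (h t)%:E = \sum_(0 <= k <oo) \int[leb]_(t in F k) (h t)%:E)%E.
  apply: ge0_integral_bigcup => //; first by move=> k; exact: bb_measurable (bF k).
    exact: measurable_funTS.
  by move=> t _; rewrite lee_fin.
have -> : lfp_fun (\bigcup_k F k) = fine (lfp_fun (\bigcup_k F k))%:E by [].
rewrite lfp_funE//.
rewrite (_ : (fun n => _) = fine \o (fun n => \sum_(0 <= k < n) \int[leb]_(t in F k) (h t)%:E)%E).
  apply: fine_cvg; rewrite fineK ?lfp_fin// UE; apply: is_cvg_nneseries => n _ _.
  by apply: integral_ge0 => t _; rewrite lee_fin.
apply/funext => n; rewrite /comp big_mkord.
have -> : (\sum_(k < n) \int[leb]_(t in F k) (h t)%:E = (\sum_(k < n) lfp_fun (F k))%:E)%E.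
  by rewrite -sumEFin; apply: eq_bigr => k _; rewrite lfp_funE.
by [].
Qed.

Definition lfp : lfsm R := Lfsm lfp_out lfp_sigma_additive.

Lemma dens_lfp : dens lfp h.
Proof. by split => // B bB; exact: lfp_funE. Qed.

End construction.

Lemma lint_exists h : lint h -> exists nu, dens nu h.
Proof.
move=> lh; pose hp t := Num.max (h t) 0; pose hm t := Num.max (- h t) 0.
have lp : lint hp.
  split => [|B bB]; first by apply: measurable_maxr => //; exact: lh.1.
  apply: le_lt_trans (lh.2 B bB); rewrite !(int_mk B); apply: le_lower_integral => t.
    by rewrite mule_ge0// lee_fin.
  rewrite -!EFinM lee_fin ler_wpM2r// /hp.
  by case: (leP (h t) 0); rewrite ?normr0.
have lm : lint hm.
  split => [|B bB]; first by apply: measurable_maxr => //; apply: measurableT_comp => //; exact: lh.1.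
  apply: le_lt_trans (lh.2 B bB); rewrite !(int_mk B); apply: le_lower_integral => t.
    by rewrite mule_ge0// lee_fin.
  rewrite -!EFinM lee_fin ler_wpM2r// /hm.
  by case: (leP (- h t) 0); rewrite ?normr0 ?normrN.
have p0 t : 0 <= hp t by rewrite le_max lexx orbT.
have m0 t : 0 <= hm t by rewrite le_max lexx orbT.
exists (lf_add (lfp lp p0) (lf_scale (-1) (lfp lm m0))).
apply: dens_ext (dens_add (dens_lfp lp p0) (dens_scale (-1) (dens_lfp lm m0))) => t.
rewrite /hp /hm mulN1r; case: (leP (h t) 0) => ht.
  by rewrite max_l ?oppr_ge0// opprK add0r.
by rewrite max_r ?oppr0 ?addr0// oppr_le0 ltW.
Qed.

(** The zero measure is the value off the event [lint]; this event being measurable, [lfint] of a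
    jointly measurable function is a random field. *)
Definition lfint (h : R2 -> R) : lfsm R := xget (lf0 R) [set nu | dens nu h].

Lemma dens_lfint h : lint h -> dens (lfint h) h.
Proof. by move=> /lint_exists[nu dnu]; apply: (@xgetPex _ (lf0 R) [set nu | dens nu h]); exists nu. Qed.

Lemma lfint_out h : ~ lint h -> lfint h = lf0 R.
Proof. by move=> nh; rewrite /lfint xgetPN// => nu [lh _]; exact: nh. Qed.

Section random_density.
Context d (T : measurableType d) (h : T -> R2 -> R).
Hypothesis mh : measurable_fun setT (fun x : T * R2 => h x.1 x.2).

Lemma measurable_section x : measurable_fun setT (h x).
Proof. exact: (measurableT_comp mh (measurable_pair1 x)). Qed.

Lemma measurable_integral_density (B : set R2) (g : R -> \bar R) : measurable B ->
  measurable_fun setT g -> (forall y, 0 <= g y)%E ->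
  measurable_fun setT (fun x => \int[leb]_(t in B) g (h x t))%E.
Proof.
move=> mB mg g0; under eq_fun do rewrite int_mk.
apply: (@measurable_fun_fubini_tonelli_F _ _ _ _ R (lam2 R) (fun x => (g (h x.1 x.2) * (\1_B x.2)%:E)%E)).
  apply: emeasurable_funM; first exact: (measurableT_comp mg mh).
  by apply/measurable_EFinP; exact: (measurableT_comp (measurable_indic mB) measurable_snd).
by move=> x; rewrite mule_ge0// lee_fin.
Qed.

Lemma measurable_lint : measurable [set x | lint (h x)].
Proof.
rewrite (_ : [set x | _] = \bigcap_n [set x | \int[leb]_(t in box n) `|(h x t)%:E| < +oo]%E); last first.
  apply/seteqP; split => x /=.
    by move=> lx n _ /=; apply: lx.2; exact: box_borel.
  by move=> H; apply: lintP; [exact: measurable_section|move=> n; exact: (H n I)].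
apply: bigcapT_measurable => n; rewrite -[X in measurable X]setTI.
have := @measurable_integral_density (box n) (fun y => `|y%:E|%E) (bb_measurable (box_borel n)) _ (fun y => abse_ge0 _).
have ma : measurable_fun setT (fun y : R => `|y%:E|%E).
  by apply: measurableT_comp => //; exact/measurable_EFinP.
move=> /(_ ma) mI; apply: emeasurable_fun_infty_o => //.
Qed.

Lemma measurable_lfint : measurable_fun setT (fun x => lfint (h x)).
Proof.
apply: measurable_lfsmP => B bB.
have mL := measurable_lint.
rewrite (_ : (fun x => _) = fun x => if x \in [set x | lint (h x)] then
   fine (\int[leb]_(t in B) (maxe (h x t)%:E 0) - \int[leb]_(t in B) (maxe (- (h x t)%:E) 0))%E else 0).
  apply: measurable_fun_ifT => //.
    apply: (measurable_fun_bool true); rewrite setTI (_ : _ @^-1` _ = [set x | lint (h x)])//.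
    by apply/seteqP; split => t; [move=> /set_mem|move=> /mem_set E; exact: E].
  apply: measurableT_comp => //; apply: emeasurable_funB.
    apply: (@measurable_integral_density B (fun y => maxe y%:E 0)%E (bb_measurable bB)).
      by apply: measurable_maxe => //; exact/measurable_EFinP.
    by move=> y; rewrite le_max lexx orbT.
  apply: (@measurable_integral_density B (fun y => maxe (- y%:E) 0)%E (bb_measurable bB)).
    by apply: measurable_maxe => //; apply: measurableT_comp => //; exact/measurable_EFinP.
  by move=> y; rewrite le_max lexx orbT.
apply/funext => x; case: ifPn => [|/negP]; rewrite inE => lx; last by rewrite lfint_out.
have [_ /(_ B bB) E] := dens_lfint lx; rewrite -[LHS]/(fine (lfint (h x) B)%:E) E.
rewrite integralE; congr (fine (_ - _)); apply: eq_integral => t _.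
  by rewrite funeposE.
by rewrite funenegE.
Qed.

End random_density.

End densities.

Section random_fields.
Context (R : realType).
Notation R2 := (measurableTypeR R * measurableTypeR R)%type.
Notation leb := (@leb2 R).

Section make.
Context d (T : measurableType d) (X : T -> lfsm R) (mX : measurable_fun setT X).

Definition mkrv_fun of measurable_fun setT X := X.

HB.instance Definition _ := isMeasurableFun.Build _ _ _ _ (mkrv_fun mX) mX.

Definition mkrv : {mfun T >-> lfsm R} := mkrv_fun mX.

End make.

Section composition.
Context d (T : measurableType d) d' (T' : measurableType d').
Variables (P : probability T R) (Q : probability T' R).

Lemma measurable_rv_comp (X : {RV Q >-> lfsm R}) h : mp P Q h -> measurable_fun setT (X \o h).
Proof. by move=> [mh _]; apply: measurableT_comp. Qed.

Definition rvcomp (X : {RV Q >-> lfsm R}) h (Ph : mp P Q h) : {RV P >-> lfsm R} :=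
  mkrv (measurable_rv_comp X Ph).

Lemma rvcomp_law X h (Ph : mp P Q h) : same_law X (rvcomp X Ph).
Proof.
move=> E mE; have [mh hE] := Ph; rewrite /distribution /pushforward.
have mXE : measurable (X @^-1` E) by rewrite -[_ @^-1` _]setTI; exact: measurable_funP.
by rewrite -hE.
Qed.

End composition.

(** Centering together with integrability: with it the means of the terms of a leak can be added and
    subtracted. *)
Definition zmean d (T : measurableType d) (P : probability T R) (X : {RV P >-> lfsm R}) :=
  forall A, bounded_borel A -> P.-integrable setT (fun x => (X x A)%:E) /\
    (\int[P]_x (X x A)%:E = 0)%E.

Lemma zmean_comp d (T : measurableType d) d' (T' : measurableType d')
    (P : probability T R) (Q : probability T' R) (X : {RV Q >-> lfsm R}) h (Ph : mp P Q h) :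
  zmean X -> zmean (rvcomp X Ph).
Proof.
move=> zX A bA; have [iX X0] := zX A bA; have [mX jX] := integrableP _ _ _ iX.
have [mh _] := Ph.
have E (g : \bar R -> \bar R) : measurable_fun setT (fun x => g (X x A)%:E) -> (forall y, 0 <= g y)%E ->
    (\int[P]_x g (X (h x) A)%:E = \int[Q]_x g (X x A)%:E)%E.
  by move=> mg g0; rewrite -(mp_integral Ph mg (fun x => g0 _)).
split.
  apply/integrableP; split; first exact: (measurableT_comp mX mh).
  rewrite [ltLHS](E abse)//; exact: measurableT_comp.
rewrite -X0 integralE [RHS]integralE; congr (_ - _)%E.
  under eq_integral do rewrite funeposE; under [RHS]eq_integral do rewrite funeposE.
  apply: (E (fun x => maxe x 0)%E); last by move=> x; rewrite le_max lexx orbT.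
  exact: measurable_maxe.
under eq_integral do rewrite funenegE; under [RHS]eq_integral do rewrite funenegE.
apply: (E (fun x => maxe (- x) 0)%E); last by move=> x; rewrite le_max lexx orbT.
by apply: measurable_maxe => //; exact: measurableT_comp.
Qed.

Section zero_mean.
Context d (T : measurableType d) (P : probability T R).
Implicit Types X : {RV P >-> lfsm R}.

Lemma zmean_centered X : zmean X -> centered X.
Proof. by move=> zX A bA; exact: (zX A bA).2. Qed.

Lemma zmean_swap X : zmean X -> zmean (rf_swap X).
Proof. by move=> zX A bA; apply: zX; have [_ _ H _] := bounded_bimeasurable_swap R; exact: H. Qed.

Lemma zmean_leak X0 Xm Xp : zmean X0 -> zmean Xm -> zmean Xp -> zmean (rf_leak X0 Xm Xp).
Proof.
move=> z0 zm zp A bA; have [mneg mpos] := measurable_halfplane R.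
have bn : bounded_borel (A `&` [set p | p.1 < 0]) by exact: bounded_borelI.
have bp : bounded_borel (A `&` [set p | 0 <= p.1]) by exact: bounded_borelI.
have E x : (rf_leak X0 Xm Xp x A)%:E = (((Xm x (A `&` [set p | p.1 < 0]))%:E - (X0 x (A `&` [set p | p.1 < 0]))%:E) +
    ((Xp x (A `&` [set p | 0 <= p.1]))%:E - (X0 x (A `&` [set p | 0 <= p.1]))%:E))%E.
  by rewrite -!EFinB -EFinD -lf_leakE.
have [im em] := zm _ bn; have [ip ep] := zp _ bp.
have [in0 en0] := z0 _ bn; have [ip0 ep0] := z0 _ bp.
have i1 := integrableB measurableT im in0; have i2 := integrableB measurableT ip ip0.
split; first by under eq_fun do rewrite E; exact: integrableD.
under eq_integral do rewrite E.
by rewrite integralD// !integralB// em en0 ep ep0 subee// adde0.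
Qed.

Lemma exp_moment_dens X (D : set R2) (m : T -> \bar R) : measurable D -> (forall x, 0 <= m x)%E ->
  {ae P, forall x, exists2 h, dens (X x) h & (\int[leb]_(t in D) `|(h t)%:E| <= m x)%E} ->
  (\int[P]_x expeR (m x) <= 2%:E)%E -> exp_moment_le2 X D.
Proof.
move=> mD m0 aeX; apply: le_trans; apply: le_lower_integral_ae.
- by move=> x; exact: expeR_ge0.
- by move=> x; exact: expeR_ge0.
apply: ae_imp aeX => x [h dh hm]; rewrite lee_expeR.
exact: le_trans (dens_variation dh mD) hm.
Qed.

(* Jensen's inequality for an average of [#|I|] exponents. *)
Lemma expeR_sum_le (I : finType) (m : I -> T -> \bar R) (ep : R) : (0 < #|I|)%N -> 0 < ep ->
  (forall i, measurable_fun setT (m i)) -> (forall i x, 0 <= m i x)%E ->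
  (forall i, \int[P]_x expeR (ep%:E * m i x) <= 2%:E)%E ->
  (\int[P]_x expeR ((ep / #|I|%:R)%:E * \sum_i m i x) <= 2%:E)%E.
Proof.
move=> I0 ep0 mm m0 mE; have n0 : 0 < #|I|%:R :> R by rewrite ltr0n.
have em0 i x : (0 <= ep%:E * m i x)%E by rewrite mule_ge0// lee_fin ltW.
have mem i : measurable_fun setT (fun x => expeR (ep%:E * m i x)).
  by apply: measurable_expeR => //; exact: measurable_funeM.
apply: (@le_trans _ _ (\int[P]_x \sum_i ((#|I|%:R^-1)%:E * expeR (ep%:E * m i x))%E)%E).
  apply: le_lower_integral => x; first exact: expeR_ge0.
  have [[i mi]|fin] := pselect (exists i, m i x = +oo%E).
    rewrite [leRHS](bigD1 i)//= mi gt0_muley ?lte_fin// [expeR +oo]/= gt0_muley ?lte_fin ?invr_gt0//.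
    rewrite addye ?leey// gt_eqF// (@lt_le_trans _ _ 0%E)//; apply: sume_ge0 => j _.
    by rewrite mule_ge0 ?lee_fin ?invr_ge0 ?expeR_ge0.
  pose k i := fine (m i x).
  have kE i : m i x = (k i)%:E.
    by rewrite /k fineK// ge0_fin_numE// lt_neqAle leey andbT; apply/eqP => mi; apply: fin; exists i.
  rewrite (eq_bigr (fun i => (k i)%:E)); last by move=> i _; exact: kE.
  rewrite [leRHS](eq_bigr (fun i => (#|I|%:R^-1 * expR (ep * k i))%:E)); last by move=> i _; rewrite kE.
  rewrite !sumEFin -EFinM/= lee_fin.
  have := @expR_convex R I (fun=> #|I|%:R^-1) (fun i => ep * k i) (fun=> ltW (etrans (invr_gt0 _) n0)).
  rewrite sumr_const -[_ *+ _]mulr_natr mulVf ?gt_eqF// => /(_ (lexx _)).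
  by rewrite subrr addr0; apply: le_trans; rewrite ler_expR mulr_sumr; apply: ler_sum => i _; lra.
rewrite ge0_integral_sum//; last 2 first.
- by move=> i; exact: measurable_funeM.
- by move=> i x _; rewrite mule_ge0 ?lee_fin ?invr_ge0 ?expeR_ge0.
apply: (@le_trans _ _ (\sum_(i : I) ((#|I|%:R^-1 * 2)%:E))%E).
  apply: lee_sum => i _; rewrite ge0_integralZl ?lee_fin ?invr_ge0//; last by move=> x _; exact: expeR_ge0.
  rewrite EFinM; apply: lee_pmul => //; rewrite ?lee_fin ?invr_ge0//.
  by apply: integral_ge0 => x _; exact: expeR_ge0.
by rewrite sumEFin lee_fin sumr_const -[_ *+ _]mulr_natr mulrAC mulVf ?gt_eqF// mul1r.
Qed.

End zero_mean.

(** The two projections of a product are independent, and the third member of the split is read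
    through any measure-preserving map [g], here a gluing. All splits constructed below have this
    form. *)
Lemma split_pprod d (T : measurableType d) (P : probability T R) (X : {RV P >-> lfsm R})
    d' (T' : measurableType d') (Q : probability T' R) (V : {RV Q >-> lfsm R}) g
    (Qg : mp (pprod Q Q) Q g) : same_law X V ->
  is_leak X (rf_leak (rvcomp V Qg) (rvcomp V (mp_fst Q Q)) (rvcomp V (mp_snd Q Q))).
Proof.
move=> XV; exists _, _, (pprod Q Q), (rvcomp V Qg), (rvcomp V (mp_fst Q Q)), (rvcomp V (mp_snd Q Q)).
have mV E : measurable E -> measurable (V @^-1` E).
  by move=> mE; rewrite -[_ @^-1` _]setTI; exact: measurable_funP.
split=> //; split.
- move=> E F mE mF.
  have EE : pprod Q Q (rvcomp V (mp_fst Q Q) @^-1` E) = Q (V @^-1` E) := (mp_fst Q Q).2 _ (mV E mE).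
  have FE : pprod Q Q (rvcomp V (mp_snd Q Q) @^-1` F) = Q (V @^-1` F) := (mp_snd Q Q).2 _ (mV F mF).
  rewrite EE FE -pprodE; [|exact: mV|exact: mV]; congr (pprod _ _ _).
- by move=> E mE; rewrite XV//; exact: rvcomp_law.
- by move=> E mE; rewrite XV//; exact: rvcomp_law.
- by move=> E mE; rewrite XV//; exact: rvcomp_law.
Qed.

Lemma measurable_set_bool d (T : measurableType d) (f : T -> bool) : measurable_fun setT f ->
  measurable [set u | f u].
Proof.
move=> mf; rewrite -[X in measurable X]setTI (_ : [set u | f u] = f @^-1` [set true])//.
exact: mf.
Qed.

Lemma measurable_eqb d (T : measurableType d) (f : T -> bool) b : measurable_fun setT f ->
  measurable_fun setT (fun u => f u == b).
Proof.
move=> mf; case: b; first by under eq_fun do rewrite eqb_id.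
by under eq_fun do rewrite eqbF_neg; exact: measurable_neg.
Qed.

End random_fields.

Section gluing.
Context dS (S : measurableType dS) (R : realType) (mu : {measure set S -> \bar R}).
Notation l2 := (l2 mu).

Lemma l2_eq (f g : l2) : (forall s, f s = g s) -> f = g.
Proof.
case: f g => f mf jf [g mg ig] /= fg; have E : f = g by apply/funext.
by subst g; congr L2; exact: Prop_irrelevance.
Qed.

(** Exchanging the two noises exchanges the roles of a region and its complement, so that a point
    may always be assumed to lie in the region governed by the first noise. *)
Lemma gl_compl (A B : set S) (mA : measurable A) (mB : measurable B) w : B = ~` A ->
  gl mA w = gl mB ((w.2, w.1) : paths R l2 * paths R l2).
Proof.
move=> BA; apply/funext => f; rewrite /gl /= addrC; congr (w.2 _ + w.1 _).
  by apply: l2_eq => s /=; rewrite BA.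
by apply: l2_eq => s /=; rewrite BA setCK.
Qed.

Lemma gl_irr (A B : set S) (mA : measurable A) (mB : measurable B) : A = B ->
  gl mA = gl mB :> (paths R l2 * paths R l2 -> paths R l2).
Proof.
by move=> AB; apply/funext => w; apply/funext => f; rewrite /gl /=; congr (w.1 _ + w.2 _);
  apply: l2_eq => s /=; rewrite AB.
Qed.

End gluing.

(** * Splits and leaks *)

Section split_leak.
Context dS (S : measurableType dS) (R : realType) (mu : {measure set S -> \bar R}).
Notation l2 := (l2 mu).
Notation R2 := (measurableTypeR R * measurableTypeR R)%type.
Notation leb := (@leb2 R).
Notation O1 := (paths R l2).
Notation O2 := (paths R l2 * paths R l2)%type.
Notation O4 := (O2 * O2)%type.
Variables (G : probability (paths R l2) R) (wG : white G).
Variables (f : O1 -> R2 -> R) (pos : S -> R2) (ep : R).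
Hypothesis mf : measurable_fun setT (fun x : O1 * R2 => f x.1 x.2).
Hypothesis mpos : measurable_fun setT pos.
Hypothesis ep0 : 0 < ep.

Definition gdiff (A : set S) (mA : measurable A) (w : O2) (t : R2) : R :=
  `|f w.1 t - f (gl mA w) t|.

Hypothesis gdiff_bound : forall (H Q : set R2) (mA : measurable (pos @^-1` H)),
  ctrl pos H Q -> measurable Q ->
  (\int[pprod G G]_w expeR (ep%:E * \int[leb]_(t in Q) (gdiff mA w t)%:E) <= 2%:E)%E.

Lemma measurable_gdiff (A : set S) (mA : measurable A) :
  measurable_fun setT (fun x : O2 * R2 => gdiff mA x.1 x.2).
Proof.
have [mg _] := mp_gl wG mA; apply: measurableT_comp => //; apply: measurable_funB.
  have h : measurable_fun setT (fun x : O2 * R2 => (x.1.1, x.2)).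
    by apply: measurable_fun_pair => //; exact: (measurableT_comp measurable_fst measurable_fst).
  exact: (measurableT_comp mf h).
have h : measurable_fun setT (fun x : O2 * R2 => (gl mA x.1, x.2)).
  by apply: measurable_fun_pair => //; exact: (measurableT_comp mg measurable_fst).
exact: (measurableT_comp mf h).
Qed.

Definition gint (A : set S) (mA : measurable A) (Q : set R2) (w : O2) : \bar R :=
  (\int[leb]_(t in Q) (gdiff mA w t)%:E)%E.

Lemma gint_ge0 (A : set S) (mA : measurable A) Q w : (0 <= gint mA Q w)%E.
Proof. by apply: integral_ge0 => t _; rewrite lee_fin normr_ge0. Qed.

Lemma measurable_gint (A : set S) (mA : measurable A) Q : measurable Q ->
  measurable_fun setT (gint mA Q).
Proof.
move=> mQ; rewrite (_ : gint mA Q = fun w => \int[leb]_(t in Q) `|(gdiff mA w t)%:E|)%E.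
  apply: (measurable_integral_density (measurable_gdiff mA) mQ (g := fun y => `|y%:E|%E)) => //.
  by apply: measurableT_comp => //; exact/measurable_EFinP.
by apply/funext => w; apply: eq_integral => t _; rewrite gee0_abs// lee_fin normr_ge0.
Qed.

Lemma gint_majorant (I : finType) (A : I -> set S) (mA : forall i, measurable (A i))
    (Q : I -> set R2) (w : I -> O2) (D : set R2) (g : R2 -> R) (k : R) : 0 <= k ->
  (forall i, measurable (Q i)) ->
  (forall u, D u -> `|g u| <= k * \sum_i gdiff (mA i) (w i) u * \1_(Q i) u) ->
  (\int[leb]_(u in D) `|(g u)%:E| <= k%:E * \sum_i gint (mA i) (Q i) (w i))%E.
Proof.
move=> k0 mQ gle.
have t0 i u : 0 <= gdiff (mA i) (w i) u * \1_(Q i) u by rewrite mulr_ge0// normr_ge0.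
have mt i : measurable_fun setT (fun u => (gdiff (mA i) (w i) u * \1_(Q i) u)%:E).
  apply/measurable_EFinP; apply: measurable_funM; last exact: measurable_indic.
  exact: (measurableT_comp (measurable_gdiff (mA i)) (measurable_pair1 (w i))).
apply: (@le_trans _ _ (\int[leb]_u (k%:E * \sum_i (gdiff (mA i) (w i) u * \1_(Q i) u)%:E))%E).
  rewrite (int_mk D); apply: le_lower_integral => u; first by rewrite mule_ge0 ?abse_ge0// lee_fin.
  rewrite indicE sumEFin; case: (boolP (u \in D)) => [|_].
    by rewrite inE mule1 -EFinM lee_fin; exact: gle.
  by rewrite mule0 -EFinM lee_fin mulr_ge0// sumr_ge0.
rewrite ge0_integralZl//; last 2 first.
- exact: emeasurable_sum.
- by move=> u _; apply: sume_ge0 => i _; rewrite lee_fin.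
apply: lee_pmul => //; rewrite ?lee_fin//.
  by apply: integral_ge0 => u _; apply: sume_ge0 => i _; rewrite lee_fin.
rewrite ge0_integral_sum//; last by move=> i u _; rewrite lee_fin.
by apply: lee_sum => i _; rewrite /gint (int_mk (Q i)).
Qed.

Lemma gint_bound d (T : measurableType d) (P : probability T R) (h : T -> O2)
    (H Q : set R2) (mA : measurable (pos @^-1` H)) : mp P (pprod G G) h ->
  ctrl pos H Q -> measurable Q -> (\int[P]_x expeR (ep%:E * gint mA Q (h x)) <= 2%:E)%E.
Proof.
move=> Ph cQ mQ; have e0 w : (0 <= ep%:E * gint mA Q w)%E.
  by rewrite mule_ge0 ?gint_ge0// lee_fin ltW.
rewrite (mp_integral (f := fun w => expeR (ep%:E * gint mA Q w)) Ph).
- exact: gdiff_bound.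
- by apply: measurable_expeR => //; apply: measurable_funeM; exact: measurable_gint.
- by move=> w; exact: expeR_ge0.
Qed.

Variables (F : {RV G >-> lfsm R}).
Notation c := (ep / 16).
Hypothesis Fd : {ae G, forall z, dens (F z) (fun t => c * f z t)}.
Hypothesis Fz : zmean F.
Variable r : R.

(* [half1 b] and [half2 b] are the two sides of the lines [t1 = 0] and [t2 = r]. *)
Definition half1 (b : bool) : set R2 := [set p | (p.1 < 0) != b].
Definition half2 (b : bool) : set R2 := [set p | (p.2 < r) != b].

Lemma measurable_half (H : set R2) : measurable H -> measurable (pos @^-1` H).
Proof. by move=> mH; rewrite -[X in measurable X]setTI; exact: mpos. Qed.

Lemma measurable_lt1 : measurable_fun setT (fun p : R2 => p.1 < 0).
Proof. by apply: measurable_fun_ltr; [exact: measurable_fst|exact: measurable_cst]. Qed.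

Lemma measurable_lt2 : measurable_fun setT (fun p : R2 => p.2 < r).
Proof. by apply: measurable_fun_ltr; [exact: measurable_snd|exact: measurable_cst]. Qed.

Lemma mhalf1 b : measurable (pos @^-1` half1 b).
Proof.
apply: measurable_half; apply: measurable_set_bool; apply: measurable_neg.
exact: measurable_eqb measurable_lt1.
Qed.

Lemma mhalf2 b : measurable (pos @^-1` half2 b).
Proof.
apply: measurable_half; apply: measurable_set_bool; apply: measurable_neg.
exact: measurable_eqb measurable_lt2.
Qed.

Definition swp T (b : bool) (w : T * T) : T * T := if b then (w.2, w.1) else w.

Lemma mp_swp d (T : measurableType d) (P : probability T R) b : mp (pprod P P) (pprod P P) (swp b).
Proof.
case: b; first exact: (mp_swap P P).
by split => //; exact: measurable_id.
Qed.

Definition g1 b : O2 -> O1 := gl (mhalf1 b).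
(** Here [x.1] and [x.2] are independent copies of the pair of noises behind the first split; each
    noise of one pair is glued with its counterpart in the other. *)
Definition g2 b (x : O4) : O2 := (gl (mhalf2 b) (x.1.1, x.2.1), gl (mhalf2 b) (x.1.2, x.2.2)).

Lemma gl_half1 b (w : O2) : g1 false w = g1 b (swp b w).
Proof. by case: b => //; apply: gl_compl; apply/seteqP; split=> s; rewrite /half1/=; case: (_ < _). Qed.

Lemma gl_half2 b (w : O2) : gl (mhalf2 false) w = gl (mhalf2 b) (swp b w).
Proof. by case: b => //; apply: gl_compl; apply/seteqP; split=> s; rewrite /half2/=; case: (_ < _). Qed.

Lemma g2_swp b x : g2 false x = g2 b (swp b x).
Proof.
by rewrite /g2 !(gl_half2 b); case: b.
Qed.

Lemma mp_g1 b : mp (pprod G G) G (g1 b). Proof. exact: mp_gl. Qed.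

Lemma mp_g2 b : mp (pprod (pprod G G) (pprod G G)) (pprod G G) (g2 b).
Proof. exact: (mp_comp (mp_interchange G G G G) (mp_pair (mp_gl wG (mhalf2 b)) (mp_gl wG (mhalf2 b)))). Qed.

Definition Ylk := rf_leak (rvcomp F (mp_g1 false)) (rvcomp F (mp_fst G G)) (rvcomp F (mp_snd G G)).

Definition yd (w : O2) (t : R2) : R :=
  (if t.1 < 0 then c * f w.1 t else c * f w.2 t) - c * f (g1 false w) t.

Lemma Ylk_dens : {ae pprod G G, forall w, dens (Ylk w) (yd w)}.
Proof.
have a1 := mp_ae (mp_g1 false) Fd; have a2 := mp_ae (mp_fst G G) Fd; have a3 := mp_ae (mp_snd G G) Fd.
apply: (ae_imp _ (filterI (filterI a1 a2) a3)) => w [[d1 d2] d3].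
exact: dens_leak.
Qed.

Lemma Ylk_zmean : zmean Ylk.
Proof. by apply: zmean_leak; exact: zmean_comp. Qed.

(** On either side of the line the leak compares the noise governing that side with the glued noise;
    the swap puts the governing noise first, as in [gdiff]. *)
Lemma ydE b w t : (0 <= t.1) = b ->
  yd w t = c * (f (swp b w).1 t - f (g1 b (swp b w)) t).
Proof. by move=> <-; rewrite /yd -gl_half1 ltNge mulrBr; case: (0 <= t.1). Qed.

Definition strip s b : set R2 := [set t | ((0 <= t.1) == b) && (s <= t.2 < s + 1)].

Lemma measurable_strip s b : measurable (strip s b).
Proof.
apply: measurable_set_bool; apply: measurable_and.
  by apply: measurable_eqb; apply: measurable_fun_ler; [exact: measurable_cst|exact: measurable_fst].
apply: measurable_and.
  by apply: measurable_fun_ler; [exact: measurable_cst|exact: measurable_snd].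
by apply: measurable_fun_ltr; [exact: measurable_snd|exact: measurable_cst].
Qed.

(** Across the line, a point is at least as far from the noise of the other side as from the line
    itself. Along the line it is within 1/2 of the center, which the additive constants in [ctrl]
    absorb. *)
Lemma ctrl_strip s b : ctrl pos (half1 b) (strip s b).
Proof.
exists (0, s + 2^-1) => t p /= /andP[/eqP tb /andP[ts1 ts2]] /negP; rewrite negbK => /eqP pb.
rewrite !prod_normE/= subr0.
have h1 : `|t.1| <= `|t.1 - (pos p).1|.
  move: tb pb; case: b => /= tb pb.
    by move/idP: tb => t0; rewrite !ger0_norm//; lra.
  by move/negbT: tb; move/negbT: pb; rewrite -ltNge -leNgt => p0 t0; rewrite !ler0_norm//; lra.
have h2 : `|t.2 - (s + 2^-1)| <= 2^-1 by rewrite ler_norml; lra.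
have : Num.max `|t.1| `|t.2 - (s + 2^-1)| <= Num.max `|t.1 - (pos p).1| `|t.2 - (pos p).2| + 2^-1.
  rewrite ge_max; apply/andP; split.
    by rewrite (le_trans h1)// (@le_trans _ _ (Num.max `|t.1 - (pos p).1| `|t.2 - (pos p).2|)) ?lerDl// le_max lexx.
  by rewrite (le_trans h2)// lerDr le_max normr_ge0.
have : 0 <= Num.max `|t.1 - (pos p).1| `|t.2 - (pos p).2| by rewrite le_max normr_ge0.
by move: (Num.max _ _) (Num.max _ _) => x y; lra.
Qed.

(** Eight sectors, cut by the lines t1 = 0 and t2 = r and by the diagonals through their crossing
    point. In the maximum norm the distance of a point to the farther of the two lines equals its
    distance to the crossing point, which serves as the center in [ctrl]. *)
Definition quad (b : bool * bool * bool) : set R2 := [set u |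
  [&& (0 <= u.1) == b.1.1, (r <= u.2) == b.1.2 & (`|u.1| < `|u.2 - r|) == b.2]].

Lemma measurable_quad b : measurable (quad b).
Proof.
apply: measurable_set_bool; apply: measurable_and.
  by apply: measurable_eqb; apply: measurable_fun_ler; [exact: measurable_cst|exact: measurable_fst].
apply: measurable_and.
  by apply: measurable_eqb; apply: measurable_fun_ler; [exact: measurable_cst|exact: measurable_snd].
apply: measurable_eqb; apply: measurable_fun_ltr.
  by apply: measurableT_comp => //; exact: measurable_fst.
by apply: measurableT_comp => //; apply: measurable_funB; [exact: measurable_snd|exact: measurable_cst].
Qed.

Lemma ctrl_of_le (H Q : set R2) (x : R * R) :
  (forall t p, Q t -> ~ H p -> `|t - x| <= `|t - p|) -> ctrl pos H Q.
Proof.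
move=> h; exists x => t s Qt Hs; have := h t (pos s) Qt Hs.
by have := normr_ge0 (t - pos s); move: `|t - pos s| `|t - x| => a b; lra.
Qed.

Lemma ctrl_quad1 b1 b2 : ctrl pos (half1 b1) (quad (b1, b2, false)).
Proof.
apply: (@ctrl_of_le _ _ (0, r)) => t p /and3P[/= /eqP tb _ /eqP/negbT]; rewrite -leNgt => tle.
move=> /negP; rewrite negbK => /eqP pb; rewrite !prod_normE/= subr0 max_l// le_max; apply/orP; left.
move: tb pb; case: b1 => /= tb pb.
  by move/idP: tb => t0; rewrite !ger0_norm//; lra.
by move/negbT: tb; move/negbT: pb; rewrite -ltNge -leNgt => p0 t0; rewrite !ler0_norm//; lra.
Qed.

Lemma ctrl_quad2 b1 b2 : ctrl pos (half2 b2) (quad (b1, b2, true)).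
Proof.
apply: (@ctrl_of_le _ _ (0, r)) => t p /and3P[/= _ /eqP tb /eqP/idP] tle.
move=> /negP; rewrite negbK => /eqP pb; rewrite !prod_normE/= subr0 max_r ?(ltW tle)// le_max; apply/orP; right.
move: tb pb; case: b2 => /= tb pb.
  by move/idP: tb => t0; rewrite !ger0_norm//; lra.
by move/negbT: tb; move/negbT: pb; rewrite -ltNge -leNgt => p0 t0; rewrite !ler0_norm//; lra.
Qed.

(** Before the swap the set is a strip crossing the line t1 = 0. Its two halves are bounded
    separately and averaged by [expeR_sum_le], for which [ep / 2] would do; the smaller factor
    [ep / 16] comes from [leak_plane]. *)
Lemma leak_strip s : exp_moment_le2 (rf_swap Ylk) [set p | s <= p.1 < s + 1].
Proof.
have mD : measurable ([set p | s <= p.1 < s + 1] : set R2).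
  apply: measurable_set_bool; apply: measurable_and.
    by apply: measurable_fun_ler; [exact: measurable_cst|exact: measurable_fst].
  by apply: measurable_fun_ltr; [exact: measurable_fst|exact: measurable_cst].
pose m b (w : O2) := gint (mhalf1 b) (strip s b) (swp b w).
have m0 b w : (0 <= m b w)%E by exact: gint_ge0.
have mm b : measurable_fun setT (m b).
  exact: (measurableT_comp (measurable_gint (mhalf1 b) (measurable_strip s b)) (mp_swp G b).1).
apply: (@exp_moment_dens _ _ _ _ _ _ (fun w => (ep / #|{: bool}|%:R)%:E * \sum_b m b w)%E) => //.
- by move=> w; rewrite mule_ge0 ?lee_fin ?divr_ge0 ?(ltW ep0)//; exact: sume_ge0.
- apply: ae_imp Ylk_dens => w dY; exists (fun t => yd w (t.2, t.1)); first exact: dens_swap.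
  have [[my _] _] := dY.
  have myn : measurable_fun setT (fun u => `|(yd w u)%:E|%E).
    by apply: measurableT_comp => //; exact/measurable_EFinP.
  pose D' : set R2 := [set u | s <= u.2 < s + 1].
  have mD' : measurable D'.
    apply: measurable_set_bool; apply: measurable_and.
      by apply: measurable_fun_ler; [exact: measurable_cst|exact: measurable_snd].
    by apply: measurable_fun_ltr; [exact: measurable_snd|exact: measurable_cst].
  rewrite (_ : integral _ _ _ = \int[leb]_(u in D') `|(yd w u)%:E|)%E.
    apply: (@gint_majorant bool (fun b => pos @^-1` half1 b) mhalf1 (strip s) (fun b => swp b w) D' (yd w)).
    - by rewrite divr_ge0// ltW.
    - exact: measurable_strip.
    move=> u Du; set b0 := (0 <= u.1).
    rewrite (ydE w (erefl b0)) normrM ger0_norm; last by rewrite divr_ge0// ltW.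
    apply: ler_pM; rewrite ?normr_ge0 ?divr_ge0 ?(ltW ep0)//.
      by rewrite card_bool ler_pM2l// lef_pV2 ?posrE// ler_nat.
    rewrite (bigD1 b0)//= indicE mem_set ?mulr1; last first.
      by rewrite /strip /= -/b0 eqxx.
    by rewrite lerDl sumr_ge0// => b _; rewrite mulr_ge0// normr_ge0.
  rewrite (int_mk [set p | _]) (int_mk D') [RHS]leb2_swap//.
  by apply: emeasurable_funM => //; apply/measurable_EFinP; exact: measurable_indic.
- apply: expeR_sum_le => //; first by rewrite card_bool.
  move=> b; apply: (gint_bound (h := swp b)); [exact: mp_swp|exact: ctrl_strip|exact: measurable_strip].
Qed.

Definition V := rf_shift r (rf_swap Ylk).
Definition Vlk := rf_leak (rvcomp V (mp_g2 false)) (rvcomp V (mp_fst (pprod G G) (pprod G G)))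
  (rvcomp V (mp_snd (pprod G G) (pprod G G))).

Definition vd (w : O2) (t : R2) : R := yd w (t.2, t.1 + r).

Lemma V_dens : {ae pprod G G, forall w, dens (V w) (vd w)}.
Proof. by apply: ae_imp Ylk_dens => w dY; exact: (dens_shift r (dens_swap dY)). Qed.

(** The density of [Vlk] in the coordinates before swap and shift, where the two lines of gluing are
    t1 = 0 and t2 = r. *)
Definition lkd (x : O4) (u : R2) : R :=
  (if u.2 < r then yd x.1 u else yd x.2 u) - yd (g2 false x) u.

Lemma Vlk_dens : {ae pprod (pprod G G) (pprod G G),
  forall x, dens (Vlk x) (fun t => lkd x (t.2, t.1 + r))}.
Proof.
have a1 := mp_ae (mp_g2 false) V_dens.
have a2 := mp_ae (mp_fst (pprod G G) (pprod G G)) V_dens.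
have a3 := mp_ae (mp_snd (pprod G G) (pprod G G)) V_dens.
apply: (ae_imp _ (filterI (filterI a1 a2) a3)) => x [[d1 d2] d3].
apply: dens_ext (dens_leak d1 d2 d3) => t; rewrite /lkd /vd/=.
by have -> : (t.1 + r < r) = (t.1 < 0) by rewrite -{2}[r]add0r ltrD2r.
Qed.

(* The two pairs to be glued along the line [t1 = 0] resp. [t2 = r]. *)
Definition pairs (b : bool * bool * bool * bool) (x : O4) : O2 :=
  let: (b1, b2, b3, b4) := b in
  let x2 := swp b2 x in let x' := (swp b1 x2.1, swp b1 x2.2) in
  if b3 then (if b4 then (g1 b1 x'.1, g1 b1 x'.2) else (x'.1.1, x'.2.1))
  else (if b4 then g2 b2 x' else x'.1).

Definition sides (b : bool * bool * bool * bool) : set R2 :=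
  let: (b1, b2, b3, b4) := b in if b3 then half2 b2 else half1 b1.

Lemma msides b : measurable (pos @^-1` sides b).
Proof. by case: b => [[[b1 b2] []] b4]; [exact: mhalf2|exact: mhalf1]. Qed.

Lemma mp_pairs b : mp (pprod (pprod G G) (pprod G G)) (pprod G G) (pairs b).
Proof.
case: b => [[[b1 b2] b3] b4].
have m2 := mp_swp (pprod G G) b2.
have m' : mp (pprod (pprod G G) (pprod G G)) (pprod (pprod G G) (pprod G G))
    (fun x => let x2 := swp b2 x in (swp b1 x2.1, swp b1 x2.2)).
  exact: (mp_comp m2 (mp_pair (mp_swp G b1) (mp_swp G b1))).
rewrite /pairs; case: b3; case: b4.
- exact: (mp_comp m' (mp_pair (mp_g1 b1) (mp_g1 b1))).
- exact: (mp_comp m' (mp_pair (mp_fst G G) (mp_fst G G))).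
- exact: (mp_comp m' (mp_g2 b2)).
- exact: (mp_comp m' (mp_fst (pprod G G) (pprod G G))).
Qed.

Lemma ctrl_sides b : ctrl pos (sides b) (quad b.1).
Proof. by case: b => [[[b1 b2] []] b4]; [exact: ctrl_quad2|exact: ctrl_quad1]. Qed.

(** Once the noises governing the side of [u] are put first, the density is [c] times a mixed second
    difference of [f]: glued or not across t1 = 0, glued or not across t2 = r. By [gl_exchange] its
    four terms may be paired into two differences across either line, and the sector of [u] selects
    the pairing. *)
Lemma lkd_le x u : `|lkd x u| <= c * \sum_b gdiff (msides b) (pairs b x) u * \1_(quad b.1) u.
Proof.
pose b1 := (0 <= u.1); pose b2 := (r <= u.2); pose b3 := (`|u.1| < `|u.2 - r|).
have cc : 0 <= c by rewrite divr_ge0// ltW.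
have g0 b : 0 <= gdiff (msides b) (pairs b x) u * \1_(quad b.1) u by rewrite mulr_ge0// normr_ge0.
apply: (@le_trans _ _ (c * (gdiff (msides (b1, b2, b3, false)) (pairs (b1, b2, b3, false) x) u +
    gdiff (msides (b1, b2, b3, true)) (pairs (b1, b2, b3, true) x) u))); last first.
  apply: ler_wpM2l => //.
  have qu : quad (b1, b2, b3) u by rewrite /quad /= !eqxx.
  rewrite (bigD1 (b1, b2, b3, false))//= (bigD1 (b1, b2, b3, true))/=; last by rewrite xpair_eqE andbF.
  by rewrite indicE mem_set// !mulr1 addrA lerDl sumr_ge0.
have yE (w : O2) : yd w u = c * (f (swp b1 w).1 u - f (g1 b1 (swp b1 w)) u) by exact: ydE.
pose x2 := swp b2 x; pose z := swp b1 x2.1; pose z' := swp b1 x2.2.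
have E1 : (if u.2 < r then yd x.1 u else yd x.2 u) = c * (f z.1 u - f (g1 b1 z) u).
  by rewrite !yE /z /x2 /b2 ltNge; case: (r <= u.2).
have E2 : yd (g2 false x) u = c * (f (g2 b2 (z, z')).1 u - f (g1 b1 (g2 b2 (z, z'))) u).
  by rewrite yE (g2_swp b2) -/x2 /z /z'; case: (b1).
rewrite /lkd E1 E2 -mulrBr normrM (ger0_norm cc); apply: ler_wpM2l => //.
have -> : pairs (b1, b2, b3, false) x = if b3 then (z.1, z'.1) else z by rewrite /pairs; case: (b3).
have -> : pairs (b1, b2, b3, true) x = if b3 then (g1 b1 z, g1 b1 z') else g2 b2 (z, z').
  by rewrite /pairs; case: (b3).
have gx : g1 b1 (g2 b2 (z, z')) = gl (mhalf2 b2) (g1 b1 z, g1 b1 z').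
  exact: (gl_exchange (mhalf1 b1) (mhalf2 b2) (z, z')).
have h1 w b4 : gdiff (msides (b1, b2, false, b4)) w u = `|f w.1 u - f (g1 b1 w) u|.
  have E : gl (msides (b1, b2, false, b4)) = gl (mhalf1 b1) :> (O2 -> O1) by exact: gl_irr.
  by rewrite /gdiff /g1 E.
have h2 w b4 : gdiff (msides (b1, b2, true, b4)) w u = `|f w.1 u - f (gl (mhalf2 b2) w) u|.
  have E : gl (msides (b1, b2, true, b4)) = gl (mhalf2 b2) :> (O2 -> O1) by exact: gl_irr.
  by rewrite /gdiff E.
case: (b3); first rewrite !h2/= gx -[gl _ (z.1, z'.1)]/((g2 b2 (z, z')).1).
  apply: le_trans (ler_normB _ _); rewrite le_eqVlt; apply/orP; left; apply/eqP; congr (`|_|); ring.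
rewrite !h1; exact: ler_normB.
Qed.

(** The sixteen indices are the eight sectors times the two differences of [lkd_le]; averaging over
    them by [expeR_sum_le] fixes the factor [ep / 16]. *)
Lemma leak_plane : exp_moment_le2 Vlk setT.
Proof.
pose I := (bool * bool * bool * bool)%type.
have cI : #|{: I}| = 16 by rewrite !card_prod card_bool.
pose m (b : I) (x : O4) := gint (msides b) (quad b.1) (pairs b x).
have m0 b x : (0 <= m b x)%E by exact: gint_ge0.
have mm b : measurable_fun setT (m b).
  exact: (measurableT_comp (measurable_gint (msides b) (measurable_quad b.1)) (mp_pairs b).1).
apply: (@exp_moment_dens _ _ _ _ _ _ (fun x => (ep / #|{: I}|%:R)%:E * \sum_b m b x)%E) => //.
- by move=> x; rewrite mule_ge0 ?lee_fin ?divr_ge0 ?(ltW ep0)//; exact: sume_ge0.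
- apply: ae_imp Vlk_dens => x dV; exists (fun t => lkd x (t.2, t.1 + r)); first exact: dV.
  have [[mV _] _] := dV.
  have ml : measurable_fun setT (lkd x).
    rewrite (_ : lkd x = (fun t => lkd x (t.2, t.1 + r)) \o (fun u => (u.2 - r, u.1))).
      apply: (measurableT_comp mV); apply: measurable_fun_pair; last exact: measurable_fst.
      by apply: measurable_funB; [exact: measurable_snd|exact: measurable_cst].
    by apply/funext => -[u1 u2] /=; rewrite subrK.
  have mln : measurable_fun setT (fun u => `|(lkd x u)%:E|%E).
    by apply: measurableT_comp => //; exact/measurable_EFinP.
  rewrite (_ : integral _ _ _ = \int[leb]_u `|(lkd x u)%:E|)%E.
    apply: (@gint_majorant I (fun b => pos @^-1` sides b) msides (fun b => quad b.1) (fun b => pairs b x) setT (lkd x)).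
    - by rewrite divr_ge0// ltW.
    - by move=> b; exact: measurable_quad.
    - by move=> u _; rewrite cI; exact: lkd_le.
  rewrite [RHS](leb2_shift (0, r))// leb2_swap//.
    by apply: eq_integral => u _; rewrite /= addr0.
  exact: (measurableT_comp mln (measurable_shift2 (0, r))).
- rewrite -/I; apply: expeR_sum_le => //; first by rewrite cI.
  by move=> b; apply: (gint_bound (h := pairs b)); [exact: mp_pairs|exact: ctrl_sides|exact: measurable_quad].
Qed.

End split_leak.

Section leak_exists.
Context dS (S : measurableType dS) (R : realType) (mu : {measure set S -> \bar R}).
Notation l2 := (l2 mu).
Notation R2 := (measurableTypeR R * measurableTypeR R)%type.

(** Being a leak depends on the law of [X] only. It can therefore be constructed on products of path
    space, with two copies of the noise for the leak and four for the leak of the leak. *)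
Lemma leak_splittable (G : probability (paths R l2) R) (f : paths R l2 -> R2 -> R) (pos : S -> R2)
    (ep : R) (F : {RV G >-> lfsm R}) : white G ->
  measurable_fun setT (fun x : paths R l2 * R2 => f x.1 x.2) -> measurable_fun setT pos -> 0 < ep ->
  (forall (H Q : set R2) (mA : measurable (pos @^-1` H)), ctrl pos H Q -> measurable Q ->
    (\int[pprod G G]_w expeR (ep%:E * \int[@leb2 R]_(t in Q) (gdiff f mA w t)%:E) <= 2%:E)%E) ->
  {ae G, forall z, dens (F z) (fun t => ep / 16 * f z t)} -> zmean F ->
  forall d (T : measurableType d) (P : probability T R) (X : {RV P >-> lfsm R}), same_law X F ->
  exists (d' : measure_display) (T' : measurableType d') (P' : probability T' R)
    (Y : {RV P' >-> lfsm R}), is_leak X Y /\ splittable11 (rf_swap Y).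
Proof.
move=> wG mf mpos ep0 gb Fd Fz d T P X XF.
exists _, _, (pprod G G), (Ylk wG mpos F); split; first exact: split_pprod.
split.
- by move=> s; exact: (leak_strip wG mf mpos ep0 gb Fd).
- by apply: zmean_centered; apply: zmean_swap; exact: Ylk_zmean.
- move=> r; exists _, _, (pprod (pprod G G) (pprod G G)), (Vlk wG mpos F r); split.
    exact: split_pprod.
  exact: (leak_plane wG mf mpos ep0 gb Fd).
Qed.

End leak_exists.

(** * Stationary fields *)

Section planar_sets.
Variable R : realType.
Notation R2 := (measurableTypeR R * measurableTypeR R)%type.
Notation leb := (@leb2 R).

Lemma leb2_bounded (A : set R2) : bounded_borel A -> (leb A < +oo)%E.
Proof.
move=> bA; have [_ /bounded_setP[M AM]] := bA; have mA := bb_measurable bA.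
pose B : set R2 := `[- M, M] `*` `[- M, M].
apply: (@le_lt_trans _ _ (leb B)).
  apply: le_measure; rewrite ?inE//; first by apply: measurableX; exact: measurable_itv.
  by move=> t /AM; rewrite prod_normE/= ge_max !ler_norml /B /= !in_itv/= => /andP[-> ->].
rewrite [ltLHS]product_measure1E; do ?exact: measurable_itv.
have E : (@lebesgue_measure R `[(- M)%R, M]%classic < +oo)%E.
  by rewrite lebesgue_measure_itv/=; case: ifP => _ //; rewrite -EFinB ltry.
by apply: lte_mul_pinfty => //; rewrite ge0_fin_numE.
Qed.

Lemma ae_swap (P : set R2) : {ae leb, forall t, P t} -> {ae leb, forall t, P (t.2, t.1)}.
Proof.
exact: (ae_pullback (@measurable_swap2 R) ltr01
  (fun f mf f0 => etrans (leb2_swap mf f0) (esym (mul1e _)))).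
Qed.

Lemma ae_shift (P : set R2) (b : R * R) : {ae leb, forall t, P t} ->
  {ae leb, forall t, P (t.1 + b.1, t.2 + b.2)}.
Proof.
move=> aeP; apply: ae_imp (@ae_affine R P 1 b ltr01 aeP) => t.
by rewrite !mul1r.
Qed.

Definition cell (s1 s2 : R) : set R2 := [set p | s1 <= p.1 < s1 + 1 /\ s2 <= p.2 < s2 + 1].

Lemma cellE s1 s2 : cell s1 s2 = `[s1, s1 + 1[ `*` `[s2, s2 + 1[.
Proof. by apply/seteqP; split => t; rewrite /cell /= !in_itv/=. Qed.

Lemma measurable_cell s1 s2 : measurable (cell s1 s2).
Proof. by rewrite cellE; apply: measurableX; exact: measurable_itv. Qed.

Lemma leb2_cell s1 s2 : leb (cell s1 s2) = 1%E.
Proof.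
rewrite cellE [LHS]product_measure1E; do ?exact: measurable_itv.
have E (a : R) : @lebesgue_measure R `[a, a + 1[%classic = 1%E.
  by rewrite lebesgue_measure_itv/= lte_fin ltrDl ltr01 -EFinB addrC addrA addNr add0r.
have -> : (1 = 1 * 1 :> \bar R)%E by rewrite mule1.
by congr (_ * _)%E; exact: E.
Qed.

End planar_sets.

Section stationary_field.
Context dS (S : measurableType dS) (R : realType).
Variable mu : {measure set S -> \bar R}.
Notation l2 := (l2 mu).
Notation R2 := (measurableTypeR R * measurableTypeR R)%type.
Notation leb := (@leb2 R).
Variables (Ic : finType) (c0 be v : R) (Jf : R -> R).
Variables (e : nat -> l2) (G : probability (paths R l2) R) (psi : paths R Ic -> R).
Hypotheses (wG : white G) (e_on : forall i j, ip (e i) (e j) = (i == j)%:R).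
Hypothesis v0 : 0 < v.
Hypothesis mpsi : measurable_fun setT psi.
Variables (kap : Ic -> R * R -> l2) (pos : S -> R * R) (Gt : Ic -> paths R l2 * R2 -> R).
Hypotheses (km : kmodel c0 be v Jf kap pos) (vG : version G kap Gt).

(** The one-point law of the field, realized by members of the orthonormal sequence [e] instead of
    the kernels. *)
Definition psi0 (z : paths R l2) : R := psi (fun c => Num.sqrt v * z (e (eidx 0 c))).

Notation f := (fld psi Gt).
Let mf := measurable_fld mpsi vG.

Lemma km_cov c c' t : ip (kap c t) (kap c' t) = v * (c == c')%:R.
Proof.
have [<-|cc] := eqVneq c c'; first by rewrite mulr1 (km_var km).
rewrite mulr0 -[RHS](@km_orth _ _ _ _ _ _ _ _ _ _ _ km c c' t setT measurableT cc).
by apply: eq_Rintegral => s _ /=; rewrite indicE mem_set ?mulr1.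
Qed.

(** By [km_orth] and [km_var] the components at one point are uncorrelated with variance [v],
    whatever the point. The exceptional times are those at which the version fails to represent the
    noise. *)
Lemma fld_law : {ae leb, forall t, forall g : R -> \bar R, measurable_fun setT g ->
  (forall y, 0 <= g y)%E -> (\int[G]_z g (f z t) = \int[G]_z g (psi0 z))%E}.
Proof.
have aeG : {ae leb, forall t, forall c, {ae G, forall z, Gt c (z, t) = z (kap c t)}}.
  by apply: filter_forall => c; exact: (vG c).2.
apply: ae_imp aeG => t Gtt g mg g0.
pose Z (z : paths R l2) : paths R Ic := fun c => z (kap c t).
pose Z' (z : paths R l2) : paths R Ic := fun c => Num.sqrt v * z (e (eidx 0 c)).
have mZ c : measurable_fun setT (fun z => Z z c) by exact: measurable_ev.
have mZ' c : measurable_fun setT (fun z => Z' z c).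
  by apply: measurable_funM => //; exact: measurable_ev.
transitivity (\int[G]_z g (psi (Z z)))%E.
  have mgf := measurableT_comp mg (measurableT_comp mf (measurable_pair2 t)).
  apply: ae_eq_integral => //.
    exact: (measurableT_comp mg (measurableT_comp mpsi (measurable_pathsP mZ))).
  have : {ae G, forall z, forall c, Gt c (z, t) = z (kap c t)} by exact: filter_forall.
  by apply: ae_imp => z zE _; congr g; rewrite /fld; congr psi; apply/funext => c; exact: zE.
apply: (law_integral (measurable_pathsP mZ) (measurable_pathsP mZ') _
   (measurableT_comp mg mpsi) (fun x => g0 (psi x))).
apply: (@gauss_law R Ic _ _ G _ _ G Z Z' (covform (fun i j => v * (i == j)%:R))) => // s.
  apply: (eq_isG (gauss_forms wG (fun c => [:: (1, kap c t)]) s)).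
    by move=> z; apply: eq_bigr => p _; rewrite /linform big_seq1 mul1r.
  by apply: eq_covform => i j; rewrite l2lin11 !mul1r km_cov.
apply: (eq_isG (gauss_forms wG (fun c => [:: (Num.sqrt v, e (eidx 0 c))]) s)).
  by move=> z; apply: eq_bigr => p _; rewrite /linform big_seq1.
apply: eq_covform => i j; rewrite l2lin11 e_on eidx_eq eqxx/= mulrA -expr2 sqr_sqrtr//.
exact: ltW.
Qed.

Variables (th K : R).
Hypotheses (th0 : 0 < th) (K1 : 1 <= K).
Hypothesis psi0_exp : (\int[G]_z (expR (th * `|psi0 z|))%:E <= K%:E)%E.
Hypothesis psi0_mean : (\int[G]_z (psi0 z)%:E = 0)%E.

Let K0 : 0 < K. Proof. exact: lt_le_trans K1. Qed.

Lemma fld_exp : {ae leb, forall t, (\int[G]_z (expR (th * `|f z t|))%:E <= K%:E)%E}.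
Proof.
apply: ae_imp fld_law => t; move=> /(_ (fun y => (expR (th * `|y|))%:E)) ->//.
by apply/measurable_EFinP; apply: measurableT_comp => //; apply: measurable_funM.
Qed.

Lemma fld_abs : {ae leb, forall t, (\int[G]_z `|(f z t)%:E| <= (th^-1 * K)%:E)%E}.
Proof.
apply: ae_imp fld_exp => t fe; have mft := measurableT_comp mf (measurable_pair2 t).
apply: (@le_trans _ _ (\int[G]_z ((th^-1)%:E * (expR (th * `|f z t|))%:E))%E).
  apply: le_lower_integral => z; first exact: abse_ge0.
  rewrite -EFinM lee_fin ler_pdivlMl//; have := expR_ge1Dx (th * `|f z t|); lra.
rewrite ge0_integralZl ?lee_fin ?invr_ge0 ?(ltW th0)//.
  by rewrite EFinM; apply: lee_pmul => //; rewrite ?lee_fin ?invr_ge0 ?(ltW th0)//; apply: integral_ge0.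
by apply/measurable_EFinP; apply: measurableT_comp => //; apply: measurable_funM => //; exact: measurableT_comp.
Qed.

Lemma fld_mean : {ae leb, forall t, (\int[G]_z (f z t)%:E = 0)%E}.
Proof.
apply: ae_imp fld_law => t law; rewrite -[RHS]psi0_mean integralE [RHS]integralE; congr (_ - _)%E.
  under eq_integral do rewrite funeposE; under [RHS]eq_integral do rewrite funeposE.
  apply: (law (fun y => maxe y%:E 0)%E); last by move=> x; rewrite le_max lexx orbT.
  by apply: measurable_maxe => //; exact/measurable_EFinP.
under eq_integral do rewrite funenegE; under [RHS]eq_integral do rewrite funenegE.
apply: (law (fun y => maxe (- y%:E) 0)%E); last by move=> x; rewrite le_max lexx orbT.
by apply: measurable_maxe => //; apply: measurableT_comp => //; exact/measurable_EFinP.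
Qed.

Lemma fld_abs_integral (A : set R2) : bounded_borel A ->
  (\int[G]_z \int[leb]_(t in A) `|(f z t)%:E| < +oo)%E.
Proof.
move=> bA; have mA := bb_measurable bA.
under eq_integral do rewrite int_mk.
pose g (x : paths R l2 * R2) := (`|(f x.1 x.2)%:E| * (\1_A x.2)%:E)%E.
have mg : measurable_fun setT g.
  apply: emeasurable_funM; first by apply: measurableT_comp => //; exact/measurable_EFinP.
  by apply/measurable_EFinP; exact: (measurableT_comp (measurable_indic mA) measurable_snd).
have g0 x : (0 <= g x)%E by rewrite mule_ge0// lee_fin.
rewrite (@fubini_tonelli _ _ _ _ R G (lam2 R) g mg g0).
apply: (@le_lt_trans _ _ (\int[leb]_t ((th^-1 * K)%:E * (\1_A t)%:E))%E).
  have C0 : 0 <= th^-1 * K by rewrite mulr_ge0 ?invr_ge0 ?(ltW th0) ?(ltW K0).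
  apply: le_lower_integral_ae.
  - by move=> t; apply: integral_ge0.
  - by move=> t; rewrite mule_ge0// lee_fin.
  apply: ae_imp fld_abs => t ft; rewrite /g /=; under eq_integral do rewrite muleC.
  rewrite ge0_integralZl ?lee_fin//.
    by rewrite muleC; apply: lee_pmul => //; apply: integral_ge0.
  apply/measurable_EFinP; apply: measurableT_comp => //; exact: (measurableT_comp mf (measurable_pair2 t)).
rewrite ge0_integralZl ?lee_fin ?mulr_ge0 ?invr_ge0 ?(ltW th0) ?(ltW K0)//.
  by rewrite integral_indic// setIT lte_mul_pinfty ?lee_fin ?mulr_ge0 ?invr_ge0 ?(ltW th0) ?(ltW K0)// leb2_bounded.
by apply/measurable_EFinP; exact: measurable_indic.
Qed.

Lemma fld_lint : {ae G, forall z, lint (f z)}.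
Proof.
have : {ae G, forall z, forall n, (\int[leb]_(t in @box R n) `|(f z t)%:E| < +oo)%E}.
  apply: ae_foralln => n.
  have ma : measurable_fun setT (fun y : R => `|y%:E|%E).
    by apply: measurableT_comp => //; exact/measurable_EFinP.
  have mI := measurable_integral_density mf (bb_measurable (@box_borel R n)) ma (fun y => abse_ge0 _).
  have I : G.-integrable setT (fun z => \int[leb]_(t in @box R n) `|(f z t)%:E|)%E.
    apply/integrableP; split => //; under eq_integral do rewrite gee0_abs ?integral_ge0//.
    exact: fld_abs_integral (@box_borel R n).
  apply: (ae_imp _ (integrable_ae measurableT I)) => z /(_ Logic.I) Hz.
  by rewrite ge0_fin_numE// in Hz; exact: integral_ge0.
by apply: ae_imp => z Hz; apply: lintP => //; exact: (measurableT_comp mf (measurable_pair1 z)).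
Qed.

Variable c : R.
Hypothesis c_gt0 : 0 < c.

Definition cfld (z : paths R l2) (t : R2) : R := c * f z t.

Lemma measurable_cfld : measurable_fun setT (fun x : paths R l2 * R2 => cfld x.1 x.2).
Proof. exact: measurable_funM. Qed.

Definition Ffld : {RV G >-> lfsm R} := mkrv (measurable_lfint measurable_cfld).

Lemma Ffld_dens : {ae G, forall z, dens (Ffld z) (cfld z)}.
Proof. by apply: ae_imp fld_lint => z lz; apply: dens_lfint; exact: lintZ. Qed.

(** Absolute integrability over the path space times [A] lets Fubini exchange expectation and
    integral, and the inner expectation vanishes by [fld_mean]. *)
Lemma Ffld_zmean : zmean Ffld.
Proof.
move=> A bA; have mA := bb_measurable bA.
have mFA : measurable_fun setT (fun z => (Ffld z A)%:E).
  apply/measurable_EFinP; exact: (measurableT_comp (@measurable_lfval R A) (measurable_lfint measurable_cfld)).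
pose g (x : paths R l2 * R2) := (cfld x.1 x.2 * \1_A x.2)%:E.
have mg : measurable_fun setT g.
  apply/measurable_EFinP; apply: measurable_funM; first exact: measurable_cfld.
  exact: (measurableT_comp (measurable_indic mA) measurable_snd).
have gE z : (\int[leb]_t `|g (z, t)| = c%:E * \int[leb]_(t in A) `|(f z t)%:E|)%E.
  rewrite (int_mk A) -ge0_integralZl ?lee_fin ?(ltW c_gt0)//; last first.
    apply: emeasurable_funM; last by apply/measurable_EFinP; exact: measurable_indic.
    apply: measurableT_comp => //; apply/measurable_EFinP; exact: (measurableT_comp mf (measurable_pair1 z)).
  apply: eq_integral => t _; rewrite /g /cfld /= -!EFinM !normrM (gtr0_norm c_gt0) -mulrA.
  by rewrite [X in _ * (_ * X)]ger0_norm.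
have mI : measurable_fun setT (fun z => \int[leb]_(t in A) `|(f z t)%:E|)%E.
  have ma : measurable_fun setT (fun y : R => `|y%:E|%E).
    by apply: measurableT_comp => //; exact/measurable_EFinP.
  exact: (measurable_integral_density mf mA ma (fun y => abse_ge0 _)).
have gfin : (\int[G]_z \int[leb]_t `|g (z, t)| < +oo)%E.
  under eq_integral do rewrite gE.
  rewrite ge0_integralZl ?lee_fin ?(ltW c_gt0)//; last by move=> z _; exact: integral_ge0.
  by rewrite lte_mul_pinfty ?lee_fin ?(ltW c_gt0)// fld_abs_integral.
have ig : (G \x lam2 R)%E.-integrable setT g.
  by apply/(@integrable12ltyP _ _ _ _ R G (lam2 R) g mg).
have FE : {ae G, forall z, (Ffld z A)%:E = \int[leb]_t g (z, t)}%E.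
  apply: ae_imp Ffld_dens => z [_ H]; rewrite (H A bA) (int_mk A).
  by apply: eq_integral => t _; rewrite -EFinM.
have mGg : measurable_fun setT (fun z => \int[leb]_t g (z, t))%E.
  exact: (measurable_int _ (@integrable_fubini_F _ _ _ _ R G (lam2 R) g ig)).
split.
  apply/integrableP; split => //.
  apply: le_lt_trans gfin; apply: le_lower_integral_ae.
  - by move=> z; exact: abse_ge0.
  - by move=> z; exact: integral_ge0.
  apply: ae_imp FE => z ->; apply: le_abse_integral => //.
  exact: (measurableT_comp mg (measurable_pair1 z)).
rewrite (ae_eq_integral (fun z => \int[leb]_t g (z, t))%E)//; last by apply: ae_imp FE => z zE _.
rewrite (@Fubini _ _ _ _ R G (lam2 R) g ig).
rewrite (ae_eq_integral (cst 0%E))//; first by rewrite integral0.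
  exact: (@measurable_fubini_G _ _ _ _ R G (lam2 R) g ig).
apply: (ae_imp _ (filterI fld_mean fld_abs)) => t [ft fa] _ /=; rewrite /g /cfld/=.
have It : G.-integrable setT (fun z => (f z t)%:E).
  apply/integrableP; split; last by apply: le_lt_trans fa _; rewrite ltry.
  by apply/measurable_EFinP; exact: (measurableT_comp mf (measurable_pair2 t)).
under eq_integral do rewrite mulrAC EFinM.
by rewrite integralZl// ft mule0.
Qed.

(** With [la = c / th], Jensen's inequality on the unit cell and [expeR_interp] give the bound
    [1 - la + la * K], where [la * K <= 1]. *)
Lemma fld_cell s1 s2 : c <= th / K ->
  (\int[G]_z expeR (\int[leb]_(t in cell s1 s2) `|(cfld z t)%:E|) <= 2%:E)%E.
Proof.
move=> cle; pose C : set R2 := cell s1 s2; have mC : measurable C by exact: measurable_cell.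
have ma z : measurable_fun setT (fun t : R2 => `|(cfld z t)%:E|%E).
  by apply: measurableT_comp => //; apply/measurable_EFinP;
    exact: (measurableT_comp measurable_cfld (measurable_pair1 z)).
pose g (x : paths R l2 * R2) := ((expR (th * `|f x.1 x.2|))%:E * (\1_C x.2)%:E)%E.
have mg : measurable_fun setT g.
  apply: emeasurable_funM; last by apply/measurable_EFinP; exact: (measurableT_comp (measurable_indic mC) measurable_snd).
  apply/measurable_EFinP; apply: measurableT_comp => //; apply: measurable_funM => //; exact: measurableT_comp.
have g0 x : (0 <= g x)%E by rewrite mule_ge0// lee_fin expR_ge0.
pose la := c / th; have la0 : 0 < la by rewrite divr_gt0.
have laK : la * K <= 1 by rewrite /la mulrAC ler_pdivrMr// mul1r -ler_pdivlMr.
have la1 : la <= 1 by apply: le_trans laK; rewrite ler_peMr// ltW.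
have mgi : measurable_fun setT (fun z => \int[leb]_t g (z, t))%E.
  exact: (@measurable_fun_fubini_tonelli_F _ _ _ _ R (lam2 R) g).
have gi0 z : (0 <= \int[leb]_t g (z, t))%E by exact: integral_ge0.
apply: (@le_trans _ _ (\int[G]_z ((1 - la)%:E + la%:E * \int[leb]_t g (z, t)))%E).
  apply: le_lower_integral => z; first exact: expeR_ge0.
  have E : (\int[leb]_(t in C) `|(cfld z t)%:E| = la%:E * \int[leb]_(t in C) (th * `|f z t|)%:E)%E.
    rewrite -ge0_integralZl ?lee_fin ?(ltW la0)//; last 2 first.
    - apply: measurable_funTS; apply/measurable_EFinP; apply: measurable_funM => //; apply: measurableT_comp => //.
      exact: (measurableT_comp mf (measurable_pair1 z)).
    - by move=> t _; rewrite lee_fin mulr_ge0// ltW.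
    apply: eq_integral => t _; rewrite -EFinM /cfld /= normrM (gtr0_norm c_gt0) /la mulrA divfK//.
    by rewrite gt_eqF.
  rewrite E; apply: le_trans (expeR_interp la0 la1 _) _.
    by apply: integral_ge0 => t _; rewrite lee_fin mulr_ge0// ltW.
  apply: leeD => //; apply: lee_pmul => //; rewrite ?lee_fin ?(ltW la0) ?expeR_ge0//.
  have mt : measurable_fun setT (fun t : R2 => (th * `|f z t|)%:E).
    apply/measurable_EFinP; apply: measurable_funM => //; apply: measurableT_comp => //.
    exact: (measurableT_comp mf (measurable_pair1 z)).
  apply: le_trans (expeR_jensen mC (leb2_cell s1 s2) mt _) _.
    by move=> t; rewrite lee_fin mulr_ge0// ltW.
  by rewrite (int_mk C).
rewrite ge0_integralD//; last 3 first.
- by move=> z _; rewrite lee_fin subr_ge0.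
- by move=> z _; rewrite mule_ge0// lee_fin ltW.
- exact: measurable_funeM.
rewrite (Ex_EFin G (@mb_cst _ _ R (1 - la))) Ex_cst ge0_integralZl ?lee_fin ?(ltW la0)//.
rewrite (@fubini_tonelli _ _ _ _ R G (lam2 R) g mg g0).
apply: (@le_trans _ _ ((1 - la)%:E + la%:E * K%:E)%E); last first.
  by rewrite -EFinM -EFinD lee_fin; have := ltW la0; lra.
apply: leeD => //; apply: lee_pmul => //; rewrite ?lee_fin ?(ltW la0)//.
  by apply: integral_ge0 => t _; exact: integral_ge0.
apply: (@le_trans _ _ (\int[leb]_t (K%:E * (\1_C t)%:E))%E).
  apply: le_lower_integral_ae.
  - by move=> t; exact: integral_ge0.
  - by move=> t; rewrite mule_ge0 ?lee_fin ?(ltW K0).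
  apply: ae_imp fld_exp => t ft; rewrite /g /=; under eq_integral do rewrite muleC.
  rewrite ge0_integralZl ?lee_fin//; last first.
    apply/measurable_EFinP; apply: measurableT_comp => //; apply: measurable_funM => //; apply: measurableT_comp => //.
    exact: (measurableT_comp mf (measurable_pair2 t)).
  by rewrite muleC; apply: lee_pmul => //; apply: integral_ge0 => z _; rewrite lee_fin expR_ge0.
rewrite ge0_integralZl ?lee_fin ?(ltW K0)//; last by apply/measurable_EFinP; exact: measurable_indic.
by rewrite integral_indic// setIT [X in (_ * X)%E]leb2_cell mule1.
Qed.

End stationary_field.

Section law_of_modification.
Context (R : realType) d (T : measurableType d) (P : probability T R).
Context d' (T' : measurableType d') (Q : probability T' R).

Lemma same_law_ae (X : {RV P >-> lfsm R}) (V : {RV Q >-> lfsm R}) h (Ph : mp P Q h) :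
  {ae P, forall x, X x = V (h x)} -> same_law X V.
Proof.
move=> XV E mE; rewrite [RHS](rvcomp_law V Ph mE) /distribution /pushforward.
have m1 (W : {RV P >-> lfsm R}) : measurable (W @^-1` E).
  by rewrite -[_ @^-1` _]setTI; exact: measurable_funP.
have E1 (W : {RV P >-> lfsm R}) : P (W @^-1` E) = (\int[P]_x (\1_(W @^-1` E) x)%:E)%E.
  by rewrite (integral_indic P measurableT (m1 W)) setIT.
rewrite [RHS]E1 [LHS]E1.
apply: ae_eq_integral => //.
- by apply/measurable_EFinP; apply: measurable_indic; exact: m1.
- by apply/measurable_EFinP; apply: measurable_indic; exact: m1.
apply: ae_imp XV => x xE _; rewrite !indicE; congr ((_ : bool)%:R%:E).
by rewrite /in_mem/=; congr asbool; rewrite /preimage/= xE.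
Qed.

End law_of_modification.

(** * Shifted and swapped kernels *)

Section transported_model.
Context dS (S : measurableType dS) (R : realType).
Variable mu : {measure set S -> \bar R}.
Notation l2 := (l2 mu).
Notation R2 := (measurableTypeR R * measurableTypeR R)%type.
Notation leb := (@leb2 R).
Variables (Ic : finType) (c0 be v : R) (Jf : R -> R).
Variables (G : probability (paths R l2) R).
Variables (kap : Ic -> R * R -> l2) (pos : S -> R * R) (Gt : Ic -> paths R l2 * R2 -> R).

(** Shifting the argument of the kernels and the positions of the noise points together preserves
    all distances. The line t1 = r becomes t1 = 0 while the noise and its law stay the same;
    [kmodel_swap] does this for the exchange of coordinates. *)
Lemma kmodel_shift r : kmodel c0 be v Jf kap pos ->
  kmodel c0 be v Jf (fun c t => kap c (t.1 + r, t.2)) (fun s => ((pos s).1 - r, (pos s).2)).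
Proof.
move=> [mpos mk bk ik ok vk].
have E (t : R * R) s : `|t - ((pos s).1 - r, (pos s).2)| = `|(t.1 + r, t.2) - pos s|.
  by rewrite !prod_normE/= opprB addrCA addrC addrAC.
split.
- apply: (measurable_fun_pair (f := fun s => (pos s).1 - r) (g := fun s => (pos s).2)).
    by apply: measurable_funB; [exact: (measurableT_comp measurable_fst mpos)|exact: measurable_cst].
  exact: (measurableT_comp measurable_snd mpos).
- move=> c; have h : measurable_fun setT (fun x : R2 * S => ((x.1.1 + r, x.1.2) : R2, x.2)).
    apply: measurable_fun_pair; last exact: measurable_snd.
    have h := measurableT_comp (measurable_shift2 (r, 0)) (@measurable_fst _ _ R2 S).
    by move: h; congr measurable_fun; apply/funext => x /=; rewrite addr0.
  exact: (measurableT_comp (mk c) h).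
- by move=> c t s; rewrite E; exact: bk.
- by move=> q t q2; under eq_integral do rewrite E; exact: ik.
- move=> c c' t H mA cc; exact: (ok c c' (t.1 + r, t.2) [set p | H (p.1 - r, p.2)] mA cc).
- by move=> c t; exact: vk.
Qed.

Lemma kmodel_swap : kmodel c0 be v Jf kap pos ->
  kmodel c0 be v Jf (fun c t => kap c (t.2, t.1)) (fun s => ((pos s).2, (pos s).1)).
Proof.
move=> [mpos mk bk ik ok vk].
have E (t : R * R) s : `|t - ((pos s).2, (pos s).1)| = `|(t.2, t.1) - pos s|.
  by rewrite !prod_normE/= maxC.
split.
- exact: (measurableT_comp (@measurable_swap2 R) mpos).
- move=> c; have h : measurable_fun setT (fun x : R2 * S => ((x.1.2, x.1.1) : R2, x.2)).
    apply: measurable_fun_pair; last exact: measurable_snd.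
    exact: (measurableT_comp (@measurable_swap2 R) (@measurable_fst _ _ R2 S)).
  exact: (measurableT_comp (mk c) h).
- by move=> c t s; rewrite E; exact: bk.
- by move=> q t q2; under eq_integral do rewrite E; exact: ik.
- move=> c c' t H mA cc; exact: (ok c c' (t.2, t.1) [set p | H (p.2, p.1)] mA cc).
- by move=> c t; exact: vk.
Qed.

Lemma version_shift r : version G kap Gt ->
  version G (fun c t => kap c (t.1 + r, t.2)) (fun c x => Gt c (x.1, (x.2.1 + r, x.2.2))).
Proof.
move=> vG c; split.
  have h : measurable_fun setT (fun x : paths R l2 * R2 => (x.1, (x.2.1 + r, x.2.2) : R2)).
    apply: measurable_fun_pair; first exact: measurable_fst.
    have h := measurableT_comp (measurable_shift2 (r, 0)) (@measurable_snd _ _ (paths R l2) R2).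
    by move: h; congr measurable_fun; apply/funext => x /=; rewrite addr0.
  exact: (measurableT_comp (vG c).1 h).
by apply: ae_imp (ae_shift (r, 0) (vG c).2) => t; rewrite /= addr0.
Qed.

Lemma version_swap : version G kap Gt ->
  version G (fun c t => kap c (t.2, t.1)) (fun c x => Gt c (x.1, (x.2.2, x.2.1))).
Proof.
move=> vG c; split; last exact: ae_swap (vG c).2.
have h : measurable_fun setT (fun x : paths R l2 * R2 => (x.1, (x.2.2, x.2.1) : R2)).
  apply: measurable_fun_pair; first exact: measurable_fst.
  exact: (measurableT_comp (@measurable_swap2 R) (@measurable_snd _ _ (paths R l2) R2)).
exact: (measurableT_comp (vG c).1 h).
Qed.

End transported_model.

Section splittable_field.
Context dS (S : measurableType dS) (R : realType).
Variable mu : {measure set S -> \bar R}.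
Notation l2 := (l2 mu).
Notation R2 := (measurableTypeR R * measurableTypeR R)%type.
Notation leb := (@leb2 R).
Variables (Ic : finType) (c0 be v : R) (Jf : R -> R).
Variables (e : nat -> l2) (G : probability (paths R l2) R) (psi : paths R Ic -> R) (C de : R).
Hypotheses (c0_ge0 : 0 <= c0) (Jf_ge0 : forall q, 0 <= Jf q).
Hypotheses (wG : white G) (e_on : forall i j, ip (e i) (e j) = (i == j)%:R).
Hypotheses (v0 : 0 < v) (C0 : 0 <= C) (de0 : 0 < de) (de1 : de <= 1) (be_de : 1 + 2 / de < be).
Hypothesis mpsi : measurable_fun setT psi.
Hypothesis psiH : forall h y : paths R Ic,
  (\int[G]_z (expR `|psi (fun c => (Num.sqrt v * z (e (eidx 0 c)) + h c + y c) / 2) -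
                     psi (fun c => (Num.sqrt v * z (e (eidx 0 c)) + h c - y c) / 2)|)%:E
   <= (expR (C * (\sum_c `|y c|) `^ de))%:E)%E.
Variables (th K : R).
Hypotheses (th0 : 0 < th) (K1 : 1 <= K).
Hypothesis psi0_exp : (\int[G]_z (expR (th * `|psi0 v e psi z|))%:E <= K%:E)%E.
Hypothesis psi0_mean : (\int[G]_z (psi0 v e psi z)%:E = 0)%E.
Variables (kap : Ic -> R * R -> l2) (pos : S -> R * R) (Gt : Ic -> paths R l2 * R2 -> R).
Hypotheses (km : kmodel c0 be v Jf kap pos) (vG : version G kap Gt).
Context d (T : measurableType d) (P : probability T R) (z : T -> paths R l2) (Pz : mp P G z).

Lemma fld_field_exists : exists X : {RV P >-> lfsm R}, {ae P, forall x, dens (X x) (fld psi Gt (z x))}.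
Proof.
exists (rvcomp (Ffld mpsi vG 1) Pz).
apply: (ae_imp _ (mp_ae Pz (Ffld_dens wG e_on v0 mpsi km vG th0 K1 psi0_exp 1))) => x.
by apply: dens_ext => t; rewrite /cfld mul1r.
Qed.

Lemma fld_splittable (X : {RV P >-> lfsm R}) :
  {ae P, forall x, dens (X x) (fld psi Gt (z x))} -> splittable X.
Proof.
move=> Xd; have [ep1 ep10 epb1] := glue_diff_bound c0_ge0 Jf_ge0 wG e_on v0 C0 de0 de1 be_de mpsi psiH.
have K0 : 0 < K by exact: lt_le_trans K1.
(* The first bound serves the leaks; the second ensures [ep / 16 <= th / K], as [fld_cell]
   requires. *)
pose ep := Num.min ep1 (16 * (th / K)).
have ep0 : 0 < ep by rewrite lt_min ep10 mulr_gt0// divr_gt0.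
have epb kap' pos' (H Q : set R2) (mA : measurable (pos' @^-1` H)) Gt' :
    kmodel c0 be v Jf kap' pos' -> ctrl pos' H Q -> measurable Q -> version G kap' Gt' ->
    (\int[pprod G G]_w expeR (ep%:E * \int[leb]_(t in Q) (glue_diff psi Gt' mA w t)%:E) <= 2%:E)%E.
  move=> km' cQ mQ vG'; apply: le_trans (epb1 kap' pos' H Q mA Gt' km' cQ mQ vG').
  apply: le_lower_integral => w; first exact: expeR_ge0.
  rewrite lee_expeR; apply: lee_wpmul2r; last by rewrite lee_fin ge_min lexx.
  by apply: integral_ge0 => t _; rewrite lee_fin; exact: normr_ge0.
pose c := ep / 16; have c0' : 0 < c by rewrite divr_gt0.
have cle : c <= th / K by rewrite ler_pdivrMr// mulrC ge_min lexx orbT.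
have Xcd : {ae P, forall x, dens (rf_scale c X x) (cfld psi Gt c (z x))}.
  by apply: ae_imp Xd => x dx; exact: (dens_scale c dx).
(* Stated for an arbitrary model with the same constants, since it is applied both to the shifted
   kernels and to those swapped and then shifted. *)
have leak kap' pos' Gt' (km' : kmodel c0 be v Jf kap' pos') (vG' : version G kap' Gt')
    (X' : {RV P >-> lfsm R}) : {ae P, forall x, dens (X' x) (cfld psi Gt' c (z x))} ->
    exists (d' : measure_display) (T' : measurableType d') (P' : probability T' R)
      (Y : {RV P' >-> lfsm R}), is_leak X' Y /\ splittable11 (rf_swap Y).
  move=> dX'; pose F := Ffld mpsi vG' c.
  have Fd : {ae G, forall z, dens (F z) (cfld psi Gt' c z)}.
    exact: (Ffld_dens wG e_on v0 mpsi km' vG' th0 K1 psi0_exp c).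
  apply: (leak_splittable (f := fld psi Gt') (pos := pos') (ep := ep) (F := F) wG) => //.
  - by have h := measurable_fld mpsi vG'; exact: h.
  - exact: km_pos km'.
  - by move=> H Q mA cQ mQ; exact: (epb _ _ _ _ _ _ km' cQ mQ vG').
  - exact: (Ffld_zmean wG e_on v0 mpsi km' vG' th0 K1 psi0_exp psi0_mean c0').
  apply: (same_law_ae Pz); apply: (ae_imp _ (filterI dX' (mp_ae Pz Fd))) => x [dx dFx].
  exact: dens_unique dx dFx.
exists c^-1; rewrite invr_gt0 invrK; split => //; split.
- move=> s1 s2; pose m z := (\int[leb]_(t in cell s1 s2) `|(cfld psi Gt c z t)%:E|)%E.
  apply: (@exp_moment_dens _ _ _ _ _ _ (fun x => m (z x))).
  + exact: measurable_cell.
  + by move=> x; exact: integral_ge0.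
  + by apply: ae_imp Xcd => x dx; exists (cfld psi Gt c (z x)).
  + rewrite (mp_integral Pz (f := fun z => expeR (m z))).
    * exact: (fld_cell wG e_on v0 mpsi km vG th0 K1 psi0_exp c0').
    * apply: measurable_expeR; last by move=> z'; exact: integral_ge0.
      have ma : measurable_fun setT (fun y : R => `|y%:E|%E).
        by apply: measurableT_comp => //; exact/measurable_EFinP.
      exact: (measurable_integral_density (measurable_cfld mpsi vG c) (measurable_cell s1 s2) ma (fun y => abse_ge0 _)).
    * by move=> z'; exact: expeR_ge0.
- pose F := Ffld mpsi vG c.
  have Fd := Ffld_dens wG e_on v0 mpsi km vG th0 K1 psi0_exp c.
  have Fz := Ffld_zmean wG e_on v0 mpsi km vG th0 K1 psi0_exp psi0_mean c0'.
  move=> A bA; have mV (W : {RV P >-> lfsm R}) : measurable_fun setT (fun x => (W x A)%:E).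
    have mW : measurable_fun setT W by exact: measurable_funP.
    by apply/measurable_EFinP; exact: (measurableT_comp (@measurable_lfval R A) mW).
  rewrite -[RHS](zmean_centered (zmean_comp Pz Fz) bA).
  apply: ae_eq_integral => //.
  + apply: (ae_imp _ (filterI Xcd (mp_ae Pz Fd))) => x [dx dFx] _.
    by rewrite (dens_unique dx dFx).
- move=> r; split.
    apply: (leak _ _ _ (kmodel_shift r km) (version_shift r vG)).
    by apply: ae_imp Xcd => x dx; exact: (dens_shift r dx).
  apply: (leak _ _ _ (kmodel_shift r (kmodel_swap km)) (version_shift r (version_swap vG))).
  by apply: ae_imp Xcd => x dx; exact: (dens_shift r (dens_swap dx)).
Qed.

End splittable_field.

(** * Fields driven by a noise *)

Section modifications.
Context d (T : measurableType d) (R : realType) (mu : {measure set T -> \bar R}).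

(** The countably many sets [f < q] with rational [q] are Borel up to null sets, and [f] is replaced
    by 0 on the union [N] of the exceptional sets. *)
Lemma lebesgue_modification (f : T -> R) : lebesgue_measurable mu f ->
  exists (g : T -> R) (N : set T), [/\ measurable_fun setT g, measurable N, mu N = 0%E &
    forall x, ~ N x -> f x = g x].
Proof.
move=> lf.
have H (q : rat) : exists AN : set T * set T, [/\ measurable AN.1, measurable AN.2,
    mu AN.2 = 0%E & forall x, ~ AN.2 x -> (AN.1 x <-> f x < ratr q)].
  have [A mA [N0 [N [mN N00 N0N]] E]] := lf _ (@measurable_itv R `]-oo, (ratr q : R)[).
  exists (A, N); split => //= x Nx.
  have E' : (A `|` N0) x <-> f x < ratr q by rewrite E /= in_itv.
  by split => [Ax|/E'[//|/N0N]//]; apply/E'; left.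
have {H}[AN H] := choice H.
pose Nq n := if unpickle n is Some q then (AN q).2 else set0.
pose N := \bigcup_n Nq n.
have mNq n : measurable (Nq n) by rewrite /Nq; case: unpickle => // q; have [] := H q.
have mN : measurable N by exact: bigcupT_measurable.
have N0 : mu N = 0%E.
  apply: measure_negligible => //; apply: negligible_bigcup => n.
  exists (Nq n); split => //; rewrite /Nq; case: unpickle => [q|]; last exact: measure0.
  by have [] := H q.
have NP x q : ~ N x -> ((AN q).1 x <-> f x < ratr q).
  move=> Nx; have [_ _ _ Hq] := H q; apply: (Hq x) => ANx; apply: Nx.
  have E : Nq (pickle q) = (AN q).2 by rewrite /Nq pickleK.
  by exists (pickle q); [exact: Logic.I|rewrite E].
exists (fun x => f x * \1_(~` N) x), N; split => //; last first.
  by move=> x Nx; rewrite indicE mem_set// mulr1.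
apply: (measurability _ (@RGenInftyO.measurableE R)) => _ [_ [a ->] <-]; rewrite setTI.
(* Off [N], a value lies below [a] exactly when it lies below some rational [q <= a]; on [N] the
   value is 0, which lies below [a] exactly when [0 < a]. *)
rewrite (_ : _ @^-1` _ =
  (\bigcup_q (if ratr q <= a then (AN q).1 `\` N else set0)) `|` (if 0 < a then N else set0)).
  apply: measurableU; last by case: ifP.
  apply: bigcupT_measurable_rat => q; case: ifP => // _; apply: measurableD => //.
  by have [] := H q.
apply/seteqP; split => x /=; rewrite in_itv/= indicE.
  have [Nx|Nx] := pselect (N x).
    by rewrite memNset ?mulr0 => [a0|/(_ Nx)//]; right; rewrite a0.
  rewrite mem_set// mulr1 => fa; left; have /rat_in_itvoo[q] := fa.
  rewrite in_itv/= => /andP[fq qa]; exists q => //; rewrite (ltW qa); split => //.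
  by apply/NP.
case=> [[q _]|]; last first.
  by case: ifP => // a0 Nx; rewrite memNset ?mulr0//= => /(_ Nx).
by case: ifP => // qa [Aq Nx]; rewrite mem_set// mulr1; apply: lt_le_trans qa; apply/NP.
Qed.

Lemma ae_lower_integral (f h : T -> \bar R) : {ae mu, forall x, f x = h x} ->
  (\int[mu]_x f x = \int[mu]_x h x)%E.
Proof.
move=> fh; rewrite integralE [RHS]integralE; congr (_ - _)%E; apply/eqP; rewrite eq_le; apply/andP; split;
  apply: le_lower_integral_ae => //; apply: ae_imp fh => x fhx; by rewrite ?funeposE ?funenegE fhx.
Qed.

Lemma lebesgue_measurable_ae (f h : T -> R) : measurable_fun setT h ->
  {ae mu, forall x, f x = h x} -> lebesgue_measurable mu f.
Proof.
move=> mh [N [mN N0 fhN]] A mA; exists ((h @^-1` A) `\` N).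
  by apply: measurableD => //; rewrite -[_ @^-1` _]setTI; exact: mh.
exists (f @^-1` A `&` N); first by exists N; split => // x [].
have fh x : ~ N x -> f x = h x by move=> Nx; apply: contrapT => ne; apply: Nx; exact: fhN.
apply/seteqP; split => x /=.
  by move=> [[hx Nx]|[]//]; rewrite fh.
by move=> fx; have [Nx|Nx] := pselect (N x); [right|left; rewrite -fh].
Qed.

End modifications.

Section fubini_null_sets.
Context d (T : measurableType d) d' (U : measurableType d') (R : realType).
Variables (P : {sigma_finite_measure set T -> \bar R}) (nu : {sigma_finite_measure set U -> \bar R}).

(** Tonelli for the indicator of [D]: sections that are null for almost every [t] make [D] null in
    the product, hence null along almost every [x]. *)
Lemma ae_fubini (D : set (T * U)) : measurable D ->
  {ae nu, forall t, {ae P, forall x, ~ D (x, t)}} -> {ae P, forall x, {ae nu, forall t, ~ D (x, t)}}.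
Proof.
move=> mD D0; pose g (p : T * U) : \bar R := (\1_D p)%:E.
have mg : measurable_fun setT g by apply/measurable_EFinP; exact: measurable_indic.
have g0 p : (0 <= g p)%E by rewrite lee_fin.
have I0 : (\int[P]_x \int[nu]_t g (x, t) = 0)%E.
  rewrite (@fubini_tonelli _ _ _ _ R P nu g mg g0).
  rewrite (ae_lower_integral (h := cst 0%E)) ?integral0//.
  apply: ae_imp D0 => t Dt; rewrite (ae_lower_integral (h := cst 0%E)) ?integral0//.
  by apply: ae_imp Dt => x Dx; rewrite /g indicE memNset.
have mF : measurable_fun setT (fun x => \int[nu]_t g (x, t))%E.
  exact: (@measurable_fun_fubini_tonelli_F _ _ _ _ R nu g).
have F0 x : (0 <= \int[nu]_t g (x, t))%E by exact: integral_ge0.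
have /(ae_eq_integral_abs P measurableT mF) H : (\int[P]_x `|\int[nu]_t g (x, t)| = 0)%E.
  by under eq_integral do rewrite gee0_abs//.
apply: ae_imp H => x /(_ Logic.I) Hx.
have mx : measurable_fun setT (fun t => g (x, t)) by exact: (measurableT_comp mg (measurable_pair1 x)).
have /(ae_eq_integral_abs nu measurableT mx) : (\int[nu]_t `|g (x, t)| = 0)%E.
  by under eq_integral do rewrite gee0_abs//.
apply: ae_imp => t /(_ Logic.I); rewrite /g indicE => Dx Dxt.
by move: Dx; rewrite mem_set// => -[/eqP]; rewrite oner_eq0.
Qed.

End fubini_null_sets.

Section identified_density.
Variable R : realType.
Notation R2 := (measurableTypeR R * measurableTypeR R)%type.
Notation leb := (@leb2 R).
Implicit Types (X : lfsm R) (f h : R2 -> R).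

Lemma ae_lower_integral_on (B : set R2) (f h : R2 -> \bar R) : {ae leb, forall t, f t = h t} ->
  (\int[leb]_(t in B) f t = \int[leb]_(t in B) h t)%E.
Proof.
move=> fh; rewrite !(int_mk B); apply: ae_lower_integral; apply: ae_imp fh => t -> //.
Qed.

(** Together with [identified_dens] this passes between [identified_with], whose functions are only
    Lebesgue measurable in time, and Borel densities. *)
Lemma dens_identified X f h : dens X h -> {ae leb, forall t, f t = h t} ->
  Defs.locally_integrable f /\
  forall B, bounded_borel B -> ((X B)%:E = \int[leb]_(t in B) (f t)%:E)%E.
Proof.
move=> [[mh lh] Xh] fh; split.
  split; first exact: lebesgue_measurable_ae mh fh.
  move=> B bB; rewrite (@ae_lower_integral_on B _ (fun t => `|(h t)%:E|%E)) ?lh//.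
  by apply: ae_imp fh => t ->.
by move=> B bB; rewrite Xh//; apply: ae_lower_integral_on; apply: ae_imp fh => t ->.
Qed.

Lemma identified_dens X f h : measurable_fun setT h -> {ae leb, forall t, f t = h t} ->
  Defs.locally_integrable f ->
  (forall B, bounded_borel B -> ((X B)%:E = \int[leb]_(t in B) (f t)%:E)%E) -> dens X h.
Proof.
move=> mh fh [_ lf] Xf; split.
  split => // B bB; have := lf B bB.
  rewrite (@ae_lower_integral_on B _ (fun t => `|(h t)%:E|%E))//.
  by apply: ae_imp fh => t ->.
by move=> B bB; rewrite Xf//; apply: ae_lower_integral_on; apply: ae_imp fh => t ->.
Qed.

End identified_density.

Lemma isG_push (R : realType) d1 (T1 : measurableType d1) d2 (T2 : measurableType d2)
    (P1 : probability T1 R) (P2 : probability T2 R) h Z v :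
  mp P1 P2 h -> measurable_fun setT Z -> isG P1 (fun t => Z (h t)) v -> isG P2 Z v.
Proof.
move=> mph mZ [v0 _ GZ]; split => // x; have [cZ sZ] := GZ x.
have mk : measurable_fun setT (fun t => x * Z t) by exact: measurable_funM.
by rewrite -cZ -sZ -(mp_Ex mph (mb_cos mk)) -(mp_Ex mph (mb_sin mk)).
Qed.

Section isonormal.
Context dS (S : measurableType dS) (R : realType).
Variable mu : {sigma_finite_measure set S -> \bar R}.
Notation l2 := (l2 mu).
Notation R2 := (measurableTypeR R * measurableTypeR R)%type.
Notation leb := (@leb2 R).
Context d (T : measurableType d) (P : probability T R).

Definition isonormal (W : l2 -> T -> R) := (forall f, measurable_fun setT (W f)) /\
  forall s, isG P (fun x => linform s (W^~ x)) (ip (l2lin s) (l2lin s)).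

Variables (W : l2 -> T -> R) (iW : isonormal W).

(** The passage from the sample space to path space, where independent copies of the noise are
    available as products. *)
Lemma noise_law : exists2 G : probability (paths R l2) R,
  white G & mp P G (fun x => (W^~ x : paths R l2)).
Proof.
have mz : measurable_fun setT (fun x => (W^~ x : paths R l2)).
  by apply: measurable_pathsP => f; exact: iW.1.
pose z : {mfun T >-> paths R l2} := mfun_Sub (mem_set mz).
have Pz : mp P (distribution P z) z by split.
exists (distribution P z) => //= s; apply: (isG_push Pz); first exact: measurable_linform.
exact: iW.2.
Qed.

Variables (Ic : finType) (c0 be v : R) (Jf : R -> R).
Variables (e : nat -> l2) (psi : paths R Ic -> R) (C de : R).
Hypotheses (c0_ge0 : 0 <= c0) (Jf_ge0 : forall q, 0 <= Jf q).
Hypothesis e_on : forall i j, ip (e i) (e j) = (i == j)%:R.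
Hypotheses (v0 : 0 < v) (C0 : 0 <= C) (de0 : 0 < de) (de1 : de <= 1) (be_de : 1 + 2 / de < be).
Hypothesis mpsi : measurable_fun setT psi.
Hypothesis psiH : forall G : probability (paths R l2) R, white G -> forall h y : paths R Ic,
  (\int[G]_z (expR `|psi (fun c => (Num.sqrt v * z (e (eidx 0 c)) + h c + y c) / 2) -
                     psi (fun c => (Num.sqrt v * z (e (eidx 0 c)) + h c - y c) / 2)|)%:E
   <= (expR (C * (\sum_c `|y c|) `^ de))%:E)%E.
Variables (th K : R).
Hypotheses (th0 : 0 < th) (K1 : 1 <= K).
Hypothesis psi0_exp : forall G : probability (paths R l2) R, white G ->
  (\int[G]_z (expR (th * `|psi0 v e psi z|))%:E <= K%:E)%E.
Hypothesis psi0_mean : forall G : probability (paths R l2) R, white G ->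
  (\int[G]_z (psi0 v e psi z)%:E = 0)%E.
Variables (kap : Ic -> R * R -> l2) (pos : S -> R * R).
Hypothesis km : kmodel c0 be v Jf kap pos.
Variable Gf : Ic -> T -> R2 -> R.
Hypothesis mGf : forall c, measurable_fun setT (fun p : T * R2 => Gf c p.1 p.2).
Hypothesis GfW : forall c t, {ae P, forall x, Gf c x t = W (kap c t) x}.
Variables (f : T -> R2 -> R) (N : set (paths R Ic)).
Hypothesis mN : measurable N.
Hypothesis N0 : forall t, {ae P, forall x, ~ N (fun c => Gf c x t)}.
Hypothesis fE : forall x t, ~ N (fun c => Gf c x t) -> f x t = psi (fun c => Gf c x t).

(** The given version [Gf] on the sample space and the version [Gt] on path space are both jointly
    measurable, and at almost every time they agree almost surely. By [ae_fubini], almost every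
    realization then agrees at almost every time, which is what densities see. *)
Lemma noise_field_splittable : is_splittable_field P f.
Proof.
have [G wG Pz] := noise_law; pose z (x : T) : paths R l2 := W^~ x.
have [mz _] := Pz.
have /choice[Gt HGt] (c : Ic) : exists Gt : paths R l2 * R2 -> R, measurable_fun setT Gt /\
    forall G : probability (paths R l2) R, white G ->
      {ae lam2 R, forall t, {ae G, forall z, Gt (z, t) = z (kap c t)}}.
  apply: (path_version (lam2 R) (c := v)); first exact: (km_meas km c).
  by move=> t; rewrite (km_var km).
have vG : version G kap Gt by move=> c; split; [exact: (HGt c).1|exact: ((HGt c).2 G wG)].
have mGt c : measurable_fun setT (fun p : T * R2 => Gt c (z p.1, p.2)).
  apply: (measurableT_comp (HGt c).1); apply: measurable_fun_pair; last exact: measurable_snd.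
  exact: (measurableT_comp mz measurable_fst).
(* The exceptional set contains, besides the disagreement of the two versions, the points whose
   state lies in [N], where the original function may differ from the Borel function [psi]. *)
pose D : set (T * R2) := [set p | N (fun c => Gf c p.1 p.2)] `|`
  \bigcup_(c in [set: Ic]) [set p | Gt c (z p.1, p.2) != Gf c p.1 p.2].
have mD : measurable D.
  apply: measurableU.
    have h : measurable_fun setT (fun p : T * R2 => (fun c => Gf c p.1 p.2) : paths R Ic).
      by apply: measurable_pathsP => c; exact: mGf.
    by rewrite -[X in measurable X]setTI; exact: h.
  apply: fin_bigcup_measurable => // c _; apply: measurable_set_bool; apply: measurable_neg.
  exact: measurable_fun_eqr.
have D0 : {ae P, forall x, {ae lam2 R, forall t, ~ D (x, t)}}.
  apply: (ae_fubini mD).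
  have aeG : {ae lam2 R, forall t, forall c, {ae G, forall z, Gt c (z, t) = z (kap c t)}}.
    by apply: filter_forall => c; exact: (vG c).2.
  apply: ae_imp aeG => t Gtt.
  have aeP : {ae P, forall x, ~ N (fun c => Gf c x t) /\
      (forall c, Gt c (z x, t) = z x (kap c t) /\ Gf c x t = W (kap c t) x)}.
    have H : {ae P, forall x, forall c, Gt c (z x, t) = z x (kap c t) /\ Gf c x t = W (kap c t) x}.
      by apply: filter_forall => c; apply: (filterI (mp_ae Pz (Gtt c)) (GfW c t)).
    exact: (filterI (N0 t) H).
  apply: ae_imp aeP => x [Nx H] [//|[c _ /=]].
  by have [-> ->] := H c; rewrite eqxx.
have fh : {ae P, forall x, {ae leb, forall t, f x t = fld psi Gt (z x) t}}.
  apply: ae_imp D0 => x; apply: ae_imp => t Dxt; rewrite fE; last by move=> Nx; apply: Dxt; left.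
  rewrite /fld; congr psi; apply/funext => c; apply: contrapT => ne; apply: Dxt; right; exists c => //=.
  by apply/eqP => E; apply: ne.
have mfx x : measurable_fun setT (fld psi Gt (z x)).
  exact: (measurableT_comp (measurable_fld mpsi vG) (measurable_pair1 (z x))).
split.
  have [X dX] := fld_field_exists wG e_on v0 mpsi th0 K1 (psi0_exp wG) km vG Pz.
  exists X; apply: (ae_imp _ (filterI dX fh)) => x [dx fx].
  exact: dens_identified dx fx.
move=> X Xf.
apply: (fld_splittable c0_ge0 Jf_ge0 wG e_on v0 C0 de0 de1 be_de mpsi (psiH wG) th0 K1
  (psi0_exp wG) (psi0_mean wG) km vG Pz).
apply: (ae_imp _ (filterI Xf fh)) => x [[lf Xx] fx].
exact: identified_dens fx lf Xx.
Qed.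

End isonormal.

Lemma maxe_pMr_fin (R : realType) (a r : R) : 0 <= r ->
  (maxe a%:E 0 * r%:E = maxe (a * r)%:E 0)%E.
Proof. by move=> r0; rewrite -!EFin_max -EFinM maxr_pMl// mul0r. Qed.

Section state_space.
Context dS (S : measurableType dS) (R : realType).
Variable mu : {sigma_finite_measure set S -> \bar R}.
Notation l2 := (l2 mu).
Notation R2 := (measurableTypeR R * measurableTypeR R)%type.
Context d (T : measurableType d) (P : probability T R).
Variables (W : l2 -> T -> R) (iW : isonormal P W).
Variables (Ic : finType) (c0 be v : R) (Jf : R -> R).
Variables (e : nat -> l2) (C de : R).
Hypotheses (c0_ge0 : 0 <= c0) (Jf_ge0 : forall q, 0 <= Jf q).
Hypothesis e_on : forall i j, ip (e i) (e j) = (i == j)%:R.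
Hypotheses (v0 : 0 < v) (C0 : 0 <= C) (de0 : 0 < de) (de1 : de <= 1) (be_de : 1 + 2 / de < be).
Variables (kap : Ic -> R * R -> l2) (pos : S -> R * R).
Hypothesis km : kmodel c0 be v Jf kap pos.
Variable Gf : Ic -> T -> R2 -> R.
Hypothesis mGf : forall c, measurable_fun setT (fun p : T * R2 => Gf c p.1 p.2).
Hypothesis GfW : forall c t, {ae P, forall x, Gf c x t = W (kap c t) x}.

Definition std_state (z : paths R l2) : paths R Ic := fun c => Num.sqrt v * z (e (eidx 0 c)).

Lemma measurable_std_state : measurable_fun setT std_state.
Proof. by apply: measurable_pathsP => c; apply: measurable_funM => //; exact: measurable_ev. Qed.

Lemma noise_field_null (N : set (paths R Ic)) t : measurable N ->
  (forall G : probability (paths R l2) R, white G -> G (std_state @^-1` N) = 0%E) ->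
  {ae P, forall x, ~ N (fun c => Gf c x t)}.
Proof.
move=> mN N0; have [G wG Pz] := noise_law iW.
pose Z (x : T) : paths R Ic := fun c => Gf c x t.
have mZ c : measurable_fun setT (fun x => Z x c).
  exact: (measurableT_comp (mGf c) (measurable_pair2 t)).
have mZ' c : measurable_fun setT (fun z => std_state z c).
  by apply: measurable_funM => //; exact: measurable_ev.
have L : forall A, measurable A -> P (Z @^-1` A) = G (std_state @^-1` A).
  apply: (@gauss_law R Ic _ _ P _ _ G Z std_state (covform (fun i j => v * (i == j)%:R))) => // s.
    have H := gauss_forms wG (fun c => [:: (1, kap c t)]) s.
    rewrite (eq_covform (K' := fun i j => v * (i == j)%:R)) in H; last first.
      by move=> i j; rewrite l2lin11 !mul1r (km_cov km).
    apply: (isG_ext (isG_mp Pz H)).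
      apply: (@measurableT_comp _ _ _ _ _ _ (linform s)); first exact: measurable_linform.
      exact: measurable_pathsP.
    have aeE : {ae P, forall x, forall c, Gf c x t = W (kap c t) x}.
      by apply: filter_forall => c; exact: GfW.
    apply: ae_imp aeE => x xE; apply: eq_bigr => p _; rewrite /linform big_seq1 mul1r.
    by rewrite /Z xE.
  apply: (eq_isG (gauss_forms wG (fun c => [:: (Num.sqrt v, e (eidx 0 c))]) s)).
    by move=> z; apply: eq_bigr => p _; rewrite /linform big_seq1.
  apply: eq_covform => i j; rewrite l2lin11 e_on eidx_eq eqxx/= mulrA -expr2 sqr_sqrtr//.
  exact: ltW.
exists (Z @^-1` N); split.
- rewrite -[X in measurable X]setTI; exact: (measurable_pathsP mZ).
- by rewrite [LHS]L// N0.
- by move=> x /= /contrapT.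
Qed.

Context dE (E : measurableType dE) (m : {measure set E -> \bar R}).
Variables (rho : E -> R) (q : paths R Ic -> E) (tr : paths R Ic -> paths R Ic -> E -> E).
Hypothesis rho0 : forall p, 0 <= rho p.
Hypothesis mq : measurable_fun setT q.
Hypothesis qlaw : forall G : probability (paths R l2) R, white G -> forall F : E -> \bar R,
  measurable_fun setT F -> (forall p, 0 <= F p)%E ->
  (\int[G]_z F (q (std_state z)) = \int[m]_p (F p * (rho p)%:E))%E.
Hypothesis mtr : forall h y, measurable_fun setT (tr h y).
Hypothesis trq : forall x h y, q (fun c => (x c + h c + y c) / 2) = tr h y (q x).
Hypothesis tr_ae : forall h y (A : set E), {ae m, forall p, A p} -> {ae m, forall p, A (tr h y p)}.
Variable psi : E -> R.
Hypothesis lpsi : lebesgue_measurable m psi.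
Variable th : R.
Hypothesis th0 : 0 < th.
Hypothesis psi_exp : (\int[m]_p (expR (th * `|psi p|) * rho p)%:E < +oo)%E.
Hypothesis psi_mean : (\int[m]_p (psi p * rho p)%:E = 0)%E.
Hypothesis psi_incr : forall h y : paths R Ic,
  (\int[m]_p (expR `|psi (tr h y p) - psi (tr h (fun c => - y c) p)| * rho p)%:E
   <= (expR (C * (\sum_c `|y c|) `^ de))%:E)%E.

(** One statement for both parts, with state space [E] the line or the plane. The function [psi] is
    replaced by a Borel function [g] off a null set; the maps [tr] pull null sets back to null sets
    and the one-point law has the density [rho], so the integral hypotheses pass to [g] and the
    field almost surely avoids the exceptional states. *)
Lemma state_field_splittable : is_splittable_field P (fun x t => psi (q (fun c => Gf c x t))).
Proof.
have [g [N [mg mN N0 psiE]]] := lebesgue_modification lpsi.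
have aeg : {ae m, forall p, psi p = g p}.
  exists N; split => // p /= ne; apply: contrapT => Np; apply: ne; exact: psiE.
have mgq := measurableT_comp mg mq.
pose K := Num.max 1 (fine (\int[m]_p (expR (th * `|psi p|) * rho p)%:E)%E).
have K1 : 1 <= K by rewrite le_max lexx.
have fin : (\int[m]_p (expR (th * `|psi p|) * rho p)%:E \is a fin_num)%E.
  by rewrite ge0_fin_numE//; apply: integral_ge0 => p _; rewrite lee_fin mulr_ge0// expR_ge0.
apply: (noise_field_splittable iW c0_ge0 Jf_ge0 e_on v0 C0 de0 de1 be_de (psi := g \o q) mgq
  _ th0 K1 _ _ km mGf GfW (N := q @^-1` N)).
- move=> G wG h y.
  pose F p := (expR `|g (tr h y p) - g (tr h (fun c => - y c) p)|)%:E.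
  have mF : measurable_fun setT F.
    apply/measurable_EFinP; do 2! apply: measurableT_comp => //; apply: measurable_funB.
      exact: (measurableT_comp mg (mtr _ _)).
    exact: (measurableT_comp mg (mtr _ _)).
  have F0 p : (0 <= F p)%E by rewrite lee_fin expR_ge0.
  rewrite (_ : (fun z => _) = fun z => F (q (std_state z))); last first.
    apply/funext => z; rewrite /F -!trq.
    by congr (expR `|_ - _|)%:E.
  rewrite (qlaw wG mF F0); apply: le_trans (psi_incr h y).
  rewrite (ae_lower_integral (h := fun p => (expR `|psi (tr h y p) - psi (tr h (fun c => - y c) p)| * rho p)%:E))//.
  apply: (ae_imp _ (filterI (tr_ae h y aeg) (tr_ae h (fun c => - y c) aeg))) => p [E1 E2].
  by rewrite /F EFinM E1 E2.
- move=> G wG; pose F p := (expR (th * `|g p|))%:E.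
  have mF : measurable_fun setT F.
    apply/measurable_EFinP; apply: measurableT_comp => //; apply: measurable_funM => //.
    exact: measurableT_comp.
  have F0 p : (0 <= F p)%E by rewrite lee_fin expR_ge0.
  rewrite -[leLHS]/(\int[G]_z F (q (std_state z)))%E (qlaw wG mF F0).
  rewrite (ae_lower_integral (h := fun p => (expR (th * `|psi p|) * rho p)%:E)).
    by rewrite -[leLHS]fineK// lee_fin le_max lexx orbT.
  by apply: ae_imp aeg => p pE; rewrite /F EFinM pE.
- move=> G wG; rewrite -[RHS]psi_mean.
  rewrite [RHS](ae_lower_integral (h := fun p => (g p * rho p)%:E)); last first.
    by apply: ae_imp aeg => p ->.
  rewrite [LHS]integralE [RHS]integralE; congr (_ - _)%E.
    under eq_integral do rewrite funeposE; under [RHS]eq_integral do rewrite funeposE.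
    rewrite -[LHS]/(\int[G]_z (fun p => maxe (g p)%:E 0) (q (std_state z)))%E (qlaw wG)//.
    + by apply: eq_integral => p _; exact: maxe_pMr_fin.
    + by apply: measurable_maxe => //; exact/measurable_EFinP.
    + by move=> p; rewrite le_max lexx orbT.
  under eq_integral do rewrite funenegE; under [RHS]eq_integral do rewrite funenegE.
  rewrite -[LHS]/(\int[G]_z (fun p => maxe (- (g p)%:E) 0) (q (std_state z)))%E (qlaw wG)//.
  + by apply: eq_integral => p _; rewrite -!EFinN -mulNr; exact: maxe_pMr_fin.
  + by apply: measurable_maxe => //; apply: measurableT_comp => //; exact/measurable_EFinP.
  + by move=> p; rewrite le_max lexx orbT.
- by rewrite -[X in measurable X]setTI; exact: mq.
- move=> t; apply: noise_field_null; first by rewrite -[X in measurable X]setTI; exact: mq.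
  move=> G wG; have mI : measurable_fun setT (fun p => (\1_N p)%:E : \bar R).
    by apply/measurable_EFinP; exact: measurable_indic.
  have := qlaw wG mI (fun p => _).
  rewrite (ae_lower_integral (f := fun p => ((\1_N p)%:E * (rho p)%:E)%E) (h := cst 0%E)); last first.
    by exists N; split => // p /= ne; apply: contrapT => Np; apply: ne; rewrite indicE memNset ?mul0e.
  rewrite integral0 => <-; last by move=> p; rewrite lee_fin.
  have mQ : measurable (std_state @^-1` (q @^-1` N)).
    by rewrite -[X in measurable X]setTI; exact: (measurableT_comp mq measurable_std_state).
  by have := integral_indic G measurableT mQ; rewrite setIT => <-.
- by move=> x t; exact: psiE.
Qed.

End state_space.

(** * Real noise *)

Section reflection.
Variable R : realType.
Notation mu := (@lebesgue_measure R).
Notation R2 := (measurableTypeR R * measurableTypeR R)%type.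
Notation leb := (@leb2 R).

Lemma lebesgue_reflect (f : R -> \bar R) (a : R) : measurable_fun setT f ->
  (forall x, 0 <= f x)%E -> (\int[mu]_x f x = \int[mu]_x f (a - x)%R)%E.
Proof.
move=> mf f0; rewrite (@lebesgue_affine R f 1 a)// mul1e.
have mg : measurable_fun setT (fun x : measurableTypeR R => f (x + a)).
  by apply: (measurableT_comp mf); exact: measurable_funD.
transitivity (\int[mu]_x f (x + a)%R)%E; first by apply: eq_integral => x _; rewrite mul1r.
transitivity (\int[pushforward mu (-%R : R -> measurableTypeR R)]_x f (x + a)%R)%E.
  by apply: eq_measure_integral => A mA _; symmetry; exact: lebesgue_measureN.
rewrite (@ge0_integral_pushforward _ _ (measurableTypeR R) (measurableTypeR R) R (-%R : R -> measurableTypeR R)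
    (measurable_funN (@measurable_id _ _ setT)) mu setT (fun x => f (x + a)%R) measurableT)//.
by rewrite preimage_setT; apply: eq_integral => x _ /=; rewrite addrC.
Qed.

Lemma measurable_reflect (t : R * R) : measurable_fun setT (fun s : R2 => (t - s : R2)).
Proof.
by apply: (measurable_fun_pair (f := fun s : R2 => t.1 - s.1) (g := fun s => t.2 - s.2));
  apply: measurable_funB => //.
Qed.

Lemma leb2_reflect (f : R2 -> \bar R) (t : R * R) : measurable_fun setT f ->
  (forall x, 0 <= f x)%E -> (\int[leb]_s f s = \int[leb]_s f (t - s)%R)%E.
Proof.
move=> mf f0; have mfa := measurableT_comp mf (measurable_reflect t).
have mF : measurable_fun setT (fun x : measurableTypeR R => \int[mu]_y f (x, y))%E.
  exact: (@measurable_fun_fubini_tonelli_F _ _ _ _ R mu f).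
have F0 x : (0 <= \int[mu]_y f (x, y))%E by exact: integral_ge0.
have fx x : measurable_fun setT (fun y : measurableTypeR R => f (x, y)).
  exact: (measurableT_comp mf (measurable_pair1 x)).
rewrite [LHS](@fubini_tonelli1 _ _ _ _ R mu mu f mf f0) /fubini_F.
rewrite [RHS](@fubini_tonelli1 _ _ _ _ R mu mu _ mfa (fun s => f0 _)) /fubini_F.
rewrite (@lebesgue_reflect _ t.1 mF F0); apply: eq_integral => x _.
by rewrite [LHS](@lebesgue_reflect (fun y => f (t.1 - x, y)) t.2 (fx _) (fun=> f0 _)).
Qed.

Lemma ae_reflect (A : set R2) (t : R * R) : {ae leb, forall s, A s} -> {ae leb, forall s, A (t - s)}.
Proof.
exact: (ae_pullback (measurable_reflect t) ltr01
  (fun f mf f0 => etrans (leb2_reflect t mf f0) (esym (mul1e _)))).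
Qed.

End reflection.

Section gaussian_laws.
Variable R : realType.

Lemma isG_scale (s : R) : isG (gam R) (fun u => s * u) (s ^+ 2).
Proof.
split; [exact: sqr_ge0|exact: measurable_funM|].
move=> x; split; under eq_Ex do rewrite mulrA; last exact: gam_sin.
by rewrite -[LHS]/(gcos _) gcosE exprMn.
Qed.

Lemma mp_normal (s : R) : s != 0 -> mp (gam R) (normal_prob 0 s) (fun u => s * u).
Proof.
move=> s0; have ms : measurable_fun setT (fun u : R => s * u) by exact: measurable_funM.
split; [exact: ms|move=> A mA].
have mI : measurable_fun setT (fun u : measurableTypeR R => (\1_A u : R)%:E) by apply/measurable_EFinP; exact: measurable_indic.
have mP : measurable ((fun u : R => s * u) @^-1` A) by rewrite -[X in measurable X]setTI; exact: ms.
have I0 (u : measurableTypeR R) : (0 <= (\1_A u : R)%:E)%E by rewrite lee_fin.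
have := normal_scale s0 mI I0.
rewrite (integral_indic (normal_prob 0 s) measurableT mA) setIT => ->.
by have := integral_indic (gam R) measurableT mP; rewrite setIT => <-.
Qed.

Context d (T : measurableType d) (P : probability T R).

Lemma isG_cst0 : isG P (fun=> 0) 0.
Proof.
split => // x; rewrite !mulr0 mul0r oppr0 expR0.
by split; [under eq_Ex do rewrite cos0; rewrite Ex_cst|under eq_Ex do rewrite sin0; rewrite Ex_cst].
Qed.

(** For [s != 0] the law is the image of [gam] under multiplication by [s]; for [s = 0] the variable
    vanishes almost surely. *)
Lemma centered_gaussian_isG (Z : T -> R) : measurable_fun setT Z -> centered_gaussian P Z ->
  exists v, isG P Z v.
Proof.
move=> mZ [s sZ]; rewrite /centered_gaussian_law in sZ; have [s0|s0] := eqVneq s 0.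
  exists 0; apply: (isG_ext isG_cst0 mZ).
  have m0 : measurable (~` [set (0 : R)]) by exact: measurableC.
  exists (Z @^-1` (~` [set 0])); split.
  - by rewrite -[X in measurable X]setTI; exact: mZ.
  - by rewrite sZ// s0 eqxx diracE memNset// => /(_ erefl).
  - by move=> x /= ne Z0; apply: ne.
exists (s ^+ 2); have PZ : mp P (normal_prob 0 s) Z by split => // A mA; rewrite sZ// (negbTE s0).
have H : isG (normal_prob 0 s) id (s ^+ 2) by apply: (isG_push (mp_normal s0)) => //; exact: isG_scale.
exact: (isG_mp PZ H).
Qed.

(** By symmetry of [gam] the positive and the negative part have the same integral, finite because
    the positive part is at most one plus the square. *)
Lemma isG_mean (Z : T -> R) v : isG P Z v -> (\int[P]_x (Z x)%:E = 0)%E.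
Proof.
move=> GZ; have [v0 mZ _] := GZ; rewrite integralE.
have mpos : measurable_fun setT (fun u : R => maxe u%:E 0).
  by apply: measurable_maxe => //; exact/measurable_EFinP.
have pos0 (u : R) : (0 <= maxe u%:E 0)%E by rewrite le_max lexx orbT.
pose I := (\int[gam R]_u maxe (Num.sqrt v * u)%:E 0)%E.
have Ep : (\int[P]_x ((EFin \o Z)^\+ x) = I)%E.
  under eq_integral do rewrite funeposE.
  exact: (isG_integral GZ mpos pos0).
have En : (\int[P]_x ((EFin \o Z)^\- x) = I)%E.
  under eq_integral do rewrite funenegE.
  have mI : measurable_fun setT (fun u : R => maxe (Num.sqrt v * u)%:E 0).
    by apply: (measurableT_comp mpos); exact: measurable_funM.
  rewrite -[RHS](gam_sym mI (fun u => pos0 _)).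
  have mneg : measurable_fun setT (fun u : R => maxe (- u)%:E 0) by exact: (measurableT_comp mpos).
  rewrite [LHS](isG_integral GZ mneg (fun u => pos0 (- u))).
  by apply: eq_integral => u _; rewrite mulrN.
have Ifin : (I < +oo)%E.
  rewrite -Ep; apply: (@le_lt_trans _ _ (\int[P]_x (1%:E + (Z x ^+ 2)%:E))%E).
    apply: le_lower_integral => x; first exact: funepos_ge0.
    rewrite funeposE/= -EFin_max lee_fin ge_max; have := sqr_ge0 (Z x - 1); have := sqr_ge0 (Z x); nra.
  rewrite ge0_integralD//; last 2 first.
  - by move=> x _; rewrite lee_fin sqr_ge0.
  - by apply/measurable_EFinP; exact: measurable_funX.
  by rewrite (isG_var GZ) (Ex_EFin P (@mb_cst _ _ R 1)) Ex_cst -EFinD ltry.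
have I0 : (0 <= I)%E by exact: integral_ge0.
by rewrite [X in (X - _)%E]Ep [X in (_ - X)%E]En subee// ge0_fin_numE.
Qed.

Lemma isG_variance (Z : T -> R) v : isG P Z v -> ('V_P[Z] = v%:E)%E.
Proof.
move=> GZ; have E0 : 'E_P[Z]%E = 0%E by rewrite unlock; exact: isG_mean GZ.
rewrite /variance covariance.unlock E0 /= expectation.unlock -(isG_var GZ).
by apply: eq_integral => x _ /=; rewrite !fctE/= subr0.
Qed.

End gaussian_laws.

Section isonormal_tools.
Context dS (S : measurableType dS) (R : realType).
Variable mu : {sigma_finite_measure set S -> \bar R}.
Notation l2 := (l2 mu).
Context d (T : measurableType d) (P : probability T R).
Implicit Type W : l2 -> T -> R.

(** Almost sure linearity identifies a formal combination with the value at the function [l2lin s],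
    whose variance is given. *)
Lemma isonormalP W : (forall f, isG P (W f) (ip f f)) ->
  (forall c f s, {ae P, forall x, W (l2lin ((c, f) :: s)) x = c * W f x + W (l2lin s) x}) ->
  isonormal P W.
Proof.
move=> GW lW; have mW f : measurable_fun setT (W f) by have [] := GW f.
split => // s; apply: (isG_ext (GW (l2lin s))).
  apply: (@measurableT_comp _ _ _ _ _ _ (linform s) _ (fun x => W^~ x)); first exact: measurable_linform.
  exact: measurable_pathsP.
elim: s => [|[c f] s IH].
  have : ip (l2lin [::] : l2) (l2lin [::]) = 0 by rewrite ip_linl big_nil.
  move=> E; have := GW (l2lin [::]); rewrite E => /isG0.
  by apply: ae_imp => x ->; rewrite /linform big_nil.
by apply: (ae_imp _ (filterI (lW c f s) IH)) => x [-> ->]; rewrite linform_cons.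
Qed.

Lemma isonormal_ae W (f g : l2) : isonormal P W -> {ae mu, forall s, f s = g s} ->
  {ae P, forall x, W f x = W g x}.
Proof.
move=> iW fg; have [G wG Pz] := noise_law iW.
exact: (mp_ae Pz (white_ae_eq wG fg)).
Qed.

End isonormal_tools.

Section planar_noise.
Variable R : realType.
Notation R2 := (measurableTypeR R * measurableTypeR R)%type.
Notation leb := (@leb2 R).
Notation l2 := (l2 (lam2 R)).

Lemma L2fun_l2 (f : l2) : L2fun f.
Proof.
have mf := l2_meas f; apply/andP; split; first by rewrite inE.
rewrite inE /= /finite_norm unlock.
rewrite poweR_lty//.
under eq_integral do rewrite /= powR_mulrn// real_normK ?num_real//.
exact: l2_int.
Qed.

Lemma L2fun_square (f : R2 -> R) : L2fun f ->
  measurable_fun setT f /\ (\int[leb]_s (f s ^+ 2)%:E < +oo)%E.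
Proof.
move=> lf; split; first by move: lf => /andP[]; rewrite inE.
have /integrableP[_] := Lfun2_integrable_sqr lf.
by under eq_integral do rewrite gee0_abs ?lee_fin ?sqr_ge0//.
Qed.

Context d (T : measurableType d) (P : probability T R) (w : (R * R -> R) -> {RV P >-> R}).
Hypothesis ww : white_noise w.

Lemma white_noise_isG (f : l2) : isG P (w f) (ip f f).
Proof.
have mw : measurable_fun setT (w f) by exact: measurable_funP.
have cg : centered_gaussian P (w f).
  have := wn_jointly_gaussian ww (n := 1) (f := fun=> f) (fun=> 1) (fun=> L2fun_l2 f).
  by congr centered_gaussian; apply/funext => x; rewrite big_ord1 mul1r.
have [v vG] := centered_gaussian_isG mw cg.
suff -> : ip f f = v by [].
have := wn_variance ww (L2fun_l2 f); rewrite (isG_variance vG).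
by under eq_integral do rewrite expr2; rewrite -[RHS](ipE f f) => -[].
Qed.

Lemma white_noise_lin c (f : l2) s :
  {ae P, forall x, w (l2lin ((c, f) :: s)) x = c * w f x + w (l2lin s) x}.
Proof.
have := wn_linear ww c 1 (L2fun_l2 f) (L2fun_l2 (l2lin s)).
apply: ae_imp => x; rewrite mul1r => <-; congr (w _ x).
by apply/funext => t /=; rewrite big_cons mul1r.
Qed.

Lemma white_noise_isonormal : isonormal P (fun f : l2 => w f : T -> R).
Proof. exact: isonormalP white_noise_isG white_noise_lin. Qed.

End planar_noise.

Section convolution_kernels.
Variable R : realType.
Notation R2 := (measurableTypeR R * measurableTypeR R)%type.
Notation leb := (@leb2 R).
Notation l2 := (l2 (lam2 R)).

Lemma wt_int_const : exists2 Jf : R -> R, (forall q, 0 <= Jf q) &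
  forall q (t : R * R), 2 < q -> (\int[leb]_s (wt q `|t - s|)%:E <= (Jf q)%:E)%E.
Proof.
have /choice[Jf H] (q : R) : exists J : R, 0 <= J /\
    (2 < q -> forall t : R * R, (\int[leb]_s (wt q `|t - s|)%:E <= J%:E)%E).
  have [q2|q2] := ltP 2 q; last by exists 0; split => // q2'; move: (lt_le_trans q2' q2); rewrite ltxx.
  by have [J J0 HJ] := @wt_int2 R q q2; exists J.
by exists Jf => [q|q t q2]; [exact: (H q).1|exact: (H q).2].
Qed.

Lemma norm_le_euclid (t : R * R) : `|t| <= euclid t.
Proof.
rewrite prod_normE ge_max /euclid -!sqrtr_sqr !ler_sqrt ?addr_ge0 ?sqr_ge0//.
by rewrite lerDl sqr_ge0 lerDr sqr_ge0.
Qed.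

(** The exponent is halved because the hypothesis bounds the square of [h]. Passing from the
    Euclidean to the smaller maximum norm only enlarges the weight. *)
Lemma decay_set (h : R2 -> R) (al : R) : 0 < al ->
  (ess_sup leb (fun t => ((1 + euclid t) `^ al * h t ^+ 2)%:E) < +oo)%E ->
  exists (c0 : R) (N : set R2), [/\ 0 <= c0, measurable N, leb N = 0%E &
    forall t, ~ N t -> `|h t| <= c0 * wt (al / 2) `|t|].
Proof.
move=> al0 Hoo; set M := ess_sup _ _ in Hoo.
have le_fine (x : \bar R) : (x < +oo -> x <= (Num.max 0 (fine x))%:E)%E.
  by case: x => [r _| |_] //=; rewrite ?leNye// lee_fin le_max lexx orbT.
have {le_fine} := le_fine _ Hoo; set B := Num.max _ _ => MB.
have /ess_supP[N [mN N0 HN]] := MB.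
exists (Num.sqrt B), N; split => // t Nt.
have H : (1 + euclid t) `^ al * h t ^+ 2 <= B.
  by rewrite -lee_fin; apply: contrapT => ne; apply: Nt; exact: HN.
have e0 : 0 <= euclid t by exact: sqrtr_ge0.
have p0 : 0 < (1 + euclid t) `^ al by rewrite powR_gt0// ltr_pwDl.
have {}H : h t ^+ 2 <= B * wt al `|t|.
  apply: (@le_trans _ _ (B * wt al (euclid t))).
    by rewrite /wt powRN ler_pdivlMr// mulrC.
  by rewrite ler_wpM2l ?le_max ?lexx// le_wt ?norm_le_euclid// ltW.
rewrite -(ler_pXn2r (n := 2)) ?nnegrE ?mulr_ge0 ?sqrtr_ge0 ?(ltW (wt_gt0 _ _))//.
rewrite real_normK ?num_real// exprMn sqr_sqrtr ?le_max ?lexx//.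
by have <- : wt al `|t| = wt (al / 2) `|t| ^+ 2 by rewrite {1}(splitr al) wtD// expr2.
Qed.

Lemma conv_proof (g : R2 -> R) (t : R * R) : measurable_fun setT g ->
  (\int[leb]_s (g s ^+ 2)%:E < +oo)%E ->
  measurable_fun setT (fun s : R2 => g (t - s)) /\ (\int[leb]_s (g (t - s) ^+ 2)%:E < +oo)%E.
Proof.
move=> mg ig; split; first exact: (measurableT_comp mg (measurable_reflect t)).
rewrite -(@leb2_reflect R (fun s => (g s ^+ 2)%:E) t)//.
- by apply/measurable_EFinP; exact: measurable_funX.
- by move=> s; rewrite lee_fin sqr_ge0.
Qed.

Definition convk (g : R2 -> R) (mg : measurable_fun setT g)
  (ig : (\int[leb]_s (g s ^+ 2)%:E < +oo)%E) (t : R * R) : l2 :=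
  L2 (mu := lam2 R) (conv_proof t mg ig).1 (conv_proof t mg ig).2.

Lemma ip_convk g (mg : measurable_fun setT g) ig t :
  ((ip (@convk g mg ig t) (convk mg ig t))%:E = \int[leb]_s (g s ^+ 2)%:E)%E.
Proof.
rewrite ipE (@leb2_reflect R (fun s => (g s ^+ 2)%:E) t)//.
- by apply/measurable_EFinP; exact: measurable_funX.
- by move=> s; rewrite lee_fin sqr_ge0.
Qed.

Lemma measurable_diff (g : R2 -> R) : measurable_fun setT g ->
  measurable_fun setT (fun x : R2 * R2 => g (x.1 - x.2)).
Proof.
move=> mg; apply: (measurableT_comp mg).
apply: (measurable_fun_pair (f := fun x : R2 * R2 => x.1.1 - x.2.1) (g := fun x => x.1.2 - x.2.2));
  apply: measurable_funB.
- exact: (measurableT_comp measurable_fst measurable_fst).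
- exact: (measurableT_comp measurable_fst measurable_snd).
- exact: (measurableT_comp measurable_snd measurable_fst).
- exact: (measurableT_comp measurable_snd measurable_snd).
Qed.

Lemma cellfun_int (n : nat) : (\int[leb]_s ((\1_(@zcell R (n%:Z, 0%:Z)) s : R) ^+ 2)%:E < +oo)%E.
Proof.
under eq_integral do rewrite expr2 indic_idem.
by rewrite integral_indic ?setIT ?leb2_zcell ?ltry//; exact: measurable_zcell.
Qed.

(** Indicators of disjoint unit cells, a concrete orthonormal sequence supplying independent
    standard normal variables. *)
Definition cellfun (n : nat) : l2 :=
  L2 (mu := lam2 R) (measurable_indic (@measurable_zcell R (n%:Z, 0%:Z))) (cellfun_int n).

Lemma ip_cellfun i j : ip (cellfun i) (cellfun j) = (i == j)%:R.
Proof.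
apply: EFin_inj; rewrite ipE; have [<-|ij] := eqVneq i j.
  under eq_integral do rewrite /= indic_idem.
  by rewrite integral_indic ?setIT; [rewrite [LHS]leb2_zcell| |exact: measurable_zcell].
rewrite (eq_integral (cst 0%E)) ?integral0// => s _ /=.
rewrite (_ : \1_ _ s * \1_ _ s = \1_(@zcell R (i%:Z, 0%:Z) `&` @zcell R (j%:Z, 0%:Z)) s); last by rewrite indicI.
rewrite (_ : _ `&` _ = set0) ?indic0//; apply/seteqP; split => // u [/eqP Eu /eqP].
by rewrite Eu => -[ijE]; move: ij; rewrite ijE eqxx.
Qed.

End convolution_kernels.

Section state_tools.
Variable R : realType.

Lemma ae_line_affine (A : set R) (a b : R) : 0 < a -> {ae @lebesgue_measure R, forall x, A x} ->
  {ae @lebesgue_measure R, forall x, A (a * x + b)}.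
Proof.
move=> a0; have m : measurable_fun setT (fun x : measurableTypeR R => a * x + b : measurableTypeR R).
  by apply: measurable_funD => //; exact: measurable_funM.
exact: (ae_pullback m a0 (fun f mf f0 => lebesgue_affine b a0 mf f0)).
Qed.

(** The centering hypothesis omits the normalizing constant of the Gaussian density. Pulling this
    constant out of a signed integral uses integrability, which the exponential moment provides. *)
Lemma mean_scale d (E : measurableType d) (m : {measure set E -> \bar R}) (psi rho : E -> R)
    (k th : R) : lebesgue_measurable m psi -> measurable_fun setT rho -> (forall p, 0 <= rho p) ->
  0 < th -> (\int[m]_p (expR (th * `|psi p|) * rho p)%:E < +oo)%E ->
  (\int[m]_p (psi p * rho p)%:E = 0)%E -> (\int[m]_p (psi p * (k * rho p))%:E = 0)%E.
Proof.
move=> lpsi mrho rho0 th0 foo m0; have [g [N [mg mN N0 psiE]]] := lebesgue_modification lpsi.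
have aeg : {ae m, forall p, psi p = g p}.
  exists N; split => // p /= ne; apply: contrapT => Np; apply: ne; exact: psiE.
have aeE (F : R -> E -> R) : (\int[m]_p (F (psi p) p)%:E = \int[m]_p (F (g p) p)%:E)%E.
  by apply: ae_lower_integral; apply: ae_imp aeg => p ->.
rewrite (aeE (fun y p => expR (th * `|y|) * rho p)) in foo.
rewrite (aeE (fun y p => y * rho p)) in m0; rewrite (aeE (fun y p => y * (k * rho p))).
have mgr : measurable_fun setT (fun p => (g p * rho p)%:E).
  by apply/measurable_EFinP; exact: measurable_funM.
have ig : m.-integrable setT (fun p => (g p * rho p)%:E).
  apply/integrableP; split => //.
  apply: (@le_lt_trans _ _ (\int[m]_p ((th^-1)%:E * (expR (th * `|g p|) * rho p)%:E))%E).
    apply: le_lower_integral => p; first exact: abse_ge0.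
    rewrite -EFinM lee_fin normrM (ger0_norm (rho0 p)) mulrA ler_wpM2r//.
    by rewrite ler_pdivlMl//; have := expR_ge1Dx (th * `|g p|); lra.
  rewrite ge0_integralZl ?lee_fin ?invr_ge0 ?(ltW th0)//.
  - by rewrite lte_mul_pinfty// lee_fin invr_ge0 ltW.
  - apply/measurable_EFinP; apply: measurable_funM => //; apply: measurableT_comp => //.
    by apply: measurable_funM => //; exact: measurableT_comp.
  - by move=> p _; rewrite lee_fin mulr_ge0// expR_ge0.
under eq_integral do rewrite mulrCA EFinM.
by rewrite integralZl// m0 mule0.
Qed.

Lemma lne_le (x : \bar R) (c : R) : (0 <= x)%E -> (lne x <= c%:E)%E -> (x <= (expR c)%:E)%E.
Proof. by move=> x0; rewrite -lee_expeR; have /eqP -> : expeR (lne x) == x by rewrite lneK_eq. Qed.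

Lemma lee_integral_bound d (E : measurableType d) (m : {measure set E -> \bar R}) (f : E -> R)
    (rho : E -> R) (k : R) : (forall p, 0 <= f p) -> (forall p, 0 <= rho p) -> 0 <= k -> k <= 1 ->
  (\int[m]_p (f p * rho p)%:E < +oo)%E -> (\int[m]_p (f p * (k * rho p))%:E < +oo)%E.
Proof.
move=> f0 rho0 k0 k1; apply: le_lt_trans; apply: le_lower_integral => p.
  by rewrite lee_fin !mulr_ge0.
by rewrite lee_fin mulrCA ler_piMl// mulr_ge0.
Qed.

End state_tools.

Section real_noise.
Variable R : realType.
Notation R2 := (measurableTypeR R * measurableTypeR R)%type.
Notation leb := (@leb2 R).
Notation l2 := (l2 (lam2 R)).
Variables (C al de : R) (phi : R * R -> R) (psi : R -> R).
Hypotheses (C0 : 0 < C) (al0 : 0 < al) (de0 : 0 < de) (de1 : de <= 1) (al_de : 2 * (1 + 2 / de) < al).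
Hypothesis phiL2 : L2fun phi.
Hypothesis phi1 : (\int[leb]_t (phi t ^+ 2)%:E = 1)%E.
Hypothesis phi_decay : (ess_sup leb (fun t => ((1 + euclid t) `^ al * phi t ^+ 2)%:E) < +oo)%E.
Hypothesis lpsi : lebesgue_measurable (@lebesgue_measure R) psi.
Hypothesis psi_exp : (\int[@lebesgue_measure R]_u
  (expR (C^-1 * `|psi u|) * expR (- (u ^+ 2 / 2)))%:E < +oo)%E.
Hypothesis psi_mean : (\int[@lebesgue_measure R]_u (psi u * expR (- (u ^+ 2 / 2)))%:E = 0)%E.
Hypothesis psi_incr : forall y h : R, (lne (\int[@lebesgue_measure R]_x
    (expR `|psi ((x + h + y) / 2) - psi ((x + h - y) / 2)| *
     ((Num.sqrt (2 * pi))^-1 * expR (- (x ^+ 2 / 2))))%:E) <= (C * `|y| `^ de)%:E)%E.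
Context d (T : measurableType d) (P : probability T R).
Variables (w : (R * R -> R) -> {RV P >-> R}) (G : T -> R * R -> R).
Hypotheses (ww : white_noise w) (wG : convolution_version w phi G).

Let k : R := (Num.sqrt (2 * pi))^-1.
Let rho (u : measurableTypeR R) : R := k * expR (- (u ^+ 2 / 2)).

Let k_ge0 : 0 <= k. Proof. by rewrite invr_ge0 sqrtr_ge0. Qed.

Let k_le1 : k <= 1.
Proof.
rewrite invf_le1 ?sqrtr_gt0 ?mulr_gt0 ?pi_gt0// -[leLHS]sqrtr1 ler_sqrt ?mulr_ge0 ?pi_ge0//.
by have := pi_ge2 R; lra.
Qed.

Let mexp : measurable_fun setT (fun u : measurableTypeR R => expR (- (u ^+ 2 / 2)) : R).
Proof.
apply: measurableT_comp => //; apply: measurableT_comp => //; exact: measurable_funM.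
Qed.

Lemma real_gauss_law (Q : probability (paths R l2) R) : white Q -> forall F : R -> \bar R,
  measurable_fun setT F -> (forall u, 0 <= F u)%E ->
  (\int[Q]_z F (std_state 1 (cellfun R) z tt) = \int[@lebesgue_measure R]_u (F u * (rho u)%:E))%E.
Proof.
move=> wQ F mF F0; pose f := cellfun R (@eidx unit 0 tt).
have f1 : ip f f = 1 by rewrite ip_cellfun eqxx.
have mF1 : measurable_fun setT (fun u : R => F (Num.sqrt 1 * u)).
  by apply: (measurableT_comp mF); exact: measurable_funM.
rewrite [LHS](isG_integral (white1 wQ f) mF1 (fun u => F0 _)) f1.
transitivity (\int[gam R]_u F u)%E.
  by apply: eq_integral => u _; rewrite sqrtr1 !mul1r.
rewrite (normal_integral 1 mF F0); apply: eq_integral => u _; congr (_ * _%:E)%E.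
rewrite normal_pdf0E ?oner_neq0// expr1n mul1r /rho /k.
by rewrite mulr_natl.
Qed.

Lemma real_field_splittable : is_splittable_field P (fun x t => psi (G x t)).
Proof.
have [mphi iphi'] := L2fun_square phiL2.
have [c0 [N [c00 mN N0 HN]]] := decay_set al0 phi_decay.
(* The kernel is set to 0 on the exceptional null set, so that the decay holds at every point, as
   [km_bound] asks. *)
pose g (t : R2) : R := phi t * \1_(~` N) t.
have mg : measurable_fun setT g.
  by apply: measurable_funM => //; apply: measurable_indic; exact: measurableC.
have aeg : {ae leb, forall t, phi t = g t}.
  exists N; split => // t /= ne; apply: contrapT => Nt; apply: ne.
  by rewrite /g indicE mem_set// mulr1.
have ig1 : (\int[leb]_t (g t ^+ 2)%:E = 1)%E.
  by rewrite -phi1; apply: ae_lower_integral; apply: ae_imp aeg => t ->.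
have ig : (\int[leb]_t (g t ^+ 2)%:E < +oo)%E by rewrite ig1 ltry.
have gb (t : R2) : `|g t| <= c0 * wt (al / 2) `|t|.
  rewrite /g indicE; have [Nt|Nt] := pselect (N t).
    by rewrite memNset ?mulr0 ?normr0 ?mulr_ge0 ?(ltW (wt_gt0 _ _))// => /(_ Nt).
  by rewrite mem_set// mulr1; exact: HN.
have [Jf Jf0 JfI] := wt_int_const R.
pose kap (c : unit) (t : R * R) : l2 := convk mg ig t.
have km : @kmodel _ _ _ (lam2 R) unit c0 (al / 2) 1 Jf kap id.
  split.
  - exact: measurable_id.
  - by move=> c; exact: (measurable_diff mg).
  - by move=> c t s; exact: gb.
  - by move=> q t q2; exact: JfI.
  - by case=> -[].
  - by move=> c t; apply: EFin_inj; rewrite ip_convk.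
have iW := white_noise_isonormal ww.
have [mG GW] := wG.
have tr_ae (h y : paths R unit) (A : set R) : {ae @lebesgue_measure R, forall u, A u} ->
    {ae @lebesgue_measure R, forall u, A ((u + h tt + y tt) / 2)}.
  move=> aeA; have h2 : 0 < 2^-1 :> R by rewrite invr_gt0.
  apply: (ae_imp _ (ae_line_affine ((h tt + y tt) / 2) h2 aeA)) => u.
  by congr A; field.
have cdim : 1 + 2 / de < al / 2 by rewrite ltr_pdivlMr// mulrC.
apply: (state_field_splittable iW c00 Jf0 (ip_cellfun R) ltr01 (ltW C0) de0 de1 cdim km
  (Gf := fun _ : unit => G) _ _ (rho := rho) (q := fun y : paths R unit => y tt : measurableTypeR R)
  (tr := fun h y u => (u + h tt + y tt) / 2) _ _ _ _ _ tr_ae lpsi (th := C^-1)).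
- by move=> c; exact: mG.
- move=> c t; have E := isonormal_ae iW (f := convk mphi iphi' t) (g := kap c t) (ae_reflect t aeg).
  by apply: (ae_imp _ (filterI (GW t) E)) => x [-> <-].
- by move=> u; rewrite mulr_ge0// expR_ge0.
- exact: measurable_ev.
- exact: real_gauss_law.
- by move=> h y; apply: measurable_funM => //; apply: measurable_funD => //; exact: measurable_funD.
- by [].
- by rewrite invr_gt0.
- by apply: lee_integral_bound psi_exp => // u; exact: expR_ge0.
- apply: mean_scale psi_exp psi_mean => //; last by rewrite invr_gt0.
- move=> h y; apply: lne_le; first by apply: integral_ge0 => u _; rewrite lee_fin !mulr_ge0 ?expR_ge0.
  rewrite (_ : \sum_c `|y c| = `|y tt|); first exact: psi_incr.
  by rewrite (bigD1 tt)//= big1 ?addr0// => -[].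
Qed.

End real_noise.

(** * Complex noise *)

Section two_sheets.
Variable R : realType.
Notation R2 := (measurableTypeR R * measurableTypeR R)%type.
Notation leb := (@leb2 R).
Notation S2 := (R2 * bool)%type.

Definition sheet (b : bool) (t : R2) : S2 := (t, b).

Lemma measurable_sheet b : measurable_fun setT (sheet b).
Proof. by apply: measurable_fun_pair => //; exact: measurable_cst. Qed.

Definition sheet_measure (b : bool) : {measure set S2 -> \bar R}.
Proof. by refine (pushforward (lam2 R) (sheet b)); exact: measurable_sheet. Defined.

(* The noise for the real part lives on one copy of the plane, that for the imaginary part
   on another one. *)
Definition sheets_fun (A : set S2) : \bar R :=
  measure_add (sheet_measure false) (sheet_measure true) A.

Let sheets0 : sheets_fun set0 = 0%E. Proof. exact: measure0. Qed.
Let sheets_ge0 A : (0 <= sheets_fun A)%E. Proof. exact: measure_ge0. Qed.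
Let sheets_sigma_additive : semi_sigma_additive sheets_fun.
Proof. exact: measure_semi_sigma_additive. Qed.

HB.instance Definition _ := isMeasure.Build _ _ _ sheets_fun sheets0 sheets_ge0 sheets_sigma_additive.

Lemma sheets_sigma_finite : sigma_finite setT sheets_fun.
Proof.
have [F TF Foo] := sigma_finiteT (lam2 R).
exists (fun n => F n `*` setT).
  apply/seteqP; split => // -[t b] _; have : [set: R2] t by [].
  by rewrite TF => -[n _ Fn]; exists n.
move=> n; have [mF oo] := Foo n; split; first exact: measurableX.
rewrite /sheets_fun measure_addE /= /pushforward.
have E b : sheet b @^-1` (F n `*` setT) = F n by apply/seteqP; split => t //= [].
by rewrite !E lte_add_pinfty.
Qed.

HB.instance Definition _ := Measure_isSigmaFinite.Build _ _ _ sheets_fun sheets_sigma_finite.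

Definition sheets : {sigma_finite_measure set S2 -> \bar R} := sheets_fun.

Lemma integral_sheets (f : S2 -> \bar R) : measurable_fun setT f -> (forall s, 0 <= f s)%E ->
  (\int[sheets]_s f s = \int[leb]_t f (t, false) + \int[leb]_t f (t, true))%E.
Proof.
move=> mf f0; pose m b := sheet_measure b.
transitivity (\int[measure_add (m false) (m true)]_s f s)%E; first by apply: eq_measure_integral.
rewrite ge0_integral_measure_add//.
have E b : (\int[m b]_s f s = \int[leb]_t f (t, b))%E.
  rewrite /m /sheet_measure (@ge0_integral_pushforward _ _ R2 S2 R (sheet b) (measurable_sheet b) (lam2 R) setT f measurableT)//.
by congr (_ + _)%E; exact: E.
Qed.

Notation l2p := (l2 (lam2 R)).
Notation l2s := (l2 sheets).

Lemma slice_proof (f : l2s) b : measurable_fun setT (fun t => f (sheet b t)) /\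
  (\int[leb]_t (f (sheet b t) ^+ 2)%:E < +oo)%E.
Proof.
split; first exact: (measurableT_comp (l2_meas f) (measurable_sheet b)).
have foo := l2_int f; rewrite integral_sheets in foo; last 2 first.
- by apply/measurable_EFinP; apply: measurable_funX; exact: l2_meas.
- by move=> s; rewrite lee_fin sqr_ge0.
have I0 c : (0 <= \int[leb]_t (f (t, c) ^+ 2)%:E)%E.
  by apply: integral_ge0 => t _; rewrite lee_fin sqr_ge0.
apply: le_lt_trans foo; case: b; first by rewrite leeDr.
by rewrite leeDl.
Qed.

Definition slice b (f : l2s) : l2p := L2 (mu := lam2 R) (slice_proof f b).1 (slice_proof f b).2.

Lemma ip_slice (f : l2s) : ip f f = ip (slice false f) (slice false f) + ip (slice true f) (slice true f).
Proof.
apply: EFin_inj; rewrite EFinD !ipE integral_sheets//.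
- by apply/measurable_EFinP; apply: measurable_funM; exact: l2_meas.
- by move=> s; rewrite lee_fin -expr2 sqr_ge0.
Qed.

(** The contributions of the two sheets cancel. This yields the orthogonality of the real and the
    imaginary component over every region of the plane. *)
Lemma ip_antisym (f g : l2s) :
  (forall t, f (t, true) * g (t, true) = - (f (t, false) * g (t, false))) -> ip f g = 0.
Proof.
move=> fg; apply: EFin_inj; rewrite ipE; pose k (s : S2) : \bar R := (f s * g s)%:E.
have mk : measurable_fun setT k.
  by apply/measurable_EFinP; apply: measurable_funM; exact: l2_meas.
have /integrableP[_ Ioo] := l2_prod f g.
have E1 : (\int[leb]_t (k ^\+ (t, true)) = \int[leb]_t (k ^\- (t, false)))%E.
  by apply: eq_integral => t _; rewrite funeposE funenegE /k fg EFinN.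
have E2 : (\int[leb]_t (k ^\- (t, true)) = \int[leb]_t (k ^\+ (t, false)))%E.
  by apply: eq_integral => t _; rewrite funeposE funenegE /k fg EFinN oppeK.
have Ep : (\int[sheets]_s k ^\+ s = \int[leb]_t k ^\+ (t, false) + \int[leb]_t k ^\+ (t, true))%E.
  by apply: integral_sheets; [exact: measurable_funepos|exact: funepos_ge0].
have En : (\int[sheets]_s k ^\- s = \int[leb]_t k ^\- (t, false) + \int[leb]_t k ^\- (t, true))%E.
  by apply: integral_sheets; [exact: measurable_funeneg|exact: funeneg_ge0].
have E : (\int[sheets]_s k ^\- s = \int[sheets]_s k ^\+ s)%E by rewrite En Ep E1 E2 addeC.
rewrite -[LHS]/(\int[sheets]_s k s)%E integralE E subee//.
rewrite ge0_fin_numE; last by apply: integral_ge0 => s _; exact: funepos_ge0.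
apply: le_lt_trans Ioo; apply: le_lower_integral => s; first exact: funepos_ge0.
by rewrite funeposE /k ge_max lee_abs abse_ge0.
Qed.

Lemma sheet_cellfun_proof n : measurable_fun setT (fun s : S2 => cellfun R n s.1 * (~~ s.2)%:R) /\
  (\int[sheets]_s ((cellfun R n s.1 * (~~ s.2)%:R) ^+ 2)%:E < +oo)%E.
Proof.
have mf : measurable_fun setT (fun s : S2 => cellfun R n s.1 * (~~ s.2)%:R).
  apply: measurable_funM; first exact: (measurableT_comp (l2_meas _) measurable_fst).
  exact: (@measurableT_comp _ _ _ _ _ _ (fun b : bool => (~~ b)%:R : R)).
split => //; rewrite integral_sheets; last 2 first.
- by apply/measurable_EFinP; exact: measurable_funX.
- by move=> s; rewrite lee_fin sqr_ge0.
rewrite /= [X in (_ + X)%E](_ : _ = 0)%E.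
  by rewrite adde0; under eq_integral do rewrite mulr1; exact: (l2_int (cellfun R n)).
by under eq_integral do rewrite mulr0 expr0n/=; rewrite integral0.
Qed.

Definition sheet_cellfun n : l2s := L2 (sheet_cellfun_proof n).1 (sheet_cellfun_proof n).2.

Lemma ip_sheet_cellfun i j : ip (sheet_cellfun i) (sheet_cellfun j) = (i == j)%:R.
Proof.
apply: EFin_inj; rewrite ipE integral_sheets; last 2 first.
- by apply/measurable_EFinP; apply: measurable_funM; exact: l2_meas.
- by move=> s; rewrite lee_fin/= !mulr_ge0.
rewrite /= [X in (_ + X)%E](_ : _ = 0)%E.
  rewrite adde0; under eq_integral do rewrite !mulr1.
  by rewrite -ip_cellfun ipE.
by under eq_integral do rewrite !mulr0; rewrite integral0.
Qed.

End two_sheets.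

Lemma isG_indep_add (R : realType) d (T : measurableType d) (P : probability T R) (X Y : T -> R) v w :
  isG P X v -> isG P Y w ->
  (forall A B, measurable A -> measurable B ->
     P (X @^-1` A `&` Y @^-1` B) = (P (X @^-1` A) * P (Y @^-1` B))%E) ->
  isG P (fun x => X x + Y x) (v + w).
Proof.
move=> GX GY XY; have [_ mX _] := GX; have [_ mY _] := GY.
pose X' : {mfun T >-> R} := mfun_Sub (mem_set mX); pose Y' : {mfun T >-> R} := mfun_Sub (mem_set mY).
have PX : mp P (distribution P X') X by split.
have PY : mp P (distribution P Y') Y by split.
have GX' : isG (distribution P X') id v by apply: (isG_push PX).
have GY' : isG (distribution P Y') id w by apply: (isG_push PY).
have PXY : mp P (pprod (distribution P X') (distribution P Y')) (fun x => (X x, Y x)).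
  by apply: mp_prod => [|A B mA mB]; [exact: measurable_fun_pair|exact: XY].
exact: (isG_mp PXY (isG_prod GX' GY')).
Qed.

Section complex_noise.
Variable R : realType.
Notation R2 := (measurableTypeR R * measurableTypeR R)%type.
Notation leb := (@leb2 R).
Notation S2 := (R2 * bool)%type.
Notation l2p := (l2 (lam2 R)).
Notation l2s := (l2 (sheets R)).
Context d (T : measurableType d) (P : probability T R).

Lemma white_noise_scale (w : (R * R -> R) -> {RV P >-> R}) c (f g : l2p) : white_noise w ->
  {ae leb, forall s, g s = c * f s} -> {ae P, forall x, w g x = c * w f x}.
Proof.
move=> ww gf; have lin := wn_linear ww c 0 (L2fun_l2 f) (L2fun_l2 f).
have gE : {ae leb, forall s, g s = l2lin [:: (c, f); (0, f)] s}.
  by apply: ae_imp gf => s ->; rewrite l2linE !big_cons big_nil/= mul0r !addr0.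
apply: (ae_imp _ (filterI lin (isonormal_ae (white_noise_isonormal ww) gE))) => x [E1 E2].
have -> : c * w f x = c * w f x + 0 * w f x by rewrite mul0r addr0.
rewrite E2 -E1; congr (w _ x).
by apply/funext => s; rewrite /= !big_cons big_nil/= addr0.
Qed.

Variables (w1 w2 : (R * R -> R) -> {RV P >-> R}).
Hypotheses (ww1 : white_noise w1) (ww2 : white_noise w2) (w12 : independent_noises w1 w2).

(** A single noise on two sheets carries both independent noises, so the complex field becomes an
    instance of the kernel model with components indexed by [bool]. *)
Definition sum_noise (f : l2s) (x : T) : R := w1 (slice false f) x + w2 (slice true f) x.

Lemma sum_noise_isonormal : isonormal P sum_noise.
Proof.
apply: isonormalP => [f|c f s].
  rewrite ip_slice; apply: isG_indep_add.
  - exact: (white_noise_isG ww1 (slice false f)).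
  - exact: (white_noise_isG ww2 (slice true f)).
  - move=> A B mA mB; apply: w12; apply: sub_sigma_algebra.
      by exists (slice false f); [exact: L2fun_l2|exists A => //; rewrite setTI].
    by exists (slice true f); [exact: L2fun_l2|exists B => //; rewrite setTI].
have L (w : (R * R -> R) -> {RV P >-> R}) : white_noise w -> forall b,
    {ae P, forall x, w (slice b (l2lin ((c, f) :: s))) x = c * w (slice b f) x + w (slice b (l2lin s)) x}.
  move=> ww b; have := wn_linear ww c 1 (L2fun_l2 (slice b f)) (L2fun_l2 (slice b (l2lin s))).
  apply: ae_imp => x; rewrite mul1r => <-; congr (w _ x).
  by apply/funext => t /=; rewrite big_cons mul1r.
apply: (ae_imp _ (filterI (L _ ww1 false) (L _ ww2 true))) => x [E1 E2].
by rewrite /sum_noise E1 E2 mulrDr addrACA.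
Qed.

End complex_noise.

Section complex_gauss.
Variable R : realType.
Notation R2 := (measurableTypeR R * measurableTypeR R)%type.
Notation leb := (@leb2 R).
Context dS (S : measurableType dS) (mu : {sigma_finite_measure set S -> \bar R}).
Notation l2 := (l2 mu).
Variables (e : nat -> l2) (e_on : forall i j, ip (e i) (e j) = (i == j)%:R).

Lemma cmod_sqr (z : R[i]) : cmod z ^+ 2 = complex.Re z ^+ 2 + complex.Im z ^+ 2.
Proof. by case: z => a b; rewrite /cmod /= sqr_sqrtr// addr_ge0 ?sqr_ge0. Qed.

Lemma covform_rank1 (J : Type) (f : J -> R) (s : seq (R * J)) :
  covform (fun i j => f i * f j) s = (\sum_(p <- s) p.1 * f p.2) ^+ 2.
Proof.
rewrite /covform expr2 mulr_suml; apply: eq_bigr => p _; rewrite mulr_sumr.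
by apply: eq_bigr => q _; rewrite mulrACA.
Qed.

Lemma gauss_pair_law (Q : probability (paths R l2) R) : white Q -> forall F : R2 -> \bar R,
  measurable_fun setT F -> (forall p, 0 <= F p)%E ->
  (\int[Q]_z F (z (e (@eidx bool 0 false)), z (e (@eidx bool 0 true))) =
   \int[pprod (gam R) (gam R)]_u F u)%E.
Proof.
move=> wQ F mF F0.
pose Z (z : paths R l2) : paths R bool := fun c => z (e (eidx 0 c)).
pose Z' (u : R2) : paths R bool := fun c => if c then u.2 else u.1.
pose q (y : paths R bool) : R2 := (y false, y true).
have mZ c : measurable_fun setT (fun z => Z z c) by exact: measurable_ev.
have mZ' c : measurable_fun setT (fun u => Z' u c).
  by case: c; [exact: measurable_snd|exact: measurable_fst].
have mq : measurable_fun setT q by apply: measurable_fun_pair; exact: measurable_ev.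
rewrite (law_integral (P' := pprod (gam R) (gam R)) (Z := Z) (Z' := Z')
  (F := F \o q) (measurable_pathsP mZ) (measurable_pathsP mZ') _
  (measurableT_comp mF mq) (fun y => F0 _)).
  by apply: eq_integral => -[].
apply: (@gauss_law R bool _ _ Q _ _ (pprod (gam R) (gam R)) Z Z' (covform (fun i j => (i == j)%:R))) => // s.
  apply: (eq_isG (gauss_forms wQ (fun c => [:: (1, e (eidx 0 c))]) s)).
    by move=> z; apply: eq_bigr => p _; rewrite /linform big_seq1 mul1r.
  by apply: eq_covform => i j; rewrite l2lin11 e_on eidx_eq eqxx/= !mul1r.
pose a c := \sum_(p <- s) p.1 * (p.2 == c)%:R.
apply: (eq_isG (isG_prod (isG_scale (a false)) (isG_scale (a true)))).
  move=> u; rewrite /linform /a !mulr_suml -big_split; apply: eq_bigr => -[x []] _ /=.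
    by rewrite mulr0 mul0r add0r mulr1.
  by rewrite mulr0 mul0r addr0 mulr1.
rewrite /a -(covform_rank1 (fun c => (c == false)%:R)) -(covform_rank1 (fun c => (c == true)%:R)) covformD; apply: eq_covform => -[] [] /=;
  by rewrite ?mulr1 ?mulr0 ?addr0 ?add0r.
Qed.

(** The density [pi^-1 * expR (- |z|^2)] is the product of two normal densities of variance 1/2;
    this is the reason for [v = 2^-1] in the complex case. *)
Lemma complex_gauss_law (Q : probability (paths R l2) R) : white Q -> forall F : R2 -> \bar R,
  measurable_fun setT F -> (forall p, 0 <= F p)%E ->
  (\int[Q]_z F (std_state 2^-1 e z false, std_state 2^-1 e z true) =
   \int[leb]_p (F p * (pi^-1 * expR (- cmod (cplx p) ^+ 2))%:E))%E.
Proof.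
move=> wQ F mF F0; pose s : R := Num.sqrt 2^-1.
have s2 : s ^+ 2 = 2^-1 by rewrite sqr_sqrtr// invr_ge0.
have s0 : s != 0 by rewrite -sqrf_eq0 s2 invr_eq0.
have mu' (a : R) : measurable_fun setT (fun u : R => a * u) by exact: measurable_funM.
pose Fs (u : R2) := F (s * u.1, s * u.2).
have mFs : measurable_fun setT Fs.
  apply: (measurableT_comp mF); apply: measurable_fun_pair.
    exact: (measurableT_comp (mu' s) measurable_fst).
  exact: (measurableT_comp (mu' s) measurable_snd).
rewrite -[LHS]/(\int[Q]_z Fs (z (e (@eidx bool 0 false)), z (e (@eidx bool 0 true))))%E.
rewrite (gauss_pair_law wQ mFs (fun u => F0 _)) pprod_fubini//; last by move=> u; exact: F0.
pose r u : R := normal_pdf 0 s u.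
have mr : measurable_fun setT r by exact: measurable_normal_pdf.
have r0 u : 0 <= r u by exact: normal_pdf_ge0.
have mFx x : measurable_fun setT (fun y : measurableTypeR R => F (x, y)).
  exact: (measurableT_comp mF (measurable_pair1 x)).
have mFr : measurable_fun setT (fun p : R2 => (F p * (r p.2)%:E)%E).
  apply: emeasurable_funM => //; apply/measurable_EFinP; exact: (measurableT_comp mr measurable_snd).
pose H (x : R) := (\int[@lebesgue_measure R]_y (F (x, y) * (r y)%:E))%E.
have mH : measurable_fun setT H.
  apply: (@measurable_fun_fubini_tonelli_F _ _ _ _ R (@lebesgue_measure R) (fun p => F p * (r p.2)%:E)%E) => //.
  by move=> p; rewrite mule_ge0// lee_fin.
have H0 x : (0 <= H x)%E by apply: integral_ge0 => y _; rewrite mule_ge0// lee_fin.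
transitivity (\int[gam R]_x H (s * x)%R)%E.
  apply: eq_integral => x _.
  by rewrite -(normal_scale s0 (mFx (s * x)%R) (fun y => F0 _)) (normal_integral s (mFx _) (fun y => F0 _)).
rewrite -(normal_scale s0 mH H0) (normal_integral s mH H0).
rewrite [RHS](@fubini_tonelli1 _ _ _ _ R (@lebesgue_measure R) (@lebesgue_measure R)); last 2 first.
- apply: emeasurable_funM => //; apply/measurable_EFinP; apply: measurable_funM => //.
  apply: measurableT_comp => //; apply: measurableT_comp => //.
  under eq_fun do rewrite cmod_sqr.
  by apply: measurable_funD; apply: measurable_funX; [exact: measurable_fst|exact: measurable_snd].
- by move=> p; rewrite mule_ge0// lee_fin mulr_ge0 ?expR_ge0// invr_ge0 pi_ge0.
apply: eq_integral => x _; rewrite /fubini_F /H muleC -ge0_integralZl ?lee_fin//; last 2 first.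
- by apply: emeasurable_funM => //; apply/measurable_EFinP.
- by move=> y _; rewrite mule_ge0// lee_fin.
apply: eq_integral => y _; rewrite muleCA; congr (_ * _)%E; rewrite -EFinM; congr EFin.
rewrite /r !normal_pdf0E// s2 cmod_sqr /= -[2^-1 *+ 2]mulr_natr mulVf// !divr1.
rewrite -mulrnAl -[2^-1 *+ 2]mulr_natr mulVf// mul1r mulrACA -expRD -invfM -expr2 sqr_sqrtr ?pi_ge0//.
by rewrite opprD.
Qed.

End complex_gauss.

Section complex_numbers.
Variable R : realType.

Lemma complex_half (a b : R) : Complex a b / 2 = Complex (a / 2) (b / 2).
Proof.
have n2 : (2 : R[i]) != 0 by rewrite pnatr_eq0.
apply: (mulIf n2); rewrite divfK// mulr_natr mulr2n; congr Complex; exact: splitr.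
Qed.

Lemma cmod_le (a b : R) : cmod (Complex a b) <= `|a| + `|b|.
Proof.
rewrite -(ler_pXn2r (n := 2)) ?nnegrE ?addr_ge0 ?sqrtr_ge0// cmod_sqr/= sqrrD.
by rewrite !real_normK ?num_real// lerD2r lerDl mulrn_wge0// mulr_ge0.
Qed.

Lemma cmod_ge (z : R[i]) : `|complex.Re z| <= cmod z /\ `|complex.Im z| <= cmod z.
Proof.
have c0 : 0 <= cmod z by case: z => a b; exact: sqrtr_ge0.
by split; rewrite -(ler_pXn2r (n := 2)) ?nnegrE// cmod_sqr real_normK ?num_real// (lerDl, lerDr) sqr_ge0.
Qed.

End complex_numbers.

Section complex_field.
Variable R : realType.
Notation R2 := (measurableTypeR R * measurableTypeR R)%type.
Notation leb := (@leb2 R).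
Notation S2 := (R2 * bool)%type.
Notation l2p := (l2 (lam2 R)).
Notation l2s := (l2 (sheets R)).
Variables (C al de : R) (phi : R * R -> R[i]) (psi : R[i] -> R).
Hypotheses (C0 : 0 < C) (al0 : 0 < al) (de0 : 0 < de) (de1 : de <= 1) (al_de : 2 * (1 + 2 / de) < al).
Hypothesis phiL2 : L2fun_complex phi.
Hypothesis phi1 : (\int[leb]_t (cmod (phi t) ^+ 2)%:E = 1)%E.
Hypothesis phi_decay : (ess_sup leb (fun t => ((1 + euclid t) `^ al * cmod (phi t) ^+ 2)%:E) < +oo)%E.
Hypothesis lpsi : lebesgue_measurable leb (fun p => psi (cplx p)).
Hypothesis psi_exp : (\int[leb]_p
  (expR (C^-1 * `|psi (cplx p)|) * expR (- cmod (cplx p) ^+ 2))%:E < +oo)%E.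
Hypothesis psi_mean : (\int[leb]_p (psi (cplx p) * expR (- cmod (cplx p) ^+ 2))%:E = 0)%E.
Hypothesis psi_incr : forall y h : R[i], (lne (\int[leb]_p
    (expR `|psi ((cplx p + h + y) / 2) - psi ((cplx p + h - y) / 2)| *
     (pi^-1 * expR (- cmod (cplx p) ^+ 2)))%:E) <= (C * cmod y `^ de)%:E)%E.
Context d (T : measurableType d) (P : probability T R).
Variables (w1 w2 : (R * R -> R) -> {RV P >-> R}) (G : T -> R * R -> R[i]).
Hypotheses (ww1 : white_noise w1) (ww2 : white_noise w2) (w12 : independent_noises w1 w2).
Hypothesis wG : complex_convolution_version w1 w2 phi G.

Let r : R := (Num.sqrt 2)^-1.

Let r2 : r ^+ 2 = 2^-1. Proof. by rewrite exprVn sqr_sqrtr. Qed.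

Let r_ge0 : 0 <= r. Proof. by rewrite invr_ge0 sqrtr_ge0. Qed.

Let r_le1 : r <= 1.
Proof. by rewrite -(ler_pXn2r (n := 2)) ?nnegrE// r2 expr1n invf_le1 ?ler1n. Qed.

(* Components and sheets are indexed by booleans, [false] being the real part. *)
Definition part (c b : bool) (u : R2) : R :=
  if c (+) b then if c then complex.Im (phi u) else - complex.Im (phi u) else complex.Re (phi u).

Lemma part_L2 c b : measurable_fun setT (part c b) /\ (\int[leb]_u (part c b u ^+ 2)%:E < +oo)%E.
Proof.
have [/L2fun_square[mr ir] /L2fun_square[mi ii]] := phiL2; rewrite /part.
case: (c (+) b) => //; case: c => //; split; first exact: measurableT_comp.
by under eq_integral do rewrite sqrrN.
Qed.

Lemma part_sqr c u : part c false u ^+ 2 + part c true u ^+ 2 = cmod (phi u) ^+ 2.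
Proof. by rewrite cmod_sqr /part; case: c => /=; rewrite ?sqrrN// addrC. Qed.

Lemma part_le c b u : `|part c b u| <= cmod (phi u).
Proof.
have [cr ci] := cmod_ge (phi u).
by rewrite /part; case: c b => -[] //=; rewrite normrN.
Qed.

Lemma complex_field_splittable : is_splittable_field P (fun x t => psi (G x t)).
Proof.
have [c0 [N [c00 mN N0 HN]]] := decay_set al0 phi_decay.
(* The factor [r] is the [1 / sqrt 2] of the complex noise; it gives each component the variance
   1/2. *)
pose g c b (t : R2) : R := r * (part c b t * \1_(~` N) t).
have mg c b : measurable_fun setT (g c b).
  apply: measurable_funM => //; apply: measurable_funM; first exact: (part_L2 c b).1.
  by apply: measurable_indic; exact: measurableC.
have aeg : {ae leb, forall t, forall c b, g c b t = r * part c b t}.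
  exists N; split => // t /= ne; apply: contrapT => Nt; apply: ne => c b.
  by rewrite /g indicE mem_set// mulr1.
have gb c b (t : R2) : `|g c b t| <= c0 * wt (al / 2) `|t|.
  rewrite /g indicE; have [Nt|Nt] := pselect (N t).
    by rewrite memNset ?mulr0 ?normr0 ?mulr_ge0 ?(ltW (wt_gt0 _ _))// => /(_ Nt).
  rewrite mem_set// mulr1 normrM (ger0_norm r_ge0); apply: le_trans (HN t Nt).
  by apply: (le_trans (ler_piMl _ r_le1)) => //; apply: le_trans (part_le c b t) (ler_norm _).
have mgsq c b : measurable_fun setT (fun t => (g c b t ^+ 2)%:E).
  by apply/measurable_EFinP; exact: measurable_funX.
have gsq c : (\int[leb]_t (g c false t ^+ 2)%:E + \int[leb]_t (g c true t ^+ 2)%:E = (2^-1)%:E)%E.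
  rewrite -ge0_integralD//; do ?[by move=> t _; rewrite lee_fin sqr_ge0].
  rewrite (ae_lower_integral (h := fun t : R2 => ((2^-1)%:E * (cmod (phi t) ^+ 2)%:E)%E)); last first.
    apply: ae_imp aeg => t gt; rewrite !gt -EFinD -EFinM !exprMn r2 -mulrDr part_sqr//.
  rewrite ge0_integralZl ?lee_fin ?invr_ge0//; first by rewrite phi1 mule1.
  - have [/L2fun_square[mr _] /L2fun_square[mi _]] := phiL2.
    under eq_fun do rewrite cmod_sqr.
    by apply/measurable_EFinP; apply: measurable_funD; exact: measurable_funX.
  - by move=> t _; rewrite lee_fin sqr_ge0.
have ig c b : (\int[leb]_t (g c b t ^+ 2)%:E < +oo)%E.
  have I0 b' : (0 <= \int[leb]_t (g c b' t ^+ 2)%:E)%E.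
    by apply: integral_ge0 => t _; rewrite lee_fin sqr_ge0.
  apply: (@le_lt_trans _ _ (2^-1)%:E); last by rewrite ltry.
  by rewrite -(gsq c); case: b; [rewrite leeDr|rewrite leeDl].
pose K c (t : R * R) (s : S2) : R := if s.2 then g c true (t - s.1) else g c false (t - s.1).
have mK c : measurable_fun setT (fun x : R2 * S2 => K c x.1 x.2).
  have h : measurable_fun setT (fun x : R2 * S2 => (x.1, x.2.1)).
    apply: measurable_fun_pair; first exact: measurable_fst.
    exact: (measurableT_comp measurable_fst measurable_snd).
  apply: measurable_fun_ifT.
  - exact: (measurableT_comp measurable_snd measurable_snd).
  - exact: (measurableT_comp (measurable_diff (mg c true)) h).
  - exact: (measurableT_comp (measurable_diff (mg c false)) h).
have mKt c t : measurable_fun setT (K c t) by exact: (measurableT_comp (mK c) (measurable_pair1 t)).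
have KE c t : (\int[sheets R]_s (K c t s ^+ 2)%:E = (2^-1)%:E)%E.
  rewrite integral_sheets; last 2 first.
  - by apply/measurable_EFinP; exact: measurable_funX.
  - by move=> s; rewrite lee_fin sqr_ge0.
  rewrite -(gsq c); congr (_ + _)%E; symmetry.
    by apply: (@leb2_reflect R (fun s => (g c false s ^+ 2)%:E) t) => // s; rewrite lee_fin sqr_ge0.
  by apply: (@leb2_reflect R (fun s => (g c true s ^+ 2)%:E) t) => // s; rewrite lee_fin sqr_ge0.
have iK c t : (\int[sheets R]_s (K c t s ^+ 2)%:E < +oo)%E by rewrite KE ltry.
pose kap c t : l2s := L2 (mu := sheets R) (mKt c t) (iK c t).
have [Jf Jf0 JfI] := wt_int_const R.
(* The position forgets the sheet, so every integral over the noise is twice the planar one. *)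
have km : @kmodel _ _ _ (sheets R) bool c0 (al / 2) 2^-1 (fun q => 2 * Jf q) kap fst.
  split.
  - exact: measurable_fst.
  - exact: mK.
  - by move=> c t [s []]; exact: gb.
  - move=> q t q2; rewrite integral_sheets; last 2 first.
    + exact: (measurable_wt_pos q t measurable_fst).
    + by move=> s; rewrite lee_fin ltW// wt_gt0.
    by rewrite mulr2n mulrDl mul1r EFinD; apply: leeD; exact: JfI.
  - move=> c c' t H mA cc; apply: ip_antisym => s /=.
    have E : (\1_(fst @^-1` H) (s, true) : R) = \1_(fst @^-1` H) (s, false) by rewrite !indicE.
    rewrite E /K /g /part /=.
    by case: c c' cc => -[] //= _; ring.
  - move=> c t; apply: EFin_inj; rewrite ipE -(KE c t).
    by apply: eq_integral => s _; rewrite expr2.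
have iW := sum_noise_isonormal ww1 ww2 w12.
have [mG1 mG2 GW] := wG.
pose Gf (c : bool) x t := if c then complex.Im (G x t) else complex.Re (G x t).
have GfW c t : {ae P, forall x, Gf c x t = sum_noise w1 w2 (kap c t) x}.
  have [[mr ir] [mi ii]] : (measurable_fun setT (fun u : R2 => complex.Re (phi u)) /\ _) /\
      (measurable_fun setT (fun u : R2 => complex.Im (phi u)) /\ _) :=
    conj (L2fun_square phiL2.1) (L2fun_square phiL2.2).
  pose fr := convk mr ir t; pose fi := convk mi ii t.
  have ae b : {ae leb, forall s, slice b (kap c t) s = r * part c b (t - s)}.
    by apply: (ae_imp _ (ae_reflect t aeg)) => s gs; rewrite /= /K /=; case: b; rewrite gs.
  have E1 : {ae P, forall x, w1 (slice false (kap c t)) x = r * w1 (if c then fi else fr) x}.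
    apply: (white_noise_scale ww1); apply: ae_imp (ae false) => s ->.
    by rewrite /part; case: c {ae}.
  have E2 : {ae P, forall x, w2 (slice true (kap c t)) x = (if c then r else - r) * w2 (if c then fr else fi) x}.
    apply: (white_noise_scale ww2); apply: ae_imp (ae true) => s ->.
    by rewrite /part; case: c {ae E1} => //=; rewrite mulrN mulNr.
  apply: (ae_imp _ (filterI (GW t) (filterI E1 E2))) => x [Gx [E1x E2x]].
  rewrite /sum_noise E1x E2x /Gf Gx /complex_noise -/r.
  by case: c {ae E1 E2 E1x E2x} => /=; rewrite -/r; ring.
have cdim : 1 + 2 / de < al / 2 by rewrite ltr_pdivlMr// mulrC.
have v0 : 0 < 2^-1 :> R by rewrite invr_gt0.
have Jf0' q : 0 <= 2 * Jf q by rewrite mulr_ge0.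
pose rho (p : R2) : R := pi^-1 * expR (- cmod (cplx p) ^+ 2).
have rho0 p : 0 <= rho p by rewrite mulr_ge0 ?expR_ge0// invr_ge0 pi_ge0.
pose q (y : paths R bool) : R2 := (y false, y true).
pose tr (h y : paths R bool) (p : R2) : R2 :=
  ((p.1 + h false + y false) / 2, (p.2 + h true + y true) / 2).
have trE h y p : cplx (tr h y p) = (cplx p + cplx (q h) + cplx (q y)) / 2.
  by rewrite [LHS]/cplx /= -complex_half.
have trN h y p : cplx (tr h (fun c => - y c) p) = (cplx p + cplx (q h) - cplx (q y)) / 2.
  by rewrite trE.
have tr_aff h y p : tr h y p = (2^-1 * p.1 + (h false + y false) / 2, 2^-1 * p.2 + (h true + y true) / 2).
  by rewrite /tr; congr pair; field.
have tr_ae h y (A : set R2) : {ae leb, forall p, A p} -> {ae leb, forall p, A (tr h y p)}.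
  move=> aeA; apply: (ae_imp _ (ae_affine ((h false + y false) / 2, (h true + y true) / 2) v0 aeA)) => p.
  by rewrite tr_aff.
have mtr h y : measurable_fun setT (tr h y).
  by have := @measurable_affine R 2^-1 ((h false + y false) / 2, (h true + y true) / 2);
    congr measurable_fun; apply/funext => p; rewrite tr_aff.
have mexp : measurable_fun setT (fun p : R2 => expR (- cmod (cplx p) ^+ 2)).
  apply: measurableT_comp => //; apply: measurableT_comp => //.
  under eq_fun do rewrite cmod_sqr.
  by apply: measurable_funD; apply: measurable_funX; [exact: measurable_fst|exact: measurable_snd].
have -> : (fun x t => psi (G x t)) = fun x t => psi (cplx (q (fun c => Gf c x t))).
  by apply/funext => x; apply/funext => t; congr psi; rewrite /Gf /=; case: (G x t).
apply: (state_field_splittable iW c00 Jf0' (ip_sheet_cellfun R) v0 (ltW C0) de0 de1 cdim km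
  (Gf := Gf) _ GfW (rho := rho) (q := q) (tr := tr) rho0 _ _ mtr _ tr_ae lpsi (th := C^-1)).
- by case; [exact: mG2|exact: mG1].
- by apply: measurable_fun_pair; exact: measurable_ev.
- exact: (complex_gauss_law (ip_sheet_cellfun R)).
- by [].
- by rewrite invr_gt0.
- apply: lee_integral_bound psi_exp => [p|p||].
  + exact: expR_ge0.
  + exact: expR_ge0.
  + by rewrite invr_ge0 pi_ge0.
  + by rewrite invf_le1 ?pi_gt0//; have := pi_ge2 R; lra.
- apply: mean_scale psi_exp psi_mean => //; last by rewrite invr_gt0.
- move=> h y; pose yc := cplx (q y).
  apply: (@le_trans _ _ (expR (C * cmod yc `^ de))%:E).
    apply: lne_le; first by apply: integral_ge0 => p _; rewrite lee_fin mulr_ge0 ?expR_ge0.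
    under eq_integral => p _ do rewrite trE trN.
    exact: psi_incr.
  (* The model measures [y] by the sum of the absolute values of its components, which dominates the
     modulus. *)
  rewrite lee_fin ler_expR ler_wpM2l ?(ltW C0)//; apply: ge0_ler_powR.
  + exact: ltW.
  + by rewrite nnegrE sqrtr_ge0.
  + by rewrite nnegrE; apply: sumr_ge0.
  + rewrite (bigD1 false)//= (bigD1 true)//= big1 ?addr0; first exact: cmod_le.
    by case.
Qed.

End complex_field.

Theorem theorem5p14 (R : realType) :
  (forall (C alpha delta : R) (phi : R * R -> R) (psi : R -> R),
    0 < C -> 0 < alpha -> 0 < delta -> delta <= 1 ->
    alpha > 2 * (1 + 2 / delta) ->
    L2fun phi ->
    (\int[@leb2 R]_t (phi t ^+ 2)%:E = 1)%E ->
    (ess_sup (@leb2 R)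
       (fun t => ((1 + euclid t) `^ alpha * phi t ^+ 2)%:E) < +oo)%E ->
    lebesgue_measurable (@lebesgue_measure R) psi ->
    (\int[@lebesgue_measure R]_u
       (expR (C^-1 * `|psi u|) * expR (- (u ^+ 2 / 2)))%:E < +oo)%E ->
    (\int[@lebesgue_measure R]_u (psi u * expR (- (u ^+ 2 / 2)))%:E = 0)%E ->
    (forall y h : R,
      (lne (\int[@lebesgue_measure R]_x
              (expR `|psi ((x + h + y) / 2) - psi ((x + h - y) / 2)| *
               ((Num.sqrt (2 * pi))^-1 * expR (- (x ^+ 2 / 2))))%:E)
       <= (C * `|y| `^ delta)%:E)%E) ->
    forall (d : measure_display) (T : measurableType d) (P : probability T R)
      (w : (R * R -> R) -> {RV P >-> R}) (G : T -> R * R -> R),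
      white_noise w ->
      convolution_version w phi G ->
      is_splittable_field P (fun x t => psi (G x t)))
  /\
  (forall (C alpha delta : R) (phi : R * R -> R[i]) (psi : R[i] -> R),
    0 < C -> 0 < alpha -> 0 < delta -> delta <= 1 ->
    alpha > 2 * (1 + 2 / delta) ->
    L2fun_complex phi ->
    (\int[@leb2 R]_t (cmod (phi t) ^+ 2)%:E = 1)%E ->
    (ess_sup (@leb2 R)
       (fun t => ((1 + euclid t) `^ alpha * cmod (phi t) ^+ 2)%:E) < +oo)%E ->
    lebesgue_measurable (@leb2 R) (fun p => psi (cplx p)) ->
    (\int[@leb2 R]_p
       (expR (C^-1 * `|psi (cplx p)|) * expR (- cmod (cplx p) ^+ 2))%:E
     < +oo)%E ->
    (\int[@leb2 R]_p (psi (cplx p) * expR (- cmod (cplx p) ^+ 2))%:E = 0)%E ->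
    (forall y h : R[i],
      (lne (\int[@leb2 R]_p
              (expR `|psi ((cplx p + h + y) / 2) - psi ((cplx p + h - y) / 2)| *
               (pi^-1 * expR (- cmod (cplx p) ^+ 2)))%:E)
       <= (C * cmod y `^ delta)%:E)%E) ->
    forall (d : measure_display) (T : measurableType d) (P : probability T R)
      (w1 w2 : (R * R -> R) -> {RV P >-> R}) (G : T -> R * R -> R[i]),
      white_noise w1 -> white_noise w2 -> independent_noises w1 w2 ->
      complex_convolution_version w1 w2 phi G ->
      is_splittable_field P (fun x t => psi (G x t))).
Proof.
split => [C al de phi psi C0 al0 de0 de1 al_de L1 phi1 pd lp pe pm pi d T P w G ww wG|].
  exact: (real_field_splittable C0 al0 de0 de1 al_de L1 phi1 pd lp pe pm pi ww wG).
move=> C al de phi psi C0 al0 de0 de1 al_de L1 phi1 pd lp pe pm pi d T P w1 w2 G ww1 ww2 w12 wG.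
exact: (complex_field_splittable C0 al0 de0 de1 al_de L1 phi1 pd lp pe pm pi ww1 ww2 w12 wG).
Qed.
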